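(* Let $D:=[0,1]\subset K$. Let $m\ge n$, let $A\subset D^m$ be definable, and let $f:D^m\to D^n$ be a definable Lipschitz function. Then $J_nf$ is $\mathcal L^m$-integrable, and $$\int_A J_nf\,d\mathcal L^m=\int_{D^n}\mathcal H^{m-n}\bigl(A\cap f^{-1}(y)\bigr)\,d\mathcal L^n(y).$$
   Context: Throughout, $K$ is an $\aleph_1$-saturated o-minimal structure expanding a field; ''definable'' means definable in $K$ with parameters; $|\cdot|$ is the Euclidean norm. $\mathring K$ is the set of finite elements of $K$ (those bounded in absolute value by a natural number), and $\operatorname{st}:K^n\to(\mathbb R\cup\{\pm\infty\})^n$ is the componentwise standard part map. A function $f$ is Lipschitz if there is a finite $C\in\mathring K$ with $|f(x)-f(y)|<C|x-y|$ for all $x\ne y$ in its domain. Measure $\mathcal L^n$. $\mathcal L^n$ is the (Berarducci-Otero) measure on the $\sigma$-ring generated by the definable subsets of $K^n$ of finite diameter, completed; it is translation invariant and, for definable $C\subset\mathring K^n$, $\mathcal L^n(C)$ is the Lebesgue measure of $\operatorname{st}(C)$. For definable $A\subseteq\mathring K^n$ and definable $f$ on $A$ one writes $\int_A f\,d\mathcal L^n$ for $\int_A \operatorname{st}(f(x))\,d\mathcal L^n(x)$ when $\operatorname{st}(f)$ is integrable, and then calls $f$ integrable. Jacobians. For a definable function $f$ and a number $e$ at most the dimension of the domain, $J_ef(a)=+\infty$ if $f$ is not differentiable at $a$ or $\operatorname{rank}Df(a)>e$; otherwise $J_ef(a)$ is the square root of the sum of the squares of the $e\times e$ minors of $Df(a)$.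 $M$-functions and $M$-cells ($M\in K_{>0}$). A definable differentiable function $f$ is an $M$-function if $|Df|\le M$ on its domain (operator norm; on a $\mathcal C^1$ cell that is not open, $Df(x)$ is the differential on the tangent space of the cell). In $K^1$ an $M$-cell is a point or an interval $(a,b)$ with $a<b$ in $K$. An $M$-cell in $K^{m+1}$ is either the graph of a definable $\mathcal C^1$ $M$-function $f:X\to K$, or a set $\{(x,r)\in X\times K: f(x)<r<g(x)\}$ with $f<g$ definable $\mathcal C^1$ $M$-functions on $X$, where $X\subseteq K^m$ is an $M$-cell. Basic $e$-rectifiable sets. $A\subseteq K^n$ is basic $e$-rectifiable with bound $M$ ($M$ finite) if, after a permutation of coordinates, $A$ is the graph of an $M$-function $f:U\to K^{n-e}$, where $U\subset K^e$ is an open $M$-cell. A basic $e$-rectifiable partition of a definable set $A$ is a finite partition $(A_0,\dots,A_k)$ of $A$ into definable sets with $\dim A_0<e$ and $A_i$ basic $e$-rectifiable for $i\ge1$. Hausdorff measure. If $C\subset\mathring K^n$ is basic $e$-rectifiable, equal up to a permutation of coordinates to the graph of an $M$-function $f:U\to K^{n-e}$ with $M$ finite and $U\subset K^e$ an open $M$-cell, and $F(x)=(x,f(x))$, then $\mathcal H^e(C):=\int_U J_eF\,d\mathcal L^e$. If $A\subseteq\mathring K^n$ is definable of dimension at most $e$, then $\mathcal H^e(A):=\sum_{i=1}^k\mathcal H^e(A_i)$ for any basic $e$-rectifiable partition $(A_0,\dots,A_k)$ of $A$ (such a partition exists and the value does not depend on it). In the formula, the integrand $\mathcal H^{m-n}(A\cap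 f^{-1}(y))$ is understood for $\mathcal L^n$-almost every $y$, namely those for which $\dim(A\cap f^{-1}(y))\le m-n$. *)

(* Defs.v *)
From HB Require Import structures.
From mathcomp Require Import all_boot all_order all_algebra.
From mathcomp Require Import perm.
From mathcomp Require Import all_classical all_reals all_analysis.

Set Implicit Arguments.
Unset Strict Implicit.
Unset Printing Implicit Defensive.

Import Order.TTheory GRing.Theory Num.Theory.

Local Open Scope classical_set_scope.
Local Open Scope ring_scope.

(** * First-order structures expanding an ordered field *)

(* Structures are based on an rcfType: an o-minimal ordered field is real
   closed, so nothing is lost, and Num.sqrt gives the Euclidean norm. *)

(* The symbols of the language other than those of ordered rings, which are
   built into the syntax below. *)
Record signature := Signature {
  fsym : Type; farity : fsym -> nat;
  rsym : Type; rarity : rsym -> nat }.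

Record structure (L : signature) (K : Type) := Structure {
  finterp : forall s : fsym L, ('I_(farity s) -> K) -> K;
  rinterp : forall s : rsym L, ('I_(rarity s) -> K) -> Prop }.

(* Terms and formulas whose free variables are indexed by 'I_n, with
   parameters from K.  A quantifier binds the variable ord0 and shifts the
   others. *)
Inductive term (L : signature) (K : Type) (n : nat) : Type :=
| TVar of 'I_n
| TPar of K
| TZero
| TOne
| TOpp of term L K n
| TAdd of term L K n & term L K n
| TMul of term L K n & term L K n
| TFun (s : fsym L) of ('I_(farity s) -> term L K n).

Inductive formula (L : signature) (K : Type) : nat -> Type :=
| FEq n of term L K n & term L K n : formula L K n
| FLt n of term L K n & term L K n : formula L K n
| FRel n (s : rsym L) of ('I_(rarity s) -> term L K n) : formula L K n
| FNot n of formula L K n : formula L K n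
| FAnd n of formula L K n & formula L K n : formula L K n
| FEx n of formula L K n.+1 : formula L K n.

Fixpoint term_over L (K : Type) (P : set K) n (t : term L K n) : Prop :=
  match t with
  | TVar _ | TZero | TOne => True
  | TPar c => P c
  | TOpp t => term_over P t
  | TAdd t u | TMul t u => term_over P t /\ term_over P u
  | TFun _ ts => forall i, term_over P (ts i)
  end.

Fixpoint formula_over L (K : Type) (P : set K) n (p : formula L K n) : Prop :=
  match p with
  | FEq _ t u | FLt _ t u => term_over P t /\ term_over P u
  | FRel _ _ ts => forall i, term_over P (ts i)
  | FNot _ p | FEx _ p => formula_over P p
  | FAnd _ p q => formula_over P p /\ formula_over P q
  end.

Definition env_cons (K : Type) n (c : K) (v : 'I_n -> K) : 'I_n.+1 -> K :=
  fun i => if unlift ord0 i is Some j then v j else c.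

Fixpoint teval L (K : rcfType) (S : structure L K) n (v : 'I_n -> K)
    (t : term L K n) : K :=
  match t with
  | TVar i => v i
  | TPar c => c
  | TZero => 0
  | TOne => 1
  | TOpp t => - teval S v t
  | TAdd t u => teval S v t + teval S v u
  | TMul t u => teval S v t * teval S v u
  | TFun s ts => finterp S (fun i => teval S v (ts i))
  end.

Fixpoint holds L (K : rcfType) (S : structure L K) n (p : formula L K n) :
    ('I_n -> K) -> Prop :=
  match p in formula _ _ n return ('I_n -> K) -> Prop with
  | FEq _ t u => fun v => teval S v t = teval S v u
  | FLt _ t u => fun v => teval S v t < teval S v u
  | FRel _ s ts => fun v => rinterp S (fun i => teval S v (ts i))
  | FNot _ p => fun v => ~ holds S p v
  | FAnd _ p q => fun v => holds S p v /\ holds S q v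
  | FEx _ p => fun v => exists c : K, holds S p (env_cons c v)
  end.

Definition definable L (K : rcfType) (S : structure L K) n
    (A : set 'rV[K]_n) : Prop :=
  exists p : formula L K n, A = [set x | holds S p (x 0)].

(* The library's intervals include singletons and unbounded intervals. *)
Definition o_minimal L (K : rcfType) (S : structure L K) : Prop :=
  forall A : set 'rV[K]_1, definable S A ->
  exists s : seq (interval K),
    forall t : K, A (const_mx t) <-> exists2 i, i \in s & t \in i.

Definition aleph1_saturated L (K : rcfType) (S : structure L K) : Prop :=
  forall P : set K, countable P ->
  forall n (T : set (formula L K n)),
    (forall p, T p -> formula_over P p) ->
    (forall T0, finite_set T0 -> T0 `<=` T ->
       exists v, forall p, T0 p -> holds S p v) ->
  exists v, forall p, T p -> holds S p v.

(** * Norm, finite elements, standard part, dimension *)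

Section Euclidean.
Variable K : rcfType.

Definition enorm n (x : 'rV[K]_n) : K := Num.sqrt (\sum_i x 0 i ^+ 2).

Definition finite_elt (c : K) : Prop := exists N : nat, `|c| <= N%:R.

Definition finite_points n : set 'rV[K]_n :=
  [set x | forall i, finite_elt (x 0 i)].

Definition unit_cube n : set 'rV[K]_n := [set x | forall i, 0 <= x 0 i <= 1].

Definition finite_diameter n (A : set 'rV[K]_n) : Prop :=
  exists2 d : K, finite_elt d & forall x y, A x -> A y -> enorm (x - y) <= d.

Definition eopen n (U : set 'rV[K]_n) : Prop :=
  forall x, U x -> exists2 r : K, 0 < r & forall y, enorm (y - x) < r -> U y.

(* dim A >= d for definable A: a projection of A to d of the coordinates has
   nonempty interior.  Hence dim set0 < 0 and dim A >= 0 for A nonempty. *)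
Definition dim_ge n (A : set 'rV[K]_n) (d : nat) : Prop :=
  exists s : 'I_d -> 'I_n, injective s /\
  exists (z : 'rV[K]_d) (r : K), 0 < r /\
    forall w, enorm (w - z) < r -> exists2 x, A x & colsub s x = w.

Definition dim_lt n (A : set 'rV[K]_n) (e : nat) : Prop :=
  forall d, (e <= d)%N -> ~ dim_ge A d.

Definition dim_le n (A : set 'rV[K]_n) (e : nat) : Prop := dim_lt A e.+1.

Definition Klipschitz n k (X : set 'rV[K]_n) (f : 'rV[K]_n -> 'rV[K]_k) : Prop :=
  exists2 C : K, finite_elt C &
    forall x y, X x -> X y -> x != y -> enorm (f x - f y) < C * enorm (x - y).

(** * Differentials and Jacobians *)

(* L represents a differential at a of the restriction of f to X, acting on
   row vectors; it is the transpose of the usual Jacobian matrix. *)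
Definition is_differential n k (X : set 'rV[K]_n) (f : 'rV[K]_n -> 'rV[K]_k)
    (a : 'rV[K]_n) (L : 'M[K]_(n, k)) : Prop :=
  X a /\ forall eps : K, 0 < eps -> exists2 delta : K, 0 < delta &
    forall x, X x -> enorm (x - a) < delta ->
      enorm (f x - f a - (x - a) *m L) <= eps * enorm (x - a).

Definition increasing d n (s : {ffun 'I_d -> 'I_n}) : bool :=
  [forall i : 'I_d, forall j : 'I_d, (i < j)%N ==> (s i < s j)%N].

Definition sum_sqr_minors n k (e : nat) (L : 'M[K]_(n, k)) : K :=
  \sum_(s : {ffun 'I_e -> 'I_n} | increasing s)
    \sum_(t : {ffun 'I_e -> 'I_k} | increasing t) (\det (mxsub s t L)) ^+ 2.

(* Df(a), which is unique at the points of an open set or of the unit cube. *)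
Definition differential n k (X : set 'rV[K]_n) (f : 'rV[K]_n -> 'rV[K]_k)
    (a : 'rV[K]_n) : 'M[K]_(n, k) :=
  xget 0 [set L | is_differential X f a L].

Definition Jac n k (e : nat) (X : set 'rV[K]_n)
    (f : 'rV[K]_n -> 'rV[K]_k) (a : 'rV[K]_n) : \bar K :=
  if `[< exists L, is_differential X f a L >]
     && (\rank (differential X f a) <= e)%N
  then (Num.sqrt (sum_sqr_minors e (differential X f a)))%:E
  else +oo%E.

(* The contingent cone; it is the tangent space when X is a C^1 submanifold,
   in particular a C^1 cell. *)
Definition tangent n (X : set 'rV[K]_n) (a v : 'rV[K]_n) : Prop :=
  forall eps : K, 0 < eps -> exists y, exists t : K,
    [/\ X y, 0 < t, enorm (y - a) < eps & enorm (t *: (y - a) - v) < eps].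

(* On a C^1 cell that is not open, the matrices G x are only determined on the
   tangent spaces; the continuous choice of G makes this the usual notion of
   a C^1 function on a submanifold. *)
Definition C1_on n k (X : set 'rV[K]_n) (f : 'rV[K]_n -> 'rV[K]_k) : Prop :=
  exists G : 'rV[K]_n -> 'M[K]_(n, k),
    (forall x, X x -> is_differential X f x (G x)) /\
    (forall x, X x -> forall eps : K, 0 < eps -> exists2 delta : K, 0 < delta &
       forall y, X y -> enorm (y - x) < delta ->
         forall i j, `|G y i j - G x i j| < eps).

Definition graph_on n k (X : set 'rV[K]_n) (f : 'rV[K]_n -> 'rV[K]_k) :
    set 'rV[K]_(n + k) :=
  [set row_mx x (f x) | x in X].

End Euclidean.

Arguments finite_points K n : clear implicits.
Arguments unit_cube K n : clear implicits.

(** * M-functions, M-cells, basic rectifiable sets *)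

Section Cells.
Variables (L : signature) (K : rcfType) (S : structure L K).

Definition definable_fun n k (X : set 'rV[K]_n) (f : 'rV[K]_n -> 'rV[K]_k) :
    Prop :=
  definable S (graph_on X f).

Definition M_function (M : K) n k (X : set 'rV[K]_n)
    (f : 'rV[K]_n -> 'rV[K]_k) : Prop :=
  definable_fun X f /\
  forall x, X x -> exists2 Df, is_differential X f x Df &
    forall v, tangent X x v -> enorm (v *m Df) <= M * enorm v.

Definition C1_M_function (M : K) n (X : set 'rV[K]_n) (f : 'rV[K]_n -> K) :
    Prop :=
  M_function M X (fun x => const_mx (f x) : 'rV[K]_1) /\
  C1_on X (fun x => const_mx (f x) : 'rV[K]_1).

(* The recursion starts from the one-point space K^0, for which the step below
   yields exactly the points and the bounded open intervals of K^1. *)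
Fixpoint M_cell (M : K) (n : nat) : set 'rV[K]_n -> Prop :=
  match n with
  | 0 => fun C => C = setT
  | n'.+1 => fun C => exists2 X : set 'rV[K]_n', M_cell M X &
      (exists f, C1_M_function M X f /\
         C = [set z | X (col' ord_max z) /\ z 0 ord_max = f (col' ord_max z)])
      \/
      (exists f g, [/\ C1_M_function M X f, C1_M_function M X g,
         (forall x, X x -> f x < g x) &
         C = [set z | X (col' ord_max z) /\
                f (col' ord_max z) < z 0 ord_max < g (col' ord_max z)]])
  end.

(* C is, after the permutation s of the coordinates, the graph of the
   M-function f on the open M-cell U of K^e. *)
Definition rect_chart e n (C : set 'rV[K]_n) (M : K) k (E : (e + k)%N = n)
    (s : 'S_n) (U : set 'rV[K]_e) (f : 'rV[K]_e -> 'rV[K]_k) : Prop :=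
  [/\ 0 < M /\ finite_elt M, M_cell M U, eopen U, M_function M U f &
      [set col_perm s z | z in C] =
      [set castmx (erefl, E) z | z in graph_on U f]].

Definition basic_rectifiable e n (C : set 'rV[K]_n) : Prop :=
  exists M k (E : (e + k)%N = n) s U f, @rect_chart e n C M k E s U f.

Definition rectifiable_partition e n (A : set 'rV[K]_n) N
    (P : 'I_N.+1 -> set 'rV[K]_n) : Prop :=
  [/\ \bigcup_i P i = A, trivIset setT P, (forall i, definable S (P i)),
      dim_lt (P ord0) e &
      forall i : 'I_N, basic_rectifiable e (P (lift ord0 i))].

End Cells.

(** * The Berarducci-Otero measure *)

Section Lebesgue.
Variable R : realType.
Local Open Scope ereal_scope.

Definition cbox n (a b : 'rV[R]_n) : set 'rV[R]_n :=
  [set y | forall i, (a 0 i <= y 0 i <= b 0 i)%R].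

(* Lebesgue outer measure on R^n.  Covers are indexed by an arbitrary set of
   naturals, so that the value at the empty set is 0 also for n = 0. *)
Definition lebesgue_outer n (X : set 'rV[R]_n) : \bar R :=
  ereal_inf [set v | exists (I : set nat) (a b : nat -> 'rV[R]_n),
    [/\ forall k i, (a k 0 i <= b k 0 i)%R,
        X `<=` \bigcup_(k in I) cbox (a k) (b k) &
        v = \esum_(k in I) (\prod_i (b k 0 i - a k 0 i))%:E]].

Lemma lebesgue_outer_ge0 n (X : set 'rV[R]_n) : 0 <= lebesgue_outer X.
Proof.
apply: le_ereal_inf_tmp => _ [I [a [b [ab _ ->]]]]; apply: esum_ge0 => k _.
by rewrite lee_fin; apply: prodr_ge0 => i _; rewrite subr_ge0.
Qed.

Lemma lebesgue_outer0 n : lebesgue_outer (@set0 'rV[R]_n) = 0.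
Proof.
apply/eqP; rewrite eq_le lebesgue_outer_ge0 andbT; apply: ereal_inf_lbound.
by exists set0, (fun=> 0%R), (fun=> 0%R); split => //; rewrite esum_set0.
Qed.

End Lebesgue.

Section StandardPart.
Variables (R : realType) (K : rcfType).

Definition st (x : K) : \bar R :=
  ereal_sup [set (ratr q)%:E | q in [set q : rat | ratr q <= x]].

Definition st_ext (x : \bar K) : \bar R :=
  match x with
  | EFin x => st x
  | +oo%E => +oo%E
  | -oo%E => -oo%E
  end.

(* The image under st of the finite points of C. *)
Definition st_image n (C : set 'rV[K]_n) : set 'rV[R]_n :=
  [set y | exists2 x, C x & forall i, st (x 0 i) = (y 0 i)%:E].

End StandardPart.

Arguments st R {K} x.
Arguments st_ext R {K} x.

Section BerarducciOtero.
Variables (R : realType) (L : signature) (K : rcfType) (S : structure L K).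
Local Open Scope ereal_scope.

(* K^n with the definable sets of finite diameter as a semiring of sets. *)
Definition definable_space of structure L K := fun n : nat => 'rV[K]_n.

Definition definable_display : structure L K -> nat -> measure_display.
Proof. exact. Qed.

Definition small_definable n : set (set 'rV[K]_n) :=
  [set A | definable S A /\ finite_diameter A].

Lemma small_definable0 n : small_definable (@set0 'rV[K]_n).
Proof.
split; last by exists 0%R; first by exists 0%N; rewrite normr0.
exists (FNot (FEq (TZero _ _ _) (TZero _ _ _))); rewrite eqEsubset.
by split => x //= /(_ erefl).
Qed.

Lemma small_definableI n : setI_closed (@small_definable n).
Proof.
move=> A B [[p ->] [d dfin dA]] [[q ->] _]; split; first by exists (FAnd p q).
by exists d => // x y [? _] [? _]; exact: dA.
Qed.

Lemma small_definableD n : semi_setD_closed (@small_definable n).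
Proof.
apply: setD_semi_setD_closed => A B [[p ->] [d dfin dA]] [[q ->] _].
split; first by exists (FAnd p (FNot q)).
by exists d => // x y [? _] [? _]; exact: dA.
Qed.

HB.instance Definition _ n := Choice.copy (definable_space S n) 'rV[K]_n.
HB.instance Definition _ n := isPointed.Build (definable_space S n) 0%R.
HB.instance Definition _ n :=
  isSemiRingOfSets.Build (definable_display S n) (definable_space S n)
    (@small_definable0 n) (@small_definableI n) (@small_definableD n).

(* The Lebesgue measure of st (C - c) for any c bringing C into the finite
   points; by translation invariance of Lebesgue measure all such c give the
   same value, and c = 0 is one of them if C already consists of finite
   points.  By saturation st (C - c) is compact, so its outer measure is its
   Lebesgue measure. *)
Definition bo_premeasure n (C : set (definable_space S n)) : \bar R :=
  ereal_inf [set lebesgue_outer (st_image [set x - c | x in C]%R)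
    | c in [set c : 'rV[K]_n | [set x - c | x in C]%R `<=` finite_points K n]].

Lemma bo_premeasure_ge0 n (C : set (definable_space S n)) :
  0 <= bo_premeasure C.
Proof. by apply: le_ereal_inf_tmp => _ [c _ <-]; exact: lebesgue_outer_ge0. Qed.

Lemma bo_premeasure0 n : bo_premeasure (@set0 (definable_space S n)) = 0.
Proof.
apply/eqP; rewrite eq_le bo_premeasure_ge0 andbT; apply: ereal_inf_lbound.
exists 0%R => /=; first by rewrite image_set0.
rewrite image_set0 (_ : st_image _ = set0) ?lebesgue_outer0//.
by rewrite eqEsubset; split => y // -[].
Qed.

(* inf of sum_k bo_premeasure (A k) over the countable covers (A k) by
   definable sets of finite diameter. *)
Definition bo_outer n : set (definable_space S n) -> \bar R :=
  mu_ext (@bo_premeasure n).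

HB.instance Definition _ n := isOuterMeasure.Build R (definable_space S n)
  (@bo_outer n)
  (mu_ext0 (@bo_premeasure0 n) (@bo_premeasure_ge0 n))
  (mu_ext_ge0 (@bo_premeasure_ge0 n))
  (le_mu_ext (@bo_premeasure n))
  (mu_ext_sigma_subadditive (@bo_premeasure_ge0 n)).

(* The complete measure given by the Caratheodory extension of bo_premeasure;
   on sets covered by countably many definable sets of finite diameter,
   Caratheodory measurability is membership in the completion of the generated
   sigma-ring. *)
Definition bo_measure n : set (caratheodory_type (@bo_outer n)) -> \bar R :=
  @bo_outer n.
Arguments bo_measure n : clear implicits.

HB.instance Definition _ n := isMeasure.Build _ _ _ (@bo_measure n)
  (@caratheodory_measure0 _ _ (@bo_outer n))
  (@caratheodory_measure_ge0 _ _ (@bo_outer n))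
  (@caratheodory_measure_sigma_additive _ _ (@bo_outer n)).

(** * Hausdorff measure *)

Definition hausdorff_basic e n (C : set 'rV[K]_n) : \bar R :=
  xget 0 [set v | exists M k (E : (e + k)%N = n) s U f,
    @rect_chart L K S e n C M k E s U f /\
    v = \int[bo_measure e]_(x in U)
          st_ext R (Jac e U (fun x => row_mx x (f x)) x)].

(* The value given by any partition; it is only meaningful when A consists of
   finite points, is definable and has dimension at most e. *)
Definition hausdorff e n (A : set 'rV[K]_n) : \bar R :=
  xget 0 [set v | exists N (P : 'I_N.+1 -> set 'rV[K]_n),
    rectifiable_partition S e A P /\
    v = \sum_(i < N) hausdorff_basic e (P (lift ord0 i))].

End BerarducciOtero.

Arguments bo_outer R {L K} S n X.
Arguments bo_measure R {L K} S n X.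
Arguments hausdorff_basic R {L K} S e {n} C.
Arguments hausdorff R {L K} S e {n} A.

(* Main.v *)
(* Let P be a countable set of parameters; a point is generic over P if its
   coordinates are acl-independent over P.  By saturation, a P-definable set
   without generic points lies in finitely many thin sets and has measure 0, a
   P-definable function is strictly differentiable at generic points, and a
   property of all generic points holds on finitely many P-definable sets that
   cover them.  The integral of the standard part of a function is the volume
   of the region below its graph.

   Up to points that are not generic, a definable set is cut into Lipschitz
   cells: its boundary is covered by almost affine hypersurfaces, and weights
   separate their slopes well enough to compare them in a common direction.
   Fubini's theorem follows by counting dyadic cubes, and the change of
   variables formula by induction on the dimension, one coordinate of the map
   being changed at a time.

   At a generic x with J_n f(x) <> 0 the map phi = (f, e = m - n remaining
   coordinates) has a local inverse a, and J_n f = J_e (a(y, .)) |det D phi| by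
   the Cauchy-Binet formula and Jacobi's identity for complementary minors.
   Hence the integral of J_n f over A is the sum, over finitely many charts, of
   the volumes of the regions 0 < t < J_e (a(y, .))(v), and Fubini's theorem
   slices them at y.  The slices add up to H^e of the fibre, because the change
   of variables formula compares the parametrisations v |-> a(y, v) with the
   charts of any rectifiable partition. *)

Require Import Defs.
From HB Require Import structures.
From mathcomp Require Import all_boot all_order all_algebra.
From mathcomp Require Import perm.
From mathcomp Require Import all_classical all_reals all_analysis.
From mathcomp Require Import measurable_realfun.
From mathcomp Require Import lra ring zify.

Set Implicit Arguments.
Unset Strict Implicit.
Unset Printing Implicit Defensive.

Import Order.TTheory GRing.Theory Num.Theory numFieldNormedType.Exports.

Local Open Scope classical_set_scope.
Local Open Scope ring_scope.

(** Three obstacles shape the proof. Standard parts respect only finite constants, so every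
    Lipschitz bound must be a natural number. Hence the bound of the cells depends on the dimension
    alone, and wherever an inverse could become infinite a largest derivative or a largest minor is
    chosen as pivot.

    Volumes are real numbers and not elements of [K], so an inequality between the volumes of the
    members of two families is not a definable condition. It is approximated by numbers of dyadic
    cubes: these take finitely many values, each on a definable set.

    Genericity, which replaces almost everywhere, is relative to a countable set of parameters.
    Hence all definability statements carry their parameters, and new parameters, such as the end
    points of an interval, are chosen so that the points under study stay generic.

    Finally, the Hausdorff measure picks an arbitrary partition and is 0 if there is none.
    Partitions must therefore be built for almost all fibres, by spreading a decomposition of one
    generic fibre over a definable set of fibres, and every partition that could be picked must give
    the same sum of volumes. *)

Local Notation "K ^^ n" := 'rV[K]_n (at level 8, n at level 2, only parsing).

(** * Renaming of variables and parameters in formulas *)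

Section Substitution.
Variables (L : signature) (K : rcfType) (S : structure L K).
Implicit Types P : set K.

Definition env_cat (T : Type) k n (w : 'I_k -> T) (v : 'I_n -> T) : 'I_(k + n) -> T :=
  fun i => match fintype.split i with inl j => w j | inr j => v j end.

Definition lift_ren n m (r : 'I_n -> 'I_m) : 'I_n.+1 -> 'I_m.+1 :=
  fun i => if unlift ord0 i is Some j then lift ord0 (r j) else ord0.

(* Renames the variables along [r]; if [z = Some j], the parameters outside
   [P] are moreover replaced by the variable [j]. *)
Fixpoint tsub P n (t : term L K n) m (r : 'I_n -> 'I_m) (z : option 'I_m) :
    term L K m :=
  match t with
  | TVar i => TVar L K (r i)
  | TPar c => if z is Some j then if `[< P c >] then TPar L m c else TVar L K j
              else TPar L m c
  | TZero => TZero L K m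
  | TOne => TOne L K m
  | TOpp t => TOpp (tsub P t r z)
  | TAdd t u => TAdd (tsub P t r z) (tsub P u r z)
  | TMul t u => TMul (tsub P t r z) (tsub P u r z)
  | TFun s ts => TFun (fun i => tsub P (ts i) r z)
  end.

Fixpoint fsub P n (p : formula L K n) m (r : 'I_n -> 'I_m) (z : option 'I_m) :
    formula L K m :=
  match p in formula _ _ n return ('I_n -> 'I_m) -> formula L K m with
  | FEq _ t u => fun r => FEq (tsub P t r z) (tsub P u r z)
  | FLt _ t u => fun r => FLt (tsub P t r z) (tsub P u r z)
  | FRel _ s ts => fun r => FRel (fun i => tsub P (ts i) r z)
  | FNot _ p => fun r => FNot (fsub P p r z)
  | FAnd _ p q => fun r => FAnd (fsub P p r z) (fsub P q r z)
  | FEx _ p => fun r => FEx (fsub P p (lift_ren r) (omap (lift ord0) z))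
  end r.

Lemma env_cons_lift_ren n m (r : 'I_n -> 'I_m) c (v : 'I_m -> K) :
  env_cons c v \o lift_ren r = env_cons c (v \o r).
Proof.
apply/funext => i; rewrite /env_cons /lift_ren /=.
by case: (unlift ord0 i) => [j|]; rewrite ?liftK ?unlift_none.
Qed.

Lemma teval_tsub P n (t : term L K n) m (r : 'I_n -> 'I_m) z v :
  (forall j c, z = Some j -> ~ P c -> term_over (P `|` [set v j]) t) ->
  teval S v (tsub P t r z) = teval S (v \o r) t.
Proof.
elim: t => //= [c Pc|t IH H|t IHt u IHu H|t IHt u IHu H|s ts IH H].
- case: z Pc => // j Pc; case: asboolP => //= nPc.
  by have [|->] := Pc j c erefl nPc.
- by rewrite IH.
- by rewrite IHt ?IHu // => j c /H /[apply] -[].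
- by rewrite IHt ?IHu // => j c /H /[apply] -[].
- by congr (finterp _ _); apply/funext => i; apply: IH => j c /H /[apply].
Qed.

(** A parameter can be replaced by the variable [j] only if it equals the value of [j]; the
    hypothesis says that all parameters outside [P] do. *)
Lemma holds_fsub P n (p : formula L K n) m (r : 'I_n -> 'I_m) z v :
  (forall j c, z = Some j -> ~ P c -> formula_over (P `|` [set v j]) p) ->
  holds S (fsub P p r z) v <-> holds S p (v \o r).
Proof.
elim: p m r z v => /= [k t u|k t u|k s ts|k p IH|k p IHp q IHq|k p IH] m r z v H.
- by rewrite !teval_tsub // => j c /H /[apply] -[].
- by rewrite !teval_tsub // => j c /H /[apply] -[].
- suff -> : (fun i => teval S v (tsub P (ts i) r z)) =
    (fun i => teval S (v \o r) (ts i)) by [].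
  by apply/funext => i; rewrite teval_tsub // => j c /H /[apply].
- by rewrite IH // => j c /H /[apply].
- by rewrite IHp ?IHq // => j c /H /[apply] -[].
- have E c : holds S (fsub P p (lift_ren r) (omap (lift ord0) z)) (env_cons c v)
      <-> holds S p (env_cons c (v \o r)).
    rewrite IH ?env_cons_lift_ren // => j d.
    by case: z H => // j0 H [<-] nPd; rewrite /env_cons liftK; exact: H nPd.
  by split=> -[c /E]; exists c.
Qed.

Lemma tsub_over P n (t : term L K n) m (r : 'I_n -> 'I_m) z :
  (z = None -> term_over P t) -> term_over P (tsub P t r z).
Proof.
elim: t => //= [c|t IHt u IHu H|t IHt u IHu H|s ts IH H i].
- by case: z => [j _|/(_ erefl)//]; case: asboolP.
- by split; [apply: IHt => /H[]|apply: IHu => /H[]].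
- by split; [apply: IHt => /H[]|apply: IHu => /H[]].
- by apply: IH => /H.
Qed.

Lemma fsub_over P n (p : formula L K n) m (r : 'I_n -> 'I_m) z :
  (z = None -> formula_over P p) -> formula_over P (fsub P p r z).
Proof.
elim: p m r z => /= [k t u|k t u|k s ts|k p IH|k p IHp q IHq|k p IH] m r z H.
- by split; apply: tsub_over => /H[].
- by split; apply: tsub_over => /H[].
- by move=> i; apply: tsub_over => /H.
- by apply: IH.
- by split; [apply: IHp => /H[]|apply: IHq => /H[]].
- by apply: IH => zN; apply: H; case: z zN.
Qed.

Lemma term_overW P P' n (t : term L K n) :
  P `<=` P' -> term_over P t -> term_over P' t.
Proof.
move=> PP'; elim: t => //= [t IHt u IHu [? ?]|t IHt u IHu [? ?]|s ts IH H i].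
- by split; [exact: IHt|exact: IHu].
- by split; [exact: IHt|exact: IHu].
- exact: IH.
Qed.

Lemma formula_overW P P' n (p : formula L K n) :
  P `<=` P' -> formula_over P p -> formula_over P' p.
Proof.
move=> PP'; elim: p => //= [k t u [? ?]|k t u [? ?]|k s ts H i|k p IHp q IHq [? ?]].
- by split; apply: term_overW; eauto.
- by split; apply: term_overW; eauto.
- exact: term_overW (H i).
- by split; [exact: IHp|exact: IHq].
Qed.

Lemma finite_overU (Q Q' : set K -> Prop) :
  (forall P P', P `<=` P' -> Q P -> Q P') ->
  (forall P P', P `<=` P' -> Q' P -> Q' P') ->
  (exists2 P, finite_set P & Q P) -> (exists2 P, finite_set P & Q' P) ->
  exists2 P, finite_set P & Q P /\ Q' P.
Proof.
move=> QW Q'W [P fP QP] [P' fP' QP']; exists (P `|` P').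
  by rewrite finite_setU.
by split; [apply: QW QP; apply: subsetUl|apply: Q'W QP'; apply: subsetUr].
Qed.

Lemma finite_over_all n (Q : 'I_n -> set K -> Prop) :
  (forall i P P', P `<=` P' -> Q i P -> Q i P') ->
  (forall i, exists2 P, finite_set P & Q i P) ->
  exists2 P, finite_set P & forall i, Q i P.
Proof.
move=> QW H; have /choice[F FP] : forall i, exists P, finite_set P /\ Q i P.
  by move=> i; have [P] := H i; exists P.
exists (\bigcup_i F i) => [|i].
  by apply: bigcup_finite => // i _; case: (FP i).
by apply: QW (FP i).2; apply: bigcup_sup.
Qed.

Lemma term_over_fin n (t : term L K n) : exists2 P, finite_set P & term_over P t.
Proof.
elim: t => /= [i|c|||t IH|t IHt u IHu|t IHt u IHu|s ts IH];
  try by exists set0.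
- by exists [set c].
- by [].
- by apply: finite_overU => //; move=> *; apply: term_overW; eauto.
- by apply: finite_overU => //; move=> *; apply: term_overW; eauto.
- by apply: finite_over_all => // *; apply: term_overW; eauto.
Qed.

Lemma formula_over_fin n (p : formula L K n) :
  exists2 P, finite_set P & formula_over P p.
Proof.
elim: p => //= [k t u|k t u|k s ts|k p IHp q IHq].
- by apply: finite_overU; try (by move=> *; apply: term_overW; eauto);
     exact: term_over_fin.
- by apply: finite_overU; try (by move=> *; apply: term_overW; eauto);
     exact: term_over_fin.
- by apply: finite_over_all => [*|i]; [apply: term_overW; eauto|exact: term_over_fin].
- by apply: finite_overU => //; move=> *; apply: formula_overW; eauto.
Qed.

Lemma env_cat_lshift (T : Type) k n (w : 'I_k -> T) (v : 'I_n -> T) i :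
  env_cat w v (lshift n i) = w i.
Proof. by rewrite /env_cat -[lshift n i]/(unsplit (inl i)) unsplitK. Qed.

Lemma env_cat_rshift (T : Type) k n (w : 'I_k -> T) (v : 'I_n -> T) i :
  env_cat w v (rshift k i) = v i.
Proof. by rewrite /env_cat -[rshift k i]/(unsplit (inr i)) unsplitK. Qed.

Lemma env_cons_cat k n c (w : 'I_k -> K) (v : 'I_n -> K) :
  env_cons c (env_cat w v) = env_cat (env_cons c w) v.
Proof.
apply/funext => i; case: (splitP (i : 'I_(k.+1 + n))) => j E.
  have -> : i = lshift n j by exact/val_inj.
  rewrite env_cat_lshift /env_cons.
  case: (unliftP ord0 j) => [j' jE|jE].
    have -> : lshift n j = lift ord0 (lshift n j') :> 'I_(k + n).+1.
      by apply: val_inj; rewrite /= jE.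
    by rewrite liftK env_cat_lshift.
  have -> : lshift n j = ord0 :> 'I_(k + n).+1 by apply: val_inj; rewrite jE.
  by rewrite unlift_none.
have -> : i = rshift k.+1 j by exact/val_inj.
rewrite env_cat_rshift /env_cons.
have -> : rshift k.+1 j = lift ord0 (rshift k j) :> 'I_(k + n).+1.
  by apply: val_inj.
by rewrite liftK env_cat_rshift.
Qed.

(** As [FEx] binds [ord0], the bound variables come first in the environment. This is why
    [encodable_prod] puts the second component of a pair, the one to be quantified, in front. *)
Lemma formula_exN P k n (p : formula L K (k + n)) : formula_over P p ->
  exists2 q : formula L K n, formula_over P q &
    forall v, holds S q v <-> exists w, holds S p (env_cat w v).
Proof.
elim: k p => [|k IH] p pP.
  exists p => // v; have E w : env_cat (w : 'I_0 -> K) v = v.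
    by apply/funext => i; rewrite -[i in LHS](_ : rshift 0 i = i) ?env_cat_rshift //;
      apply: val_inj.
  by split=> [|[w]]; rewrite ?E //; exists (fun=> 0); rewrite E.
have [q qP qE] := IH (FEx (p : formula L K (k + n).+1)) pP.
exists q => // v; rewrite qE; split=> [[w /= [c]]|[w pw]].
  by rewrite env_cons_cat; exists (env_cons c w).
exists (fun i => w (lift ord0 i)); exists (w ord0); rewrite env_cons_cat.
have -> // : env_cons (w ord0) (fun i => w (lift ord0 i)) = w.
by apply/funext => i; rewrite /env_cons; case: unliftP => [j ->|->].
Qed.

End Substitution.

(* The types that are powers of [K] up to bracketing. *)
Class encodable (K : rcfType) (T : Type) := Encodable {
  edim : nat;
  encv : T -> 'I_edim -> K;
  decv : ('I_edim -> K) -> T;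
  encvK : cancel encv decv;
  decvK : cancel decv encv }.

Section Encodings.
Variable K : rcfType.

#[global] Program Instance encodable_self : encodable K (K : Type) :=
  {| edim := 1%N; encv x := fun=> x; decv v := v ord0 |}.
Next Obligation. by []. Qed.
Next Obligation. by move=> v; apply/funext => i; rewrite (ord1 i). Qed.

#[global] Program Instance encodable_rV n : encodable K K^^n :=
  {| edim := n; encv x := x 0; decv v := \row_i v i |}.
Next Obligation. by move=> n x; apply/rowP => i; rewrite mxE. Qed.
Next Obligation. by move=> n v; apply/funext => i; rewrite mxE. Qed.

(* The second component comes first. *)
#[global] Program Instance encodable_prod T U (eT : encodable K T)
    (eU : encodable K U) : encodable K (T * U) :=
  {| edim := (edim (T := U) + edim (T := T))%N;
     encv x := env_cat (encv x.2) (encv x.1);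
     decv v := (decv (fun i => v (rshift _ i)), decv (fun i => v (lshift _ i))) |}.
Next Obligation.
move=> T U eT eU [x y] /=; congr pair.
  by under eq_fun do rewrite env_cat_rshift; exact: encvK.
by under eq_fun do rewrite env_cat_lshift; exact: encvK.
Qed.
Next Obligation.
move=> T U eT eU v /=; rewrite !decvK; apply/funext => i.
by case: (splitP i) => j E; [have -> : i = lshift _ j by exact/val_inj|
  have -> : i = rshift _ j by exact/val_inj]; rewrite ?env_cat_lshift ?env_cat_rshift.
Qed.

End Encodings.

(** * Closure properties of definability *)

Section Definability.
Variables (L : signature) (K : rcfType) (S : structure L K).
Implicit Types P : set K.

(* Definability over [P], of sets and of functions. *)
Definition D P T {eT : encodable K T} (Q : T -> Prop) : Prop :=
  exists2 p : formula L K (edim (T := T)), formula_over P p &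
    forall x, Q x <-> holds S p (encv x).

Definition Df P T U {eT : encodable K T} {eU : encodable K U} (g : T -> U) : Prop :=
  D P (fun p : T * U => p.2 = g p.1).

Section Closure.
Variable P : set K.
Context {T : Type} {eT : encodable K T}.
Implicit Types Q : T -> Prop.

Lemma D_ext Q Q' : (forall x, Q x <-> Q' x) -> D P Q -> D P Q'.
Proof. by move=> E [p pP pE]; exists p => // x; rewrite -E. Qed.

Lemma D_not Q : D P Q -> D P (fun x => ~ Q x).
Proof. by move=> [p pP pE]; exists (FNot p) => // x /=; rewrite pE. Qed.

Lemma D_and Q Q' : D P Q -> D P Q' -> D P (fun x => Q x /\ Q' x).
Proof. by move=> [p pP pE] [q qP qE]; exists (FAnd p q) => //= x; rewrite pE qE. Qed.

Lemma D_or Q Q' : D P Q -> D P Q' -> D P (fun x => Q x \/ Q' x).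
Proof.
move=> H H'; apply: D_ext (D_not (D_and (D_not H) (D_not H'))) => x.
by split=> [/not_andP[]/contrapT|[]]; tauto.
Qed.

Lemma D_imp Q Q' : D P Q -> D P Q' -> D P (fun x => Q x -> Q' x).
Proof.
move=> H H'; apply: D_ext (D_or (D_not H) H') => x.
by split=> [[]//|]; case: (pselect (Q x)); tauto.
Qed.

Lemma D_iff Q Q' : D P Q -> D P Q' -> D P (fun x => Q x <-> Q' x).
Proof. by move=> H H'; apply: D_and; apply: D_imp. Qed.

Lemma D_ex U {eU : encodable K U} (Q : T -> U -> Prop) :
  D P (fun p : T * U => Q p.1 p.2) -> D P (fun x => exists y, Q x y).
Proof.
move=> [p pP pE]; have [q qP qE] := @formula_exN L K S P _ _ p pP.
exists q => // x; rewrite qE; split=> [[y /(pE (x, y))]|[w pw]].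
  by exists (encv y).
by exists (decv w); apply/(pE (x, decv w)); rewrite /= decvK.
Qed.

Lemma D_all U {eU : encodable K U} (Q : T -> U -> Prop) :
  D P (fun p : T * U => Q p.1 p.2) -> D P (fun x => forall y, Q x y).
Proof.
move=> [p pP pE].
have /D_not : D P (fun x => exists y, ~ Q x y); first apply: D_ex.
  by exists (FNot p) => // x /=; rewrite pE.
by apply: D_ext => x; split=> [/forallNP H0 y|H0 [y]]; [exact: contrapT|exact].
Qed.

Lemma D_True : D P (fun _ : T => True).
Proof. by exists (FNot (FLt (TZero _ _ _) (TZero _ _ _))) => //= x; rewrite ltxx. Qed.

(** A proposition that does not depend on the point is true or false, and both constants are
    definable. In this way conditions on real numbers or on finite index sets enter definable
    sets. *)
Lemma D_const (Q : Prop) : D P (fun _ : T => Q).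
Proof.
case: (pselect Q) => HQ; first by apply: D_ext D_True.
by apply: D_ext (D_not D_True) => x; tauto.
Qed.

Lemma D_big n (Q : 'I_n -> T -> Prop) :
  (forall i, D P (Q i)) -> D P (fun x => forall i, Q i x).
Proof.
elim: n Q => [|n IH] Q H; first by apply: D_ext D_True => x; split=> // _ [].
apply: D_ext (D_and (H ord0) (IH (fun i => Q (lift ord0 i)) (fun i => H _))) => x.
split=> [[Q0 Qr] i|Qx]; last by split.
by case: (unliftP ord0 i) => [j ->|->].
Qed.

Lemma D_bigex n (Q : 'I_n -> T -> Prop) :
  (forall i, D P (Q i)) -> D P (fun x => exists i, Q i x).
Proof.
move=> H; have /D_not : D P (fun x => forall i, ~ Q i x).
  by apply: D_big => i; exact: D_not.
by apply: D_ext => x; split=> [/existsNP[i /contrapT]|[i Qi] /(_ i)]; [exists i|].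
Qed.

(* [g] forgets, permutes or repeats coordinates. *)
Definition reindexing U {eU : encodable K U} (g : T -> U) : Prop :=
  forall i, exists j, forall x, encv (g x) i = encv x j.

Lemma D_reindex U {eU : encodable K U} (g : T -> U) (Q : U -> Prop) :
  reindexing g -> D P Q -> D P (fun x => Q (g x)).
Proof.
move=> /choice[r E] [p pP pE]; exists (fsub P p r None); first exact: fsub_over.
move=> x; rewrite pE holds_fsub //.
by have -> : encv x \o r = encv (g x) by apply/funext => i; rewrite E.
Qed.

Lemma reindexing_id : reindexing (fun x : T => x).
Proof. by move=> i; exists i. Qed.

Lemma reindexing_fst U V {eU : encodable K U} {eV : encodable K V} (g : T -> U * V) :
  reindexing g -> reindexing (fun x => (g x).1).
Proof.
move=> H i; have [j E] := H (rshift _ i); exists j => x.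
by rewrite -E /= env_cat_rshift.
Qed.

Lemma reindexing_snd U V {eU : encodable K U} {eV : encodable K V} (g : T -> U * V) :
  reindexing g -> reindexing (fun x => (g x).2).
Proof.
move=> H i; have [j E] := H (lshift _ i); exists j => x.
by rewrite -E /= env_cat_lshift.
Qed.

Lemma reindexing_pair U V {eU : encodable K U} {eV : encodable K V}
    (g : T -> U) (h : T -> V) :
  reindexing g -> reindexing h -> reindexing (fun x => (g x, h x)).
Proof.
move=> Hg Hh i; case: (splitP i) => k E.
  have [j Ej] := Hh k; exists j => x; rewrite -Ej /=.
  by have -> : i = lshift _ k; [exact: val_inj|rewrite env_cat_lshift].
have [j Ej] := Hg k; exists j => x; rewrite -Ej /=.
by have -> : i = rshift _ k; [exact: val_inj|rewrite env_cat_rshift].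
Qed.

End Closure.

Ltac reindex :=
  lazymatch goal with
  | |- reindexing (fun x => (@?g x, @?h x)) =>
      apply: (reindexing_pair (g := g) (h := h)); reindex
  | |- reindexing (fun x => fst (@?g x)) =>
      apply: (reindexing_fst (g := g)); reindex
  | |- reindexing (fun x => snd (@?g x)) =>
      apply: (reindexing_snd (g := g)); reindex
  | |- reindexing fst => apply: (reindexing_fst (g := id)); reindex
  | |- reindexing snd => apply: (reindexing_snd (g := id)); reindex
  | |- _ => exact: reindexing_id
  end.

Lemma D_snd P T U (eT : encodable K T) (eU : encodable K U) (Q : U -> Prop) :
  D P Q -> D P (fun p : T * U => Q p.2).
Proof. by apply: D_reindex; reindex. Qed.

Lemma D_fst P T U (eT : encodable K T) (eU : encodable K U) (Q : T -> Prop) :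
  D P Q -> D P (fun p : T * U => Q p.1).
Proof. by apply: D_reindex; reindex. Qed.

Section Functions.
Variable P : set K.

Lemma D_var_eq T {eT : encodable K T} (i j : 'I_(edim (T := T))) :
  D P (fun x : T => encv x i = encv x j).
Proof. by exists (FEq (TVar L K i) (TVar L K j)). Qed.

Lemma D_eq_reindex T U {eT : encodable K T} {eU : encodable K U} (g h : T -> U) :
  reindexing g -> reindexing h -> D P (fun x => g x = h x).
Proof.
move=> /choice[r rE] /choice[s sE].
have := D_big (fun i => @D_var_eq T _ (r i) (s i)).
apply: D_ext => x; split=> [H|E i]; last by rewrite -rE -sE E.
by apply: (can_inj encvK); apply/funext => i; rewrite rE sE H.
Qed.

Lemma Df_reindex T U {eT : encodable K T} {eU : encodable K U} (g : T -> U) :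
  reindexing g -> Df P g.
Proof.
move=> H; apply: D_eq_reindex; first by reindex.
move=> i; have [j E] := H i.
by exists (rshift _ j) => -[x y] /=; rewrite env_cat_rshift.
Qed.

Section OneType.
Context {T : Type} {eT : encodable K T}.

Lemma Df_id : Df P (fun x : T => x).
Proof. by apply: Df_reindex; reindex. Qed.

Context {U : Type} {eU : encodable K U}.

Lemma D_comp (Q : U -> Prop) (g : T -> U) :
  D P Q -> Df P g -> D P (fun x => Q (g x)).
Proof.
move=> DQ Dg; apply: D_ext (D_ex (Q := fun x y => y = g x /\ Q y) _) => [x|].
  by split=> [[y [->]]|Qx] //; exists (g x).
by apply: D_and => //; exact: D_snd.
Qed.

Lemma Df_pair V {eV : encodable K V} (g : T -> U) (h : T -> V) :
  Df P g -> Df P h -> Df P (fun x => (g x, h x)).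
Proof.
move=> Dg Dh; rewrite /Df.
have D1 : D P (fun p : T * (U * V) => p.2.1 = g p.1).
  by apply: (D_reindex (g := fun p : T * (U * V) => (p.1, p.2.1))) Dg; reindex.
have D2 : D P (fun p : T * (U * V) => p.2.2 = h p.1).
  by apply: (D_reindex (g := fun p : T * (U * V) => (p.1, p.2.2))) Dh; reindex.
by apply: D_ext (D_and D1 D2) => -[x [y z]] /=; split=> [[-> ->]|[-> ->]].
Qed.

End OneType.

Lemma Df_comp T U V (eT : encodable K T) (eU : encodable K U) (eV : encodable K V)
  (h : U -> V) (g : T -> U) : Df P h -> Df P g -> Df P (fun x => h (g x)).
Proof.
move=> Dh Dg; have Dp : Df P (fun p : T * V => (g p.1, p.2)).
  apply: Df_pair; last by apply: Df_reindex; reindex.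
  by apply: (D_reindex (g := fun p : T * V * U => (p.1.1, p.2))) Dg; reindex.
exact: (D_comp (Q := fun p : U * V => p.2 = h p.1) Dh Dp).
Qed.

Lemma Df_fst T U V (eT : encodable K T) (eU : encodable K U) (eV : encodable K V)
  (g : T -> U * V) : Df P g -> Df P (fun x => (g x).1).
Proof. by apply: Df_comp; apply: Df_reindex; reindex. Qed.

Lemma Df_snd T U V (eT : encodable K T) (eU : encodable K U) (eV : encodable K V)
  (g : T -> U * V) : Df P g -> Df P (fun x => (g x).2).
Proof. by apply: Df_comp; apply: Df_reindex; reindex. Qed.

Section Fields.
Context {T : Type} {eT : encodable K T}.
Implicit Types g h : T -> K.

Lemma D_eqT U {eU : encodable K U} (g h : T -> U) :
  Df P g -> Df P h -> D P (fun x => g x = h x).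
Proof.
move=> Dg Dh; apply: D_ext (D_comp (Q := fun p : T * U => p.2 = g p.1)
  (g := fun x => (x, h x)) Dg (Df_pair Df_id Dh)) => x /=.
by split=> ->.
Qed.

Lemma D_lt g h : Df P g -> Df P h -> D P (fun x => g x < h x).
Proof.
move=> Dg Dh; have E : D P (fun p : K * K => p.1 < p.2).
  exists (FLt (TVar L K (rshift _ ord0)) (TVar L K (lshift _ ord0))) => // -[x y] /=.
  by rewrite env_cat_lshift env_cat_rshift.
exact: D_comp E (Df_pair Dg Dh).
Qed.

Lemma D_le g h : Df P g -> Df P h -> D P (fun x => g x <= h x).
Proof.
move=> Dg Dh; apply: D_ext (D_not (D_lt Dh Dg)) => x.
by rewrite leNgt; split=> /negP.
Qed.

Lemma Df_cst (c : K) : P c -> Df P (fun _ : T => c).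
Proof.
move=> Pc; exists (FEq (TVar L K (lshift _ ord0)) (TPar L _ c)) => // -[x y] /=.
by rewrite env_cat_lshift.
Qed.

Lemma Df_0 : Df P (fun _ : T => 0 : K).
Proof.
exists (FEq (TVar L K (lshift _ ord0)) (TZero L K _)) => // -[x y] /=.
by rewrite env_cat_lshift.
Qed.

Lemma Df_1 : Df P (fun _ : T => 1 : K).
Proof.
exists (FEq (TVar L K (lshift _ ord0)) (TOne L K _)) => // -[x y] /=.
by rewrite env_cat_lshift.
Qed.

Lemma Df_opp g : Df P g -> Df P (fun x => - g x).
Proof.
move=> Dg; apply: (Df_comp (h := fun y : K => - y)) Dg.
exists (FEq (TVar L K (lshift _ ord0)) (TOpp (TVar L K (rshift _ ord0)))) => // -[x y] /=.
by rewrite env_cat_lshift env_cat_rshift.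
Qed.

Lemma Df_add g h : Df P g -> Df P h -> Df P (fun x => g x + h x).
Proof.
move=> Dg Dh; apply: (Df_comp (h := fun p : K * K => p.1 + p.2)) (Df_pair Dg Dh).
exists (FEq (TVar L K (lshift _ ord0)) (TAdd (TVar L K (rshift _ (rshift _ ord0)))
   (TVar L K (rshift _ (lshift _ ord0))))) => // -[[x y] z] /=.
by rewrite env_cat_lshift !env_cat_rshift env_cat_lshift.
Qed.

Lemma Df_mul g h : Df P g -> Df P h -> Df P (fun x => g x * h x).
Proof.
move=> Dg Dh; apply: (Df_comp (h := fun p : K * K => p.1 * p.2)) (Df_pair Dg Dh).
exists (FEq (TVar L K (lshift _ ord0)) (TMul (TVar L K (rshift _ (rshift _ ord0)))
   (TVar L K (rshift _ (lshift _ ord0))))) => // -[[x y] z] /=.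
by rewrite env_cat_lshift !env_cat_rshift env_cat_lshift.
Qed.

Lemma Df_if U {eU : encodable K U} (Q : T -> Prop) (b : T -> bool) (g h : T -> U) :
  (forall x, b x <-> Q x) -> D P Q -> Df P g -> Df P h ->
  Df P (fun x => if b x then g x else h x).
Proof.
move=> bQ DQ Dg Dh.
have := D_or (D_and (D_fst _ DQ) Dg) (D_and (D_fst _ (D_not DQ)) Dh).
apply: D_ext => -[x y] /=.
by case: ifP => [/bQ|/negP nb]; [|have : ~ Q x by move/bQ]; tauto.
Qed.

Lemma Df_nat n : Df P (fun _ : T => n%:R : K).
Proof.
elim: n => [|n IH]; first exact: Df_0.
by under eq_fun do rewrite -addn1 natrD; apply: Df_add => //; exact: Df_1.
Qed.

End Fields.

Lemma Df_inv T {eT : encodable K T} (g : T -> K) :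
  Df P g -> Df P (fun x => (g x)^-1).
Proof.
apply: Df_comp.
have D1 : Df P (fun p : K * K => p.1) by apply: Df_reindex; reindex.
have D2 : Df P (fun p : K * K => p.2) by apply: Df_reindex; reindex.
(* The second alternative is the convention that 0 is its own inverse. *)
have := D_or (D_eqT (Df_mul D1 D2) (Df_1 (T := K * K)))
  (D_and (D_eqT D1 (Df_0 (T := K * K))) (D_eqT D2 (Df_0 (T := K * K)))).
apply: D_ext => -[x y] /=; split=> [[xy|[-> ->]]|->]; last 1 first.
- by have [->|x0] := eqVneq x 0; [right; rewrite invr0|left; rewrite divff].
- have x0 : x != 0 by apply/eqP => x0; move: xy; rewrite x0 mul0r => /eqP; rewrite eq_sym oner_eq0.
  by rewrite -[RHS]mulr1 -xy mulKf.
- by rewrite invr0.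
Qed.

Lemma Df_sqrt T {eT : encodable K T} (g : T -> K) :
  Df P g -> Df P (fun x => Num.sqrt (g x)).
Proof.
apply: Df_comp.
have D1 : Df P (fun p : K * K => p.1) by apply: Df_reindex; reindex.
have D2 : Df P (fun p : K * K => p.2) by apply: Df_reindex; reindex.
have D0 : Df P (fun _ : K * K => 0 : K) by exact: Df_0.
have := D_or (D_and (D_and (D_le D0 D1) (D_le D0 D2)) (D_eqT (Df_mul D2 D2) D1))
  (D_and (D_lt D1 D0) (D_eqT D2 D0)).
apply: D_ext => -[x y] /=; split=> [[[[x0 y0] <-]|[x0 ->]]|->].
- by rewrite -expr2 sqrtr_sqr ger0_norm.
- by rewrite ltr0_sqrtr.
- by have [x0|x0] := leP 0 x; [left; rewrite sqrtr_ge0 -expr2 sqr_sqrtr|right; rewrite ltr0_sqrtr].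
Qed.

Section Vectors.
Context {T : Type} {eT : encodable K T}.

Lemma Df_norm (g : T -> K) : Df P g -> Df P (fun x => `|g x|).
Proof.
move=> Dg; have -> : (fun x => `|g x|) = (fun x => if 0 <= g x then g x else - g x).
  by apply/funext => x; case: (leP 0 (g x)) => [/ger0_norm|/ltr0_norm].
by apply: Df_if (D_le Df_0 Dg) Dg (Df_opp Dg).
Qed.

Lemma Df_exp (g : T -> K) n : Df P g -> Df P (fun x => g x ^+ n).
Proof.
move=> Dg; elim: n => [|n IH]; first exact: Df_1.
by under eq_fun do rewrite exprS; exact: Df_mul.
Qed.

Lemma Df_sum (I : Type) (r : seq I) (B : pred I) (F : I -> T -> K) :
  (forall i, Df P (F i)) -> Df P (fun x => \sum_(i <- r | B i) F i x).
Proof.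
move=> DF; elim: r => [|i r IH].
  by under eq_fun do rewrite big_nil; exact: Df_0.
under eq_fun do rewrite big_cons.
by case: (B i) => //; apply: Df_add.
Qed.

Lemma Df_prod (I : Type) (r : seq I) (B : pred I) (F : I -> T -> K) :
  (forall i, Df P (F i)) -> Df P (fun x => \prod_(i <- r | B i) F i x).
Proof.
move=> DF; elim: r => [|i r IH].
  by under eq_fun do rewrite big_nil; exact: Df_1.
under eq_fun do rewrite big_cons.
by case: (B i) => //; apply: Df_mul.
Qed.

Lemma Df_entry n (g : T -> K^^n) i : Df P g -> Df P (fun x => g x 0 i).
Proof.
apply: (Df_comp (h := fun v : K^^n => v 0 i)); apply: Df_reindex => j.
by exists i.
Qed.

Lemma Df_rV n (g : T -> K^^n) : (forall i, Df P (fun x => g x 0 i)) -> Df P g.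
Proof.
move=> H.
have : D P (fun p : T * K^^n => forall i, p.2 0 i = g p.1 0 i).
  apply: D_big => i; apply: D_eqT.
    apply: (Df_comp (h := fun v : K^^n => v 0 i)); apply: Df_reindex.
      by move=> j; exists i.
    by reindex.
  by apply: (Df_comp (h := fun x => g x 0 i)) => //; apply: Df_reindex; reindex.
by apply: D_ext => -[x v] /=; split=> [E|-> //]; apply/rowP => i; rewrite E.
Qed.

End Vectors.
End Functions.

Lemma D_mono P P' T {eT : encodable K T} (Q : T -> Prop) : P `<=` P' -> D P Q -> D P' Q.
Proof. by move=> PP' [p pP pE]; exists p => //; apply: formula_overW pP. Qed.

Lemma Df_mono P P' T U {eT : encodable K T} {eU : encodable K U} (g : T -> U) :
  P `<=` P' -> Df P g -> Df P' g.
Proof. exact: D_mono. Qed.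

Lemma term_overI P P' n (t : term L K n) :
  term_over P t -> term_over P' t -> term_over (P `&` P') t.
Proof.
elim: t => //= [t IHt u IHu [? ?] [? ?]|t IHt u IHu [? ?] [? ?]|s ts IH H H' i].
- by split; [exact: IHt|exact: IHu].
- by split; [exact: IHt|exact: IHu].
- exact: IH.
Qed.

Lemma formula_overI P P' n (p : formula L K n) :
  formula_over P p -> formula_over P' p -> formula_over (P `&` P') p.
Proof.
elim: p => //= [k t u [? ?] [? ?]|k t u [? ?] [? ?]|k s ts H H' i|k p IHp q IHq [? ?] [? ?]].
- by split; exact: term_overI.
- by split; exact: term_overI.
- exact: term_overI.
- by split; [exact: IHp|exact: IHq].
Qed.

(** Only finitely many parameters occur in a formula; the list form supports induction on them. *)
Lemma D_finite P T {eT : encodable K T} (Q : T -> Prop) : D P Q ->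
  exists2 s : seq K, (forall c, c \in s -> P c) & D [set` s] Q.
Proof.
move=> [p pP pE]; have [P0 fP0 pP0] := formula_over_fin p.
have /finite_seqP[s sE] : finite_set (P0 `&` P) by exact: finite_setIl.
exists s => [c cs|]; last by exists p => //; rewrite -sE; exact: formula_overI.
by have : [set` s] c by []; rewrite -sE => -[].
Qed.

(** The parameters outside [P] all equal [c], and one new variable can stand for them. *)
Lemma D_param P c T {eT : encodable K T} (Q : T -> Prop) : D (P `|` [set c]) Q ->
  exists Q' : T * K -> Prop, D P Q' /\ forall x, Q x <-> Q' (x, c).
Proof.
move=> [p pP pE].
pose p' : formula L K (1 + @edim K T eT)%N :=
  fsub P p (@rshift 1 _) (Some (lshift _ ord0)).
exists (fun y : T * K => holds S p' (@encv K (T * K) (encodable_prod eT (encodable_self K)) y)); split.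
  by exists p' => //; exact: fsub_over.
move=> x; rewrite pE /p' holds_fsub => [|j d [<-] _]; last by rewrite /= env_cat_lshift.
rewrite (_ : _ \o _ = encv x) //.
by apply/funext => i; exact: env_cat_rshift.
Qed.

Lemma D_definable n (A : set K^^n) : definable S A <-> exists2 P, finite_set P & D P A.
Proof.
split=> [[p ->]|[P _ [p _ pE]]]; last by exists p; apply/seteqP; split=> x /= /pE.
by have [P fP pP] := formula_over_fin p; exists P => //; exists p.
Qed.

End Definability.

Arguments D {L K} S P {T eT} Q.
Arguments Df {L K} S P {T U eT eU} g.

Section MoreClosure.
Variables (L : signature) (K : rcfType) (S : structure L K) (P : set K).
Context {T : Type} {eT : encodable K T}.

Lemma D_andb (b c : T -> bool) : D S P (fun x => b x) -> D S P (fun x => c x) ->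
  D S P (fun x => b x && c x).
Proof. by move=> Db Dc; apply: D_ext (D_and Db Dc) => x; split=> [[-> ->]|/andP]. Qed.

Lemma D_negb (b : T -> bool) : D S P (fun x => b x) -> D S P (fun x => ~~ b x).
Proof. by move=> Db; apply: D_ext (D_not Db) => x; split=> /negP. Qed.

Lemma D_eqb (g h : T -> K) : Df S P g -> Df S P h -> D S P (fun x => g x == h x).
Proof. by move=> Dg Dh; apply: D_ext (D_eqT Dg Dh) => x; split=> /eqP. Qed.

Lemma D_eqbV n (g h : T -> K^^n) :
  Df S P g -> Df S P h -> D S P (fun x => g x == h x).
Proof. by move=> Dg Dh; apply: D_ext (D_eqT Dg Dh) => x; split=> /eqP. Qed.

Lemma D_ex2 U {eU : encodable K U} (A B : T -> U -> Prop) :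
  D S P (fun p : T * U => A p.1 p.2) -> D S P (fun p : T * U => B p.1 p.2) ->
  D S P (fun x => exists2 y, A x y & B x y).
Proof.
move=> DA DB; apply: D_ext (D_ex (Q := fun x y => A x y /\ B x y) (D_and DA DB)) => x.
by split=> -[y]; [case; exists y|exists y].
Qed.

Lemma Df_row_mx n k (g : T -> K^^n) (h : T -> K^^k) :
  Df S P g -> Df S P h -> Df S P (fun x => row_mx (g x) (h x)).
Proof.
move=> Dg Dh; apply: Df_rV => i; case: (splitP i) => j E.
  have -> : i = lshift k j by exact: val_inj.
  by under eq_fun do rewrite row_mxEl; exact: Df_entry.
have -> : i = rshift n j by exact: val_inj.
by under eq_fun do rewrite row_mxEr; exact: Df_entry.
Qed.

Lemma Df_enorm n (g : T -> K^^n) : Df S P g -> Df S P (fun x => enorm (g x)).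
Proof.
by move=> Dg; apply: Df_sqrt; apply: Df_sum => i; apply: Df_exp; exact: Df_entry.
Qed.

End MoreClosure.

(* Leaves the goals about constants and functions that it does not know. *)
Ltac ddef :=
  lazymatch goal with
  | |- D _ _ (fun x => _ /\ _) => apply: D_and; ddef
  | |- D _ _ (fun x => _ \/ _) => apply: D_or; ddef
  | |- D _ _ (fun x => ~ _) => apply: D_not; ddef
  | |- D _ _ (fun x => _ <-> _) => apply: D_iff; ddef
  | |- D _ _ (fun x => exists y : 'I_ _, _) => apply: D_bigex => ?; ddef
  | |- D _ _ (fun x => forall y : 'I_ _, _) => apply: D_big => ?; ddef
  | |- D _ _ (fun x => @ex2 _ _ _) => apply: D_ex2; ddef
  | |- D _ _ (fun x => exists y, _) => apply: D_ex; ddef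
  | |- D _ _ (fun x => @?A x -> @?B x) => apply: D_imp; ddef
  | |- D _ _ (fun x => forall y, _) => apply: D_all; ddef
  | |- D _ _ (fun x => is_true (andb _ _)) => apply: D_andb; ddef
  | |- D _ _ (fun x => is_true (negb _)) => apply: D_negb; ddef
  | |- D _ _ (fun x => is_true (@Order.le _ _ _ _)) => apply: D_le; ddef
  | |- D _ _ (fun x => is_true (@Order.lt _ _ _ _)) => apply: D_lt; ddef
  | |- D _ _ (fun x => is_true (@eq_op _ _ _)) =>
      first [apply: D_eqb|apply: D_eqbV]; ddef
  | H : D ?S ?P (fun y => y = ?c) |- D ?S ?P (fun x => @eq _ (@?g x) ?c) =>
      refine (@D_comp _ _ _ _ _ _ _ _ (fun y => y = c) g H _); ddef
  | |- D _ _ (fun x => @eq _ _ _) => apply: D_eqT; ddef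
  | H : D ?S ?P ?A |- D ?S ?P (fun x => ?A (@?g x)) =>
      refine (@D_comp _ _ _ _ _ _ _ _ A g H _); ddef
  | H : D ?S ?P ?A |- D ?S ?P ?A => exact: H
  | H : D ?S ?P (fun p => ?R (fst p) (snd p)) |- D ?S ?P (fun x => ?R (@?g x) (@?h x)) =>
      refine (@D_comp _ _ _ _ _ _ _ _ (fun p => R (fst p) (snd p)) (fun x => (g x, h x)) H _); ddef
  | H : forall i, D ?S ?P (@?A i) |- D ?S ?P (fun x => ?Q (@?g x)) =>
      first [apply: (D_comp (Q := Q) (H _)); ddef | idtac]
  | |- D _ _ (@eq _ ?s) => apply: (D_eqT (g := fun=> s) (h := fun x => x)); ddef
  | |- D _ _ (fun x => _) => try (exact: D_const)
  | H : Df ?S ?P ?h |- Df ?S ?P ?h => exact: H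
  | |- Df _ _ (fun x => x) => exact: Df_id
  | |- Df _ _ (fun x => (_, _)) => apply: Df_pair; ddef
  | |- Df _ _ (fun x => fst (@?g x)) => apply: (Df_fst (g := g)); ddef
  | |- Df _ _ (fun x => snd (@?g x)) => apply: (Df_snd (g := g)); ddef
  | |- Df _ _ fst => apply: Df_fst; exact: Df_id
  | |- Df _ _ snd => apply: Df_snd; exact: Df_id
  | H : Df ?S ?P ?h |- Df ?S ?P (fun x => ?h (@?g x)) =>
      refine (@Df_comp _ _ _ _ _ _ _ _ _ _ h g H _); ddef
  | |- Df _ _ (fun x => row_mx _ _) => apply: Df_row_mx; ddef
  | |- Df _ _ (fun x => enorm _) => apply: Df_enorm; ddef
  | |- Df _ _ (fun x => Num.norm _) => apply: Df_norm; ddef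
  | |- Df _ _ (fun x => GRing.inv _) => apply: Df_inv; ddef
  | |- Df _ _ (fun x => GRing.mul _ _) => apply: Df_mul; ddef
  | |- Df _ _ (fun x => GRing.exp _ _) => apply: Df_exp; ddef
  | |- Df _ _ (fun x => Num.sqrt _) => apply: Df_sqrt; ddef
  | |- Df _ _ (GRing.mul ?s) => apply: (Df_mul (g := fun=> s) (h := fun x => x)); ddef
  | |- Df _ _ (GRing.add ?s) => apply: (Df_add (g := fun=> s) (h := fun x => x)); ddef
  | |- Df _ _ (fun x => bigop.body GRing.zero _ _) => apply: Df_sum => ?; ddef
  | |- Df _ _ (fun x => bigop.body GRing.one _ _) => apply: Df_prod => ?; ddef
  | |- Df _ _ (fun x => fun_of_matrix (@?g x) _ _) =>
      first [apply: (Df_entry (g := g)); ddef | idtac]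
  | |- Df _ _ _ =>
      first [ exact: Df_0 | exact: Df_1 | exact: Df_nat
            | (apply: Df_cst; first [assumption | by right | by left; right | by left; left; right])
            | apply: Df_add; ddef | apply: Df_opp; ddef
            | (apply: Df_rV => ?; under eq_fun do rewrite !mxE; ddef)
            | idtac ]
  end.

Lemma countable_setU T (A B : set T) : countable A -> countable B -> countable (A `|` B).
Proof.
by move=> cA cB; rewrite -bigcup2E; apply: bigcup_countable => // -[|[|?]].
Qed.

Lemma countable_seq (T : choiceType) (s : seq T) : countable [set` s].
Proof. exact/finite_set_countable/finite_seq. Qed.

Ltac ctb := solve [repeat first [assumption | exact: countable1 |
  exact: countable_seq | apply: countable_setU]].

Section TameGeometry.
Variables (L : signature) (K : rcfType) (S : structure L K).
Hypotheses (Ksat : aleph1_saturated S) (Komin : o_minimal S).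
Implicit Types P : set K.

(** * Consequences of o-minimality on the line *)

Lemma seq_gap (E : seq K) t : exists2 d : K, 0 < d &
  forall e, e \in E -> e != t -> d <= `|e - t|.
Proof.
elim: E => [|e E [d d0 dE]]; first by exists 1.
have [->|et] := eqVneq e t.
  by exists d => // c; rewrite in_cons => /orP[/eqP-> /eqP//|]; exact: dE.
exists (Num.min d `|e - t|); first by rewrite lt_min d0 normr_gt0 subr_eq0.
by move=> c; rewrite in_cons ge_min => /orP[/eqP-> _|/dE H /H ->//]; rewrite lexx orbT.
Qed.

(** [E] consists of the end points of the intervals that make up [Q]. If none of them lies strictly
    between [a] and [b], each interval contains everything in between or nothing. *)
Lemma omin_pts P (Q : K -> Prop) : D S P Q -> exists E : seq K,
  forall a b, a < b -> (forall e, e \in E -> ~~ (a < e < b)) ->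
  (forall t, a < t < b -> Q t) \/ (forall t, a < t < b -> ~ Q t).
Proof.
move=> DQ.
have /Komin[s sP] : definable S [set x : K^^1 | Q (x 0 0)].
  have [p _ pE] : D S P (fun x : K^^1 => Q (x 0 0)) by ddef.
  by exists p; apply/seteqP; split => x /pE.
have {}sP t : Q t <-> exists2 i, i \in s & t \in i.
  by rewrite -sP /= mxE.
pose bp (b : itv_bound K) := if b is BSide _ x then [:: x] else [::].
exists (flatten [seq (let: Interval l u := i in bp l ++ bp u) | i <- s]).
elim: s Q {DQ} sP => [|[l u] s IH] Q sP a b ab HE.
  by right => t _ /sP[].
pose Q' t := exists2 i, i \in s & t \in i.
have [//|H|H] := IH Q' (fun=> iff_refl _) a b ab.
- by move=> e es; apply: HE; rewrite /= mem_cat es orbT.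
- by left => t /H[i si ti]; apply/sP; exists i; rewrite // in_cons si orbT.
have gap e : e \in bp l ++ bp u -> ~~ (a < e < b).
  by move=> ee; apply: HE; rewrite /= mem_cat ee.
have QE t : a < t < b -> (Q t <-> t \in Interval l u).
  move=> tab; rewrite sP; split=> [[i]|tI]; last by exists (Interval l u); rewrite ?mem_head.
  by rewrite in_cons => /orP[/eqP->//|si ti]; case: (H t tab); exists i.
have side (v : itv_bound K) : {subset bp v <= bp l ++ bp u} ->
    forall t t', a < t < b -> a < t' < b ->
    ((v <= BLeft t)%O = (v <= BLeft t')%O) * ((BRight t <= v)%O = (BRight t' <= v)%O).
  case: v => [c x|[]] sub t t' /andP[at_ tb] /andP[at' t'b] //.
  have := gap x (sub x (mem_head _ _)); rewrite negb_and -!leNgt => xx.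
  by split; move: (c) => [] ; rewrite ?bnd_simp; apply/idP/idP => ?;
    case/orP: xx => xx; lra.
have cst t t' : a < t < b -> a < t' < b -> (t \in Interval l u) = (t' \in Interval l u).
  move=> tab tab'; rewrite !itv_boundlr.
  rewrite (side l _ t t' tab tab').1 ?(side u _ t t' tab tab').2 // => x xx;
    by rewrite mem_cat xx ?orbT.
have mab : a < (a + b) / 2%:R < b by rewrite !midf_lt.
case mI : ((a + b) / 2%:R \in Interval l u); [left|right] => t tab.
  by apply/(QE _ tab); rewrite (cst _ _ tab mab).
by move=> /(QE _ tab); rewrite (cst _ _ tab mab) mI.
Qed.

Lemma omin_nbhs P (Q : K -> Prop) : D S P Q -> exists E : seq K,
  forall t, t \notin E -> exists2 d : K, 0 < d &
   (forall u, `|u - t| < d -> Q u) \/ (forall u, `|u - t| < d -> ~ Q u).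
Proof.
move=> /omin_pts[E HE]; exists E => t tE; have [d d0 dE] := seq_gap E t.
have [|e eE|H|H] := HE (t - d) (t + d).
- lra.
- have := dE e eE; have [et|_] := eqVneq e t; first by rewrite et (negbTE tE) in eE.
  by move=> /(_ isT); apply: contraTN => /andP[? ?]; rewrite -ltNge ltr_norml; lra.
- by exists d => //; left => u; rewrite ltr_norml => ?; apply: H; lra.
- by exists d => //; right => u; rewrite ltr_norml => ?; apply: H; lra.
Qed.

Lemma omin_right P (Q : K -> Prop) a : D S P Q -> exists2 d : K, 0 < d &
   (forall u, a < u < a + d -> Q u) \/ (forall u, a < u < a + d -> ~ Q u).
Proof.
move=> /omin_pts[E HE]; have [d d0 dE] := seq_gap E a.
exists d => //; apply: HE; first lra.
move=> e eE; apply/negP => /andP[ae ed]; have := dE e eE.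
rewrite gt_eqF // => /(_ isT); rewrite ger0_norm; lra.
Qed.

Definition fin (Q : K -> Prop) := exists s : seq K, forall y, Q y -> y \in s.

Definition has_itv (Q : K -> Prop) :=
  exists a, exists2 b, a < b & forall t, a < t < b -> Q t.

Lemma fin_or_itv P Q : D S P Q -> fin Q \/ has_itv Q.
Proof.
move=> /omin_nbhs[E HE]; have [|/existsNP[t /not_implyP[Qt /negP tE]]] :=
  pselect (forall t, Q t -> t \in E); first by left; exists E.
right; have [d d0 [H|H]] := HE t tE; last by case: (H t) => //; rewrite subrr normr0.
by exists (t - d), (t + d); [lra|move=> u ?; apply: H; rewrite ltr_norml; lra].
Qed.

Lemma itv_infinite (s : seq K) a b : a < b -> exists2 c, a < c < b & c \notin s.
Proof.
elim: s b => [|x s IH] b ab; first by exists ((a + b) / 2%:R); rewrite ?midf_lt //.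
have [xab|xab] := boolP (a < x < b).
  have [|c acx cs] := IH x; first by case/andP: xab.
  exists c; first by case/andP: xab acx; lra.
  by rewrite in_cons negb_or cs andbT lt_eqF //; case/andP: acx.
have [c acb cs] := IH b ab; exists c => //; rewrite in_cons negb_or cs andbT.
by apply: contraNneq xab => <-.
Qed.

Lemma fin_itvF Q : fin Q -> has_itv Q -> False.
Proof. by move=> [s sQ] [a [b ab H]]; have [c /H/sQ ->] := itv_infinite s ab. Qed.

Lemma seq_max_ex (s : seq K) x : x \in s -> exists2 m, m \in s & forall y, y \in s -> y <= m.
Proof.
elim: s x => // a s IH x _; case: s IH => [|b s] IH.
  by exists a; rewrite ?mem_head // => y; rewrite inE => /eqP->.
have [m ms mM] := IH b (mem_head _ _).
exists (Num.max a m); first by rewrite in_cons maxEle; case: ifP => _; rewrite ?ms ?eqxx ?orbT.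
by move=> y; rewrite in_cons le_max => /orP[/eqP->|/mM ->]; rewrite ?lexx ?orbT.
Qed.

Lemma seq_min_ex (s : seq K) x : x \in s -> exists2 m, m \in s & forall y, y \in s -> m <= y.
Proof.
move=> xs; have [|m /mapP[z zs ->] mM] := @seq_max_ex [seq - y | y <- s] (- x).
  exact: map_f.
by exists z => // y ys; rewrite -lerN2; apply: mM; exact: map_f.
Qed.

(** Let [m] be the largest point outside [U] and [m'] the smallest point in [U] among [a], [b] and
    the points where [U] can change. Then [U] is constant between [m] and [m'], and one of the two
    is the cut. This definable completeness replaces the completeness of the reals. *)
Lemma cut P (U : K -> Prop) a b : D S P U -> (forall t u, U t -> t <= u -> U u) ->
  U b -> ~ U a -> exists x, (forall t, x < t -> U t) /\ (forall t, t < x -> ~ U t).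
Proof.
move=> /omin_pts[E HE] up Ub Ua.
have [|m] := @seq_max_ex [seq e <- a :: E | ~~ `[< U e >]] a.
  by rewrite mem_filter mem_head andbT; apply/asboolP.
rewrite mem_filter => /andP[/asboolP Um mE] mM.
have [|m'] := @seq_min_ex [seq e <- b :: E | `[< U e >]] b.
  by rewrite mem_filter mem_head andbT; apply/asboolP.
rewrite mem_filter => /andP[/asboolP Um' mE'] mM'.
have mm' : m < m' by rewrite ltNge; apply/negP => /up H; apply: Um; exact: H.
have [e eE|H|H] := HE m m' mm'.
- apply/negP => /andP[me em']; have [Ue|Ue] := pselect (U e).
    by have := mM' e; rewrite mem_filter in_cons eE orbT andbT leNgt em' => /(_ (asboolT Ue)).
  have := mM e; rewrite mem_filter in_cons eE orbT andbT leNgt me => H; have := H.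
  by move/implyP; rewrite implybF => /negP; apply; apply/asboolP.
- exists m; split=> t tm; last by move=> Ut; apply: Um; apply: up Ut _; exact: ltW.
  by have [tb|bt] := ltP t m'; [apply: H; rewrite tm|exact: up bt].
- exists m'; split=> t tm; first by apply: up Um' _; exact: ltW.
  have [ta|at_] := ltP m t; first by apply: H; rewrite ta.
  by move=> Ut; apply: Um; exact: up at_.
Qed.

Lemma def_sup P (Q : K -> Prop) x b : D S P Q -> Q x -> (forall t, Q t -> t <= b) ->
  exists m, (forall t, Q t -> t <= m) /\ (forall u, (forall t, Q t -> t <= u) -> m <= u).
Proof.
move=> DQ Qx Qb.
have [|t u H tu v vt|//|/(_ x Qx)|m [mU mN]] :=
  @cut P (fun u => forall t, Q t -> t <= u) (x - 1) b.
- by ddef.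
- exact: le_trans (H v vt) tu.
- by rewrite leNgt ltrBlDr ltrDl ltr01.
exists m; split=> [t Qt|u uU].
  by rewrite leNgt; apply/negP => tm; have [c /andP[mc ct]] := itv_infinite [::] tm;
     have := mU c mc t Qt; rewrite leNgt ct.
by rewrite leNgt; apply/negP => /mN.
Qed.

(** * Algebraic closure *)

Definition acl P (x : K) := exists Q, [/\ D S P Q, Q x & fin Q].

Lemma acl_mem P x : P x -> acl P x.
Proof.
move=> Px; exists (fun y => y = x); split=> //; last by exists [:: x] => y ->; rewrite mem_head.
by ddef.
Qed.

Lemma acl_mono P P' x : P `<=` P' -> acl P x -> acl P' x.
Proof. by move=> PP' [Q [DQ Qx fQ]]; exists Q; split=> //; apply: D_mono DQ. Qed.

(** The points of [Q] that are not interior to [Q] form a [P]-definable set that contains no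
    interval, hence a finite set. All its elements are algebraic over [P]. *)
Lemma acl_nbhs P a Q : ~ acl P a -> D S P Q -> Q a ->
  exists2 d : K, 0 < d & forall t, `|t - a| < d -> Q t.
Proof.
move=> Na DQ Qa; apply: contrapT => H; apply: Na.
pose B t := Q t /\ forall d : K, 0 < d -> exists2 u : K, `|u - t| < d & ~ Q u.
have DB : D S P B by rewrite /B; ddef.
exists B; split=> //.
  split=> // d d0; apply: contrapT => H'; apply: H; exists d => // t td.
  by apply: contrapT => nQ; apply: H'; exists t.
have [//|[a' [b' ab' H']]] := fin_or_itv DB.
have /H'[_ /(_ ((b' - a') / 2%:R))] : a' < (a' + b') / 2%:R < b' by rewrite !midf_lt.
case; first lra.
move=> u; rewrite ltr_norml => uu; case.
by have /H'[] : a' < u < b'; first lra.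
Qed.

(** The order tells the elements of a finite set apart: its minimum is definable, and so is the set
    without its minimum. *)
Lemma acl_dcl P a : acl P a -> D S P (fun y => y = a).
Proof.
move=> [Q [DQ Qa [s sQ]]]; move: {2}(size s) (leqnn (size s)) => n.
elim: n s Q DQ Qa sQ => [|n IH] s Q DQ Qa sQ sn.
  by move: sn; rewrite leqn0 size_eq0 => /eqP s0; move: (sQ a Qa); rewrite s0.
have [|m] := @seq_min_ex [seq e <- s | `[< Q e >]] a.
  by rewrite mem_filter sQ // andbT; apply/asboolP.
rewrite mem_filter => /andP[/asboolP Qm ms] mM.
have mle y : Q y -> m <= y by move=> Qy; apply: mM; rewrite mem_filter sQ // andbT; apply/asboolP.
have Dm : D S P (fun y => y = m).
  have : D S P (fun y => Q y /\ forall z, Q z -> y <= z) by ddef.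
  apply: D_ext => y; split=> [[Qy H]|->] //.
  by apply/eqP; rewrite eq_le H // mle.
have [-> //|am] := pselect (a = m).
apply: (IH (rem m s) (fun y => Q y /\ ~ y = m)); [by ddef|by []| |].
  move=> y [Qy /eqP ym]; have := sQ y Qy; rewrite (perm_mem (perm_to_rem ms)).
  by rewrite in_cons (negbTE ym).
by rewrite size_rem // -ltnS (leq_trans _ sn) // prednK //; case: (s) ms.
Qed.

Lemma D_acl1 P c T {eT : encodable K T} (Q : T -> Prop) :
  acl P c -> D S (P `|` [set c]) Q -> D S P Q.
Proof.
move=> /acl_dcl Dc /D_param[Q' [DQ' E]].
have : D S P (fun x => exists y, y = c /\ Q' (x, y)) by ddef.
by apply: D_ext => x; rewrite E; split=> [[y [-> ]]|H] //; exists c.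
Qed.

Lemma D_acl P P' T {eT : encodable K T} (Q : T -> Prop) :
  (forall c, P' c -> acl P c) -> D S P' Q -> D S P Q.
Proof.
move=> P'P /D_finite[s sP' DQ].
have {sP' P'P} : forall c, c \in s -> acl P c by move=> c /sP'/P'P.
have {DQ} : D S (P `|` [set` s]) Q by apply: D_mono DQ; exact: subsetUr.
elim: s => [|c s IH] DQ sP.
  by apply: D_mono DQ => x [].
apply: IH => [|d ds]; last by apply: sP; rewrite in_cons ds orbT.
apply: (@D_acl1 _ c).
  by apply: acl_mono (sP c (mem_head _ _)); exact: subsetUl.
apply: D_mono DQ => x [Px|/=]; first by left; left.
by rewrite in_cons => /orP[/eqP->|xs]; [right|left; right].
Qed.

Lemma acl_trans P P' x : (forall c, P' c -> acl P c) -> acl P' x -> acl P x.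
Proof. by move=> P'P [Q [DQ Qx fQ]]; exists Q; split=> //; exact: D_acl DQ. Qed.

Lemma acl_fun P T {eT : encodable K T} (g : T -> K) x :
  Df S P g -> D S P (fun y => y = x) -> acl P (g x).
Proof.
move=> Dg Dx; exists (fun y => y = g x); split=> //; last first.
  by exists [:: g x] => y ->; rewrite mem_head.
have : D S P (fun y : K => exists z, z = x /\ y = g z) by ddef.
by apply: D_ext => y; split=> [[z [-> ->]]|->] //; exists x.
Qed.

(* [R] is the graph of a function of one variable with definable, locally
   constant part: the left end points of its intervals of constancy are
   discrete. *)
Lemma exchange P a c : ~ acl P c -> ~ acl P a -> acl (P `|` [set c]) a ->
  acl (P `|` [set a]) c.
Proof.
move=> Nc Na /acl_dcl/D_param[R0 [DR0 E]]; apply: contrapT => Nca.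
pose R x y := R0 (y, x) /\ forall z, R0 (z, x) -> z = y.
have DR : D S P (fun p : K * K => R p.1 p.2) by rewrite /R; ddef.
have Rca : R c a by split; [exact/E|move=> z /E].
have Rf x y z : R x y -> R x z -> y = z by move=> [_ H] [/H].
(* As [c] is supposed not to be algebraic over [P] and [a], the function is constant near [c], with
   value [a]. It remains to recover [a] from the interval of constancy around [c], without using
   [c]. *)
have [|d d0 Hd] := @acl_nbhs (P `|` [set a]) c (fun x => R x a) Nca _ Rca.
  have DR' := D_mono (@subsetUl _ P [set a]) DR; by ddef.
pose B (x : K) := exists y d : K, (0 < d /\ (forall t, x < t < x + d -> R t y)) /\
   forall b, b < x -> exists2 t, b < t < x + d & ~ R t y.
have DB : D S P B.
  by rewrite /B; ddef.
have Bu x x' y e d' : 0 < e -> 0 < d' -> x < x' < x + e ->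
    (forall t, x < t < x + e -> R t y) ->
    (forall t, x' < t < x' + d' -> R t y) -> forall t, x < t < x' + d' -> R t y.
  move=> e0 d'0 xx' H H' t tt; have [td|dt] := ltP t (x + e); first by apply: H; lra.
  by apply: H'; lra.
have finB : fin B.
  have [//|[p [q pq Hpq]]] := fin_or_itv DB; exfalso.
  have [x xpq _] := itv_infinite [::] pq; have [y [e [[e0 He] _]]] := Hpq x xpq.
  have [|x' xx' _] := @itv_infinite [::] x (Num.min q (x + e)).
    by rewrite lt_min; apply/andP; split; lra.
  move: xx'; rewrite lt_min => xx'.
  have [|y' [d' [[d'0 Hd'] /(_ x)[|t]]]] := Hpq x'; [lra|lra|].
  have [|t' tt' _] := @itv_infinite [::] x' (Num.min (x + e) (x' + d')).
    by rewrite lt_min; apply/andP; split; lra.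
  have yy' : y = y'.
    move: tt'; rewrite lt_min => tt'.
    by apply: (Rf t'); [apply: He; lra|apply: Hd'; lra].
  by rewrite -yy' in Hd' * => tt; apply; apply: (Bu x x' y e d') => //; lra.
pose U b := forall t, b < t < c -> R t a.
have DU : D S (P `|` [set a] `|` [set c]) U.
  have DR' : D S (P `|` [set a] `|` [set c]) (fun p : K * K => R p.1 p.2).
    by apply: D_mono DR => z Pz; left; left.
  by rewrite /U; ddef.
(* If this interval has no left end, [a] is the value near minus infinity, which is definable over
   [P]. *)
have [allU|/existsNP[b0 Ub0]] := pselect (forall b, U b).
  apply: Na; exists (fun y => exists b, forall t, t < b -> R t y); split.
  - by ddef.
  - by exists c => t tc; apply: (allU (t - 1)); lra.
  exists [:: a] => y [b Hb]; rewrite inE; apply/eqP.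
  apply: (Rf (Num.min b c - 1)).
    by apply: Hb; rewrite ltrBlDr gt_min ltrDl ltr01.
  by apply: (allU (Num.min b c - 2%:R)); rewrite ler_ltB ?ltr1n //= ltrBlDr gt_min ltrDl ltr01 orbT.
have [|||x [xU xN]] := @cut _ U b0 c DU.
- by move=> t u Ut tu v /andP[uv vc]; apply: Ut; rewrite (le_lt_trans tu).
- by move=> t /andP[ct /(lt_trans ct)]; rewrite ltxx.
- by [].
have xc : x < c.
  rewrite ltNge; apply/negP => cx; apply: (xN (c - d)); first lra.
  by move=> t td; apply: Hd; rewrite ltr_norml; lra.
have Rx t : x < t < c -> R t a.
  by move=> /andP[xt tc]; apply: (xU ((x + t) / 2%:R)); rewrite ?midf_lt // tc midf_lt.
(* The left end [x] belongs to the finite set [B], and [a] is the value immediately to the right of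
   [x]. *)
have aclx : acl P x.
  exists B; split => //; exists a, (c - x); rewrite subr_gt0 addrC subrK.
  by split=> [|b /xN/existsNP[t /not_implyP[tb nR]]]; [|exists t].
apply: Na; apply: (@acl_trans P (P `|` [set x])) => [z [/acl_mem//|->//]|].
have DR' : D S (P `|` [set x]) (fun p : K * K => R p.1 p.2).
  by apply: D_mono DR; exact: subsetUl.
exists (fun y => exists2 e : K, 0 < e & forall t, x < t < x + e -> R t y); split.
- by ddef.
- by exists (c - x); rewrite ?subr_gt0 // addrC subrK.
exists [:: a] => y [e e0 He]; rewrite inE; apply/eqP.
have [|t tt _] := @itv_infinite [::] x (Num.min (x + e) c).
  by rewrite lt_min; apply/andP; split; lra.
by move: tt; rewrite lt_min => tt; apply: (Rf t); [apply: He|apply: Rx]; lra.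
Qed.

(** * Independence *)

Fixpoint ind P (s : seq K) : Prop :=
  if s is x :: s' then ~ acl P x /\ ind (P `|` [set x]) s' else True.

Lemma ind_mono P P' s : P `<=` P' -> ind P' s -> ind P s.
Proof.
elim: s P P' => //= x s IH P P' PP' [Nx Is]; split; first by move/(acl_mono PP').
by apply: IH Is; exact: setSU.
Qed.

Lemma ind_swap P x y s : ind P (x :: y :: s) -> ind P (y :: x :: s).
Proof.
move=> /= [Nx [Ny Is]]; split; first by move=> Ay; apply: Ny; apply: acl_mono Ay; exact: subsetUl.
split; last by apply: ind_mono Is => z [[?|?]|?]; [left; left|right|left; right].
move=> /exchange H; apply: (Ny); apply: H => //.
by move=> Ay; apply: Ny; apply: acl_mono Ay; exact: subsetUl.
Qed.

Lemma setmem_cons (x : K) s : [set` x :: s] = [set x] `|` [set` s].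
Proof.
apply/seteqP; split => y /=; rewrite in_cons; first by case/orP => [/eqP->|]; [left|right].
by case=> ->; rewrite ?eqxx ?orbT.
Qed.

Lemma ind_cat P s t : ind P (s ++ t) <-> ind P s /\ ind (P `|` [set` s]) t.
Proof.
elim: s P => [|x s IH] P /=; first by rewrite set_nil setU0; tauto.
rewrite IH setmem_cons setUA; tauto.
Qed.

Lemma ind_perm P s t : perm_eq s t -> ind P s -> ind P t.
Proof.
elim: s t P => [|x s IH] t P; first by rewrite perm_sym => /perm_nilP->.
move=> st; have xt : x \in t by rewrite -(perm_mem st) mem_head.
case/splitPr: {t} xt st => t1 t2; rewrite -[x :: t2]/([:: x] ++ t2) perm_sym perm_catCA perm_sym /= perm_cons.
move=> st /= [Nx Is]; have {IH Is} := IH _ _ st Is.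
elim: t1 P Nx {st} => [|y t1 IH] P Nx //= [Ny I1].
have [Ny' [Nx' I']] : ind P [:: y, x & t1 ++ t2] by apply: ind_swap.
split=> //; exact: IH.
Qed.

Lemma ind_uniq P s : ind P s -> uniq s.
Proof.
elim: s P => //= x s IH P [Nx Is]; rewrite (IH _ Is) andbT; apply/negP => xs.
have [s1 [s2 E]] : exists s1 s2, s = s1 ++ x :: s2 by case/splitPr: xs => s1 s2; exists s1, s2.
move: Is; rewrite E => /ind_cat[_ /= [+ _]]; apply.
by apply: acl_mem; left; right.
Qed.

(** Let [y] be the first element of [s] that makes [x] algebraic over [P] and the elements of [s] up
    to [y]. By exchange [y] is algebraic once [x] is added, so that [x] can take its place, and the
    induction continues over [P] and [x]. *)
Lemma steinitz P t s : ind P t -> (forall y, y \in t -> acl (P `|` [set` s]) y) ->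
  (size t <= size s)%N.
Proof.
elim: t P s => //= x t IH P s [Nx It] tS.
have [s1 [y [s2 [E Ny Hy]]]] : exists s1 y s2, [/\ s = s1 ++ y :: s2,
    ~ acl (P `|` [set` s1]) x & acl (P `|` [set` s1] `|` [set y]) x].
  have {tS} : acl (P `|` [set` s]) x by apply: tS; exact: mem_head.
  elim: s P Nx {IH It} => [|y s IH] P Nx; first by rewrite set_nil setU0.
  rewrite setmem_cons setUA => Hx; have [Hy|Hy] := pselect (acl (P `|` [set y]) x).
    by exists [::], y, s; rewrite set_nil setU0.
  have [s1 [z [s2 [-> ? ?]]]] := IH _ Hy Hx.
  by exists (y :: s1), z, s2; rewrite setmem_cons setUA.
rewrite E size_cat /= addnS ltnS -size_cat; apply: (IH (P `|` [set x])) => // z zt.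
apply: (@acl_trans _ (P `|` [set` s])); last by apply: tS; rewrite in_cons zt orbT.
rewrite E => c [Pc|/=]; first by apply: acl_mem; left; left.
rewrite mem_cat in_cons => /or3P[cs|/eqP->|cs]; try by apply: acl_mem; right; rewrite /= mem_cat cs ?orbT.
have [Ay|Ay] := pselect (acl (P `|` [set` s1]) y).
  apply: acl_mono Ay => d [|/= ds]; first by left; left.
  by right; rewrite /= mem_cat ds.
have := exchange Ay Ny Hy; apply: acl_mono => d [[|/= ds]|/= ->]; first by left; left.
  by right; rewrite /= mem_cat ds.
by left; right.
Qed.

(** * Compactness from saturation *)

Lemma finite_enum (T : Type) (A : set T) : finite_set A ->
  exists n, exists f : 'I_n -> T, (forall i, A (f i)) /\ forall x, A x -> exists i, f i = x.
Proof.
move=> [n]; rewrite card_eq_sym => /card_bijP[g [h gK hK]].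
exists n, (fun i : 'I_n => val (g (SigSub (mem_set (ltn_ord i : `I_n i))))).
split=> [i|x Ax]; first exact: set_valP.
have hx := set_valP (h (SigSub (mem_set Ax))).
exists (Ordinal hx); set u := SigSub _.
suff -> : u = h (SigSub (mem_set Ax)) by rewrite hK.
exact: val_inj.
Qed.

Lemma sat_D P T {eT : encodable K T} (F : set (T -> Prop)) : countable P ->
  (forall Q, F Q -> D S P Q) ->
  (forall n (G : 'I_n -> T -> Prop), (forall i, F (G i)) -> exists x, forall i, G i x) ->
  exists x, forall Q, F Q -> Q x.
Proof.
move=> cP FD FG.
have [|T0 fT0 T0F|v vT] := Ksat cP (T := [set p : formula L K (edim (T := T)) |
  formula_over P p /\ exists2 Q, F Q & forall x, Q x <-> holds S p (encv x)]).
- by move=> p [].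
- have [n [f [fT fS]]] := finite_enum fT0.
  have /choice[G HG] : forall i, exists Q, F Q /\ forall x, Q x <-> holds S (f i) (encv x).
    by move=> i; have [_ [Q FQ QE]] := T0F _ (fT i); exists Q.
  have [x Hx] := FG n G (fun i => (HG i).1); exists (encv x) => p /fS[i <-].
  by apply/(HG i).2.
exists (decv v) => Q FQ; have [p pP pE] := FD Q FQ.
by apply/pE; rewrite decvK; apply: vT; split => //; exists Q.
Qed.

(** If no finite subfamily covered [A], then [A] together with the complements of the members of [F]
    would be finitely satisfiable, and saturation would give a point of [A] outside all members.
    Only the parameters have to be countable, not the family. *)
Lemma compactness P T {eT : encodable K T} (A : T -> Prop) (F : set (T -> Prop)) :
  countable P -> D S P A -> (forall Q, F Q -> D S P Q) ->
  (forall x, A x -> exists2 Q, F Q & Q x) ->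
  exists n (G : 'I_n -> T -> Prop), (forall i, F (G i)) /\ forall x, A x -> exists i, G i x.
Proof.
move=> cP DA FD AF; have [[x0 Ax0]|nA] := pselect (exists x, A x); last first.
  by exists 0%N, (fun=> A); split=> [[]//|x Ax]; case: nA; exists x.
apply: contrapT => H; have [Q0 FQ0 _] := AF x0 Ax0.
have [|n G HG|x Hx] := @sat_D P T _ (A |` [set Q | exists2 Q', F Q' & Q = (fun x => ~ Q' x)]) cP.
- by move=> Q [->//|[Q' /FD DQ' ->]]; exact: D_not.
- apply: contrapT => nx; apply: H.
  have /choice[G' HG'] : forall i, exists Q, F Q /\ (G i = A \/ G i = fun x => ~ Q x).
    by move=> i; have [->|[Q' FQ' ->]] := HG i; [exists Q0; split=> //; left|exists Q'; split=> //; right].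
  exists n, G'; split=> [i|x Ax]; first by case: (HG' i).
  apply: contrapT => nG; apply: nx; exists x => i.
  by have [_ [->//|->]] := HG' i => Gx; apply: nG; exists i.
have Ax : A x by apply: Hx; left.
have [Q FQ Qx] := AF x Ax.
by have /(_ (or_intror _)) := Hx (fun x => ~ Q x); apply => //; exists Q.
Qed.

(** Otherwise the finite [P]-definable sets would cover the interval, and by compactness finitely
    many of them would do. *)
Lemma ex_notin_acl P a b : countable P -> a < b -> exists2 c, a < c < b & ~ acl P c.
Proof.
move=> cP ab; apply: contrapT => H.
pose P' := P `|` [set a] `|` [set b].
have [|||x /= xab|n [G [GF GA]]] := @compactness P' K _ (fun x => a < x < b)
    [set Q | D S P Q /\ fin Q].
- by rewrite /P'; ctb.
- by rewrite /P'; ddef.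
- move=> Q [DQ _]; apply: D_mono DQ => y Py; left; left; exact: Py.
- have [Q [DQ Qx fQ]] : acl P x by apply: contrapT => N; apply: H; exists x.
  by exists Q.
have /choice[s Hs] : forall i, exists s : seq K, forall y, G i y -> y \in s.
  by move=> i; have [] := GF i.
apply: (@fin_itvF (fun x => a < x < b)); last by exists a, b.
exists (flatten [seq s i | i <- enum 'I_n]) => y /GA[i /Hs ys].
by apply/flattenP; exists (s i) => //; apply: map_f; rewrite mem_enum.
Qed.

(** Take [c] that is not algebraic over [P] and [s]: as independence does not depend on the order,
    [s] stays independent over [P] and [c]. In this way an interval is shrunk to one whose end
    points can serve as parameters without destroying genericity. *)
Lemma ind_shrink P s a b : countable P -> ind P s -> a < b ->
  exists2 c, a < c < b & ind (P `|` [set c]) s /\ ~ acl (P `|` [set` s]) c.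
Proof.
move=> cP Is ab; have [|c cab Nc] := @ex_notin_acl (P `|` [set` s]) a b _ ab.
  by ctb.
exists c => //; split=> //; have : ind P (s ++ [:: c]) by apply/ind_cat; split.
by move/(ind_perm (_ : perm_eq _ ([:: c] ++ s))) => -[|//]; rewrite perm_catC.
Qed.

(** * Generic points and rank *)

Definition vals n (x : K^^n) : seq K := [seq x 0 i | i <- enum 'I_n].

Local Notation "P <+ x" := (P `|` [set` vals x]) (at level 50, x at level 9, only parsing).

Definition gen P n (x : K^^n) : Prop := ind P (vals x).

Definition ins n (i : 'I_n.+1) (t : K) (v : K^^n) : K^^n.+1 :=
  \row_j (if unlift i j is Some k then v 0 k else t).

Lemma insE n (i : 'I_n.+1) t (v : K^^n) : ins i t v 0 i = t.
Proof. by rewrite mxE unlift_none. Qed.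

Lemma ins_lift n (i : 'I_n.+1) t (v : K^^n) j : ins i t v 0 (lift i j) = v 0 j.
Proof. by rewrite mxE liftK. Qed.

Lemma col'_ins n (i : 'I_n.+1) t (v : K^^n) : col' i (ins i t v) = v.
Proof. by apply/rowP => j; rewrite mxE ins_lift. Qed.

Lemma ins_col' n (i : 'I_n.+1) (x : K^^n.+1) : ins i (x 0 i) (col' i x) = x.
Proof.
by apply/rowP => j; case: (unliftP i j) => [k ->|->]; rewrite ?ins_lift ?insE // mxE.
Qed.

Lemma Df_ins P T {eT : encodable K T} n (i : 'I_n.+1) (t : T -> K) (v : T -> K^^n) :
  Df S P t -> Df S P v -> Df S P (fun x => ins i (t x) (v x)).
Proof.
move=> Dt Dv; apply: Df_rV => j; case: (unliftP i j) => [k ->|->].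
  by under eq_fun do rewrite ins_lift; exact: Df_entry.
by under eq_fun do rewrite insE.
Qed.

Lemma vals_perm n (i : 'I_n.+1) (x : K^^n.+1) :
  perm_eq (vals x) (x 0 i :: vals (col' i x)).
Proof.
have -> : x 0 i :: vals (col' i x) = [seq x 0 j | j <- i :: [seq lift i k | k <- enum 'I_n]].
  by rewrite /= -map_comp; congr cons; apply: eq_map => k /=; rewrite mxE.
apply: perm_map; apply: uniq_perm; rewrite ?enum_uniq //=.
  rewrite map_inj_uniq ?enum_uniq ?andbT; last exact: lift_inj.
  by apply/mapP => -[k _ /eqP]; rewrite (negbTE (neq_lift _ _)).
move=> j; rewrite mem_enum in_cons inE; apply/esym.
by case: (unliftP i j) => [k ->|->]; rewrite ?eqxx // map_f ?orbT ?mem_enum.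
Qed.

Lemma mem_vals n (x : K^^n) i : x 0 i \in vals x.
Proof. by apply: map_f; rewrite mem_enum. Qed.

Lemma size_vals n (x : K^^n) : size (vals x) = n.
Proof. by rewrite size_map size_enum_ord. Qed.

Lemma valsP n (x : K^^n) y : y \in vals x -> exists i, y = x 0 i.
Proof. by case/mapP => i _ ->; exists i. Qed.

Lemma gen_ins P n (i : 'I_n.+1) (x : K^^n.+1) : gen P x <->
  ~ acl P (x 0 i) /\ gen (P `|` [set x 0 i]) (col' i x).
Proof.
split; first by move/(ind_perm (vals_perm i x)).
by move=> H; apply: (ind_perm (s := x 0 i :: vals (col' i x))) => //;
  rewrite perm_sym vals_perm.
Qed.

Lemma gen_col' P n (i : 'I_n.+1) (x : K^^n.+1) : gen P x <->
  gen P (col' i x) /\ ~ acl (P <+ (col' i x)) (x 0 i).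
Proof.
have -> : gen P x <-> ind P (vals (col' i x) ++ [:: x 0 i]).
  have p : perm_eq (vals x) (vals (col' i x) ++ [:: x 0 i]).
    by rewrite (permPl (vals_perm i x)) perm_sym perm_catC.
  by split; apply: ind_perm => //; rewrite perm_sym.
by rewrite ind_cat /=; tauto.
Qed.

Lemma D_param_vec P n (v : K^^n) T {eT : encodable K T} (Q : T -> Prop) :
  D S (P <+ v) Q ->
  exists Q' : T * K^^n -> Prop, D S P Q' /\ forall x, Q x <-> Q' (x, v).
Proof.
elim: n P v T eT Q => [|n IH] P v T eT Q.
  rewrite (_ : vals v = [::]) ?set_nil ?setU0 => [DQ|]; last first.
    by apply/nilP; rewrite /nilp size_vals.
  by exists (fun p => Q p.1); split=> //; exact: D_fst.
rewrite (_ : [set` vals v] = [set v 0 ord0] <+ (col' ord0 v)); last first.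
  by rewrite -setmem_cons; apply/seteqP; split=> x /=; rewrite (perm_mem (vals_perm ord0 v)).
rewrite setUA => DQ; have [Q' [/D_param[Q'' [DQ'' E2]] E1]] := IH _ _ _ _ _ DQ.
exists (fun p => Q'' (p.1, col' ord0 p.2, p.2 0 ord0)); split.
  by ddef.
by move=> x; rewrite E1 E2.
Qed.

Lemma D_inst_vec P n (v : K^^n) T {eT : encodable K T} (Q : T * K^^n -> Prop) :
  D S P Q -> D S (P <+ v) (fun x => Q (x, v)).
Proof.
move=> DQ; apply: (D_comp (Q := Q) (g := fun x => (x, v))).
  by apply: D_mono DQ; exact: subsetUl.
apply: Df_pair; first exact: Df_id.
by apply: Df_rV => i; apply: Df_cst; right; exact: mem_vals.
Qed.

(** With the other coordinates [v] fixed, [Q] holds on an interval around the first one. End points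
    [c1], [c2] are chosen inside this interval over which [v] is still generic; then the condition
    that [Q] holds for all values between them is an open condition at [v] by induction. *)
Lemma gen_open P n (x : K^^n) (Q : K^^n -> Prop) : countable P -> gen P x -> D S P Q -> Q x ->
  exists2 d : K, 0 < d & forall y : K^^n, (forall i, `|y 0 i - x 0 i| < d) -> Q y.
Proof.
elim: n P x Q => [|n IH] P x Q cP gx DQ Qx.
  by exists 1 => // y _; rewrite (_ : y = x) //; apply/rowP => -[].
set i := ord0 : 'I_n.+1; set v := col' i x; set a := x 0 i.
have [gv Na] := (gen_col' P i x).1 gx.
have [||d d0 Hd] := @acl_nbhs (P <+ v) a
    (fun t => Q (ins i t v)) Na.
- apply: (@D_inst_vec P n v K _ (fun p => Q (ins i p.1 p.2))).
  apply: (D_comp DQ); apply: Df_ins; ddef.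
- by rewrite ins_col'.
have [|c1 c1P [gv1 _]] := ind_shrink cP gv (_ : a - d < a); first by rewrite ltrBlDr ltrDl.
have [||c2 c2P [gv2 _]] := ind_shrink _ gv1 (_ : a < a + d); first by ctb.
  by rewrite ltrDl.
have [||||d' d'0 Hd'] := IH (P `|` [set c1] `|` [set c2]) v
    (fun w => forall t, c1 < t < c2 -> Q (ins i t w)).
- by ctb.
- exact: gv2.
- have DQ' : D S (P `|` [set c1] `|` [set c2]) Q.
    by apply: D_mono DQ => z Pz; left; left.
  apply: D_all; apply: D_imp; first by ddef.
  apply: (D_comp DQ'); apply: Df_ins; ddef.
- move=> t tc; apply: Hd; rewrite ltr_norml; lra.
exists (Num.min d' (Num.min (a - c1) (c2 - a))).
  by rewrite !lt_min d'0 !subr_gt0; lra.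
move=> y yx; rewrite -(ins_col' i y); apply: Hd' => [j|].
  by have := yx (lift i j); rewrite !lt_min !mxE => /andP[].
by have := yx i; rewrite !lt_min -/a !ltr_norml; lra.
Qed.

Lemma ex_gen P n (x : K^^n) (r : K) : countable P -> 0 < r ->
  exists2 y, gen P y & forall i, `|y 0 i - x 0 i| < r.
Proof.
move=> cP r0; elim: n P cP x => [|n IH] P cP x; first (exists x => [|[]//]).
  by rewrite /gen (_ : vals x = [::]) //; apply/nilP; rewrite /nilp size_vals.
set i := ord0 : 'I_n.+1.
have [|c cx Nc] := @ex_notin_acl P (x 0 i - r) (x 0 i + r) cP; first lra.
have [|v gv vx] := IH (P `|` [set c]) _ (col' i x); first by ctb.
exists (ins i c v); first by apply/(gen_ins P i); rewrite insE col'_ins.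
move=> j; case: (unliftP i j) => [k ->|->]; last by rewrite insE ltr_norml; lra.
by rewrite ins_lift; have := vx k; rewrite mxE.
Qed.

(** Rank at least [d], not equal to [d]: the predicate is decreasing in [d] by [rk_le]. *)
Definition rk P (s : seq K) d := exists t, [/\ {subset t <= s}, ind P t & size t = d].

Lemma basis P (s : seq K) : exists t, [/\ {subset t <= s}, ind P t &
  forall y, y \in s -> acl (P `|` [set` t]) y].
Proof.
elim: s => [|x s [t [ts It tS]]]; first by exists [::].
have [Ax|Nx] := pselect (acl (P `|` [set` t]) x).
  exists t; split=> // y; first by move/ts; rewrite in_cons orbC => ->.
  by rewrite in_cons => /orP[/eqP->//|/tS].
exists (t ++ [:: x]); split.
- by move=> y; rewrite mem_cat inE in_cons => /orP[/ts->|->]; rewrite ?orbT.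
- by apply/ind_cat.
move=> y; rewrite in_cons => /orP[/eqP->|/tS].
  by apply: acl_mem => //; right; rewrite /= mem_cat inE eqxx orbT.
by apply: acl_mono => z [Pz|/= zt]; [left|right; rewrite /= mem_cat zt].
Qed.

Lemma rk_le P s d e : (d <= e)%N -> rk P s e -> rk P s d.
Proof.
move=> de [t [ts It te]]; exists (take d t); split.
- by move=> x /mem_take/ts.
- by move: It; rewrite -{1}(cat_take_drop d t) => /ind_cat[].
- by rewrite size_take te; case: ltngtP de.
Qed.

Lemma rk_acl P s u d : (forall y, y \in s -> acl (P `|` [set` u]) y) -> rk P s d -> rk P u d.
Proof.
move=> su [t [ts It td]]; have [b [bu Ib bU]] := basis P u.
apply: (@rk_le _ _ _ (size b)); last by exists b.
rewrite -td; apply: (steinitz It) => y /ts/su.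
apply: acl_trans => // c [Pc|/bU //]; by apply: acl_mem => //; left.
Qed.

Lemma rk_sub P s u d : {subset s <= u} -> rk P s d -> rk P u d.
Proof. by move=> su [t [ts It td]]; exists t; split=> // x /ts/su. Qed.

Lemma rk_size P s d : rk P s d -> (d <= size s)%N.
Proof. by move=> [t [ts It <-]]; apply: uniq_leq_size => //; exact: (ind_uniq It). Qed.

Lemma rk_gen P n (x : K^^n) : rk P (vals x) n -> gen P x.
Proof.
move=> [t [ts It tn]]; have ut := ind_uniq It; apply: ind_perm (It) => //.
have [|_ e] := uniq_min_size ut ts; first by rewrite size_vals tn.
by apply: uniq_perm => //; apply: (leq_size_uniq ut ts); rewrite size_vals tn.
Qed.

Lemma gen_rk P n (x : K^^n) : gen P x -> rk P (vals x) n.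
Proof. by move=> gx; exists (vals x); split=> //; exact: size_vals. Qed.

Lemma rk_cat P s u d : ind P s -> rk (P `|` [set` s]) u d -> rk P (s ++ u) (size s + d).
Proof.
move=> Is [t [tu It td]]; exists (s ++ t); split; last by rewrite size_cat td.
  by move=> x; rewrite !mem_cat => /orP[->//|/tu->]; rewrite orbT.
exact/ind_cat.
Qed.

Lemma seq_coords n (x : K^^n) (t : seq K) : {subset t <= vals x} ->
  exists I : 'I_(size t) -> 'I_n, forall i, x 0 (I i) = t`_i.
Proof.
move=> tx; have /choice[I HI] : forall i : 'I_(size t), exists j, t`_i = x 0 j.
  by move=> i; apply: valsP; apply: tx; exact: mem_nth.
by exists I.
Qed.

Lemma vals_seq n (w : K^^n) (t : seq K) (E : size t = n) :
  (forall i : 'I_n, w 0 i = t`_i) -> vals w = t.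
Proof.
move=> H; apply: (@eq_from_nth _ 0); rewrite size_vals // => i it.
by rewrite /vals (nth_map (Ordinal it)) ?size_enum_ord // H nth_enum_ord.
Qed.

(** All coordinates of [x] are functions of fewer than [e] of them, and [G] requires the same
    formulas to define such functions at [y]. Low rank is thus inherited by a whole [P]-definable
    set around [x]. *)
Lemma lowrk_def P n (x : K^^n) e : ~ rk P (vals x) e ->
  exists G : K^^n -> Prop, [/\ D S P G, G x & forall y, G y -> ~ rk P (vals y) e].
Proof.
move=> Nrk; have [t [tx It tS]] := basis P (vals x).
have te : (size t < e)%N by rewrite ltnNge; apply/negP => et; apply: Nrk; apply: (rk_le et); exists t.
have [I xI] := seq_coords tx.
have vt : vals (colsub I x) = t by apply: vals_seq => // i; rewrite mxE.
have /choice[R HR] : forall j, exists R : K * K^^(size t) -> Prop,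
    D S P R /\ forall y, y = x 0 j <-> R (y, colsub I x).
  move=> j; apply: D_param_vec; rewrite vt; apply: acl_dcl => //.
  by apply: tS; exact: mem_vals.
have DR j := (HR j).1.
exists (fun y : K^^n => forall j, R j (y 0 j, colsub I y) /\
  forall z, R j (z, colsub I y) -> z = y 0 j); split.
- apply: D_big => j; have := DR j; set Rj := R j => DRj; ddef.
- by move=> j; split=> [|z]; [apply/(HR j).2|move/(HR j).2].
move=> y Gy /(@rk_acl P _ (vals (colsub I y)))H.
suff /H/rk_size : forall z, z \in vals y -> acl (P <+ (colsub I y)) z.
  by rewrite size_vals leqNgt te.
move=> _ /valsP[j ->]; have [Ry Ru] := Gy j.
exists (fun z => R j (z, colsub I y)); split=> //; last first.
  by exists [:: y 0 j] => z /Ru->; rewrite mem_head.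
exact: D_inst_vec.
Qed.

(** Compactness applies although nothing is known about the points of rank below [e]: the sets of
    [lowrk_def] cover them and are discarded afterwards. *)
Lemma rk_compact_cover P n e (A : K^^n -> Prop) (F : set (K^^n -> Prop)) :
  countable P -> D S P A -> (forall Q, F Q -> D S P Q) ->
  (forall x, A x -> rk P (vals x) e -> exists2 Q, F Q & Q x) ->
  exists k (G : 'I_k -> K^^n -> Prop), (forall i, F (G i)) /\
    forall x, A x -> rk P (vals x) e -> exists i, G i x.
Proof.
move=> cP DA FD FA.
have [||k [G [HG GA]]] := @compactness P _ _ A
    (F `|` [set G | D S P G /\ forall y, G y -> ~ rk P (vals y) e]) cP DA.
- by move=> Q [/FD|[]].
- move=> x Ax; have [/(FA x Ax)[Q FQ Qx]|Nrk] := pselect (rk P (vals x) e).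
    by exists Q => //; left.
  by have [G [DG Gx Gy]] := lowrk_def Nrk; exists G => //; right.
have [[Q0 FQ0]|nF] := pselect (exists Q, F Q); last first.
  exists 0%N, (fun=> A); split=> [[]//|x Ax /(FA x Ax)[Q FQ]].
  by case: nF; exists Q.
have /choice[G' HG'] : forall i, exists Q, F Q /\ forall x, rk P (vals x) e -> G i x -> Q x.
  move=> i; have [FG|[_ NG]] := HG i; first by exists (G i).
  by exists Q0; split=> // x xe /NG.
exists k, G'; split=> [i|x Ax xe]; first by case: (HG' i).
by have [i Gi] := GA x Ax; exists i; apply: (HG' i).2.
Qed.

Lemma enorm_ge0 n (x : K^^n) : 0 <= enorm x.
Proof. exact: sqrtr_ge0. Qed.

Lemma le_enorm n (x : K^^n) i : `|x 0 i| <= enorm x.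
Proof.
rewrite -sqrtr_sqr ler_sqrt; last by apply: sumr_ge0 => j _; exact: sqr_ge0.
by rewrite (bigD1 i) //= lerDl; apply: sumr_ge0 => j _; exact: sqr_ge0.
Qed.

Lemma enorm_le_sum n (x : K^^n) : enorm x <= \sum_i `|x 0 i|.
Proof.
have s0 : 0 <= \sum_i `|x 0 i| by apply: sumr_ge0.
rewrite -[leRHS](ger0_norm s0) -sqrtr_sqr ler_sqrt ?sqr_ge0 //.
suff [] : 0 <= \sum_i `|x 0 i| /\ \sum_i x 0 i ^+ 2 <= (\sum_i `|x 0 i|) ^+ 2 by [].
elim/big_rec2: _ => [|i q s _ [s00 qs]]; first by rewrite expr0n.
split; first by rewrite addr_ge0.
rewrite sqrrD -normrX [`|_ ^+ 2|]ger0_norm ?sqr_ge0 // -addrA lerD2l.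
by rewrite (le_trans qs) // lerDr mulrn_wge0 // mulr_ge0.
Qed.

Lemma enorm_lt n (x : K^^n) (r : K) : 0 < r ->
  (forall i, `|x 0 i| < r / n.+1%:R) -> enorm x < r.
Proof.
move=> r0 H; apply: le_lt_trans (enorm_le_sum x) _.
apply: (@le_lt_trans _ _ (\sum_(i < n) r / n.+1%:R)); first by apply: ler_sum => i _; exact: ltW.
rewrite sumr_const card_ord -[X in X < _]mulr_natr mulrAC ltr_pdivrMr ?ltr0n //.
by rewrite ltr_pM2l // ltr_nat.
Qed.

Lemma rk_coords P n (x : K^^n) d : rk P (vals x) d <->
  exists2 s : 'I_d -> 'I_n, injective s & gen P (colsub s x).
Proof.
split=> [[t [tx It <-]]|[s sI gs]].
  have [I xI] := seq_coords tx; have vt : vals (colsub I x) = t.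
    by apply: vals_seq => // i; rewrite mxE.
  exists I; last by rewrite /gen vt.
  move=> i j eIJ; apply: val_inj; apply/eqP.
  by rewrite -(nth_uniq 0 (ltn_ord i) (ltn_ord j) (ind_uniq It)) -!xI eIJ.
exists (vals (colsub s x)); split=> //; last exact: size_vals.
by move=> _ /valsP[i ->]; rewrite mxE; exact: mem_vals.
Qed.

(** A ball in a coordinate space contains generic points, and conversely a generic point of a
    projection is interior to it. Dimension is thus the maximal rank of a point over any countable
    set of parameters that defines [A]. *)
Lemma dim_geP P n (A : set K^^n) d : countable P -> D S P A ->
  dim_ge A d <-> exists2 x, A x & rk P (vals x) d.
Proof.
move=> cP DA; split=> [[s [_ [z [r [r0 H]]]]]|[x Ax /rk_coords[s sI gs]]].
  have [|w gw wz] := @ex_gen P d z (r / d.+1%:R) cP; first by rewrite divr_gt0.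
  have [|x Ax xw] := H w; first by apply: enorm_lt => // i; rewrite !mxE.
  exists x => //; apply: rk_sub (gen_rk gw) => _ /valsP[i ->].
  by rewrite -xw mxE mem_vals.
exists s; split=> //.
have [||r r0 Hr] := @gen_open P d (colsub s x) (fun w => exists2 y, A y & colsub s y = w) cP gs.
- by ddef.
- by exists x.
exists (colsub s x), r; split=> // w wr; apply: Hr => i.
by apply: le_lt_trans wr; have := le_enorm (w - colsub s x) i; rewrite !mxE.
Qed.

(** * Smoothness at generic points *)

Lemma min2 (a b : K) : 0 < a -> 0 < b -> exists c, [/\ 0 < c, c <= a & c <= b].
Proof.
move=> a0 b0; exists (Num.min a b); split; first by rewrite lt_min a0.
  by rewrite ge_min lexx.
by rewrite ge_min lexx orbT.
Qed.

Lemma ind_shrink1 P t a b : countable P -> ~ acl P t -> a < b ->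
  exists2 c, a < c < b & ~ acl (P `|` [set c]) t.
Proof.
move=> cP Nt ab; have [|c cab [[Nc _] _]] := ind_shrink cP (_ : ind P [:: t]) ab.
  by [].
by exists c.
Qed.

(* The sign of [h u - h t] for [u] slightly larger than [t] propagates to all
   pairs of points near [t], because the bound [c] on [u] can be chosen so that
   [t] remains generic. *)
Lemma germ_right P (h : K -> K) (r : K -> K -> bool) t : countable P -> ~ acl P t ->
  Df S P h -> D S P (fun p : K * K => r p.1 p.2) ->
  (exists2 d : K, 0 < d & forall u, t < u < t + d -> r (h t) (h u)) ->
  exists2 d : K, 0 < d & forall u w : K, t - d < u -> u < w -> w < t + d -> r (h u) (h w).
Proof.
move=> cP Nt Dh Dr [d d0 Hd].
have [|c cd Nc] := ind_shrink1 cP Nt (_ : t < t + d); first by rewrite ltrDl.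
have Dh' := Df_mono (@subsetUl _ P [set c]) Dh.
have Dr' := D_mono (@subsetUl _ P [set c]) Dr.
have [||e e0 He] := @acl_nbhs _ t (fun v => forall u, v < u < c -> r (h v) (h u)) Nc.
- apply: D_all; apply: D_imp; first by ddef.
  apply: (D_comp (Q := fun p : K * K => r p.1 p.2)
    (g := fun p : K * K => (h p.1, h p.2)) Dr'); ddef.
- by move=> u /andP[tu uc]; apply: Hd; case/andP: cd; lra.
have [|e' [e'0 ee' ec]] := min2 e0 (_ : 0 < c - t); first by rewrite subr_gt0; case/andP: cd.
by exists e' => // u w ? ? ?; apply: He; rewrite ?ltr_norml; lra.
Qed.

Lemma monotone_gen P (h : K -> K) t : countable P -> ~ acl P t -> Df S P h ->
  exists2 d : K, 0 < d &
   [\/ forall u w : K, t - d < u -> u < w -> w < t + d -> h u < h w,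
       forall u w : K, t - d < u -> u < w -> w < t + d -> h u = h w |
       forall u w : K, t - d < u -> u < w -> w < t + d -> h w < h u].
Proof.
move=> cP Nt Dh.
have DQ c : D S (P `|` [set c]) (fun u => h u < c) /\ D S (P `|` [set c]) (fun u => h u = c).
  have Dh' := Df_mono (@subsetUl _ P [set c]) Dh.
  by split; [ddef|apply: D_eqT => //; apply: Df_cst; right].
have [d1 d10 H1] := omin_right t (DQ (h t)).1.
have [d2 d20 H2] := omin_right t (DQ (h t)).2.
case: H1 => H1.
  have [||e e0 He] := @germ_right P h (fun x y => y < x) t cP Nt Dh; first by ddef.
    by exists d1.
  by exists e => //; apply: Or33.
case: H2 => H2.
  have [||e e0 He] := @germ_right P h (fun x y => y == x) t cP Nt Dh; first by ddef.
    by exists d2 => // u /H2->.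
  by exists e => //; apply: Or32 => u w *; apply/esym/eqP; exact: He.
have [||e e0 He] := @germ_right P h (fun x y => x < y) t cP Nt Dh; first by ddef.
  exists (Num.min d1 d2) => [|u]; first by rewrite lt_min d10.
  rewrite -ltrBlDl lt_min !ltrBlDl => /andP[tu /andP[u1 u2]].
  have /H1/negP := introT andP (conj tu u1); have /H2/eqP := introT andP (conj tu u2).
  by rewrite -leNgt lt_neqAle eq_sym => -> ->.
by exists e => //; apply: Or31.
Qed.

(** The supremum of the points up to which all values exceed [h u0] is [w0], because the local
    hypothesis carries the property beyond any smaller point. The supremum exists by definable
    completeness. *)
Lemma loc_incr P (h : K -> K) (u0 w0 : K) : Df S P h -> u0 < w0 ->
  (forall t : K, u0 <= t <= w0 -> exists2 d : K, 0 < d &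
     (forall u : K, t - d < u -> u < t -> u0 <= u -> h u < h t) /\
     (forall u : K, t < u -> u < t + d -> u <= w0 -> h t < h u)) ->
  h u0 < h w0.
Proof.
move=> Dh uw H.
pose Q (t : K) := (u0 < t /\ t <= w0) /\ forall s, u0 < s <= t -> h u0 < h s.
have DQ : D S (P `|` [set u0] `|` [set w0]) Q.
  have Dh' : Df S (P `|` [set u0] `|` [set w0]) h.
    by apply: Df_mono Dh => z ?; left; left.
  have Dhc : D S (P `|` [set u0] `|` [set w0]) (fun s => h u0 < h s).
    apply: D_lt => //; apply: (Df_comp (h := h)) => //; apply: Df_cst; by left; right.
  rewrite /Q; apply: D_and; first by ddef.
  by apply: D_all; apply: D_imp; [ddef|apply: (D_comp (Q := fun s => h u0 < h s) Dhc); ddef].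
have [d d0 [_ Hd]] := H u0 (introT andP (conj (lexx _) (ltW uw))).
have Q0 : Q (Num.min w0 (u0 + d / 2%:R)).
  split; first by rewrite lt_min ge_min lexx uw ltrDl divr_gt0.
  by move=> s; rewrite le_min => /andP[? /andP[? ?]]; apply: Hd => //; lra.
have [|m [mU mL]] := def_sup DQ Q0 (b := w0); first by move=> t [[]].
have um : u0 < m by apply: lt_le_trans (mU _ Q0); case: Q0 => -[].
have mw : m <= w0 by apply: mL => t [[]].
have [e e0 [He He']] := H m (introT andP (conj (ltW um) mw)).
have [s Qs ms] : exists2 s, Q s & m - e < s.
  apply: contrapT => N; have : m <= m - e.
    by apply: mL => t Qt; rewrite leNgt; apply/negP => mt; apply: N; exists t.
  lra.
have sm := mU s Qs; case: (Qs) => -[us sw] Hs.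
have hum : h u0 < h m.
  have [E|sm'] := eqVneq s m; first by apply: Hs; rewrite -E us lexx.
  by apply: lt_trans (Hs s _) (He s _ _ _); rewrite ?us ?lexx //; lra.
have Qv : Q (Num.min w0 (m + e / 2%:R)).
  split; first by rewrite lt_min ge_min lexx uw /=; lra.
  move=> v; rewrite le_min => /andP[uv /andP[vw ?]].
  have [vs|sv] := leP v s; first by apply: Hs; rewrite uv.
  have [vm|mv|->//] := ltgtP v m.
    have [s' Qs' vs'] : exists2 s', Q s' & v < s'.
      apply: contrapT => N; have : m <= v; last lra.
      by apply: mL => t Qt; rewrite leNgt; apply/negP => mt; apply: N; exists t.
    by case: Qs' => _; apply; lra.
  by apply: lt_trans hum _; apply: He' => //; lra.
have := mU _ Qv; rewrite ge_min => /orP[wm|]; last by lra.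
by case: Qv => _; apply; rewrite uw le_min lexx /=; lra.
Qed.

(** If [Q] were left between [t] and [u], the function that adds [u - t + 1] to the identity on [Q]
    would be locally increasing, as [Q] is locally constant, but it would decrease from [t] to [u].
    This reduces connectedness to [loc_incr]. *)
Lemma conn1 P (Q : K -> Prop) (a b : K) : D S P Q ->
  (forall t, a < t < b -> exists2 d : K, 0 < d &
     (forall u, `|u - t| < d -> Q u) \/ (forall u, `|u - t| < d -> ~ Q u)) ->
  forall t u, a < t < b -> a < u < b -> Q t -> Q u.
Proof.
move=> DQ H.
have key (Q' : K -> Prop) t u : D S P Q' -> (forall t, a < t < b -> exists2 d : K, 0 < d &
     (forall u, `|u - t| < d -> Q' u) \/ (forall u, `|u - t| < d -> ~ Q' u)) ->
    a < t -> t < u -> u < b -> Q' t -> Q' u.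
  move=> DQ' H' at_ tu ub Q't; apply: contrapT => NQu.
  pose h (v : K) := v + (if `[< Q' v >] then u - t + 1 else 0).
  have Dh : Df S (P `|` [set t] `|` [set u]) h.
    apply: Df_add; first exact: Df_id.
    apply: (Df_if (Q := Q')); [by move=> x; split=> /asboolP| |by ddef|by ddef].
    by apply: D_mono DQ' => z ?; left; left.
  suff : h t < h u by rewrite /h asboolT // asboolF //; lra.
  apply: (loc_incr Dh) => // v tvu; have [|d d0 Hd] := H' v; first lra.
  have cst w : `|w - v| < d -> `[< Q' w >] = `[< Q' v >].
    by move=> wv; case: Hd => Hd; [rewrite !asboolT|rewrite !asboolF]; auto;
      apply: Hd; rewrite ?subrr ?normr0.
  by exists d => //; split=> w ? ? ?; rewrite /h cst ?ltr_norml; lra.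
move=> t u /andP[at_ tb] /andP[au ub] Qt; have [tu|ut|<-//] := ltgtP t u.
  exact: (key Q t u).
apply: contrapT => Qu; suff : ~ Q t by [].
apply: (key (fun v => ~ Q v) u t) => //; first by ddef.
by move=> v /H[d d0 [Hd|Hd]]; exists d => //; [right=> w /Hd Qw NQ; exact: NQ|left].
Qed.

(** For every positive [e] the functions [(r + e) * v - c v] and [(r + e) * v + c v] are locally
    increasing, hence increasing. If the bound failed for a pair of points, the excess of their
    slope could be taken as [e]. *)
Lemma lip1 P (c : K -> K) (a b r : K) : Df S P c ->
  (forall t, a < t < b -> exists2 d : K, 0 < d &
     forall u, `|u - t| < d -> `|c u - c t| <= r * `|u - t|) ->
  forall t u, a < t < b -> a < u < b -> `|c u - c t| <= r * `|u - t|.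
Proof.
move=> Dc H.
have key (c' : K -> K) (e t u : K) : Df S P c' -> (forall t, a < t < b -> exists2 d : K, 0 < d &
     forall u, `|u - t| < d -> `|c' u - c' t| <= r * `|u - t|) ->
    0 < e -> a < t -> t < u -> u < b -> c' u - c' t < (r + e) * (u - t).
  move=> Dc' H' e0 at_ tu ub.
  suff : (r + e) * t - c' t < (r + e) * u - c' u by lra.
  have Dc'' : Df S (P `|` [set r + e]) c' by apply: Df_mono Dc'; exact: subsetUl.
  apply: (@loc_incr (P `|` [set r + e]) (fun v => (r + e) * v - c' v)) => //; first by ddef.
  move=> v tvu; have [|d d0 Hd] := H' v; first lra.
  exists d => //; split=> w ? ? ?; (have := Hd w; rewrite ltr_norml => /(_ ltac:(lra))).
    rewrite [X in _ * X]ltr0_norm; last lra.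
    rewrite ler_norml => /andP[? ?]; have : 0 < e * (v - w) by rewrite mulr_gt0; lra.
    lra.
  rewrite [X in _ * X]gtr0_norm; last lra.
  rewrite ler_norml => /andP[? ?]; have : 0 < e * (w - v) by rewrite mulr_gt0; lra.
  lra.
have keyN : forall t, a < t < b -> exists2 d : K, 0 < d &
     forall u, `|u - t| < d -> `|- c u - - c t| <= r * `|u - t|.
  by move=> t /H[d d0 Hd]; exists d => // u /Hd; rewrite -opprD normrN.
have DN : Df S P (fun u => - c u) by ddef.
have wl t u : a < t -> t < u -> u < b -> `|c u - c t| <= r * `|u - t|.
  move=> at_ tu ub; rewrite [X in _ * X]gtr0_norm ?subr_gt0 //.
  rewrite leNgt; apply/negP => HH; set e := (`|c u - c t| - r * (u - t)) / (u - t).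
  have e0 : 0 < e by rewrite divr_gt0 ?subr_gt0.
  have E : e * (u - t) = `|c u - c t| - r * (u - t) by rewrite divfK // subr_eq0 gt_eqF.
  have := key c e t u Dc H e0 at_ tu ub; have := key _ e t u DN keyN e0 at_ tu ub.
  rewrite mulrDl E; case: (ger0P (c u - c t)); lra.
move=> t u /andP[at_ tb] /andP[au ub]; have [tu|ut|->] := ltgtP t u.
- exact: wl.
- by rewrite distrC [X in _ * X]distrC; exact: wl.
- by rewrite !subrr normr0 mulr0.
Qed.

(* [a] is the strict derivative of [g] at [t]. *)
Definition sder (g : K -> K) (t a : K) := forall s1 s2 : K, s1 < a -> a < s2 ->
  exists2 d : K, 0 < d & forall u w : K, t - d < u -> u < w -> w < t + d ->
    s1 * (w - u) < g w - g u /\ g w - g u < s2 * (w - u).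

Lemma slope_gen P (g : K -> K) t s : countable P -> ~ acl (P `|` [set s]) t ->
  Df S P g -> exists2 d : K, 0 < d &
   [\/ forall u w : K, t - d < u -> u < w -> w < t + d -> s * (w - u) < g w - g u,
       forall u w : K, t - d < u -> u < w -> w < t + d -> g w - g u = s * (w - u) |
       forall u w : K, t - d < u -> u < w -> w < t + d -> g w - g u < s * (w - u)].
Proof.
move=> cP Nt Dg; have Dg' := Df_mono (@subsetUl _ P [set s]) Dg.
have [||d d0 H] := @monotone_gen (P `|` [set s]) (fun u => g u - s * u) t _ Nt.
- by ctb.
- by ddef.
exists d => //; case: H => H; [apply: Or31|apply: Or32|apply: Or33] => u w tu uw wt;
  have := H u w tu uw wt; lra.
Qed.

(** Infinite slope at a generic [t] would persist near [t]. Subtracting a linear function whose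
    slope [s] is that of a secant, one would get a strictly increasing function with equal values at
    the ends of the secant. *)
Let infinite_slope P (g : K -> K) t : countable P -> ~ acl P t -> Df S P g ->
  ~ forall s : K, exists2 d : K, 0 < d & forall u w : K, t - d < u -> u < w -> w < t + d ->
     s * (w - u) < g w - g u.
Proof.
move=> cP Nt Dg H.
have [||d d0 Hd] := @acl_nbhs P t (fun t => forall s : K,
  exists2 d : K, 0 < d & forall u w : K, t - d < u -> u < w -> w < t + d ->
     s * (w - u) < g w - g u) Nt; first by ddef.
  by [].
set s := (g (t + d / 2%:R) - g t) / (d / 2%:R).
have Dg' := Df_mono (@subsetUl _ P [set s]) Dg.
have : g t - s * t < g (t + d / 2%:R) - s * (t + d / 2%:R).
  apply: (@loc_incr (P `|` [set s]) (fun u => g u - s * u)).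
  - by ddef.
  - by rewrite ltrDl divr_gt0.
  move=> v tv; have [|e e0 He] := Hd v _ s; first by rewrite ltr_norml; lra.
  exists e => //; split=> u vu uw wv; [have := He u v|have := He v u];
    by move=> /(_ ltac:(lra) ltac:(lra) ltac:(lra)); lra.
have : s * (d / 2%:R) = g (t + d / 2%:R) - g t by rewrite divfK // gt_eqF // divr_gt0.
lra.
Qed.

(** For every slope [s] over which [t] is still generic, the slopes near [t] are all above [s], all
    below [s] or all equal to [s]. Such [s] are dense, and no infinite slopes occur, so the supremum
    of the lower bounds is the derivative unless some slope is attained exactly. *)
Lemma sder_gen P (g : K -> K) t : countable P -> ~ acl P t -> Df S P g ->
  exists a, sder g t a.
Proof.
move=> cP Nt Dg.
pose Lo (s : K) := exists2 d : K, 0 < d & forall u w : K, t - d < u -> u < w -> w < t + d ->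
     s * (w - u) < g w - g u.
pose Hi (s : K) := exists2 d : K, 0 < d & forall u w : K, t - d < u -> u < w -> w < t + d ->
     g w - g u < s * (w - u).
pose Eq (s : K) := exists2 d : K, 0 < d & forall u w : K, t - d < u -> u < w -> w < t + d ->
     g w - g u = s * (w - u).
have Lo_le s s' : Lo s -> s' <= s -> Lo s'.
  move=> [d d0 H] ss'; exists d => // u w tu uw wt; apply: le_lt_trans (H u w tu uw wt).
  by rewrite ler_pM2r // subr_gt0.
have Hi_le s s' : Hi s -> s <= s' -> Hi s'.
  move=> [d d0 H] ss'; exists d => // u w tu uw wt; apply: lt_le_trans (H u w tu uw wt) _.
  by rewrite ler_pM2r // subr_gt0.
have LoHi s s' : Lo s -> Hi s' -> s <= s'.
  move=> Ls Hs'; rewrite leNgt; apply/negP => /ltW/(Lo_le _ _ Ls)[d d0 H].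
  have [d' d'0 H'] := Hs'; have [e [e0 ed ed']] := min2 d0 d'0.
  have := H (t - e / 2%:R) (t + e / 2%:R); have := H' (t - e / 2%:R) (t + e / 2%:R).
  by move=> /(_ ltac:(lra) ltac:(lra) ltac:(lra)) ? /(_ ltac:(lra) ltac:(lra) ltac:(lra)) ?; lra.
have [[a [d d0 Ha]]|NEq] := pselect (exists s, Eq s).
  exists a => s1 s2 s1a as2; exists d => // u w tu uw wt; rewrite Ha // !ltr_pM2r //; lra.
have tri s : ~ acl (P `|` [set s]) t -> Lo s \/ Hi s.
  move=> /(slope_gen cP) -/(_ g Dg)[d d0 []] H.
  - by left; exists d.
  - by case: NEq; exists s, d.
  - by right; exists d.
have gs a b : a < b -> exists2 s, a < s < b & Lo s \/ Hi s.
  by move=> ab; have [s sab Ns] := ind_shrink1 cP Nt ab; exists s => //; exact: tri.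
have [h0 Hh0] : exists s, Hi s.
  have /existsNP[s Ns] := infinite_slope cP Nt Dg.
  have [|s' ss' [Ls'|]] := gs s (s + 1); [lra| |by exists s'].
  by case: Ns; apply: Lo_le Ls' _; lra.
have [l0 Hl0] : exists s, Lo s.
  have DN : Df S P (fun u => - g u) by ddef.
  have /existsNP[s Ns] := infinite_slope cP Nt DN.
  have [|s' ss' [|[d d0 Hs']]] := gs (- s - 1) (- s); [lra|by exists s'|].
  case: Ns; exists d => // u w tu uw wt; have := Hs' u w tu uw wt.
  by have : s' * (w - u) < - s * (w - u); [rewrite ltr_pM2r; lra|lra].
have DLo : D S (P `|` [set t]) Lo.
  by have Dg' := Df_mono (@subsetUl _ P [set t]) Dg; rewrite /Lo; ddef.
have [|a [aU aL]] := def_sup DLo Hl0 (b := h0); first by move=> s Ls; exact: LoHi Hh0.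
have LoP s : s < a -> Lo s.
  move=> sa; apply: contrapT => Ns; have : a <= s; last by lra.
  by apply: aL => r Lr; rewrite leNgt; apply/negP => /ltW/(Lo_le _ _ Lr).
have HiP s : a < s -> Hi s.
  by move=> /gs[r ras [/aU|Hr]]; [lra|apply: Hi_le Hr _; lra].
exists a => s1 s2 /LoP[d d0 H] /HiP[d' d'0 H'].
have [e [e0 ed ed']] := min2 d0 d'0; exists e => // u w tu uw wt.
by split; [apply: H|apply: H']; lra.
Qed.

(** * Strict differentiability in several variables *)

Definition box n (x : K^^n) (d : K) (y : K^^n) := forall i, `|y 0 i - x 0 i| < d.

(** Strict differentiability with gradient [G]: both points vary. It gives a Lipschitz bound near
    [x], and where it holds on a whole set the gradient is continuous there ([sdm_C1]). *)
Definition sdiff n (f : K^^n -> K) (x G : K^^n) := forall e : K, 0 < e ->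
  exists2 d : K, 0 < d & forall y z, box x d y -> box x d z ->
    `|f y - f z - \sum_i G 0 i * (y 0 i - z 0 i)| <= e * \sum_i `|y 0 i - z 0 i|.

Lemma D_box P T {eT : encodable K T} n (x y : T -> K^^n) (d : T -> K) :
  Df S P x -> Df S P y -> Df S P d -> D S P (fun t => box (x t) (d t) (y t)).
Proof. by move=> Dx Dy Dd; rewrite /box; ddef. Qed.

Lemma D_sdiff P n (f : K^^n -> K) : Df S P f ->
  D S P (fun p : K^^n * K^^n => sdiff f p.1 p.2).
Proof. by move=> Df0; rewrite /sdiff /box; ddef. Qed.

Lemma sdiff_unique n (f : K^^n -> K) x G G' : sdiff f x G -> sdiff f x G' -> G = G'.
Proof.
move=> H H'; apply/rowP => i; apply: contrapT => /eqP GG'.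
set e := `|G 0 i - G' 0 i| / 4%:R.
have e0 : 0 < e by rewrite divr_gt0 // normr_gt0 subr_eq0.
have [d d0 Hd] := H e e0; have [d' d'0 Hd'] := H' e e0.
have [r [r0 rd rd']] := min2 d0 d'0.
pose y := x + (r / 2%:R) *: delta_mx 0 i.
have yi j : y 0 j - x 0 j = (r / 2%:R) * (j == i)%:R by rewrite !mxE /= addrC addKr.
have by_ c : r <= c -> box x c y.
  move=> rc j; rewrite yi; case: eqP => _; rewrite ?mulr1 ?mulr0 ?normr0; last lra.
  by rewrite gtr0_norm; lra.
have bx c : 0 < c -> box x c x by move=> c0 j; rewrite subrr normr0.
have S1 (C : K^^n) : \sum_j C 0 j * (y 0 j - x 0 j) = C 0 i * (r / 2%:R).
  rewrite (bigD1 i) //= yi eqxx mulr1 big1 ?addr0 // => j /negbTE ji.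
  by rewrite yi ji !mulr0.
have S2 : \sum_j `|y 0 j - x 0 j| = r / 2%:R.
  rewrite (bigD1 i) //= yi eqxx mulr1 big1 ?addr0 => [|j /negbTE ji].
    by rewrite gtr0_norm //; lra.
  by rewrite yi ji mulr0 normr0.
have := Hd y x (by_ d rd) (bx d d0); have := Hd' y x (by_ d' rd') (bx d' d'0).
rewrite !S1 !S2 => A B.
have : `|(G 0 i - G' 0 i) * (r / 2%:R)| <= (e + e) * (r / 2%:R).
  rewrite [X in _ <= X]mulrDl; apply: (le_trans _ (lerD A B)); rewrite -[X in _ <= _ + X]normrN.
  apply: le_trans (ler_normD _ _); rewrite le_eqVlt; apply/orP; left; apply/eqP.
  by congr `|_|; ring.
rewrite normrM [X in _ * X]gtr0_norm ?divr_gt0 // ler_pM2r ?divr_gt0 // /e.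
have : 0 < `|G 0 i - G' 0 i| by rewrite normr_gt0 subr_eq0.
lra.
Qed.

Lemma min_all n (d : 'I_n -> K) : (forall i, 0 < d i) -> exists2 c : K, 0 < c & forall i, c <= d i.
Proof.
elim: n d => [|n IH] d d0; first by exists 1 => // -[].
have [c c0 Hc] := IH (fun i => d (lift ord0 i)) (fun i => d0 _).
have [e [e0 ec ed]] := min2 c0 (d0 ord0); exists e => // i.
by case: (unliftP ord0 i) => [j ->|->//]; apply: le_trans (Hc j).
Qed.

(** The bounds [s1], [s2] for the slopes and the ends [c1], [c2] of the interval are chosen so that
    the remaining coordinates stay generic over them. The slope estimate then is a definable
    property of these coordinates, which holds in a neighbourhood. *)
Lemma partial_unif P n (f : K^^n.+1 -> K) x i a e : countable P -> gen P x ->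
  Df S P f -> sder (fun t => f (ins i t (col' i x))) (x 0 i) a -> 0 < e ->
  exists2 d : K, 0 < d & forall v u w, box (col' i x) d v -> `|u - x 0 i| < d ->
    `|w - x 0 i| < d ->
    `|f (ins i u v) - f (ins i w v) - a * (u - w)| <= e * `|u - w|.
Proof.
move=> cP gx Dff Ha e0; set t := x 0 i in Ha *.
have [|s1 s1P [g1 _]] := ind_shrink cP gx (_ : a - e < a); first lra.
have [||s2 s2P [g2 _]] := ind_shrink _ g1 (_ : a < a + e); [by ctb|lra|].
have [||d d0 Hd] := Ha s1 s2; [lra|lra|].
have [||c1 c1P [g3 _]] := ind_shrink _ g2 (_ : t - d < t); [by ctb|lra|].
have [||c2 c2P [g4 _]] := ind_shrink _ g3 (_ : t < t + d); [by ctb|lra|].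
set P' := (X in ind X _) in g4.
have cP' : countable P' by rewrite /P'; ctb.
have gv : gen P' (col' i x).
  have /(gen_ins) -/(_ i)[_] : gen P' x by exact: g4.
  by apply: ind_mono; exact: subsetUl.
have Df' : Df S P' f by apply: Df_mono Dff => z Pz; do 4!left.
have [||r r0 Hr] := @gen_open P' n (col' i x) (fun v => forall u w : K,
    (c1 < u /\ u < w) /\ w < c2 -> s1 * (w - u) < f (ins i w v) - f (ins i u v) /\
     f (ins i w v) - f (ins i u v) < s2 * (w - u)) cP' gv.
- have Ps1 : P' s1 by do 3!left; right.
  have Ps2 : P' s2 by do 2!left; right.
  have Pc1 : P' c1 by left; right.
  have Pc2 : P' c2 by right.
  have DI (g : K^^n * K * K -> K) : Df S P' g ->
      Df S P' (fun x => f (ins i (g x) x.1.1)).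
    by move=> Dg; apply: (Df_comp Df'); apply: Df_ins => //; ddef.
  do 2!apply: D_all; apply: D_imp; first by ddef.
  apply: D_and; apply: D_lt; try (apply: Df_mul; ddef);
    (apply: Df_add; [apply: DI|apply: Df_opp; apply: DI]; ddef).
- move=> u w [[? ?] ?]; apply: Hd; lra.
have [||q [q0 q1 q2]] := min2 (_ : 0 < t - c1) (_ : 0 < c2 - t); [lra|lra|].
have [p [p0 pr pq]] := min2 r0 q0; exists p => // v u w xv; rewrite !ltr_norml => ut wt.
have {}Hr : forall u w : K, c1 < u -> u < w -> w < c2 ->
   s1 * (w - u) < f (ins i w v) - f (ins i u v) /\
     f (ins i w v) - f (ins i u v) < s2 * (w - u).
  by move=> u' w' *; apply: Hr => // j; apply: lt_le_trans (xv j) _.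
have wlog_lt u' w' : c1 < u' -> u' < w' -> w' < c2 ->
    `|f (ins i w' v) - f (ins i u' v) - a * (w' - u')| <= e * `|w' - u'|.
  move=> cu uw wc; have [A B] := Hr u' w' cu uw wc.
  have : (a - e) * (w' - u') <= s1 * (w' - u') by rewrite ler_pM2r; lra.
  have : s2 * (w' - u') <= (a + e) * (w' - u') by rewrite ler_pM2r; lra.
  by rewrite [`|w' - u'|]gtr0_norm ?subr_gt0 // ler_norml; lra.
have [uw|wu|->] := ltgtP u w; last by rewrite !subrr mulr0 subrr !normr0 mulr0.
  rewrite -normrN distrC; have -> : - (f (ins i u v) - f (ins i w v) - a * (u - w)) =
    f (ins i w v) - f (ins i u v) - a * (w - u) by ring.
  by apply: wlog_lt; lra.
by apply: wlog_lt; lra.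
Qed.

(** From [z] to [y] one coordinate is changed at a time, and each increment is estimated by
    [partial_unif], which is uniform in the other coordinates. *)
Lemma sdiff_gen P n (f : K^^n -> K) x : countable P -> gen P x -> Df S P f ->
  exists G, sdiff f x G.
Proof.
case: n f x => [|n] f x cP gx Dff.
  exists 0 => e e0; exists 1 => // y z _ _; rewrite (_ : y = z); last by apply/rowP => -[].
  by rewrite subrr !big_ord0 mulr0 subrr normr0.
have /choice[G HG] : forall i, exists a, sder (fun t => f (ins i t (col' i x))) (x 0 i) a.
  move=> i; have [_ Na] := (gen_col' P i x).1 gx.
  apply: (sder_gen _ Na); first by ctb.
  apply: (@D_inst_vec P n (col' i x) (K * K)%type _
    (fun p : K * K * K^^n => p.1.2 = f (ins i p.1.1 p.2))).
  by apply: D_eqT; [ddef|apply: (Df_comp Dff); apply: Df_ins; ddef].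
exists (\row_i G i) => e e0.
have /choice[d Hd] : forall i, exists d : K, 0 < d /\ forall v u w, box (col' i x) d v ->
    `|u - x 0 i| < d -> `|w - x 0 i| < d ->
    `|f (ins i u v) - f (ins i w v) - G i * (u - w)| <= e * `|u - w|.
  by move=> i; have [d d0 H] := partial_unif cP gx Dff (HG i) e0; exists d.
have [r r0 Hr] := min_all (fun i => (Hd i).1); exists r => // y z xy xz.
pose mix (k : nat) : K^^n.+1 := \row_j (if (j < k)%N then y 0 j else z 0 j).
have my : y = mix n.+1 by apply/rowP => j; rewrite mxE ltn_ord.
have mz : z = mix 0%N by apply/rowP => j; rewrite mxE.
have T : f y - f z = \sum_(i < n.+1) (f (mix i.+1) - f (mix i)).
  by rewrite -(big_mkord xpredT (fun i => f (mix i.+1) - f (mix i))) telescope_sumr // -my -mz.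
rewrite T -sumrB mulr_sumr; apply: le_trans (ler_norm_sum _ _ _) _.
apply: ler_sum => i _; rewrite mxE.
have -> : mix i.+1 = ins i (y 0 i) (col' i (mix i)).
  apply/rowP => j; case: (unliftP i j) => [k ->|->]; rewrite ?insE ?ins_lift !mxE ?ltnSn //.
  have := neq_lift i k; rewrite -val_eqE /= ltnS leq_eqVlt => /negbTE.
  by rewrite eq_sym => ->.
have -> : mix i = ins i (z 0 i) (col' i (mix i)) :> K^^n.+1.
  apply/rowP => j; case: (unliftP i j) => [k ->|->]; rewrite ?insE ?ins_lift !mxE ?ltnn //.
rewrite col'_ins; apply: (Hd i).2.
- move=> j; rewrite !mxE; apply: lt_le_trans (Hr i).
  by case: ifP => _; [exact: xy|exact: xz].
- exact: lt_le_trans (xy i) (Hr i).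
- exact: lt_le_trans (xz i) (Hr i).
Qed.

(** The default 0 makes the gradient a total definable function; see [Df_grad]. *)
Definition grad n (f : K^^n -> K) x : K^^n := xget 0 [set G | sdiff f x G].

Lemma gradP n (f : K^^n -> K) x G : sdiff f x G -> grad f x = G.
Proof.
move=> H; rewrite /grad; case: xgetP => [y -> /= yP|/(_ G)//].
exact: sdiff_unique yP H.
Qed.

Lemma Df_grad P n (f : K^^n -> K) : Df S P f -> Df S P (grad f).
Proof.
move=> Dff; have DS := D_sdiff Dff.
have : D S P (fun p : K^^n * K^^n =>
    sdiff f p.1 p.2 \/ (forall G, ~ sdiff f p.1 G) /\ forall i, p.2 0 i = 0).
  by ddef.
apply: D_ext => -[x G] /=; split=> [[/gradP->//|[N G0]]|->].
  apply/rowP => i; rewrite G0 /grad; case: xgetP => [y _ /N//|_]; by rewrite mxE.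
rewrite /grad; case: xgetP => [y -> ?|N]; first by left.
by right; split=> [G' /N//|i]; rewrite mxE.
Qed.

Lemma grad_gen P n (f : K^^n -> K) x : countable P -> gen P x -> Df S P f ->
  sdiff f x (grad f x).
Proof. by move=> cP gx Dff; have [G HG] := sdiff_gen cP gx Dff; rewrite (gradP HG). Qed.

Lemma near_gen P n (Q : K^^n -> Prop) x : countable P -> gen P x -> D S P Q -> Q x ->
  exists2 d : K, 0 < d & forall y, box x d y -> Q y.
Proof. by move=> cP gx DQ Qx; have [d d0 H] := gen_open cP gx DQ Qx; exists d. Qed.

Definition l1 n (x : K^^n) : K := \sum_i `|x 0 i|.

Lemma l1_ge0 n (x : K^^n) : 0 <= l1 x.
Proof. by apply: sumr_ge0. Qed.

Lemma le_l1 n (x : K^^n) i : `|x 0 i| <= l1 x.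
Proof. by rewrite /l1 (bigD1 i) //= lerDl; apply: sumr_ge0. Qed.

Lemma l1D n (x y : K^^n) : l1 (x + y) <= l1 x + l1 y.
Proof. by rewrite /l1 -big_split /=; apply: ler_sum => i _; rewrite mxE ler_normD. Qed.

Lemma l1_ins n (i : 'I_n.+1) t v : l1 (ins i t v) = `|t| + l1 v.
Proof.
rewrite /l1 (bigD1_ord i) //= insE; congr (_ + _).
by apply: eq_bigr => j _; rewrite ins_lift.
Qed.

Lemma insB n (i : 'I_n.+1) (t u : K) v w : ins i t v - ins i u w = ins i (t - u) (v - w).
Proof.
by apply/rowP => j; rewrite !mxE; case: (unlift i j) => [k|]; rewrite ?mxE.
Qed.

Definition dot n (G x : K^^n) : K := \sum_i G 0 i * x 0 i.

Lemma dot_le n (G x : K^^n) : `|dot G x| <= l1 G * l1 x.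
Proof.
rewrite /dot; apply: le_trans (ler_norm_sum _ _ _) _.
rewrite [X in _ <= _ * X]/l1 mulr_sumr; apply: ler_sum => i _.
by rewrite normrM ler_wpM2r // le_l1.
Qed.

Lemma dotBr n (G x y : K^^n) : dot G (x - y) = dot G x - dot G y.
Proof. by rewrite /dot -sumrB; apply: eq_bigr => i _; rewrite !mxE mulrBr. Qed.

Lemma sdiffE n (f : K^^n -> K) x G : sdiff f x G <-> forall e : K, 0 < e ->
  exists2 d : K, 0 < d & forall y z, box x d y -> box x d z ->
    `|f y - f z - dot G (y - z)| <= e * l1 (y - z).
Proof.
have E y z : dot G (y - z) = \sum_i G 0 i * (y 0 i - z 0 i).
  by apply: eq_bigr => i _; rewrite !mxE.
have E' (y z : K^^n) : l1 (y - z) = \sum_i `|y 0 i - z 0 i|.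
  by apply: eq_bigr => i _; rewrite !mxE.
by split=> H e /H[d d0 Hd]; exists d => // y z yx zx; have := Hd y z yx zx; rewrite E E'.
Qed.

Lemma box_le n (x y : K^^n) d d' : d <= d' -> box x d y -> box x d' y.
Proof. by move=> dd xy i; apply: lt_le_trans (xy i) dd. Qed.

Lemma box_refl n (x : K^^n) d : 0 < d -> box x d x.
Proof. by move=> d0 i; rewrite subrr normr0. Qed.

Lemma box_l1 n (x y : K^^n) d : l1 (y - x) < d -> box x d y.
Proof. by move=> yx i; apply: le_lt_trans yx; have := le_l1 (y - x) i; rewrite !mxE. Qed.

Lemma l1_box n (x : K^^n) d : 0 < d -> exists2 e : K, 0 < e &
  forall y, box x e y -> l1 (y - x) < d.
Proof.
move=> d0; exists (d / n.+1%:R); first by rewrite divr_gt0.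
move=> y xy; rewrite /l1; apply: (@le_lt_trans _ _ (\sum_(i < n) d / n.+1%:R)).
  by apply: ler_sum => i _; rewrite !mxE; apply/ltW/xy.
by rewrite sumr_const card_ord -[X in X < _]mulr_natr mulrAC ltr_pdivrMr ?ltr0n // ltr_pM2l // ltr_nat.
Qed.

Lemma sdiff_lip n (f : K^^n -> K) x G (e : K) : sdiff f x G -> 0 < e ->
  exists2 d : K, 0 < d & forall y z, box x d y -> box x d z ->
    `|f y - f z| <= (l1 G + e) * l1 (y - z).
Proof.
move=> /sdiffE H e0; have [d d0 Hd] := H e e0; exists d => // y z xy xz.
rewrite -(subrK (dot G (y - z)) (f y - f z)) mulrDl addrC.
by apply: le_trans (ler_normD _ _) _; apply: lerD; [exact: dot_le|exact: Hd].
Qed.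

Lemma sdiff_local n (f g : K^^n -> K) x G (d : K) : 0 < d ->
  (forall y, box x d y -> f y = g y) -> sdiff f x G -> sdiff g x G.
Proof.
move=> d0 fg H e /H[d' d'0 Hd']; have [r [r0 rd rd']] := min2 d0 d'0.
exists r => // y z xy xz; rewrite -!fg; [apply: Hd'| |]; exact: box_le (xy) || exact: box_le (xz).
Qed.

Lemma sdiff_coord n (x : K^^n) i : sdiff (fun y => y 0 i) x (delta_mx 0 i).
Proof.
apply/sdiffE => e e0; exists 1 => // y z _ _; rewrite /dot (bigD1 i) //= big1 => [|j ji].
  by rewrite !mxE !eqxx mul1r addr0 subrr normr0 mulr_ge0 ?l1_ge0 // ltW.
by rewrite !mxE eqxx (negbTE ji) mul0r.
Qed.

Lemma sdiff_cst n (x : K^^n) c : sdiff (fun=> c) x 0.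
Proof.
apply/sdiffE => e e0; exists 1 => // y z _ _; rewrite /dot big1 => [|j _]; last by rewrite mxE mul0r.
by rewrite !subrr normr0 mulr_ge0 ?l1_ge0 // ltW.
Qed.

Lemma chain n k (phi : K^^n -> K^^k) (J : 'M[K]_(n, k)) (F : K^^k -> K) x G :
  (forall l, sdiff (fun y => phi y 0 l) x (\row_j J j l)) -> sdiff F (phi x) G ->
  sdiff (fun y => F (phi y)) x (G *m J^T).
Proof.
move=> Hphi HF; set B := \sum_l (l1 (\row_j J j l) + 1).
have B0 : 0 <= B by apply: sumr_ge0 => l _; rewrite addr_ge0 ?l1_ge0.
have /choice[d1 Hd1] l : exists d : K, 0 < d /\ forall y z, box x d y -> box x d z ->
    `|phi y 0 l - phi z 0 l| <= (l1 (\row_j J j l) + 1) * l1 (y - z).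
  by have [d d0 H] := sdiff_lip (Hphi l) ltr01; exists d.
have [r1 r10 Hr1] := min_all (fun l => (Hd1 l).1).
have lipphi y z : box x r1 y -> box x r1 z -> l1 (phi y - phi z) <= B * l1 (y - z).
  move=> xy xz; rewrite /B [X in X <= _]/l1 mulr_suml; apply: ler_sum => l _; rewrite !mxE.
  by apply: (Hd1 l).2; apply: box_le (Hr1 l) _.
(* [B] is the factor of the error of [F], [l1 G] that of the error of [phi], and the summand 1 makes
   the divisor positive. *)
apply/sdiffE => e e0; set C := B + l1 G + 1.
have C0 : 0 < C by rewrite /C; have := l1_ge0 G; lra.
have e'0 : 0 < e / C by rewrite divr_gt0.
have [d2 d20 Hd2] := (sdiffE _ _ _).1 HF _ e'0.
have /choice[d3 Hd3] l : exists d : K, 0 < d /\ forall y z, box x d y -> box x d z ->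
    `|phi y 0 l - phi z 0 l - dot (\row_j J j l) (y - z)| <= e / C * l1 (y - z).
  by have [d d0 H] := (sdiffE _ _ _).1 (Hphi l) _ e'0; exists d.
have [r3 r30 Hr3] := min_all (fun l => (Hd3 l).1).
have [|r4 r40 Hr4] := @l1_box n x (d2 / (B + 1)); first by rewrite divr_gt0 //; lra.
have [r5 [r50 r51 r53]] := min2 r10 r30; have [r [r0 rr5 rr4]] := min2 r50 r40.
exists r => // y z xy xz.
have inbox w : box x r w -> box (phi x) d2 (phi w).
  move=> xw; apply: box_l1; apply: (@le_lt_trans _ _ (B * l1 (w - x))).
    by apply: lipphi; [apply: box_le xw; lra|exact: box_refl].
  apply: (@le_lt_trans _ _ ((B + 1) * l1 (w - x))); first by rewrite ler_wpM2r ?l1_ge0 //; lra.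
  by rewrite mulrC -ltr_pdivlMr; [apply: Hr4; apply: box_le xw|lra].
have -> : dot (G *m J^T) (y - z) = \sum_l G 0 l * dot (\row_j J j l) (y - z).
  rewrite /dot; under eq_bigr do rewrite mxE mulr_suml.
  rewrite exchange_big /=; apply: eq_bigr => l _; rewrite mulr_sumr; apply: eq_bigr => j _.
  by rewrite !mxE mulrA.
set T := \sum_l _.
have -> : F (phi y) - F (phi z) - T = (F (phi y) - F (phi z) - dot G (phi y - phi z)) +
    (dot G (phi y - phi z) - T) by ring.
have -> : e * l1 (y - z) = e / C * (B * l1 (y - z)) + l1 G * (e / C * l1 (y - z)) + e / C * l1 (y - z).
  rewrite -[in LHS](divfK (lt0r_neq0 C0) e) {2}/C; ring.
apply: le_trans (ler_normD _ _) _; rewrite -[X in _ <= X]addrA; apply: lerD.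
  apply: le_trans (Hd2 _ _ (inbox _ xy) (inbox _ xz)) _.
  by rewrite ler_wpM2l ?(ltW e'0) //; apply: lipphi; [apply: box_le xy|apply: box_le xz]; lra.
apply: (@le_trans _ _ (l1 G * (e / C * l1 (y - z)))); last by rewrite lerDl mulr_ge0 ?l1_ge0 // ltW.
rewrite /T /dot -sumrB; apply: le_trans (ler_norm_sum _ _ _) _.
rewrite [X in _ <= X * _]/l1 mulr_suml; apply: ler_sum => l _.
rewrite -mulrBr normrM ler_wpM2l // !mxE; apply: (Hd3 l).2.
  by apply: box_le xy; apply: le_trans rr5 (le_trans r53 (Hr3 l)).
by apply: box_le xz; apply: le_trans rr5 (le_trans r53 (Hr3 l)).
Qed.

Arguments grad {n} f x.

(** * Decomposition into Lipschitz cells *)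

Lemma graph_fun P T U {eT : encodable K T} {eU : encodable K U} (R : T -> U -> Prop) :
  D S P (fun p : T * U => R p.1 p.2) ->
  (forall x, exists y, R x y) -> (forall x y z, R x y -> R x z -> y = z) ->
  exists2 g : T -> U, Df S P g & forall x, R x (g x).
Proof.
move=> DR /choice[g Hg] Ru; exists g => //.
by apply: D_ext DR => -[x y] /=; split=> [/Ru-/(_ _ (Hg x))|->].
Qed.

(** The function is 0 wherever the formula does not have exactly one solution, so that it is
    total. *)
Lemma acl_func P n (v : K^^n) y : acl (P <+ v) y ->
  exists2 a : K^^n -> K, Df S P a & a v = y.
Proof.
move=> /acl_dcl/D_param_vec[R0 [DR0 E]].
pose R (w : K^^n) (z : K) := (R0 (z, w) /\ forall z', R0 (z', w) -> z' = z) \/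
  (z = 0 /\ ~ exists z', R0 (z', w) /\ forall z'', R0 (z'', w) -> z'' = z').
have [||w z z' [[R1 u1]|[-> N1]] [[R2 u2]|[-> N2]]|a Da Ha] := @graph_fun P _ _ _ _ R.
- by rewrite /R; ddef.
- move=> w; have [[z Hz]|N] := pselect (exists z', R0 (z', w) /\ forall z'', R0 (z'', w) -> z'' = z').
    by exists z; left.
  by exists 0; right.
- exact: u2.
- by case: N2; exists z.
- by case: N1; exists z'.
- by [].
exists a => //; case: (Ha v) => [[/E//]|[_ N]].
by case: N; exists y; split=> [|z /E//]; exact/E.
Qed.

Definition ptlip n (r : K) (b : K^^n -> K) x := exists2 d : K, 0 < d &
  forall y, box x d y -> `|b y - b x| <= r * l1 (y - x).

Lemma dot_max n (G x : K^^n) (M : K) : (forall j, `|G 0 j| <= M) -> `|dot G x| <= M * l1 x.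
Proof.
move=> GM; rewrite /dot; apply: le_trans (ler_norm_sum _ _ _) _.
rewrite mulr_sumr; apply: ler_sum => i _.
by rewrite normrM ler_wpM2r.
Qed.

Lemma sdiff_ptlip n (b : K^^n -> K) x G (M e : K) : sdiff b x G ->
  (forall j, `|G 0 j| <= M) -> 0 < e -> ptlip (M + e) b x.
Proof.
move=> /sdiffE H GM e0; have [d d0 Hd] := H e e0; exists d => // y xy.
rewrite -(subrK (dot G (y - x)) (b y - b x)) mulrDl addrC.
by apply: le_trans (ler_normD _ _) _; apply: lerD; [exact: dot_max|apply: Hd => //; exact: box_refl].
Qed.

Definition reg n (M : K) (X : set K^^n) (f : K^^n -> K) := forall x, X x ->
  sdiff f x (grad f x) /\ forall j, `|grad f x 0 j| <= M.

(* Open [M]-cells in which each step may single out any coordinate [i]. *)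
Fixpoint PC P (M : K) n : set K^^n -> Prop :=
  match n with
  | 0 => fun C => C = setT
  | n'.+1 => fun C => exists i X f g,
      [/\ PC P M X, Df S P f /\ Df S P g, reg M X f /\ reg M X g,
        forall x, X x -> f x < g x &
        C = [set z : K^^n'.+1 | X (col' i z) /\ f (col' i z) < z 0 i < g (col' i z)]]
  end.

Lemma PC_D P M n (C : set K^^n) : PC P M C -> D S P C.
Proof.
elim: n C => [|n IH] C /=; first by move=> ->; exact: D_True.
move=> [i [X [f [g [/IH DX [Df1 Dg1] _ _ ->]]]]].
have H : D S P (fun z => X (col' i z) /\ f (col' i z) < z 0 i < g (col' i z)) by ddef.
exact: H.
Qed.

Lemma PC_monoM P M M' n (C : set K^^n) : M <= M' -> PC P M C -> PC P M' C.
Proof.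
move=> MM'; elim: n C => //= n IH C [i [X [f [g [HX Dfg [rf rg] fg ->]]]]].
exists i, X, f, g; split=> //; first exact: IH.
by split=> x Xx; [have [? H] := rf x Xx|have [? H] := rg x Xx]; split=> // j;
  apply: le_trans (H j) _.
Qed.

Lemma PC_mono P P' M n (C : set K^^n) : P `<=` P' -> PC P M C -> PC P' M C.
Proof.
move=> PP'; elim: n C => //= n IH C [i [X [f [g [HX [Df1 Dg1] rfg fg ->]]]]].
exists i, X, f, g; split=> //; first exact: IH.
by split; apply: Df_mono PP' _.
Qed.

Lemma sdiff_cont n (b : K^^n -> K) x G (e : K) : sdiff b x G -> 0 < e ->
  exists2 d : K, 0 < d & forall y, box x d y -> `|b y - b x| < e.
Proof.
move=> /sdiff_lip-/(_ _ ltr01)[d d0 Hd] e0.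
have C0 : 0 < l1 G + 1 + 1 by have := l1_ge0 G; lra.
have [|r r0 Hr] := @l1_box n x (e / (l1 G + 1 + 1)); first by rewrite divr_gt0.
have [q [q0 qd qr]] := min2 d0 r0; exists q => // y xy.
apply: le_lt_trans (Hd y x (box_le qd xy) (box_refl _ d0)) _.
apply: (@le_lt_trans _ _ ((l1 G + 1 + 1) * l1 (y - x))); first by rewrite ler_wpM2r ?l1_ge0 //; lra.
by rewrite mulrC -ltr_pdivlMr //; apply: Hr; exact: box_le xy.
Qed.

Lemma PC_open P M n (C : set K^^n) x : PC P M C -> C x ->
  exists2 d : K, 0 < d & forall y, box x d y -> C y.
Proof.
elim: n C x => /= [C x -> _|n IH C x]; first by exists 1.
move=> [i [X [f [g [HX _ [rf rg] _ ->]]]]] /= [Xx /andP[fx gx]].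
have [d d0 Hd] := IH X _ HX Xx.
have [|d1 d10 H1] := sdiff_cont (rf _ Xx).1 (_ : 0 < (x 0 i - f (col' i x)) / 2%:R).
  by rewrite divr_gt0 ?subr_gt0.
have [|d2 d20 H2] := sdiff_cont (rg _ Xx).1 (_ : 0 < (g (col' i x) - x 0 i) / 2%:R).
  by rewrite divr_gt0 ?subr_gt0.
have [d3 [d30 d31 d32]] := min2 d10 d20; have [d4 [d40 d43 d4d]] := min2 d30 d0.
have [||d5 [d50 d5f d5g]] := min2 (_ : 0 < (x 0 i - f (col' i x)) / 2%:R) (_ : 0 < (g (col' i x) - x 0 i) / 2%:R);
  try by rewrite divr_gt0 ?subr_gt0.
have [r [r0 r4 r5]] := min2 d40 d50; exists r => // y xy.
have xy' : box (col' i x) r (col' i y) by move=> j; rewrite !mxE; exact: xy.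
split; first by apply: Hd; apply: box_le xy'; lra.
have := H1 _ (box_le (_ : r <= d1) xy'); have := H2 _ (box_le (_ : r <= d2) xy').
move=> /(_ ltac:(lra)) + /(_ ltac:(lra)); have := xy i; rewrite !ltr_norml; lra.
Qed.

(** The quasiconvexity constant. In the next lemma the path over [X] costs [N + 2] times the
    constant of [X], the vertical segment costs [N + 1] times this constant for the change of
    height, and 1 for the difference of the last coordinates. *)
Fixpoint kap (N n : nat) : nat := if n is n'.+1 then (kap N n' * (2 * N + 3)).+1 else 0%N.

(* Two points of a cell over [X] are joined by a path over [X] at constant
   relative height between the two boundary functions, followed by a vertical
   segment. *)
Lemma quasiconvex (N n : nat) P (C : set K^^n) b (r : K) : PC P N%:R C -> Df S P b -> 0 <= r ->
  (forall x, C x -> ptlip r b x) ->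
  forall x y, C x -> C y -> `|b y - b x| <= (kap N n)%:R * r * l1 (y - x).
Proof.
elim: n P C b r => [|n IH] P C b r.
  move=> _ _ _ _ x y _ _; rewrite (_ : y = x) ?subrr ?normr0; last by apply/rowP => -[].
  by rewrite !mul0r.
move=> /= [i [X [f [g [HX [Df1 Dg1] [rf rg] fg ->]]]]] Db r0 Hb x y [Xx fgx] [Xy fgy].
set v := col' i x in Xx fgx *; set w := col' i y in Xy fgy *.
set M := N%:R : K; have M0 : 0 <= M by rewrite ler0n.
have [fx gx] := andP fgx; have [fy gy] := andP fgy.
have fgv : 0 < g v - f v by rewrite subr_gt0 fg.
set lam := (x 0 i - f v) / (g v - f v).
have lamE : lam * (g v - f v) = x 0 i - f v by rewrite divfK // gt_eqF.
have lam0 : 0 < lam by rewrite divr_gt0 // subr_gt0.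
have lam1 : lam < 1 by rewrite ltr_pdivrMr // mul1r; lra.
pose h u := f u + lam * (g u - f u).
pose P' := P `|` [set lam].
have PP' : P `<=` P' by exact: subsetUl.
have Df' := Df_mono PP' Df1; have Dg' := Df_mono PP' Dg1; have Db' := Df_mono PP' Db.
have Dh : Df S P' h by rewrite /h; ddef.
have hX u : X u -> f u < h u < g u.
  move=> /fg; rewrite -subr_gt0 => fgu; rewrite /h.
  have : 0 < lam * (g u - f u) by rewrite mulr_gt0.
  have : lam * (g u - f u) < 1 * (g u - f u) by rewrite ltr_pM2r.
  lra.
have hlip u : X u -> ptlip (M + 1) h u.
  move=> Xu; have [d1 d10 H1] := sdiff_ptlip (rf u Xu).1 (rf u Xu).2 ltr01.
  have [d2 d20 H2] := sdiff_ptlip (rg u Xu).1 (rg u Xu).2 ltr01.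
  have [d [d0 dd1 dd2]] := min2 d10 d20; exists d => // z uz.
  have := H1 z (box_le dd1 uz); have := H2 z (box_le dd2 uz); rewrite -/M.
  set T := (M + 1) * _; rewrite /h => A B.
  have -> : f z + lam * (g z - f z) - (f u + lam * (g u - f u)) =
    (1 - lam) * (f z - f u) + lam * (g z - g u) by ring.
  have n1 : `|(1 - lam) * (f z - f u)| = (1 - lam) * `|f z - f u|.
    by rewrite normrM gtr0_norm // subr_gt0.
  have n2 : `|lam * (g z - g u)| = lam * `|g z - g u| by rewrite normrM gtr0_norm.
  apply: le_trans (ler_normD _ _) _; rewrite n1 n2.
  have : (1 - lam) * `|f z - f u| <= (1 - lam) * T by rewrite ler_pM2l // subr_gt0.
  have : lam * `|g z - g u| <= lam * T by rewrite ler_pM2l.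
  lra.
pose B u := b (ins i (h u) u).
have DB : Df S P' B.
  by rewrite /B; apply: (Df_comp Db'); apply: Df_ins => //; exact: Df_id.
have Blip u : X u -> ptlip (r * (M + 2%:R)) B u.
  move=> Xu; have [d1 d10 H1] := hlip u Xu.
  have [|d2 d20 H2] := Hb (ins i (h u) u).
    by rewrite /= col'_ins insE; split=> //; exact: hX.
  have M20 : 0 < M + 2%:R by lra.
  have [|d3 d30 H3] := @l1_box n u (d2 / (M + 2%:R)); first by rewrite divr_gt0.
  have [d [d0 dd1 dd3]] := min2 d10 d30; exists d => // z uz.
  have A := H1 z (box_le dd1 uz).
  have E : l1 (ins i (h z) z - ins i (h u) u) <= (M + 2%:R) * l1 (z - u).
    by rewrite insB l1_ins; lra.
  apply: le_trans (H2 _ _) _.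
    apply: box_l1; apply: le_lt_trans E _; rewrite mulrC -ltr_pdivlMr //.
    by apply: H3; exact: box_le uz.
  by rewrite -mulrA ler_wpM2l.
set k := (kap N n)%:R : K; have k0 : 0 <= k by rewrite ler0n.
have M1 : 0 <= M + 1 by lra.
have hxy := IH P' X h (M + 1) (PC_mono PP' HX) Dh M1 hlip v w Xx Xy.
have Bxy := IH P' X B (r * (M + 2%:R)) (PC_mono PP' HX) DB _ Blip v w Xx Xy.
have {}Bxy := Bxy (mulr_ge0 r0 (_ : 0 <= M + 2%:R)).
have hv : h v = x 0 i by rewrite /h lamE; lra.
have Ex : x = ins i (h v) v by rewrite hv ins_col'.
have Ey : y = ins i (y 0 i) w by rewrite ins_col'.
have Dv : Df S (P <+ w) (fun t => b (ins i t w)).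
  apply: (@D_inst_vec P n w (K * K)%type _
    (fun p : K * K * K^^n => p.1.2 = b (ins i p.1.1 p.2))).
  by apply: D_eqT; [ddef|apply: (Df_comp Db); apply: Df_ins; ddef].
have vert : `|b (ins i (y 0 i) w) - b (ins i (h w) w)| <= r * `|y 0 i - h w|.
  apply: (lip1 Dv (a := f w) (b := g w)) => //; last exact: hX.
  move=> t tw; have [|d d0 Hd] := Hb (ins i t w); first by rewrite /= col'_ins insE.
  exists d => // u tu; have := Hd (ins i u w); rewrite insB subrr l1_ins.
  rewrite (_ : l1 0 = 0) ?addr0; last by rewrite /l1 big1 // => j _; rewrite mxE normr0.
  apply=> j; case: (unliftP i j) => [j' ->|->]; rewrite ?ins_lift ?insE //.
  by rewrite subrr normr0.
have l1E : l1 (y - x) = `|y 0 i - x 0 i| + l1 (w - v).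
  by rewrite {1}Ex {1}Ey insB l1_ins hv.
set l := l1 (w - v) in l1E Bxy hxy; have l0 : 0 <= l by exact: l1_ge0.
have -> : (kap N n.+1)%:R = k * (2%:R * M + 3%:R) + 1 :> K.
  by rewrite /= -addn1 natrD natrM natrD natrM.
have tri : `|b y - b x| <= `|B w - B v| + r * `|y 0 i - h w|.
  rewrite {1}Ey {1}Ex -/(B v) -[b _](subrK (B w)) -addrA addrC.
  by apply: le_trans (ler_normD _ _) _; rewrite lerD2l.
have tri2 : `|y 0 i - h w| <= `|y 0 i - x 0 i| + `|h w - h v|.
  rewrite hv -[h w - _]opprB -{1}(subrK (x 0 i) (y 0 i)) -addrA.
  by apply: le_trans (ler_normD _ _) _; rewrite normrN.
have : r * `|y 0 i - h w| <= r * (`|y 0 i - x 0 i| + k * (M + 1) * l).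
  by rewrite ler_wpM2l //; lra.
rewrite l1E; set d := `|y 0 i - x 0 i|; have d0 : 0 <= d by exact: normr_ge0.
have : 0 <= r * (k * (2%:R * M + 3%:R) * d) by rewrite !mulr_ge0 //; lra.
have : k * (r * (M + 2%:R)) * l = r * k * M * l + 2%:R * (r * k * l) by ring.
have : r * (d + k * (M + 1) * l) = r * d + r * k * M * l + r * k * l by ring.
have : (k * (2%:R * M + 3%:R) + 1) * r * (d + l) = r * (k * (2%:R * M + 3%:R) * d) + r * d +
   2%:R * (r * k * M * l) + 3%:R * (r * k * l) + r * l by ring.
have : 0 <= r * l by rewrite mulr_ge0.
lra.
Qed.

(* McShane's extension. *)
Lemma extension P n (C : set K^^n) (a : K^^n -> K) (c : K^^n) (t : K) x0 :
  D S P C -> Df S P a -> (forall j, D S P (fun y => y = c 0 j)) -> D S P (fun y => y = t) ->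
  0 <= t -> C x0 ->
  (forall x y, C x -> C y -> `|a x - a y - dot c (x - y)| <= t * l1 (x - y)) ->
  exists2 a' : K^^n -> K, Df S P a' & (forall x, C x -> a' x = a x) /\
    forall x y, `|a' x - a' y - dot c (x - y)| <= t * l1 (x - y).
Proof.
move=> DC Da Dc Dt t0 Cx0 aC.
have Dcst (T : Type) (eT : encodable K T) (z : K) : D S P (fun y => y = z) -> Df S P (fun _ : T => z).
  by move=> Dz; rewrite /Df; ddef.
have Ddot : Df S P (fun x => dot c x).
  rewrite /dot; apply: Df_sum => j; apply: Df_mul; last by ddef.
  exact: Dcst.
have Dl1 : Df S P (fun x : K^^n => l1 x) by rewrite /l1; ddef.
(* Without its linear part the function is Lipschitz with constant [t]. The extension by infima is
   applied to the difference, so that the extended function deviates from slope [c] by no more than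
   before. *)
pose b x := a x - dot c x.
have bC x y : C x -> C y -> b x - b y <= t * l1 (x - y).
  by move=> Cx Cy; have := aC x y Cx Cy; rewrite dotBr /b ler_norml; lra.
have l1C (x y : K^^n) : l1 (x - y) = l1 (y - x).
  by rewrite /l1; apply: eq_bigr => j _; rewrite !mxE distrC.
have l1T (x y z : K^^n) : l1 (x - z) <= l1 (x - y) + l1 (y - z).
  by have := l1D (x - y) (y - z); rewrite addrA subrK.
have ler_t (x y : K) : x <= y -> t * x <= t * y by move=> ?; rewrite ler_wpM2l.
pose R (x : K^^n) (m : K) := (forall y, C y -> m <= b y + t * l1 (x - y)) /\
  forall m', (forall y, C y -> m' <= b y + t * l1 (x - y)) -> m' <= m.
have Dtt (T : Type) (eT : encodable K T) : Df S P (fun _ : T => t) by exact: Dcst.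
have DR : D S P (fun p : K^^n * K => R p.1 p.2).
  rewrite /R; apply: D_and; do ?[apply: D_all|apply: D_imp]; ddef; exact: Dtt.
have [x|x y z [y1 y2] [z1 z2]|b' Db' Hb'] := graph_fun DR.
- pose Q (s : K) := forall y, C y -> s <= b y + t * l1 (x - y).
  have DQ : D S (P <+ x) Q.
    apply: (@D_inst_vec P n x K _ (fun p : K * K^^n => forall y, C y -> p.1 <= b y + t * l1 (p.2 - y))).
    by ddef; exact: Dtt.
  have [||m [m1 m2]] := def_sup DQ (x := b x0 - t * l1 (x - x0)) (b := b x0 + t * l1 (x - x0)).
  + move=> y Cy; have := bC x0 y Cx0 Cy.
    by have := ler_t _ _ (l1T x0 x y); rewrite (l1C x0 x) mulrDr; lra.
  + by move=> s /(_ x0 Cx0).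
  exists m; split=> [y Cy|m' Hm']; last exact: m1.
  by apply: m2 => s; apply.
- by apply/eqP; rewrite eq_le z2 ?y2.
exists (fun x => b' x + dot c x); first by ddef.
split=> [x Cx|].
  suff -> : b' x = b x by rewrite /b subrK.
  have [h1 h2] := Hb' x; apply/eqP; rewrite eq_le.
  have := h1 x Cx; rewrite subrr (_ : l1 0 = 0); last by rewrite /l1 big1 // => j _; rewrite mxE normr0.
  by rewrite mulr0 addr0 => -> /=; apply: h2 => y Cy; have := bC x y Cx Cy; lra.
have half x y : b' x - b' y <= t * l1 (x - y).
  have : b' x - t * l1 (x - y) <= b' y; last by lra.
  apply: (Hb' y).2 => z Cz; have := (Hb' x).1 z Cz.
  by have := ler_t _ _ (l1T x y z); rewrite mulrDr; lra.
move=> x y; rewrite dotBr ler_norml; have := half x y; have := half y x.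
by rewrite (l1C y x); lra.
Qed.

(** * Weights that separate slopes *)

Definition wexp (N i k : nat) : nat := (k * N ^ i)%N.
Definition wmax (N : nat) : nat := (N * N ^ N)%N.
(** The weight of direction [i] and class [k] is 2 to the power [k * N ^ i]. The exponents are
    digits placed in base [N], so an equality between sums of exponents of two directions determines
    the digits ([wexp_inj]). *)
Definition W (N i k : nat) : K := 2%:R ^+ wexp N i k.
(** Different ratios of weights differ by at least [2 ^- (2 * wmax N)], which is 8 times the gap.
    The factor 8 pays for the distance to two ratios in [pick_class], for rounding slopes and for
    nonlinearity. *)
Definition gap (N : nat) : K := 2%:R ^- (2 * wmax N + 3).

Lemma wexp_le N i k : (i < N)%N -> (k < N)%N -> (wexp N i k <= wmax N)%N.
Proof.
move=> iN kN; rewrite leq_mul //; first exact: ltnW.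
by rewrite leq_pexp2l ?(ltnW iN) //; case: (N) iN.
Qed.

(** After division by the smaller power of [N] the equation is reduced modulo [N]. This gives either
    [k = k'] at once or [l = l'], and then [k = k'] by cancellation. *)
Lemma wexp_inj N i j k k' l l' : (0 < N)%N -> i != j -> (k < N)%N -> (k' < N)%N ->
  (l < N)%N -> (l' < N)%N -> (wexp N j l + wexp N i k' = wexp N j l' + wexp N i k)%N -> k = k'.
Proof.
rewrite /wexp => N0 ij kN k'N lN l'N.
have cancelN m (a b : nat) : (a * N ^ m = b * N ^ m)%N -> a = b.
  by move/eqP; rewrite eqn_pmul2r ?expn_gt0 ?N0 // => /eqP.
have [ltij|ltji|eij] := ltngtP i j; last by rewrite eij eqxx in ij.
  rewrite -(subnK ltij) addnS -addSn expnD !mulnA -!mulnDl => /cancelN/(congr1 (modn^~ N)).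
  by rewrite expnSr !mulnA !modnMDl !modn_small.
rewrite -(subnK ltji) addnS -addSn expnD !mulnA -!mulnDl => /cancelN E.
have ll : l = l'.
  have := congr1 (modn^~ N) E.
  by rewrite expnSr !mulnA !(addnC _ (_ * N)%N) !modnMDl !modn_small.
by move: E; rewrite ll => /addnI/cancelN.
Qed.

Lemma W_gt0 N i k : 0 < W N i k.
Proof. by rewrite exprn_gt0. Qed.

Lemma W_ge1 N i k : 1 <= W N i k.
Proof. by rewrite exprn_ege1 // ler1n. Qed.

Lemma gap_gt0 N : 0 < gap N.
Proof. by rewrite invr_gt0 exprn_gt0. Qed.

Lemma gap_small N : gap N <= 8%:R^-1.
Proof.
rewrite lef_pV2 ?posrE // exprD.
have -> : (2%:R : K) ^+ 3 = 8%:R by rewrite -natrX.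
by rewrite ler_peMl // exprn_ege1 // ler1n.
Qed.

Lemma pow2_gap (a b : nat) : a != b -> 1 <= `|(2%:R : K) ^+ a - 2%:R ^+ b|.
Proof.
have key (c d : nat) : (c < d)%N -> 1 <= `|(2%:R : K) ^+ c - 2%:R ^+ d|.
  move=> cd; rewrite -!natrX distrC ger0_norm; last by rewrite subr_ge0 ler_nat leq_exp2l // ltnW.
  by rewrite -natrB ?leq_exp2l ?(ltnW cd) // ler1n subn_gt0 ltn_exp2l.
by rewrite neq_ltn => /orP[/key//|/key]; rewrite distrC.
Qed.

Lemma W_ratio_gap N i j k k' l l' : (i < N)%N -> (j < N)%N -> i != j -> k != k' ->
  (k < N)%N -> (k' < N)%N -> (l < N)%N -> (l' < N)%N ->
  8%:R * gap N <= `|W N j l / W N i k - W N j l' / W N i k'|.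
Proof.
move=> iN jN ij kk' kN k'N lN l'N; have N0 : (0 < N)%N by case: (N) iN.
have W0 i' k0 : W N i' k0 != 0 by rewrite gt_eqF // W_gt0.
have -> : W N j l / W N i k - W N j l' / W N i k' =
    (2%:R ^+ (wexp N j l + wexp N i k') - 2%:R ^+ (wexp N j l' + wexp N i k)) / (W N i k * W N i k').
  rewrite !exprD -/(W N j l) -/(W N i k') -/(W N j l') -/(W N i k); field.
  by rewrite !W0.
rewrite normrM normfV [`|W N i k * _|]gtr0_norm ?mulr_gt0 ?W_gt0 //.
have -> : 8%:R * gap N = 1 / 2%:R ^+ (2 * wmax N).
  rewrite /gap exprD (_ : 2%:R ^+ 3 = 8%:R :> K); last by rewrite -natrX.
  by field; rewrite ?expf_neq0 // pnatr_eq0.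
apply: ler_pM; rewrite ?ler01 ?invr_ge0 ?exprn_ge0 //.
  apply: pow2_gap; apply: contraNneq kk' => /(wexp_inj N0 ij kN k'N lN l'N) ->; exact: eqxx.
rewrite lef_pV2 ?posrE ?mulr_gt0 ?exprn_gt0 //.
rewrite -exprD ler_eXn2l ?ltr1n // mul2n -addnn.
by rewrite leq_add // wexp_le.
Qed.

(* Among the [N] classes of direction [i] each other direction spoils at most
   one, because the ratios of weights are separated. *)
Lemma pick_class N (i : 'I_N) (r : 'I_N -> K) : exists k : 'I_N, forall j l : 'I_N, j != i ->
  4%:R * gap N <= `|r j - W N j l / W N i k|.
Proof.
apply: contrapT => /forallNP H.
have /choice[J HJ] : forall k : 'I_N, exists j : 'I_N, j != i /\ exists l : 'I_N,
    `|r j - W N j l / W N i k| < 4%:R * gap N.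
  move=> k; have /existsNP[j /existsNP[l /not_implyP[ji /negP]]] := H k.
  by rewrite -ltNge => ?; exists j; split=> //; exists l.
have Jinj : injective J.
  move=> k k' JJ; apply: contrapT => /eqP kk'.
  have [ji [l Hl]] := HJ k; have [_ [l' Hl']] := HJ k'; rewrite -JJ in Hl'.
  have := @W_ratio_gap N i (J k) k k' l l' (ltn_ord _) (ltn_ord _).
  rewrite eq_sym => /(_ ji kk' (ltn_ord _) (ltn_ord _) (ltn_ord _) (ltn_ord _)).
  apply/negP; rewrite -ltNge.
  have -> : W N (J k) l / W N i k - W N (J k) l' / W N i k' =
    (r (J k) - W N (J k) l' / W N i k') - (r (J k) - W N (J k) l / W N i k) by ring.
  apply: le_lt_trans (ler_normB _ _) _; lra.
(* An injective map from the [N] classes to the [N] directions would hit [i], which [J] avoids. *)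
have [k Jk] : exists k, J k = i.
  by have := inj_card_onto Jinj (leqnn _) i; case/codomP => k ->; exists k.
by have [] := HJ k; rewrite Jk eqxx.
Qed.

Lemma nat_floor (y : K) (b : nat) : 0 <= y -> y < b%:R ->
  exists p : nat, (p < b)%N /\ p%:R <= y < p%:R + 1.
Proof.
elim: b => [|b IH] y0 yb; first by rewrite ltNge y0 in yb.
have [/IH[//|p [pb Hp]]|by_] := ltP y b%:R; first by exists p; split=> //; exact: ltnW.
by exists b; split=> //; rewrite by_ -natr1 in yb *.
Qed.

(** Rounding to a multiple of [1 / T] makes a slope definable without any new parameter. *)
Lemma grid (x : K) (T : nat) P : (0 < T)%N -> `|x| <= 1 ->
  exists2 c : K, D S P (fun y => y = c) & `|x - c| <= T%:R^-1 /\ `|c| <= 1.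
Proof.
move=> T0; rewrite ler_norml => /andP[x0 x1].
have T0' : 0 < T%:R :> K by rewrite ltr0n.
have y0 : 0 <= (x + 1) * T%:R by rewrite mulr_ge0; lra.
have y1 : (x + 1) * T%:R < (2 * T).+1%:R.
  by rewrite -natr1 natrM; apply: (@le_lt_trans _ _ (2%:R * T%:R)); [rewrite ler_pM2r|]; lra.
have [p [pT /andP[p1 p2]]] := nat_floor y0 y1.
have T0n : T%:R != 0 :> K by rewrite gt_eqF.
exists (p%:R / T%:R - 1).
  apply: D_eqT; first exact: Df_id.
  apply: Df_add; last by apply: Df_opp; exact: Df_1.
  by apply: Df_mul; [exact: Df_nat|apply: Df_inv; exact: Df_nat].
have pE : p%:R = p%:R / T%:R * T%:R :> K by rewrite divfK.
set c := p%:R / T%:R in pE *.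
have c0 : 0 <= c by rewrite divr_ge0.
have cx : c <= x + 1 by rewrite -(ler_pM2r T0') -pE.
have xc : x + 1 < c + T%:R^-1 by rewrite -(ltr_pM2r T0') [X in _ < X]mulrDl mulVf // -pE.
split; rewrite ler_norml; lra.
Qed.

Lemma l1_col' n (i : 'I_n.+1) (x : K^^n.+1) : l1 (col' i x) <= l1 x.
Proof.
rewrite /l1 [X in _ <= X](bigD1_ord i) //=.
by under eq_bigr do rewrite !mxE; rewrite lerDr.
Qed.

Lemma col'B n (i : 'I_n.+1) (x y : K^^n.+1) : col' i x - col' i y = col' i (x - y).
Proof. by apply/rowP => j; rewrite !mxE. Qed.

Lemma sdiff_col' n (i : 'I_n.+1) (a : K^^n -> K) (x : K^^n.+1) G :
  sdiff a (col' i x) G -> sdiff (fun y => a (col' i y)) x (ins i 0 G).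
Proof.
move=> /sdiffE H; apply/sdiffE => e e0; have [d d0 Hd] := H e e0; exists d => // y z xy xz.
have cb w : box x d w -> box (col' i x) d (col' i w) by move=> xw j; rewrite !mxE; exact: xw.
have -> : dot (ins i 0 G) (y - z) = dot G (col' i y - col' i z).
  rewrite /dot (bigD1_ord i) //= insE mul0r add0r; apply: eq_bigr => j _.
  by rewrite ins_lift !mxE.
apply: le_trans (Hd _ _ (cb _ xy) (cb _ xz)) _.
apply: ler_wpM2l; first exact: ltW.
by rewrite col'B; exact: l1_col'.
Qed.

Lemma sdiff_sub n (f g : K^^n -> K) x G H : sdiff f x G -> sdiff g x H ->
  sdiff (fun y => f y - g y) x (G - H).
Proof.
move=> /sdiffE sf /sdiffE sg; apply/sdiffE => e e0.
have e20 : 0 < e / 2%:R by rewrite divr_gt0.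
have [d1 d10 H1] := sf _ e20; have [d2 d20 H2] := sg _ e20.
have [d [d0 dd1 dd2]] := min2 d10 d20; exists d => // y z xy xz.
have -> : dot (G - H) (y - z) = dot G (y - z) - dot H (y - z).
  by rewrite /dot -sumrB; apply: eq_bigr => j _; rewrite !mxE mulrBl.
have := H1 y z (box_le dd1 xy) (box_le dd1 xz); have := H2 y z (box_le dd2 xy) (box_le dd2 xz).
set T := l1 _ => A B.
have -> : f y - g y - (f z - g z) - (dot G (y - z) - dot H (y - z)) =
  (f y - f z - dot G (y - z)) - (g y - g z - dot H (y - z)) by ring.
by apply: le_trans (ler_normB _ _) _; lra.
Qed.

Lemma dot_delta n (x : K^^n) i : dot (delta_mx 0 i) x = x 0 i.
Proof.
rewrite /dot (bigD1 i) //= big1 => [|j ji]; first by rewrite mxE !eqxx mul1r addr0.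
by rewrite mxE eqxx (negbTE ji) mul0r.
Qed.

Lemma sdiff_lin n (c x : K^^n) : sdiff (dot c) x c.
Proof.
apply/sdiffE => e e0; exists 1 => // y z _ _.
by rewrite dotBr subrr normr0 mulr_ge0 ?l1_ge0 // ltW.
Qed.

(* [u] is almost the linear function with coefficients [nu], and is the
   distance, in direction [i], to the graph of a Lipschitz function. *)
Definition surface P n (i k : 'I_n.+1) (nu : K^^n.+1) (u : K^^n.+1 -> K) :=
  [/\ Df S P u, nu 0 i = 1 /\ (forall j, `|nu 0 j| <= 2%:R),
    forall j l : 'I_n.+1, j != i -> 3%:R * gap n.+1 <= `| `|nu 0 j| - W n.+1 j l / W n.+1 i k|,
    forall x y, `|u x - u y - dot nu (x - y)| <= gap n.+1 / 4%:R * l1 (x - y) &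
    exists a, forall x, u x = x 0 i - a (col' i x)].

Lemma dot_ins0 n (nu : K^^n.+1) i t : dot nu (ins i t 0) = nu 0 i * t.
Proof.
rewrite /dot (bigD1_ord i) //= insE big1 ?addr0 // => j _.
by rewrite ins_lift mxE mulr0.
Qed.

Lemma l1_0 n : l1 (0 : K^^n) = 0.
Proof. by rewrite /l1 big1 // => j _; rewrite mxE normr0. Qed.

(* Decomposition into Lipschitz cells, up to points that are not generic. *)
Definition LD n N := forall P (U : set K^^n), countable P -> D S P U ->
  U `<=` unit_cube K n -> exists (I : finType) (C : I -> set K^^n),
  [/\ forall i, PC P N%:R (C i), forall i, C i `<=` U,
      forall i j x, C i x -> C j x -> i = j &
      forall x, U x -> gen P x -> exists i, C i x].

Lemma D_cube P n : D S P (unit_cube K n).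
Proof. by rewrite /unit_cube; have : D S P (fun x : K^^n => forall i, 0 <= x 0 i <= 1) by ddef. Qed.

(** Near [z] the coordinate [i] is a function [a] of the others. Only the part of its graph where
    the gradient is near that at [z] is kept, and the function on one Lipschitz cell of that part is
    extended to the whole space. The surface is therefore global although it describes the given set
    only on the cell. *)
Lemma local_surface n N P (z : K^^n.+1) : LD n N -> countable P -> unit_cube K n.+1 z ->
  ~ gen P z -> rk P (vals z) n ->
  exists i k nu u, surface P i k nu u /\ u z = 0.
Proof.
move=> HLD cP cz Nz rz.
have [i0 g0] : exists i0, gen P (col' i0 z).
  have /rk_coords[s sI gs] := rz.
  have [i0 Hi0] : exists i0, i0 \notin codom s.
    apply: contrapT => /forallNP H.
    have /choice[f Hf] : forall i, exists j, s j = i.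
      by move=> i; have /negP/negPn/codomP[j ->] := H i; exists j.
    have /leq_card : injective f by move=> i j fij; rewrite -(Hf i) -(Hf j) fij.
    by rewrite !card_ord ltnn.
  exists i0; apply: rk_gen.
  apply: rk_sub (gen_rk gs) => _ /valsP[j ->]; rewrite mxE.
  have : i0 != s j by apply: contraNneq Hi0 => ->; exact: codom_f.
  case/unlift_some => j' -> _; have := mem_vals (col' i0 z) j'; by rewrite mxE.
have [a0 Da0 a0z] : exists2 a : K^^n -> K, Df S P a & a (col' i0 z) = z 0 i0.
  apply: acl_func; apply: contrapT => N0; apply: Nz.
  exact/(gen_col' P i0).
set G0 := grad a0 (col' i0 z).
have s0 : sdiff a0 (col' i0 z) G0 by exact: (grad_gen cP g0 Da0).
pose F (x : K^^n.+1) := x 0 i0 - a0 (col' i0 x).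
have DF : Df S P F by rewrite /F; ddef.
have Fz : F z = 0 by rewrite /F a0z subrr.
set nu := delta_mx 0 i0 - ins i0 0 G0 : K^^n.+1.
have sF : sdiff F z nu by apply: sdiff_sub; [exact: sdiff_coord|exact: sdiff_col'].
have nu0 : nu 0 i0 = 1 by rewrite mxE [X in _ + X]mxE insE oppr0 addr0 mxE !eqxx.
clearbody nu.
(* Solving for the coordinate with the largest partial derivative makes all slopes of the solution
   at most 1; see [G1]. *)
pose i := [arg max_(j > i0) `|nu 0 j|]%O.
have [nui numax] : 1 <= `|nu 0 i| /\ forall j, `|nu 0 j| <= `|nu 0 i|.
  rewrite /i; case: arg_maxP => // j _ Hj; split=> [|l]; last exact: Hj.
  by apply: le_trans (Hj i0 isT); rewrite nu0 normr1.
have nui0 : 0 < `|nu 0 i| by lra.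
set v := col' i z.
have Dfib : D S (P <+ v) (fun t => F (ins i t v) = 0).
  apply: (@D_inst_vec P n v K _ (fun p : K * K^^n => F (ins i p.1 p.2) = 0)).
  by apply: D_eqT; [apply: (Df_comp DF); apply: Df_ins; ddef|exact: Df_0].
(* Otherwise [F] would vanish on an interval in direction [i], although its partial derivative in
   this direction is nonzero. *)
have az : acl (P <+ v) (z 0 i).
  apply: contrapT => Na.
  have [|d d0 Hd] := acl_nbhs Na Dfib; first by rewrite ins_col'.
  have /sdiffE sE := sF.
  have [|r r0 Hr] := sE (`|nu 0 i| / 2%:R); first by rewrite divr_gt0.
  have [q [q0 qd qr]] := min2 d0 r0.
  have yz : ins i (z 0 i + q / 2%:R) v - z = ins i (q / 2%:R) 0.
    apply/rowP => j; rewrite !mxE; case: (unliftP i j) => [j' ->|->]; rewrite ?liftK ?unlift_none.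
      by rewrite !mxE subrr.
    by rewrite addrC addKr.
  have := Hr (ins i (z 0 i + q / 2%:R) v) z; rewrite Hd; last first.
    by rewrite addrC addKr gtr0_norm; lra.
  rewrite Fz subrr sub0r normrN yz.
  rewrite dot_ins0 l1_ins l1_0.
  rewrite addr0 normrM => H; have {H} H := H^~ (box_refl _ r0).
  have qE : `|q / 2%:R| = q / 2%:R by rewrite gtr0_norm // divr_gt0.
  rewrite qE in H.
  have p0 : 0 < `|nu 0 i| * (q / 2%:R) by rewrite mulr_gt0 // divr_gt0.
  have : box z r (ins i (z 0 i + q / 2%:R) v).
    move=> j; case: (unliftP i j) => [j' ->|->].
      by rewrite ins_lift mxE subrr normr0.
    by rewrite insE addrC addKr gtr0_norm; lra.
  move=> /H {H} H; rewrite -[_ / _ * _]mulrAC in H; lra.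
have gv : gen P v.
  apply: rk_gen => //; apply: (rk_acl) rz => y /valsP[j ->].
  case: (unliftP i j) => [j' ->|->//]; apply: acl_mem; right.
  by have := mem_vals v j'; rewrite mxE.
have [a Da av] := acl_func az.
set G := grad a v.
have sG : sdiff a v G by exact: (grad_gen cP gv Da).
(* Implicit differentiation of [F (ins i (a w) w) = 0]: the entry [j] of [G] is, up to sign, a
   quotient of two entries of [nu] with the largest one as denominator. *)
have G1 j : `|G 0 j| <= 1.
  have [||d d0 Hd] := near_gen cP gv (Q := fun w => F (ins i (a w) w) = 0).
  - apply: D_eqT; last exact: Df_0.
    by apply: (Df_comp DF); apply: Df_ins => //; exact: Df_id.
  - by rewrite av ins_col'.
  pose J : 'M[K]_(n, n.+1) := \matrix_(j, l) if unlift i l is Some m then (delta_mx 0 m : K^^n) 0 j else G 0 j.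
  have sphi l : sdiff (fun w => ins i (a w) w 0 l) v (\row_j J j l).
    case: (unliftP i l) => [m ->|->].
      have E1 : (fun w : K^^n => ins i (a w) w 0 (lift i m)) = fun w => w 0 m.
        by apply/funext => w; rewrite ins_lift.
      have -> : \row_j J j (lift i m) = delta_mx 0 m by apply/rowP => j'; rewrite !mxE liftK mxE.
      exact: (eq_rect_r (fun f => sdiff f v (delta_mx 0 m)) (sdiff_coord v m) E1).
    have E1 : (fun w : K^^n => ins i (a w) w 0 i) = a by apply/funext => w; rewrite insE.
    have -> : \row_j J j i = G by apply/rowP => j'; rewrite !mxE unlift_none.
    exact: (eq_rect_r (fun f => sdiff f v G) sG E1).
  have sF' : sdiff F (ins i (a v) v) nu by rewrite av ins_col'.
  have /(sdiff_local d0 Hd) s1 := chain sphi sF'.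
  have := sdiff_unique s1 (sdiff_cst v 0) => /rowP/(_ j).
  rewrite !mxE (bigD1_ord i) //= (bigD1 j) //= big1 => [|m mj].
    rewrite !mxE unlift_none liftK mxE !eqxx addr0 mulr1 => /eqP; rewrite addr_eq0 => /eqP E.
    by rewrite -(ler_pM2l nui0) mulr1 -normrM E normrN; exact: numax.
  by rewrite !mxE liftK mxE eqxx eq_sym (negbTE mj) mulr0.
have [k Hk] := @pick_class n.+1 i (fun j => if unlift i j is Some m then `|G 0 m| else 0).
(* The grid must be finer than the gap, and twice its mesh, the deviation of the gradient from the
   rounded slopes, must be at most a quarter of the gap after multiplication by the quasiconvexity
   constant. *)
pose T := (2 * (kap N n).+1 * 4 * 2 ^ (2 * wmax n.+1 + 3))%N.
have T0 : (0 < T)%N by rewrite !muln_gt0 expn_gt0.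
have T0' : 0 < T%:R :> K by rewrite ltr0n.
have g0' := gap_gt0 n.+1; have gs := gap_small n.+1.
have tau : 2%:R * (kap N n)%:R * T%:R^-1 <= gap n.+1 / 4%:R.
  have -> : gap n.+1 / 4%:R = 2%:R * (kap N n).+1%:R * T%:R^-1.
    rewrite /gap !natrM natrX; field.
    by rewrite expf_neq0 ?pnatr_eq0 //= addrC natr1 pnatr_eq0.
  by rewrite ler_pM2r ?invr_gt0 // ler_pM2l // ler_nat.
have T1 : T%:R^-1 <= gap n.+1.
  have -> : gap n.+1 = (2 * (kap N n).+1 * 4)%:R * T%:R^-1.
    rewrite /gap !natrM natrX; field.
    by rewrite expf_neq0 ?pnatr_eq0 //= addrC natr1 pnatr_eq0.
  by rewrite ler_peMl ?invr_ge0 ?ler0n // ler1n.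
have /choice[c Hc] m : exists c : K, D S P (fun y => y = c) /\ `|G 0 m - c| <= T%:R^-1 /\ `|c| <= 1.
  by have [c Dc Hc] := grid P T0 (G1 m); exists c.
pose cv := \row_m c m : K^^n.
have Dcv j : D S P (fun y => y = cv 0 j).
  by rewrite mxE; exact: (Hc j).1.
have DG := Df_grad Da.
(* On [X0] the gradient of [a] is near the rounded slopes [cv]. On a Lipschitz cell inside [X0]
   quasiconvexity turns this pointwise bound into a Lipschitz bound for [a - dot cv], which the
   extension preserves. *)
pose X0 (w : K^^n) := unit_cube K n w /\ (sdiff a w (grad a w) /\ forall m, `|grad a w 0 m - cv 0 m| <= T%:R^-1).
have DX0 : D S P X0.
  apply: D_and; first exact: D_cube.
  apply: D_and.
    exact: (D_comp (Q := fun p => sdiff a p.1 p.2) (g := fun w => (w, grad a w)) (D_sdiff Da) (Df_pair (Df_id _ _) DG)).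
  apply: D_big => m; apply: D_le; last by apply: Df_inv; exact: Df_nat.
  apply: Df_norm; apply: Df_add; first by apply: Df_entry.
  by apply: Df_opp; rewrite /Df; have := Dcv m; move=> Dc0; ddef.
have X0v : X0 v.
  split; first by move=> j; rewrite mxE; exact: cz.
  by split=> // m; rewrite mxE; exact: (Hc m).2.1.
have [|I [C [PCC CX _ Ccov]]] := HLD P X0 cP DX0; first by move=> w [].
have [l Cv] := Ccov v X0v gv.
have [|||||||a' Da' [a'C a'lip]] := @extension P n (C l) a cv (gap n.+1 / 4%:R) v.
- exact: PC_D (PCC l).
- exact: Da.
- exact: Dcv.
- apply: D_eqT; first exact: Df_id.
  by apply: Df_mul; [apply: Df_inv; apply: Df_exp; exact: Df_nat|apply: Df_inv; exact: Df_nat].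
- by rewrite divr_ge0 // ltW.
- exact: Cv.
- move=> x y Cx Cy.
  have Dcst (T' : Type) (eT : encodable K T') m : Df S P (fun _ : T' => cv 0 m).
    by have Dc0 := Dcv m; rewrite /Df; ddef.
  have Db : Df S P (fun w => a w - dot cv w).
    apply: Df_add => //; apply: Df_opp; apply: Df_sum => m; apply: Df_mul; first exact: Dcst.
    by apply: Df_entry; exact: Df_id.
  have Hb w : C l w -> ptlip (T%:R^-1 + T%:R^-1) (fun w => a w - dot cv w) w.
    move=> /CX[_ [sw Hw]]; apply: (@sdiff_ptlip _ _ _ (grad a w - cv)); rewrite ?invr_gt0 //.
      by apply: sdiff_sub => //; exact: sdiff_lin.
    by move=> m; have := Hw m; rewrite !mxE.
  have := quasiconvex (PCC l) Db _ Hb Cy Cx; rewrite dotBr.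
  have -> : a x - dot cv x - (a y - dot cv y) = a x - a y - (dot cv x - dot cv y) by ring.
  move=> /(_ (addr_ge0 _ _)) H; apply: le_trans (H _ _) _; rewrite ?invr_ge0 ?ler0n //.
  by rewrite ler_wpM2r ?l1_ge0 //; apply: le_trans tau; rewrite -mulr2n -mulr_natl; lra.
exists i, k, (ins i 1 (- cv)), (fun x : K^^n.+1 => x 0 i - a' (col' i x)); split; last first.
  by rewrite a'C // av subrr.
have nuE m : ins i 1 (- cv) 0 (lift i m) = - c m by rewrite ins_lift !mxE.
split.
- by ddef.
- split; first exact: insE.
  move=> j; case: (unliftP i j) => [m ->|->]; last by rewrite insE normr1; lra.
  by rewrite nuE normrN; have := (Hc m).2.2; lra.
- move=> j l' ji; have := Hk j l' ji.
  case: (unliftP i j) => [m ->|ij]; last by rewrite ij eqxx in ji.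
  rewrite nuE normrN; have := (Hc m).2.1.
  set R := W _ _ _ / _ => A B.
  have : `| `|G 0 m| - `|c m| | <= `|G 0 m - c m| by exact: ler_dist_dist.
  have : `| `|G 0 m| - R| <= `| `|G 0 m| - `|c m| | + `| `|c m| - R|.
    by rewrite -{1}(subrK `|c m| `|G 0 m|) -addrA; exact: ler_normD.
  lra.
- move=> x y.
  have -> : x 0 i - a' (col' i x) - (y 0 i - a' (col' i y)) - dot (ins i 1 (- cv)) (x - y) =
     - (a' (col' i x) - a' (col' i y) - dot cv (col' i x - col' i y)).
    have -> : dot (ins i 1 (- cv)) (x - y) = x 0 i - y 0 i - dot cv (col' i x - col' i y).
      rewrite /dot (bigD1_ord i) //= insE mul1r !mxE; congr (_ + _).
      by rewrite -sumrN; apply: eq_bigr => j _; rewrite ins_lift !mxE mulNr.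
    ring.
  rewrite normrN; apply: le_trans (a'lip _ _) _.
  apply: ler_wpM2l; first by rewrite divr_ge0 // ltW.
  by rewrite col'B; exact: l1_col'.
- by exists a'.
Qed.

Lemma surface_cover n N P (Z : set K^^n.+1) : LD n N -> countable P -> D S P Z ->
  Z `<=` unit_cube K n.+1 -> (forall z, Z z -> ~ gen P z) ->
  exists r (s : 'I_r -> 'I_n.+1 * 'I_n.+1 * K^^n.+1 * (K^^n.+1 -> K)),
   (forall q, surface P (s q).1.1.1 (s q).1.1.2 (s q).1.2 (s q).2) /\
   forall z, Z z -> rk P (vals z) n -> exists q, (s q).2 z = 0.
Proof.
move=> HLD cP DZ Zc Zg.
have [||r [G [HG GZ]]] := @rk_compact_cover P n.+1 n Z [set Q : K^^n.+1 -> Prop |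
   exists s : 'I_n.+1 * 'I_n.+1 * K^^n.+1 * (K^^n.+1 -> K),
   surface P s.1.1.1 s.1.1.2 s.1.2 s.2 /\ Q = fun z => s.2 z = 0] cP DZ.
- move=> _ [s [[Du _ _ _ _] ->]]; apply: D_eqT => //; exact: Df_0.
- move=> z Zz rz; have [i [k [nu [u [Su uz]]]]] := local_surface HLD cP (Zc z Zz) (Zg z Zz) rz.
  by exists (fun z => u z = 0) => //; exists (i, k, nu, u).
have /choice[s Hs] := HG; exists r, s; split=> [q|z Zz rz]; first by case: (Hs q).
by have [q Gq] := GZ z Zz rz; exists q; move: Gq; rewrite (Hs q).2.
Qed.

(** * Bands bounded by Lipschitz functions *)

Section Band.
Variables (n : nat) (J : finType) (G : J -> K -> K^^n -> K) (fl : J -> bool) (B eta : K).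

Definition slope_inc (g : K -> K^^n -> K) := forall t t' v, t < t' -> eta * (t' - t) <= g t' v - g t v.

Definition slope_cond (g : K -> K^^n -> K) := [\/ forall t t' v, g t v = g t' v,
   slope_inc g | slope_inc (fun t v => - g t v)].

(** The flag [fl] marks the inequalities in which equality is allowed; it serves to break ties
    between surfaces at equal weighted distance. *)
Definition fiber (v : K^^n) (t : K) := forall q, 0 < G q t v \/ (G q t v = 0 /\ fl q).

Hypothesis eta0 : 0 < eta.
Hypothesis Gslope : forall q, slope_cond (G q).
Hypothesis Glip : forall q t v y, `|G q t v - G q t y| <= B * l1 (v - y).

Lemma fiber_ge0 v t q : fiber v t -> 0 <= G q t v.
Proof. by move=> /(_ q)[/ltW|[->]]. Qed.

Lemma fiber_convex v t1 t t2 : fiber v t1 -> fiber v t2 -> t1 < t -> t < t2 -> fiber v t.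
Proof.
move=> f1 f2 tt1 tt2 q; case: (Gslope q) => H.
- by have := f1 q; rewrite (H t1 t).
- left; have := H _ _ v tt1; have := fiber_ge0 q f1.
  have : 0 < eta * (t - t1) by rewrite mulr_gt0 // subr_gt0.
  lra.
- left; have := H _ _ v tt2; have := fiber_ge0 q f2.
  have : 0 < eta * (t2 - t) by rewrite mulr_gt0 // subr_gt0.
  lra.
Qed.

(** Starting from [s0] in the fibre over [y], a rise by [B / eta * l1 (v - y)] makes the increasing
    inequalities true over [v], while the decreasing ones hold below [t0]. If [m] were larger than
    the claimed bound, a point between would lie in the fibre below its lower bound [m]. *)
Lemma fiber_lo v y t0 s0 m : fiber v t0 -> (forall t, fiber v t -> m <= t) -> fiber y s0 ->
  m - B / eta * l1 (v - y) <= s0.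
Proof.
move=> f0 fm fy; rewrite leNgt; apply/negP => sm.
set t1 := s0 + B / eta * l1 (v - y).
have tm : t1 < m by rewrite /t1; lra.
have mt0 : m <= t0 by exact: fm.
suff : fiber v ((t1 + m) / 2%:R).
  by move/fm; lra.
have t1m : t1 < (t1 + m) / 2%:R by lra.
have Beta : eta * (B / eta * l1 (v - y)) = B * l1 (v - y).
  by rewrite mulrA [eta * _]mulrC divfK // gt_eqF.
move=> q; case: (Gslope q) => H.
- by have := f0 q; rewrite (H t0 ((t1 + m) / 2%:R)).
- left; have gy := fiber_ge0 q fy.
  have := H _ _ v t1m; have := Glip q s0 v y; rewrite ler_norml => /andP[gl _].
  have : 0 < eta * ((t1 + m) / 2%:R - t1) by rewrite mulr_gt0 // subr_gt0.
  have B0 : 0 <= B * l1 (v - y) by apply: le_trans (Glip q s0 v y).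
  have : G q s0 v + B * l1 (v - y) <= G q t1 v; last by lra.
  have [E|ls] := eqVneq (B * l1 (v - y)) 0.
    by rewrite /t1 -mulrAC E mul0r !addr0.
  have st : s0 < t1.
    rewrite /t1 ltrDl mulrAC divr_gt0 // lt_neqAle eq_sym ls B0 //.
  by have := H _ _ v st; rewrite /t1 addrC addKr Beta; lra.
- left; have := H _ _ v (_ : (t1 + m) / 2%:R < t0); have := fiber_ge0 q f0.
  have : 0 < eta * (t0 - (t1 + m) / 2%:R) by rewrite mulr_gt0 // subr_gt0; lra.
  by move=> + + /(_ ltac:(lra)); lra.
Qed.

End Band.

Lemma grad_bound n (f : K^^n -> K) x G (M d : K) : sdiff f x G -> 0 < d ->
  (forall y, box x d y -> `|f y - f x| <= M * l1 (y - x)) -> forall j, `|G 0 j| <= M.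
Proof.
move=> /sdiffE H d0 Hd j; rewrite leNgt; apply/negP => MG.
have [|r r0 Hr] := H ((`|G 0 j| - M) / 2%:R); first by rewrite divr_gt0 // subr_gt0.
have [q [q0 qd qr]] := min2 d0 r0.
set y := x + (q / 2%:R) *: delta_mx 0 j.
have q20 : 0 < q / 2%:R by rewrite divr_gt0.
have yx : y - x = (q / 2%:R) *: delta_mx 0 j by rewrite addrC addKr.
have ly : l1 (y - x) = q / 2%:R.
  rewrite yx /l1 (bigD1 j) //= big1 => [|l lj].
    by rewrite addr0 !mxE !eqxx mulr1 gtr0_norm.
  by rewrite !mxE eqxx (negbTE lj) mulr0 normr0.
have dy : dot G (y - x) = G 0 j * (q / 2%:R).
  rewrite yx /dot (bigD1 j) //= big1 => [|l lj].
    by rewrite addr0 !mxE !eqxx mulr1.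
  by rewrite !mxE eqxx (negbTE lj) !mulr0.
have by_ c : q <= c -> box x c y by move=> qc; apply: box_l1; rewrite ly; lra.
have := Hr y x (by_ r qr) (box_refl _ r0); have := Hd y (by_ d qd).
rewrite dy ly => A C.
have : `|G 0 j * (q / 2%:R)| <= `|f y - f x| + `|f y - f x - G 0 j * (q / 2%:R)|.
  rewrite -[X in `|X| <= _](subKr (f y - f x)).
  exact: ler_normB.
rewrite normrM [X in _ * X](gtr0_norm q20) => E.
have : 0 < (`|G 0 j| - M) / 2%:R * (q / 2%:R) by rewrite mulr_gt0 // divr_gt0 // subr_gt0.
have : (`|G 0 j| - M) / 2%:R * (q / 2%:R) = (`|G 0 j| * (q / 2%:R) - M * (q / 2%:R)) / 2%:R by ring.
lra.
Qed.

Lemma inf_fun P n (Q : K^^n -> K -> Prop) : D S P (fun p : K^^n * K => Q p.1 p.2) ->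
  (forall v t, Q v t -> 0 < t < 1) ->
  exists2 lo : K^^n -> K, Df S P lo & forall v t, Q v t ->
   (forall t', Q v t' -> lo v <= t') /\ forall s, lo v < s -> exists2 t', Q v t' & t' < s.
Proof.
move=> DQ Q01.
pose isinf v (m : K) := (forall t, Q v t -> m <= t) /\ forall m', (forall t, Q v t -> m' <= t) -> m' <= m.
pose R v (m : K) := ((exists t, Q v t) /\ isinf v m) \/ (m = 0 /\ ~ exists t, Q v t).
have DR : D S P (fun p : K^^n * K => R p.1 p.2) by rewrite /R /isinf; ddef.
have [v|v m m' [[Qv [i1 i2]]|[-> NQ]] [[Qv' [j1 j2]]|[-> NQ']]|lo Dlo Hlo] := graph_fun DR.
- have [[t Qt]|N] := pselect (exists t, Q v t); last by exists 0; right.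
  have Dlb : D S (P <+ v) (fun m => forall t, Q v t -> m <= t).
    apply: (@D_inst_vec P n v K _ (fun p : K * K^^n => forall t, Q p.2 t -> p.1 <= t)).
    by ddef.
  have [||m [m1 m2]] := def_sup Dlb (x := 0) (b := t).
  + by move=> s /Q01/andP[/ltW].
  + by move=> s; apply.
  exists m; left; split; first by exists t.
  by split=> [s Qs|m' Hm']; [apply: m2 => l; apply|apply: m1].
- by apply/eqP; rewrite eq_le j2 ?i2.
- by case: NQ'.
- by case: NQ.
- by [].
exists lo => // v t Qt; case: (Hlo v) => [[_ [i1 i2]]|[_ []]]; last by exists t.
split=> // s ls; apply: contrapT => N; move: ls; apply/negP; rewrite -leNgt; apply: i2 => t' Qt'.
by rewrite leNgt; apply/negP => ts; apply: N; exists t'.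
Qed.

Lemma band P n (J : finType) (G : J -> K -> K^^n -> K) fl (B eta : K) :
  0 < eta -> (forall q, slope_cond eta (G q)) ->
  (forall q t v y, `|G q t v - G q t y| <= B * l1 (v - y)) ->
  D S P (fun p : K^^n * K => fiber G fl p.1 p.2) ->
  (forall v t, fiber G fl v t -> 0 < t < 1) ->
  exists lo : K^^n -> K, [/\ Df S P lo, forall v t, fiber G fl v t -> lo v <= t,
    forall v t s, fiber G fl v t -> lo v < s -> exists2 t', fiber G fl v t' & t' < s &
    forall v y t s, fiber G fl v t -> fiber G fl y s -> `|lo v - lo y| <= B / eta * l1 (v - y)].
Proof.
move=> eta0 Gs Gl DF F01; have [lo Dlo Hlo] := inf_fun DF F01.
exists lo; split=> //; [by move=> v t Ft; have [H _] := Hlo v t Ft; exact: H|by move=> v t s Ft; exact: (Hlo v t Ft).2|].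
have half v y t s : fiber G fl v t -> fiber G fl y s -> lo v - B / eta * l1 (v - y) <= lo y.
  move=> fv fy; rewrite leNgt; apply/negP => /(Hlo _ _ fy).2[s' fs' ss'].
  have := fiber_lo eta0 Gs Gl fv (Hlo _ _ fv).1 fs'; lra.
move=> v y t s fv fy; rewrite ler_norml; have := half _ _ _ _ fv fy; have := half _ _ _ _ fy fv.
rewrite (_ : l1 (y - v) = l1 (v - y)); first lra.
by rewrite /l1; apply: eq_bigr => j _; rewrite !mxE distrC.
Qed.

Lemma LD0 N : LD 0 N.
Proof.
move=> P U cP DU _; have [U0|U0] := pselect (U 0).
  exists unit, (fun=> setT); split; [by []| |by move=> [] []|by move=> x _ _; exists tt].
  move=> _ x _.
  by rewrite (_ : x = 0) //; apply/rowP => -[].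
exists void, (fun=> setT); split; [by case|by case|by case|].
by move=> x Ux; case: U0; rewrite (_ : 0 = x) //; apply/rowP => -[].
Qed.

Lemma surface_slope P n i k (nu : K^^n.+1) u j (t t' : K) v : surface P i k nu u ->
  `|u (ins j t' v) - u (ins j t v) - nu 0 j * (t' - t)| <= gap n.+1 / 4%:R * `|t' - t|.
Proof.
move=> [_ _ _ H _]; have := H (ins j t' v) (ins j t v).
by rewrite insB subrr dot_ins0 l1_ins l1_0 addr0.
Qed.

Lemma surface_slope0 P n i k (nu : K^^n.+1) u (t t' : K) v : surface P i k nu u ->
  u (ins i t' v) - u (ins i t v) = t' - t.
Proof. by move=> [_ _ _ _ [a Ha]]; rewrite !Ha !insE !col'_ins opprB addrA subrK. Qed.

Lemma surface_lip P n i k (nu : K^^n.+1) u x y : surface P i k nu u ->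
  `|u x - u y| <= 3%:R * l1 (x - y).
Proof.
move=> [_ [_ nu2] _ H _]; have := H x y; have := dot_max (x - y) nu2.
have := gap_small n.+1; have := l1_ge0 (x - y); set l := l1 _ => l0 g8 A C.
rewrite -(subrK (dot nu (x - y)) (u x - u y)).
apply: le_trans (ler_normD _ _) _.
have : gap n.+1 / 4%:R * l <= 1 * l by rewrite ler_wpM2r //; lra.
lra.
Qed.

Lemma slopeP n (g : K -> K^^n -> K) (c e eta : K) : eta + e <= `|c| ->
  (forall t t' v, t < t' -> `|g t' v - g t v - c * (t' - t)| <= e * (t' - t)) ->
  slope_cond eta g.
Proof.
move=> Hc H.
have key (t t' : K) v : t < t' -> -(e * (t' - t)) <= g t' v - g t v - c * (t' - t) <= e * (t' - t).
  by move=> tt'; rewrite -ler_norml; exact: H.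
have mulle (t t' x y : K) : t < t' -> x <= y -> x * (t' - t) <= y * (t' - t).
  by move=> tt' xy; rewrite ler_wpM2r // subr_ge0 ltW.
have [c0|c0] := ler0P c.
  apply: Or33 => t t' v tt'; have /andP[h1 h2] := key t t' v tt'.
  rewrite ler0_norm // in Hc; have := mulle t t' _ _ tt' Hc; lra.
apply: Or32 => t t' v tt'; have /andP[h1 h2] := key t t' v tt'.
rewrite gtr0_norm // in Hc; have := mulle t t' _ _ tt' Hc; lra.
Qed.

Lemma tie_absurd (x y : K) (p q : nat) : 0 < x - y \/ (x - y = 0 /\ (p < q)%N) ->
  0 < y - x \/ (y - x = 0 /\ (q < p)%N) -> False.
Proof.
case=> [A1|[A1 pq]]; case=> [A2|[A2 qp]]; [lra|lra|lra|].
by have := ltn_trans pq qp; rewrite ltnn.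
Qed.

(** Ties are broken in favour of the smaller index, which makes the regions of different minimisers
    disjoint ([tie_absurd]). *)
Lemma argmin_tie r (g : 'I_r.+1 -> K) : exists p, forall q, q != p ->
  0 < g q - g p \/ (g q - g p = 0 /\ (p < q)%N).
Proof.
have [p0 Hp0] : exists p, forall q, g p <= g q.
  by exists [arg min_(p < ord0) g p]%O; case: arg_minP => // p _ Hp q; exact: Hp.
have [p gp Hp] : exists2 p, g p = g p0 & forall q : 'I_r.+1, g q = g p0 -> (p <= q)%N.
  exists [arg min_(p < p0 | g p == g p0) (p : nat)]; case: arg_minnP => // p /eqP // gp Hp q /eqP.
  exact: Hp.
exists p => q qp; have := Hp0 q; rewrite -gp le_eqVlt => /orP[/eqP E|]; last by left; rewrite subr_gt0.
right; rewrite E subrr; split=> //; rewrite ltn_neqAle Hp -?E // andbT.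
by apply: contraNneq qp => pq; apply/eqP/val_inj.
Qed.

Definition sg (b : bool) : K := if b then 1 else -1.

Lemma sg_norm b : `|sg b| = 1.
Proof. by case: b; rewrite /sg ?normrN normr1. Qed.

(** If both surfaces have direction [i], their slopes in this direction are exactly 1, and two
    signed weights are equal or differ by at least 1. If the directions differ, the class of the
    second surface keeps its slope in direction [i] away from the ratio of the two weights by 3
    gaps; its nonlinearity costs only a quarter of a gap. *)
Lemma slope_pair P n i k (nu : K^^n.+1) u b i' k' (nu' : K^^n.+1) u' b' :
  surface P i k nu u -> surface P i' k' nu' u' ->
  slope_cond (gap n.+1) (fun t v => W n.+1 i' k' * sg b' * u' (ins i t v) -
                                    W n.+1 i k * sg b * u (ins i t v)).
Proof.
move=> Su Su'; have g8 := gap_small n.+1; have g0 := gap_gt0 n.+1.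
have [E|ii'] := eqVneq i' i.
  subst i'; have [E|NE] := eqVneq (W n.+1 i k' * sg b') (W n.+1 i k * sg b).
    apply: Or31 => t t' v; rewrite -E -!mulrBr; congr (_ * _).
    have := surface_slope0 t t' v Su; have := surface_slope0 t t' v Su'; lra.
  apply: (@slopeP _ _ (W n.+1 i k' * sg b' - W n.+1 i k * sg b) 0).
    rewrite addr0; apply: (@le_trans _ _ 1); first lra.
    have W1 := W_ge1 n.+1 i k; have W2 := W_ge1 n.+1 i k'.
    have W12 : (W n.+1 i k' == W n.+1 i k) = false -> 1 <= `|W n.+1 i k' - W n.+1 i k|.
      move=> Wn; apply: pow2_gap; apply: contraFneq Wn => E; by rewrite /W E.
    move: NE; case: (b); case: (b') => /=; rewrite ?mulr1 ?mulrN1 ?opprK => NE.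
    + by apply: W12; exact/negbTE.
    + rewrite ler_normr; apply/orP; right; lra.
    + rewrite ler_normr; apply/orP; left; lra.
    + rewrite addrC distrC; apply: W12; apply/negbTE; apply: contraNneq NE => ->; exact: eqxx.
  move=> t t' v tt'; rewrite mul0r; set X := W n.+1 i k' * _; set Y := W n.+1 i k * _.
  have -> : X * u' (ins i t' v) - Y * u (ins i t' v) - (X * u' (ins i t v) - Y * u (ins i t v)) - (X - Y) * (t' - t) =
     X * (u' (ins i t' v) - u' (ins i t v)) - Y * (u (ins i t' v) - u (ins i t v)) - (X - Y) * (t' - t) by ring.
  by rewrite (surface_slope0 t t' v Su) (surface_slope0 t t' v Su') -mulrBl subrr normr0.
have W1 := W_ge1 n.+1 i' k'; have W0 := W_gt0 n.+1 i k.
have W'0 : 0 < W n.+1 i' k' by lra.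
apply: (@slopeP _ _ (W n.+1 i' k' * sg b' * nu' 0 i - W n.+1 i k * sg b) (W n.+1 i' k' * (gap n.+1 / 4%:R))).
  have [_ _ /(_ i k) Hg _ _] := Su'; have {}Hg := Hg (_ : i != i'); rewrite eq_sym in Hg.
  have {}Hg := Hg ii'.
  set w' := W n.+1 i' k' in W1 W'0 Hg *; set w := W n.+1 i k in W0 Hg *; set g := gap _ in g0 Hg *.
  apply: (@le_trans _ _ (w' * (3%:R * g))).
    have : 0 <= (w' - 1) * g by rewrite mulr_ge0 ?subr_ge0 // ltW.
    lra.
  have {}Hg : w' * (3%:R * g) <= w' * `| `|nu' 0 i| - w / w'| by rewrite ler_pM2l.
  apply: (le_trans Hg); rewrite -{1}(gtr0_norm W'0) -normrM mulrBr [w' * (w / w')]mulrC divfK ?gt_eqF //.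
  have -> : w' * `|nu' 0 i| = `|w' * sg b' * nu' 0 i| by rewrite !normrM sg_norm mulr1 gtr0_norm.
  have E : w = `|w * sg b| by rewrite normrM sg_norm mulr1 gtr0_norm.
  by rewrite [X in `| _ - X| <= _]E; exact: ler_dist_dist.
move=> t t' v tt'.
have Sl := surface_slope i t t' v Su'.
rewrite (gtr0_norm (_ : 0 < t' - t)) in Sl; last by rewrite subr_gt0.
set X := W n.+1 i' k' in W'0 *; set Y := W n.+1 i k * _.
have E := surface_slope0 t t' v Su.
have -> : X * sg b' * u' (ins i t' v) - Y * u (ins i t' v) - (X * sg b' * u' (ins i t v) - Y * u (ins i t v)) - (X * sg b' * nu' 0 i - Y) * (t' - t) =
   X * sg b' * (u' (ins i t' v) - u' (ins i t v) - nu' 0 i * (t' - t)) - Y * (u (ins i t' v) - u (ins i t v) - (t' - t)) by ring.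
by rewrite E subrr mulr0 subr0 !normrM sg_norm mulr1 gtr0_norm // -mulrA ler_pM2l.
Qed.

Lemma D_fin P (J : finType) T {eT : encodable K T} (Q : J -> T -> Prop) :
  (forall j, D S P (Q j)) -> D S P (fun x => forall j, Q j x).
Proof.
move=> DQ; have : D S P (fun x => forall i : 'I_#|J|, Q (enum_val i) x) by apply: D_big => i.
apply: D_ext => x; split=> H j //.
by have := H (enum_rank j); rewrite enum_rankK.
Qed.

(** Put in front of the list of surfaces, so that a nearest one always exists. *)
Lemma dummy_surface P n : surface P ord0 ord0 (delta_mx 0 ord0 : K^^n.+1) (fun x => x 0 ord0).
Proof.
have g0 := gap_gt0 n.+1.
split.
- by ddef.
- split=> [|j]; rewrite mxE ?eqxx //=; case: eqP => _; rewrite ?normr1 ?normr0; lra.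
- move=> j l j0; rewrite mxE eqxx (negbTE j0) /= normr0 sub0r normrN gtr0_norm; last by rewrite divr_gt0 ?W_gt0.
  apply: (@le_trans _ _ (W n.+1 (ord0 : 'I_n.+1) (ord0 : 'I_n.+1))^-1); last first.
    by rewrite ler_peMl ?W_ge1 // invr_ge0 ltW // W_gt0.
  rewrite /W /wexp mul0n expr0 invr1; have := gap_small n.+1; lra.
- by move=> x y; rewrite dot_delta !mxE subrr normr0 mulr_ge0 ?l1_ge0 // divr_ge0 // ltW.
- by exists (fun=> 0) => x; rewrite subr0.
Qed.

(** The surfaces that cover the boundary of [U] divide the cube into regions, according to the sides
    of the surfaces and to the surface at the smallest weighted distance. In the direction of this
    nearest surface all defining inequalities are constant or steep, so the region is a band between
    two Lipschitz functions. Over generic points [U] does not change inside a band. A decomposition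
    of the bases of the bands then gives the cells. *)
Lemma LD_step n N : LD n N -> exists N', LD n.+1 N'.
Proof.
(* [w0] bounds the weights. The functions [u] have Lipschitz constant 3, so differences of two
   weighted ones have constant [6 * w0]; division by the minimal slope [gap] gives [BN] for the ends
   of the bands. *)
move=> HLD; set w0 := (2 ^ wmax n.+1)%N; set BN := (6 * w0 * 2 ^ (2 * wmax n.+1 + 3))%N.
exists (N + BN)%N => P U cP DU Uc.
set eta := gap n.+1; have eta0 : 0 < eta := gap_gt0 n.+1.
set B := (6 * w0)%:R : K.
have BE : B / eta = BN%:R by rewrite invrK -natrX -natrM.
pose Z (z : K^^n.+1) := unit_cube K n.+1 z /\ forall d : K, 0 < d ->
   exists y y' : K^^n.+1, box z d y /\ box z d y' /\ U y /\ ~ U y'.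
have DZ : D S P Z.
  apply: D_and; first exact: D_cube.
  by rewrite /box; ddef.
have Zg z : Z z -> ~ gen P z.
  move=> [_ Hz] gz; have [Uz|Uz] := pselect (U z).
    have [d d0 Hd] := near_gen cP gz DU Uz.
    by have [y [y' [_ [zy' [_ []]]]]] := Hz d d0; exact: Hd.
  have [d d0 Hd] := near_gen cP gz (D_not DU) Uz.
  by have [y [y' [zy [_ [Uy _]]]]] := Hz d d0; case: (Hd y).
have [r [s [Hs Zs]]] := surface_cover HLD cP DZ (fun z => @proj1 _ _) Zg.
pose s' (q : 'I_r.+1) := if unlift ord0 q is Some q' then s q' else
  (ord0, ord0, delta_mx 0 ord0, fun x : K^^n.+1 => x 0 ord0).
pose ii q := (s' q).1.1.1; pose kk q := (s' q).1.1.2; pose nu q := (s' q).1.2; pose u q := (s' q).2.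
have Hs' q : surface P (ii q) (kk q) (nu q) (u q).
  rewrite /ii /kk /nu /u /s'; case: (unliftP ord0 q) => [q' _|_] /=; first exact: Hs.
  exact: dummy_surface.
have {Zs} Zs z : Z z -> rk P (vals z) n -> exists q, u q z = 0.
  by move=> Zz rz; have [q Hq] := Zs z Zz rz; exists (lift ord0 q); rewrite /u /s' liftK.
pose w q : K := W n.+1 (ii q) (kk q).
have wgt0 q : 0 < w q by exact: W_gt0.
have wle q : w q <= w0%:R by rewrite /w /W -natrX ler_nat leq_pexp2l // wexp_le.
(* An index records the side of every surface and the nearest surface. Besides the comparisons with
   the nearest surface, [G] contains, under [inl], the two faces of the cube in its direction, which
   keep the bands bounded. *)
pose A := ({ffun 'I_r.+1 -> bool} * 'I_r.+1)%type.
pose G (a : A) (j : bool + 'I_r.+1) (x : K^^n.+1) : K := match j with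
  | inl true => x 0 (ii a.2) | inl false => 1 - x 0 (ii a.2)
  | inr q => if q == a.2 then sg (a.1 q) * u q x else w q * sg (a.1 q) * u q x - w a.2 * sg (a.1 a.2) * u a.2 x
  end.
pose fl (a : A) (j : bool + 'I_r.+1) := if j is inr q then (a.2 < q)%N else false.
pose F a v t := fiber (fun j t v => G a j (ins (ii a.2) t v)) (fl a) v t.
have Du q : Df S P (u q) by case: (Hs' q).
have Dsg (T : Type) (eT : encodable K T) b : Df S P (fun _ : T => sg b).
  by case: b; rewrite /sg; [exact: Df_1|apply: Df_opp; exact: Df_1].
have Dw (T : Type) (eT : encodable K T) q : Df S P (fun _ : T => w q).
  by rewrite /w /W; apply: Df_exp; exact: Df_nat.
have DG a j : Df S P (G a j).
  rewrite /G; case: j => [[|]|q]; [by ddef|by ddef|].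
  by case: eqP => _; [apply: Df_mul|apply: Df_add; [|apply: Df_opp]; do ?apply: Df_mul] => //.
have DF a : D S P (fun p : K^^n * K => F a p.1 p.2).
  rewrite /fiber; apply: D_fin => j.
  have DGi : Df S P (fun p : K^^n * K => G a j (ins (ii a.2) p.2 p.1)).
    by apply: (Df_comp (DG a j)); apply: Df_ins; ddef.
  apply: D_or; first by apply: D_lt => //; exact: Df_0.
  by apply: D_and; [apply: D_eqT => //; exact: Df_0|exact: D_const].
have Gs a q : slope_cond eta (fun t v => G a q (ins (ii a.2) t v)).
  have g8 := gap_small n.+1.
  have su1 p t t' v (Sp := Hs' p) := surface_slope0 t t' v Sp.
  have etaM (t t' : K) : t < t' -> eta * (t' - t) <= t' - t.
    by move=> tt'; rewrite ler_piMl ?subr_ge0 ?(ltW tt') //; rewrite /eta; lra.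
  case: q => [[|]|q] /=.
  - by apply: Or32 => t t' v tt'; rewrite !insE; exact: etaM.
  - by apply: Or33 => t t' v tt'; rewrite !insE; have := etaM _ _ tt'; lra.
  case: eqP => [->|_]; last exact: slope_pair.
  case: (a.1 a.2); rewrite /sg.
    by apply: Or32 => t t' v tt'; rewrite !mul1r su1; exact: etaM.
  by apply: Or33 => t t' v tt'; rewrite !mulN1r !opprK su1; exact: etaM.
have wB q b x y : `|w q * sg b * u q x - w q * sg b * u q y| <= w0%:R * 3%:R * l1 (x - y).
  rewrite -mulrBr !normrM sg_norm mulr1 gtr0_norm // -mulrA.
  apply: ler_pM; rewrite ?normr_ge0 ?(ltW (wgt0 q)) //; exact: surface_lip (Hs' q).
have w01 : 1 <= w0%:R :> K by rewrite ler1n expn_gt0.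
have Gl a q t v y : `|G a q (ins (ii a.2) t v) - G a q (ins (ii a.2) t y)| <= B * l1 (v - y).
  have l0 := l1_ge0 (v - y).
  have B0 : 0 <= B * l1 (v - y) by rewrite mulr_ge0.
  have lE : l1 (ins (ii a.2) t v - ins (ii a.2) t y) = l1 (v - y).
    by rewrite insB subrr l1_ins normr0 add0r.
  rewrite /G; case: q => [[|]|q]; rewrite ?insE ?subrr ?normr0 //.
  case: eqP => [->|_].
    rewrite -mulrBr normrM sg_norm mul1r; apply: le_trans (surface_lip _ _ (Hs' _)) _.
    by rewrite lE /B natrM ler_wpM2r //; lra.
  set X := ins _ _ v; set Y := ins _ _ y.
  have -> : w q * sg (a.1 q) * u q X - w a.2 * sg (a.1 a.2) * u a.2 X - (w q * sg (a.1 q) * u q Y - w a.2 * sg (a.1 a.2) * u a.2 Y)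
    = (w q * sg (a.1 q) * u q X - w q * sg (a.1 q) * u q Y) - (w a.2 * sg (a.1 a.2) * u a.2 X - w a.2 * sg (a.1 a.2) * u a.2 Y) by ring.
  apply: le_trans (ler_normB _ _) _.
  have := wB q (a.1 q) X Y; have := wB a.2 (a.1 a.2) X Y; rewrite lE /B natrM; lra.
have F01 a v t : F a v t -> 0 < t < 1.
  by move=> H; have [/=|[_]//] := H (inl true); have [/=|[_]//] := H (inl false); rewrite insE subr_gt0 => -> ->.
have Fpos a x : (forall j, 0 < G a j x \/ (G a j x = 0 /\ fl a j)) -> forall q, 0 < sg (a.1 q) * u q x.
  move=> H; have p0 : 0 < sg (a.1 a.2) * u a.2 x.
    by have [|[_]] := H (inr a.2); rewrite /= ?eqxx // ltnn.
  move=> q; have [->//|qp] := eqVneq q a.2.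
  have : 0 <= G a (inr q) x by have [/ltW|[->]] := H (inr q).
  rewrite /= (negbTE qp) subr_ge0 -!mulrA => le1.
  have : 0 < w q * (sg (a.1 q) * u q x) by apply: lt_le_trans le1; rewrite mulr_gt0.
  by rewrite pmulr_rgt0.
have Funiq a a' x : (forall j, 0 < G a j x \/ (G a j x = 0 /\ fl a j)) ->
    (forall j, 0 < G a' j x \/ (G a' j x = 0 /\ fl a' j)) -> a = a'.
  move=> H H'; have h := Fpos _ _ H; have h' := Fpos _ _ H'.
  have E1 : a.1 = a'.1.
    apply/ffunP => q; have := h q; have := h' q; rewrite /sg.
    by case: (a.1 q); case: (a'.1 q) => //; lra.
  have [E2|N2] := eqVneq a.2 a'.2; first by move: a a' E1 E2 {H H' h h'} => [? ?] [? ?] /= -> ->.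
  have N2' : (a'.2 == a.2) = false by rewrite eq_sym (negbTE N2).
  have := H (inr a'.2); have := H' (inr a.2); rewrite /= N2' (negbTE N2) E1.
  by move=> H1 H2; case: (tie_absurd H1 H2).
have Hband (a : A) : exists lu : (K^^n -> K) * (K^^n -> K),
  [/\ Df S P lu.1 /\ Df S P lu.2, forall v t, F a v t -> lu.1 v <= t <= lu.2 v,
      forall v t s, F a v s -> lu.1 v < t < lu.2 v -> F a v t &
      forall v y t s, F a v t -> F a y s -> `|lu.1 v - lu.1 y| <= BN%:R * l1 (v - y) /\
        `|lu.2 v - lu.2 y| <= BN%:R * l1 (v - y)].
  have [lo [Dlo lo1 lo2 lo3]] := band eta0 (Gs a) (Gl a) (DF a) (F01 a).
  (* Upper ends are lower ends after the reflection that replaces [t] by [1 - t]. *)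
  have [||||up [Dup up1 up2 up3]] := @band P n _ (fun j t v => G a j (ins (ii a.2) (1 - t) v)) (fl a) B eta eta0.
  - move=> q; case: (Gs a q) => H; [apply: Or31|apply: Or33|apply: Or32] => t t' v.
    + exact: H.
    + by move=> tt'; have := H (1 - t') (1 - t) v; rewrite ltrD2l ltrN2 => /(_ tt'); lra.
    + by move=> tt'; have := H (1 - t') (1 - t) v; rewrite ltrD2l ltrN2 => /(_ tt'); lra.
  - by move=> q t v y; exact: Gl.
  - have DF' : D S P (fun p : K^^n * K => F a p.1 (1 - p.2)).
      by apply: (D_comp (Q := fun p : K^^n * K => F a p.1 p.2) (g := fun p => (p.1, 1 - p.2))) => //; ddef.
    exact: DF'.
  - by move=> v t /(F01 a v); lra.
  have upF v t : F a v t -> fiber (fun j t v => G a j (ins (ii a.2) (1 - t) v)) (fl a) v (1 - t).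
    by rewrite /fiber subKr.
  exists (lo, fun v => 1 - up v); split=> /=.
  - by split=> //; ddef.
  - by move=> v t Ft; rewrite lo1 //=; have := up1 _ _ (upF _ _ Ft); lra.
  - move=> v t s0 Fs /andP[lt tu].
    have [t1 Ft1 tt1] := lo2 v s0 t Fs lt.
    have [|t2 Ft2 tt2] := up2 v (1 - s0) (1 - t) (upF _ _ Fs); first lra.
    apply: (@fiber_convex _ _ _ _ eta eta0 (Gs a) v t1 t (1 - t2)) => //; lra.
  - move=> v y t s0 Fv Fy; rewrite -BE; split; first exact: lo3 Fv Fy.
    rewrite distrC (_ : _ - _ = up v - up y); last by ring.
    exact: up3 (upF _ _ Fv) (upF _ _ Fy).
have [lu Hlu] := choice Hband.
set M' := (N + BN)%:R : K.
(* The base of a band: the points over which the band is not empty, lies entirely in [U], and has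
   ends with bounded strict derivatives. *)
pose X1 (a : A) (v : K^^n) := unit_cube K n v /\ (exists t, F a v t) /\ (lu a).1 v < (lu a).2 v /\
  (forall t, (lu a).1 v < t -> t < (lu a).2 v -> U (ins (ii a.2) t v)) /\
  (sdiff (lu a).1 v (grad (lu a).1 v) /\ forall j, `|grad (lu a).1 v 0 j| <= M') /\
  (sdiff (lu a).2 v (grad (lu a).2 v) /\ forall j, `|grad (lu a).2 v 0 j| <= M').
have Dreg (h : K^^n -> K) : Df S P h -> D S P (fun v => sdiff h v (grad h v) /\ forall j, `|grad h v 0 j| <= M').
  move=> Dh; have Dg := Df_grad Dh; apply: D_and.
    exact: (D_comp (Q := fun p => sdiff h p.1 p.2) (g := fun w => (w, grad h w)) (D_sdiff Dh) (Df_pair (Df_id _ _) Dg)).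
  apply: D_big => j; apply: D_le; last exact: Df_nat.
  by apply: Df_norm; apply: Df_entry.
have DX1 a : D S P (X1 a).
  have [[D1 D2] _ _ _] := Hlu a; have DFa := DF a.
  apply: D_and; first exact: D_cube.
  apply: D_and; first by ddef.
  apply: D_and; first by ddef.
  apply: D_and; last by apply: D_and; exact: Dreg.
  apply: D_all; apply: D_imp; first by ddef.
  apply: D_imp; first by ddef.
  by apply: (D_comp DU); apply: Df_ins; ddef.
have HC (a : A) : exists IC : {I : finType & I -> set K^^n},
  [/\ forall i, PC P N%:R (projT2 IC i), forall i, projT2 IC i `<=` X1 a,
      forall i j x, projT2 IC i x -> projT2 IC j x -> i = j &
      forall x, X1 a x -> gen P x -> exists i, projT2 IC i x].
  have [|I [C HIC]] := HLD P (X1 a) cP (DX1 a); first by move=> v [].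
  by exists (existT _ I C).
have [IC HIC] := choice HC.
pose I := {a : A & projT1 (IC a)} : finType.
exists I, (fun al : I => [set z | projT2 (IC (tag al)) (tagged al) (col' (ii (tag al).2) z) /\
   (lu (tag al)).1 (col' (ii (tag al).2) z) < z 0 (ii (tag al).2) < (lu (tag al)).2 (col' (ii (tag al).2) z)]).
have CF (a : A) (l : projT1 (IC a)) z : projT2 (IC a) l (col' (ii a.2) z) ->
    (lu a).1 (col' (ii a.2) z) < z 0 (ii a.2) < (lu a).2 (col' (ii a.2) z) ->
    forall j, 0 < G a j z \/ (G a j z = 0 /\ fl a j).
  move=> Cz zi; have [_ _ H _] := Hlu a; have [_ CX _ _] := HIC a.
  have [_ [[t Ft] _]] := CX _ _ Cz.
  by have := H _ _ _ Ft zi; rewrite /F /fiber ins_col'.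
split.
- move=> [a l] /=; have [PCC CX _ _] := HIC a; have [D12 _ _ _] := Hlu a.
  exists (ii a.2), (projT2 (IC a) l), (lu a).1, (lu a).2; split=> //.
  + by apply: PC_monoM (PCC l); rewrite ler_nat leq_addr.
  + by split=> v /CX[_ [_ [_ [_ []]]]].
  + by move=> v /CX[_ [_ []]].
- move=> [a l] /= z [Cz /andP[z1 z2]]; have [_ CX _ _] := HIC a.
  by have [_ [_ [_ [H _]]]] := CX _ _ Cz; have := H _ z1 z2; rewrite ins_col'.
- move=> [a l] [a' l'] z /= [Cz zi] [Cz' zi'].
  have E := Funiq _ _ _ (CF _ _ _ Cz zi) (CF _ _ _ Cz' zi'); subst a'.
  by have [_ _ H _] := HIC a; rewrite (H _ _ _ Cz Cz').
move=> x Ux gx.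
(* On a surface the coordinate in its direction is a function of the others, which is impossible at
   a generic point. *)
have une0 q : u q x != 0.
  apply/eqP => uq; have [_ _ _ _ [b Hb]] := Hs' q.
  have /(gen_col' P (ii q))[_] := gx; apply.
  have Dui : D S (P <+ (col' (ii q) x)) (fun t => u q (ins (ii q) t (col' (ii q) x)) = 0).
    apply: (@D_inst_vec P n (col' (ii q) x) K _ (fun p : K * K^^n => u q (ins (ii q) p.1 p.2) = 0)).
    by apply: D_eqT; [apply: (Df_comp (Du q)); apply: Df_ins; ddef|exact: Df_0].
  exists (fun t => u q (ins (ii q) t (col' (ii q) x)) = 0); split=> //; first by rewrite ins_col'.
  exists [:: x 0 (ii q)] => t; rewrite Hb insE col'_ins => /eqP; rewrite subr_eq0 => /eqP ->.
  by move: uq; rewrite Hb => /eqP; rewrite subr_eq0 => /eqP ->; rewrite mem_head.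
pose sgm : {ffun 'I_r.+1 -> bool} := [ffun q => 0 < u q x].
have spos q : 0 < sg (sgm q) * u q x.
  rewrite ffunE; have [uq|uq] := ltP 0 (u q x); rewrite ?uq ?ltNge /=.
    by rewrite mul1r -ltNge.
  by rewrite mulN1r oppr_le0 -ltNge lt_neqAle une0.
have [p Hp] := argmin_tie (fun q => w q * (sg (sgm q) * u q x)).
pose a : A := (sgm, p); pose v := col' (ii p) x; pose t := x 0 (ii p).
have xE : x = ins (ii p) t v by rewrite ins_col'.
have [gv Nt] : gen P v /\ ~ acl (P <+ v) t by exact/(gen_col' P (ii p)).
have [[D1 D2] lu1 lu2 lu3] := Hlu a.
have cx := Uc x Ux.
have aclf (b : K^^n -> K) : Df S P b -> acl (P <+ v) (b v).
  move=> Db; exists (fun s => s = b v); split=> //; last by exists [:: b v] => y ->; rewrite mem_head.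
  by apply: (@D_inst_vec P n v K _ (fun p : K * K^^n => p.1 = b p.2)); ddef.
have tne (b : K^^n -> K) : Df S P b -> b v != t.
  by move=> Db; apply/eqP => E; apply: Nt; rewrite -E; exact: aclf.
have Ft : F a v t.
  rewrite /F /fiber -xE => -[[|]|q] /=.
  - left; rewrite lt_neqAle (proj1 (andP (cx _))) andbT.
    exact: (tne (fun=> 0) (Df_0 _ _)).
  - left; rewrite subr_gt0 lt_neqAle (proj2 (andP (cx _))) andbT eq_sym.
    exact: (tne (fun=> 1) (Df_1 _ _)).
  - have [->|qp] := eqVneq q p; first by left.
    by rewrite -!mulrA; exact: Hp.
have /andP[lt tu] := lu1 _ _ Ft.
have {}lt : (lu a).1 v < t by rewrite lt_neqAle lt andbT tne.
have {}tu : t < (lu a).2 v by rewrite lt_neqAle tu andbT eq_sym tne.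
have regb (b : K^^n -> K) : Df S P b -> (forall y s0, F a y s0 -> `|b y - b v| <= BN%:R * l1 (y - v)) ->
    sdiff b v (grad b v) /\ forall j, `|grad b v 0 j| <= M'.
  move=> Db Hb; have sb := grad_gen cP gv Db; split=> // j.
  have [||d d0 Hd] := near_gen cP gv (Q := fun y => exists s0, F a y s0).
  - by have DFa := DF a; ddef.
  - by exists t.
  apply: (@le_trans _ _ BN%:R); last by rewrite ler_nat leq_addl.
  apply: (grad_bound sb d0) => y /Hd[s0]; exact: Hb.
have X1v : X1 a v.
  split; first by move=> j; rewrite mxE; exact: cx.
  split; first by exists t.
  split; first exact: lt_trans lt tu.
  split; last by split; apply: regb => // y s0 Fy; have [] := lu3 _ _ _ _ Fy Ft.
  pose Q s0 := U (ins (ii p) s0 v).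
  have DQ : D S (P <+ v) Q.
    apply: (@D_inst_vec P n v K _ (fun p0 : K * K^^n => U (ins (ii p) p0.1 p0.2))).
    by apply: (D_comp DU); apply: Df_ins; ddef.
  move=> s0 ls su.
  have Qt : Q t by rewrite /Q -xE.
  have Cn := conn1 DQ (a := (lu a).1 v) (b := (lu a).2 v).
  apply: (Cn _ t s0 _ _ Qt); rewrite ?lt ?tu ?ls ?su // => t' t'lu.
  have Ft' := lu2 _ _ _ Ft t'lu.
  (* Over the generic [v] all points have rank at least [n], so a boundary point of [U] would lie on
     one of the surfaces. None meets the interior of the band, where all [u q] keep their signs.
     Hence [U] is locally constant along the segment. *)
  have NZ : ~ Z (ins (ii p) t' v).
    move=> Zt'; have [|q uq] := Zs _ Zt'.
      apply: rk_sub (gen_rk gv) => _ /valsP[j ->].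
      by have := mem_vals (ins (ii p) t' v) (lift (ii p) j); rewrite ins_lift.
    by have := Fpos _ _ Ft' q; rewrite uq mulr0 ltxx.
  have ct' : unit_cube K n.+1 (ins (ii p) t' v).
    move=> j; case: (unliftP (ii p) j) => [j' ->|->]; first by rewrite ins_lift mxE; exact: cx.
    by rewrite insE; have /andP[/ltW -> /ltW ->] := F01 _ _ _ Ft'.
  have [d [d0 Hd]] : exists d : K, 0 < d /\ ~ exists y y' : K^^n.+1,
      box (ins (ii p) t' v) d y /\ box (ins (ii p) t' v) d y' /\ U y /\ ~ U y'.
    apply: contrapT => H; apply: NZ; split=> // d d0; apply: contrapT => H'; apply: H.
    by exists d.
  exists d => //; have bx u0 : `|u0 - t'| < d -> box (ins (ii p) t' v) d (ins (ii p) u0 v).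
    move=> ud j; case: (unliftP (ii p) j) => [j' ->|->]; rewrite ?ins_lift ?insE //.
    by rewrite subrr normr0.
  have [Ut|Ut] := pselect (Q t'); [left|right] => u0 ud.
    apply: contrapT => Nu; apply: Hd; exists (ins (ii p) t' v), (ins (ii p) u0 v).
    by split; [exact: box_refl|split=> //; exact: bx].
  move=> Qu; apply: Hd; exists (ins (ii p) u0 v), (ins (ii p) t' v).
  by split; [exact: bx|split=> //; exact: box_refl].
have [_ _ _ HI] := HIC a; have [l Cl] := HI v X1v gv.
by exists (existT _ a l) => /=; split=> //; rewrite -/v -/t lt tu.
Qed.

Lemma LD_ex n : exists N, LD n N.
Proof.
elim: n => [|n [N HN]]; first by exists 0%N; exact: LD0.
exact: LD_step HN.
Qed.

Variable R : realType.

(** * Standard parts *)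

Section StandardPartTheory.
Implicit Types (x y : K) (r s : R).

(** The standard part expressed by comparison with rational numbers, which are common to [K] and
    [R]. *)
Definition stP x r := forall q : rat,
  (ratr q < r -> ratr q <= x) /\ (r < ratr q -> x <= ratr q).

Lemma dense_rat (r s : R) : r < s -> exists q : rat, r < ratr q < s.
Proof. by move=> /rat_in_itvoo[q]; rewrite in_itv /= => H; exists q. Qed.

Lemma st_stP x r : st R x = r%:E <-> stP x r.
Proof.
split=> [E q|H].
  split=> qr.
    have : ((ratr q)%:E < st R x)%E by rewrite E lte_fin.
    move=> /ereal_sup_gt[_ [q' /= q'x <-]]; rewrite lte_fin ltr_rat => qq'.
    by apply: le_trans q'x; rewrite ler_rat ltW.
  rewrite leNgt; apply/negP => qx; move: qr; apply/negP; rewrite -leNgt -lee_fin -E.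
  by apply: ereal_sup_ubound; exists q => //=; exact: ltW.
apply/eqP; rewrite eq_le; apply/andP; split.
  apply: ge_ereal_sup => _ [q /= qx <-]; rewrite lee_fin leNgt; apply/negP => rq.
  have [q' /andP[rq' q'q]] := dense_rat rq.
  by have := le_trans qx ((H q').2 rq'); rewrite ler_rat leNgt -(ltr_rat R) q'q.
rewrite leNgt; apply/negP => sr.
have sx : (-oo < st R x)%E.
  have [|q /andP[_ q1]] := @dense_rat (r - 1) r; first by rewrite ltrBlDr ltrDl.
  by apply: lt_le_trans (ltNyr (ratr q)) _; apply: ereal_sup_ubound; exists q => //=; exact: (H q).1.
move: sr sx; case E: (st R x) => [s| |] //; rewrite lte_fin => sr _.
have [q /andP[sq qr]] := dense_rat sr.
have : ((ratr q)%:E <= st R x)%E by apply: ereal_sup_ubound; exists q => //=; exact: (H q).1.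
by rewrite E lee_fin leNgt sq.
Qed.

Lemma ex_st x : finite_elt x -> exists r, stP x r.
Proof.
move=> [N]; rewrite ler_norml => /andP[Nx xN].
have h1 : (- N%:R%:E <= st R x)%E.
  apply: ereal_sup_ubound; exists (- N%:R); rewrite /= ?raddfN /= ?ratr_nat //.
have h2 : (st R x <= N%:R%:E)%E.
  apply: ge_ereal_sup => _ [q /= qx <-]; rewrite lee_fin.
  have := le_trans qx xN; rewrite -[X in _ <= X](ratr_nat K) ler_rat.
  by rewrite -(ler_rat R) ratr_nat.
have : st R x \is a fin_num by rewrite fin_numE; case: (st R x) h1 h2.
by move=> /fineK E; exists (fine (st R x)); apply/st_stP.
Qed.

Definition str x : R := fine (st R x).

Lemma strP x : finite_elt x -> stP x (str x).
Proof. by move=> /ex_st[r /[dup] /st_stP E H]; rewrite /str E. Qed.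

Lemma st_str x : finite_elt x -> st R x = (str x)%:E.
Proof. by move=> /strP/st_stP. Qed.

Lemma strE x r : stP x r -> str x = r.
Proof. by move=> /st_stP; rewrite /str => ->. Qed.

Lemma stPD x y r s : stP x r -> stP y s -> stP (x + y) (r + s).
Proof.
move=> Hx Hy q; split=> qrs.
  have [|q1 /andP[a1 a2]] := @dense_rat (ratr q - s) r; first by rewrite ltrBlDr.
  rewrite -(subrK q1 q) addrC raddfD /=; apply: lerD; first exact: (Hx q1).1.
  by apply: (Hy _).1; rewrite raddfB /=; lra.
have [|q1 /andP[a1 a2]] := @dense_rat r (ratr q - s); first by rewrite ltrBrDr.
rewrite -(subrK q1 q) addrC raddfD /=; apply: lerD; last exact: (Hx q1).2.
by apply: (Hy _).2; rewrite raddfB /=; lra.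
Qed.

Lemma stPN x r : stP x r -> stP (- x) (- r).
Proof.
move=> Hx q; split=> qr; [rewrite lerNr -raddfN; apply: (Hx _).2|rewrite lerNl -raddfN; apply: (Hx _).1];
  rewrite raddfN /=; lra.
Qed.

Lemma stP_rat (q : rat) : stP (ratr q) (ratr q).
Proof. by move=> p; rewrite !ler_rat !ltr_rat; split; exact: ltW. Qed.

Lemma stP_nat (p : nat) : stP p%:R p%:R.
Proof. by have := stP_rat p%:R; rewrite !ratr_nat. Qed.

Lemma stPM x r (q : rat) : (0 : rat) <= q -> stP x r -> stP (ratr q * x) (ratr q * r).
Proof.
rewrite le_eqVlt => /orP[/eqP <-|q0] Hx p.
  by have := stP_rat 0 p; rewrite !rmorph0 !mul0r.
have qR : 0 < ratr q :> R by rewrite ltr0q.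
have qK : 0 < ratr q :> K by rewrite ltr0q.
have E (F : numFieldType) : ratr p = ratr q * ratr (p / q) :> F.
  by rewrite -rmorphM /= mulrC divfK // gt_eqF.
by rewrite (E R) (E K) !ltr_pM2l // !ler_pM2l //; exact: Hx.
Qed.

Lemma stP_le x y r s : stP x r -> stP y s -> x <= y -> r <= s.
Proof.
move=> Hx Hy xy; rewrite leNgt; apply/negP => sr.
have [q /andP[sq qr]] := dense_rat sr; have [q' /andP[sq' q'q]] := dense_rat sq.
have := le_trans ((Hx q).1 qr) (le_trans xy ((Hy q').2 sq')).
by rewrite ler_rat leNgt -(ltr_rat R) q'q.
Qed.

Lemma stP_eq x r s : stP x r -> stP x s -> r = s.
Proof. by move=> h h'; apply/eqP; rewrite eq_le (stP_le h h') ?(stP_le h' h). Qed.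

Lemma finD x y : finite_elt x -> finite_elt y -> finite_elt (x + y).
Proof. by move=> [N HN] [M HM]; exists (N + M)%N; rewrite natrD; apply: le_trans (ler_normD _ _) (lerD _ _). Qed.

Lemma finN x : finite_elt x -> finite_elt (- x).
Proof. by move=> [N HN]; exists N; rewrite normrN. Qed.

Lemma fin_nat (N : nat) : finite_elt (N%:R : K).
Proof. by exists N; rewrite normr_nat. Qed.

Lemma fin_itv x (N : nat) : 0 <= x <= N%:R -> finite_elt x.
Proof. by move=> /andP[x0 xN]; exists N; rewrite ger0_norm. Qed.

End StandardPartTheory.

Section OuterMeasure.
Local Open Scope ereal_scope.

Lemma lo_mono n (X Y : set R^^n) : X `<=` Y -> lebesgue_outer X <= lebesgue_outer Y.
Proof.
move=> XY; apply: ereal_inf_le_tmp => _ [I [a [b [ab YI ->]]]].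
by exists I, a, b; split=> //; apply: subset_trans YI.
Qed.

Definition vol n (a b : R^^n) : R := (\prod_i (b 0 i - a 0 i))%R.

Lemma lo_cover n (J : finType) (a b : J -> R^^n) (X : set R^^n) :
  (forall j i, (a j 0 i <= b j 0 i)%R) -> (forall x, X x -> exists j, cbox (a j) (b j) x) ->
  lebesgue_outer X <= (\sum_j vol (a j) (b j))%:E.
Proof.
move=> ab XJ; case: (pickP (fun _ : J => true)) => [j0 _|J0]; last first.
  rewrite (_ : X = set0); last first.
    by apply/seteqP; split=> // x /XJ[j]; have := J0 j.
  rewrite lebesgue_outer0 lee_fin; apply: sumr_ge0 => j _.
  by apply: prodr_ge0 => i _; rewrite subr_ge0.
pose e (k : nat) : J := nth j0 (enum J) k.
apply: (@le_trans _ _ (\esum_(k in [set k | (k < #|J|)%N]) (vol (a (e k)) (b (e k)))%:E)).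
  apply: ereal_inf_lbound; exists [set k | (k < #|J|)%N], (a \o e), (b \o e); split=> //= x /XJ[j xj].
  by exists (enum_rank j) => /=; rewrite ?ltn_ord // /e -(enum_val_nth j0) enum_rankK.
rewrite esum_fset; last 2 first.
- exact: finite_II.
- by move=> i _; rewrite lee_fin; apply: prodr_ge0 => l _; rewrite subr_ge0.
rewrite -fsbig_ord sumEFin lee_fin [X in (_ <= X)%R](reindex _ (onW_bij _ (@enum_val_bij J))) /=.
by apply: ler_sum => i _; rewrite /e -enum_val_nth.
Qed.

End OuterMeasure.

(** * Volume by counting dyadic cubes *)

Definition bdd (b n : nat) (A : set K^^n) := forall x, A x -> forall i, 0 <= x 0 i < b%:R.

(* The dyadic cubes of side 2^-k, indexed by their corner scaled by 2^k. *)
Definition cell (b k n : nat) (j : {ffun 'I_n -> 'I_(b * 2 ^ k)}) (x : K^^n) :=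
  forall i, (j i)%:R <= x 0 i * 2%:R ^+ k < (j i)%:R + 1.

Definition cells b k n (A : set K^^n) : {set {ffun 'I_n -> 'I_(b * 2 ^ k)}} :=
  [set j | `[< exists2 x, A x & cell j x >]].

(* Upper bound for the volume, by the dyadic cubes that meet [A]. *)
Definition oc b k n (A : set K^^n) : R := #|cells b k A|%:R / 2%:R ^+ (k * n).

Definition vl n (A : set K^^n) : R := fine (lebesgue_outer (st_image A)).

Lemma in_cells b k n (A : set K^^n) j : reflect (exists2 x, A x & cell j x) (j \in cells b k A).
Proof. by rewrite inE; exact: asboolP. Qed.

Lemma pow2_gt0 (F : numFieldType) k : 0 < 2%:R ^+ k :> F.
Proof. by rewrite exprn_gt0. Qed.

Lemma cell_ex b k n (A : set K^^n) x : bdd b A -> A x -> exists j : {ffun 'I_n -> 'I_(b * 2 ^ k)}, cell j x.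
Proof.
move=> bA Ax; have H i : exists j : 'I_(b * 2 ^ k), j%:R <= x 0 i * 2%:R ^+ k < j%:R + 1.
  have /andP[x0 xb] := bA x Ax i; have p2 := pow2_gt0 K k.
  have [||p [pb Hp]] := @nat_floor (x 0 i * 2%:R ^+ k) (b * 2 ^ k).
  - by rewrite mulr_ge0 // ltW.
  - by rewrite natrM natrX ltr_pM2r.
  by exists (Ordinal pb).
by have [j Hj] := choice H; exists [ffun i => j i] => i; rewrite ffunE.
Qed.

Lemma cells_sub b k n (A B : set K^^n) : A `<=` B -> cells b k A \subset cells b k B.
Proof.
by move=> AB; apply/fintype.subsetP => j /in_cells[x Ax jx]; apply/in_cells; exists x => //; exact: AB.
Qed.

Lemma cellsU b k n (A B : set K^^n) : cells b k (A `|` B) = cells b k A :|: cells b k B.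
Proof.
apply/setP => j; rewrite finset.in_setU; apply/in_cells/orP => [[x [Ax|Bx] jx]|[/in_cells[x Ax jx]|/in_cells[x Bx jx]]].
- by left; apply/in_cells; exists x.
- by right; apply/in_cells; exists x.
- by exists x => //; left.
- by exists x => //; right.
Qed.

Lemma oc_mono b k n (A B : set K^^n) : A `<=` B -> oc b k A <= oc b k B.
Proof.
by move=> AB; rewrite ler_pM2r ?invr_gt0 ?pow2_gt0 // ler_nat subset_leq_card // cells_sub.
Qed.

Lemma ocU b k n (A B : set K^^n) : oc b k (A `|` B) <= oc b k A + oc b k B.
Proof.
rewrite -mulrDl ler_pM2r // -natrD ler_nat cellsU.
by rewrite cardsU leq_subr.
Qed.

Lemma oc_ge0 b k n (A : set K^^n) : 0 <= oc b k A.
Proof. by rewrite divr_ge0 // ltW // pow2_gt0. Qed.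

Lemma oc_le b k n (A : set K^^n) : oc b k A <= b%:R ^+ n.
Proof.
rewrite ler_pdivrMr //; apply: (@le_trans _ _ #|{ffun 'I_n -> 'I_(b * 2 ^ k)}|%:R).
  by rewrite ler_nat max_card.
by rewrite card_ffun !card_ord natrX natrM natrX exprMn -exprM.
Qed.

Lemma oc_bigU b k n (J : eqType) (s : seq J) (B : J -> set K^^n) (A : set K^^n) :
  (forall x, A x -> exists j, j \in s /\ B j x) -> oc b k A <= \sum_(j <- s) oc b k (B j).
Proof.
elim: s A => [|j s IH] A H.
  rewrite big_nil (_ : A = set0) /oc; last by apply/seteqP; split=> // x /H[? []].
  rewrite (_ : cells _ _ _ = finset.set0) ?cards0 //.
  by apply/setP => i; rewrite finset.in_set0; apply/in_cells => -[].
rewrite big_cons; apply: le_trans (oc_mono b k (_ : A `<=` B j `|` (A `\` B j))) _.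
  by move=> x Ax; have [|] := pselect (B j x); [left|right].
apply: le_trans (ocU _ _ _ _) _; rewrite lerD2l; apply: IH => x [/H[i [+ Bx]] NB].
by rewrite in_cons => /orP[/eqP E|si]; [rewrite E in Bx|exists i].
Qed.

(** The standard part maps a half-open dyadic cube of [K] into the closed real cube with the same
    corners. *)
Lemma vl_le_oc b k n (A : set K^^n) : bdd b A -> (lebesgue_outer (st_image A) <= (oc b k A)%:E :> \bar R)%E.
Proof.
move=> bA; pose J := {j : {ffun 'I_n -> 'I_(b * 2 ^ k)} | j \in cells b k A}.
pose lo (j : J) : R^^n := \row_i ((val j i)%:R / 2%:R ^+ k).
pose hi (j : J) : R^^n := \row_i (((val j i)%:R + 1) / 2%:R ^+ k).
apply: le_trans (@lo_cover n J lo hi _ _ _) _.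
- by move=> j i; rewrite !mxE ler_pM2r ?invr_gt0 //; lra.
- move=> y [x Ax xy]; have [j jx] := cell_ex k bA Ax.
  have jA : j \in cells b k A by apply/in_cells; exists x.
  exists (Sub j jA) => i; rewrite !mxE /=; have /st_stP Hi := xy i; have /andP[j1 j2] := jx i.
  have E (q : nat) : stP (q%:R / 2%:R ^+ k : K) (q%:R / 2%:R ^+ k : R).
    by have := @stP_rat (q%:R / 2%:R ^+ k); rewrite !fmorph_div !rmorphXn /= !ratr_nat.
  apply/andP; split.
    by apply: (stP_le (E _) Hi); rewrite ler_pdivrMr.
  rewrite natr1; apply: (stP_le Hi (E _)); rewrite natr1 in j2; rewrite ler_pdivlMr //; exact: ltW.
rewrite lee_fin /oc (_ : \sum_j _ = \sum_(j : J) (2%:R ^+ (k * n))^-1); last first.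
  apply: eq_bigr => j _; rewrite /vol exprM -exprVn -[in RHS](card_ord n) -prodr_const.
  by apply: eq_bigr => i _; rewrite !mxE -mulrBl addrAC subrr add0r mul1r.
by rewrite sumr_const /J card_sig mulr_natl.
Qed.

Lemma vl_fin b n (A : set K^^n) : bdd b A -> lebesgue_outer (st_image A) = (vl A)%:E :> \bar R.
Proof.
move=> bA; rewrite fineK // ge0_fin_numE ?lebesgue_outer_ge0 //.
by apply: le_lt_trans (vl_le_oc 0 bA) _; rewrite ltry.
Qed.

Lemma vl_le b k n (A : set K^^n) : bdd b A -> vl A <= oc b k A.
Proof. by move=> bA; rewrite -lee_fin -(vl_fin bA); exact: vl_le_oc. Qed.

Lemma vl_ge0 n (A : set K^^n) : 0 <= vl A.
Proof. by apply: fine_ge0; exact: lebesgue_outer_ge0. Qed.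

Lemma card_span M (Q : {set 'I_M}) (l : R) : 0 <= l + 1 ->
  (forall i j, i \in Q -> j \in Q -> i%:R - j%:R <= l) -> #|Q|%:R <= l + 1.
Proof.
move=> l0 H; have [->|[i0 Qi0]] := set_0Vmem Q; first by rewrite cards0.
pose a := [arg min_(i < i0 in Q) (i : nat)]; pose c := [arg max_(i > i0 in Q) (i : nat)].
have [Qa Ha] : a \in Q /\ forall i, i \in Q -> (a <= i)%N by rewrite /a; case: arg_minnP.
have [Qc Hc] : c \in Q /\ forall i, i \in Q -> (i <= c)%N by rewrite /c; case: arg_maxnP.
have ac : (a <= c)%N by exact: Ha.
have : (#|Q| <= (c - a).+1)%N.
  rewrite cardE -(size_map val) -[(c - a).+1](size_iota a); apply: uniq_leq_size.
    by rewrite map_inj_uniq ?enum_uniq //; exact: val_inj.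
  move=> _ /mapP[i + ->]; rewrite mem_enum mem_iota => Qi.
  by rewrite Ha //= addnS subnKC // ltnS Hc.
by rewrite -(ler_nat R) -natr1 natrB // => h; apply: le_trans h _; rewrite lerD2r; exact: H.
Qed.

Definition kbox n (a c : 'I_n -> rat) : set K^^n :=
  [set x | forall i, ratr (a i) <= x 0 i /\ x 0 i <= ratr (c i)].

Lemma oc_kbox b k n (a c : 'I_n -> rat) : (forall i, a i <= c i) ->
  oc b k (kbox a c) <= \prod_i (ratr (c i - a i) + 2%:R / 2%:R ^+ k).
Proof.
move=> ac; have p2 := pow2_gt0 R k.
pose Q i : {set 'I_(b * 2 ^ k)} := [set j : 'I_(b * 2 ^ k) | `[< exists x : K, [/\ ratr (a i) <= x, x <= ratr (c i) & j%:R <= x * 2%:R ^+ k < j%:R + 1] >]]%SET.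
(* Along one coordinate at most [(c i - a i) * 2 ^ k + 2] dyadic intervals meet the interval from
   [a i] to [c i]. *)
have HQ i : #|Q i|%:R <= (ratr (c i - a i) + 2%:R / 2%:R ^+ k) * 2%:R ^+ k :> R.
  rewrite mulrDl divfK ?gt_eqF //.
  have E2 : 2%:R = 1 + 1 :> R by rewrite -(natrD _ 1 1).
  rewrite [X in _ <= _ + X]E2 addrA; apply: (@card_span _ (Q i) (ratr (c i - a i) * 2%:R ^+ k + 1)) => [|j j'].
    by rewrite !addr_ge0 // mulr_ge0 ?(ltW p2) // ler0q subr_ge0.
  rewrite !finset.in_set => /asboolP[x [_ xc /andP[jx _]]] /asboolP[x' [ax' _ /andP[_ j'x']]].
  have EL (F : numFieldType) : ratr (j%:R - j'%:R) = j%:R - j'%:R :> F by rewrite rmorphB /= !ratr_nat.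
  have ER (F : numFieldType) : ratr ((c i - a i) * 2%:R ^+ k + 1) = (ratr (c i) - ratr (a i)) * 2%:R ^+ k + 1 :> F.
    by rewrite rmorphD rmorphM rmorphXn rmorphB /= ratr_nat rmorph1.
  have key : j%:R - j'%:R <= (c i - a i) * 2%:R ^+ k + 1 :> rat.
    rewrite -(ler_rat K) EL ER.
    have : x * 2%:R ^+ k <= ratr (c i) * 2%:R ^+ k by rewrite ler_pM2r.
    have : ratr (a i) * 2%:R ^+ k <= x' * 2%:R ^+ k by rewrite ler_pM2r.
    rewrite mulrBl; lra.
  by move: key; rewrite -(ler_rat R) EL ER -rmorphB.
rewrite ler_pdivrMr // exprM -[X in _ * _ ^+ X](card_ord n) -prodr_const -big_split /=.
apply: (@le_trans _ _ (\prod_i (#|Q i|%:R))); last by apply: ler_prod => i _; rewrite HQ ler0n.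
rewrite -natr_prod ler_nat; apply: leq_trans (_ : #|family Q| <= _)%N.
  apply: subset_leq_card; apply/fintype.subsetP => j /in_cells[x xb jx]; apply/familyP => i.
  by rewrite inE; apply/asboolP; exists (x 0 i); have [] := xb i.
by rewrite card_family foldrE big_map big_enum.
Qed.

Lemma prod_eps n (l : 'I_n -> R) (e : R) : (forall i, 0 <= l i) -> 0 < e ->
  exists2 d : R, 0 < d & \prod_i (l i + d) <= \prod_i l i + e.
Proof.
move=> l0 e0.
pose p : {poly R} := \prod_i ((l i)%:P + 'X).
have pE d : p.[d] = \prod_i (l i + d).
  by rewrite /p horner_prod; apply: eq_bigr => i _; rewrite hornerD hornerC hornerX.
have cp : {for 0, continuous (fun d : R => p.[d])} by apply: continuous_horner.
have /cvgrPdist_lt/(_ e e0) := cp.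
move=> /nbhs_ballP[r /= r0 Hr]; exists (r / 2%:R); first by rewrite divr_gt0.
have := Hr (r / 2%:R); rewrite /ball /= sub0r normrN gtr0_norm ?divr_gt0 // => /(_ ltac:(lra)).
have E0 : \prod_i (l i + 0) = \prod_i l i by apply: eq_bigr => i _; rewrite addr0.
rewrite !pE E0.
by rewrite ltr_norml => /andP[+ _]; lra.
Qed.

Lemma D_kbox P n (a c : 'I_n -> rat) : D S P (kbox a c).
Proof.
have Drat (T : Type) (eT : encodable K T) q : Df S P (fun _ : T => ratr q : K).
  have -> : ratr q = (numq q)%:~R / (denq q)%:~R :> K by [].
  have Dint (z : int) : Df S P (fun _ : T => z%:~R : K).
    case: z => m; first exact: Df_nat.
    by rewrite NegzE mulrNz; apply: Df_opp; exact: Df_nat.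
  by apply: Df_mul => //; exact: Df_inv.
apply: D_big => i; apply: D_and; apply: D_le => //; apply: Df_entry; exact: Df_id.
Qed.

Lemma pow2_small (e : R) : 0 < e -> exists k0, forall k, (k0 <= k)%N -> 2%:R / 2%:R ^+ k <= e.
Proof.
move=> e0; have := ltW (archi_boundP (divr_ge0 (ler0n R 2) (ltW e0))).
set N := Num.bound _ => HN.
exists N => k Nk; rewrite ler_pdivrMr // -ler_pdivrMl // mulrC.
apply: (le_trans HN); apply: (@le_trans _ _ k%:R); first by rewrite ler_nat.
by rewrite -natrX ler_nat ltnW // ltn_expl.
Qed.

Lemma real_rat_box (u v d : R) : u <= v -> 0 < d -> exists a c : rat,
  [/\ ratr a < u, v < ratr c, a <= c & ratr (c - a) <= v - u + d].
Proof.
move=> uv d0; have [|a /andP[a1 a2]] := @dense_rat (u - d / 2%:R) u; first by lra.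
have [|c /andP[c1 c2]] := @dense_rat v (v + d / 2%:R); first by lra.
exists a, c; split=> //; last by rewrite rmorphB /=; lra.
by rewrite -(ler_rat R); lra.
Qed.

Lemma geo_sum M : \sum_(k < M) 2%:R ^- k.+1 <= 1 :> R.
Proof.
have -> : \sum_(k < M) 2%:R ^- k.+1 = 1 - 2%:R ^- M :> R.
  elim: M => [|M IH]; first by rewrite big_ord0 expr0 invr1 subrr.
  rewrite big_ord_recr /= IH exprS; field.
  by rewrite expf_neq0 // pnatr_eq0.
by rewrite gerBl invr_ge0 ltW // pow2_gt0.
Qed.

(** A countable cover of the standard part by real boxes yields, after slight enlargement, a cover
    of [A] itself by boxes with rational corners. By compactness finitely many suffice, and for
    finitely many boxes the numbers of dyadic cubes are close to the volumes at all fine levels.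
    With [vl_le] this makes the counts converge to the volume. *)
Lemma oc_lower P b n (A : set K^^n) (v : R) : countable P -> D S P A -> bdd b A -> vl A < v ->
  exists k0, forall k, (k0 <= k)%N -> oc b k A <= v.
Proof.
move=> cP DA bA; rewrite -lte_fin -(vl_fin bA) => /ereal_inf_lt[_ [I [a [c [ac AI ->]]]]] sv.
set s := \esum_(i in I) _ in sv.
have s0 : (0 <= s)%E.
  by apply: esum_ge0 => k _; rewrite lee_fin; apply: prodr_ge0 => i _; rewrite subr_ge0.
have /fineK sE : s \is a fin_num by rewrite ge0_fin_numE // (lt_trans sv) // ltry.
rewrite -sE lte_fin in sv; set e := v - fine s; have e0 : 0 < e by rewrite subr_gt0.
(* Rational corners make sense in [K]. The enlargement and the counting error of the box number [k]
   together may cost [e * 2 ^- k.+1], which sums to at most [e]. *)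
have Hk k : exists ac' : ('I_n -> rat) * ('I_n -> rat), exists k0 : nat,
   [/\ forall i, ratr (ac'.1 i) < a k 0 i /\ c k 0 i < ratr (ac'.2 i), forall i, ac'.1 i <= ac'.2 i &
    forall m, (k0 <= m)%N -> oc b m (kbox ac'.1 ac'.2) <= vol (a k) (c k) + e * 2%:R ^- k.+1].
  have [||d d0 Hd] := @prod_eps n (fun i => c k 0 i - a k 0 i) (e * 2%:R ^- k.+1).
  - by move=> i; rewrite subr_ge0.
  - by rewrite mulr_gt0 // invr_gt0 pow2_gt0.
  have d20 : 0 < d / 2%:R by rewrite divr_gt0.
  have /choice[f Hf] i : exists q : rat * rat, [/\ ratr q.1 < a k 0 i, c k 0 i < ratr q.2, q.1 <= q.2 &
      ratr (q.2 - q.1) <= c k 0 i - a k 0 i + d / 2%:R].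
    by have [p [q Hpq]] := real_rat_box (ac k i) d20; exists (p, q).
  have [k0 Hk0] := pow2_small d20.
  exists (fun i => (f i).1, fun i => (f i).2), k0; split=> [i|i|m km] /=; try by have [] := Hf i.
  have f12 i : (f i).1 <= (f i).2 by have [] := Hf i.
  apply: le_trans (oc_kbox b m f12) _; apply: le_trans Hd; apply: ler_prod => i _.
  have [_ _ _ h] := Hf i; have := Hk0 m km => h'; apply/andP; split; last by lra.
  by apply: addr_ge0; [rewrite ler0q subr_ge0|rewrite divr_ge0 // ltW // pow2_gt0].
have [f Hf] := choice Hk.
have [|x Ax|p [G [GF GA]]] := @compactness P K^^n _ A
    [set Q | exists2 k, I k & Q = kbox (f k).1 (f k).2] cP DA.
- by move=> _ [k _ ->]; exact: D_kbox.
- have xf i : finite_elt (x 0 i) by apply: (@fin_itv _ b); have /andP[-> /ltW] := bA x Ax i.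
  pose y : R^^n := \row_i str (x 0 i).
  have Ay : st_image A y by exists x => // i; rewrite mxE st_str.
  have [k Ik yk] := AI y Ay; exists (kbox (f k).1 (f k).2); first by exists k.
  move=> i; have [k0 [/(_ i)[h1 h2] _ _]] := Hf k.
  have := yk i; rewrite mxE => /andP[y1 y2]; have Hs := strP (xf i).
  by split; [apply: (Hs _).1|apply: (Hs _).2]; lra.
have /choice[g Hg] i : exists k, I k /\ G i = kbox (f k).1 (f k).2.
  by have [k Ik E] := GF i; exists k.
have /choice[h Hh] k : exists k0 : nat, forall m, (k0 <= m)%N ->
    oc b m (kbox (f k).1 (f k).2) <= vol (a k) (c k) + e * 2%:R ^- k.+1.
  by have [k0 [_ _ H]] := Hf k; exists k0.
pose M := (\max_i g i).+1.
have gM i : (g i < M)%N by rewrite ltnS leq_bigmax.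
exists (\max_(k < M) h k) => m hm.
pose J := [seq k : 'I_M <- enum 'I_M | [exists i, g i == k :> nat]].
apply: le_trans (oc_bigU b m (s := J) (B := fun k : 'I_M => kbox (f k).1 (f k).2) _) _.
  move=> x /GA[i]; rewrite (Hg i).2 => xi; exists (Ordinal (gM i)); split=> //.
  rewrite mem_filter mem_enum andbT; apply/existsP; exists i => /=; exact: eqxx.
rewrite big_filter big_enum_cond /=.
apply: (@le_trans _ _ (\sum_(k < M | [exists i, g i == k :> nat]) (vol (a k) (c k) + e * 2%:R ^- k.+1))).
  by apply: ler_sum => k _; apply: Hh; apply: leq_trans hm; exact: leq_bigmax.
rewrite big_split /= -(subrK (fine s) v) addrC; apply: lerD.
  rewrite -mulr_sumr -[leRHS]mulr1 ler_pM2l //; apply: le_trans (geo_sum M).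
  by rewrite [leRHS](bigID (fun k : 'I_M => [exists i, g i == k :> nat])) /= lerDl sumr_ge0 // => k _;
    rewrite invr_ge0 ltW // pow2_gt0.
rewrite -lee_fin sE -sumEFin.
pose X : set nat := [set k | exists i, g i = k].
have fX : finite_set X.
  rewrite (_ : X = g @` [set: 'I_p]); first by apply: finite_image; exact: finite_finset.
  by apply/seteqP; split=> k [i]; [move=> <-; exists i|move=> _ <-; exists i].
apply: ereal_sup_ubound; exists X.
  split=> // _ [i <-]; exact: (Hg i).1.
pose r := [seq val k | k <- J].
have Er : [set` r] = X.
  apply/seteqP; split=> k /=.
    by move=> /mapP[q + ->]; rewrite mem_filter => /andP[/existsP[i /eqP gi] _]; exists i.
  move=> [i gi]; apply/mapP; have kM : (k < M)%N by rewrite -gi.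
  exists (Ordinal kM) => //; rewrite mem_filter mem_enum andbT; apply/existsP; exists i; exact/eqP.
rewrite -Er -fsbig_seq; last by rewrite (map_inj_uniq val_inj) filter_uniq // enum_uniq.
by rewrite big_map big_filter big_enum_cond.
Qed.

Lemma bdd_sub b n (A B : set K^^n) : A `<=` B -> bdd b B -> bdd b A.
Proof. by move=> AB bB x /AB; exact: bB. Qed.

Lemma bddU b n (A B : set K^^n) : bdd b A -> bdd b B -> bdd b (A `|` B).
Proof. by move=> bA bB x [/bA|/bB]. Qed.

Lemma vl_mono b n (A B : set K^^n) : bdd b B -> A `<=` B -> vl A <= vl B.
Proof.
move=> bB AB; rewrite -lee_fin -(vl_fin bB) -(vl_fin (bdd_sub AB bB)).
by apply: lo_mono => y [x /AB Bx xy]; exists x.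
Qed.

Lemma vl_set0 n : vl (@set0 K^^n) = 0.
Proof.
rewrite /vl (_ : st_image _ = set0) ?lebesgue_outer0 //.
by apply/seteqP; split=> // y [].
Qed.

Lemma vlU_le P b n (A B : set K^^n) : countable P -> D S P A -> D S P B -> bdd b A -> bdd b B ->
  vl (A `|` B) <= vl A + vl B.
Proof.
move=> cP DA DB bA bB; apply/ler_addgt0Pr => e e0.
have e2 : 0 < e / 2%:R by rewrite divr_gt0.
have [|k1 H1] := oc_lower cP DA bA (v := vl A + e / 2%:R); first by rewrite ltrDl.
have [|k2 H2] := oc_lower cP DB bB (v := vl B + e / 2%:R); first by rewrite ltrDl.
have := H1 _ (leq_maxl k1 k2); have := H2 _ (leq_maxr k1 k2); set k := maxn _ _ => h2 h1.
apply: le_trans (vl_le k (bddU bA bB)) _; apply: le_trans (ocU b k A B) _; lra.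
Qed.

Lemma vl_eps b n (A : set K^^n) : bdd b A -> (forall e : R, 0 < e -> exists k, oc b k A <= e) -> vl A = 0.
Proof.
move=> bA H; apply/eqP; rewrite eq_le vl_ge0 andbT; apply/ler_addgt0Pr => e e0.
by have [k Hk] := H e e0; rewrite add0r; apply: le_trans (vl_le k bA) Hk.
Qed.

Lemma card_fibers (T U : finType) (X : {set T}) (f : T -> U) (Y : {set U}) d :
  (forall x, x \in X -> f x \in Y) ->
  (forall y, #|[set x in X | f x == y]%SET| <= d)%N -> (#|X| <= d * #|Y|)%N.
Proof.
move=> XY Hd; rewrite -sum1_card (partition_big f (mem Y)) //= mulnC -sum_nat_const.
apply: leq_sum => y _; apply: leq_trans (Hd y); rewrite -sum1_card; apply: eq_leq.
by apply: eq_bigl => x; rewrite inE.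
Qed.

Definition dropc M n (i : 'I_n.+1) (j : {ffun 'I_n.+1 -> 'I_M}) : {ffun 'I_n -> 'I_M} :=
  [ffun l => j (lift i l)].

Lemma dropc_inj M n (i : 'I_n.+1) (j j' : {ffun 'I_n.+1 -> 'I_M}) : dropc i j = dropc i j' ->
  j i = j' i -> j = j'.
Proof.
move=> E Ei; apply/ffunP => l; case: (unliftP i l) => [l' ->|->//].
by have := congr1 (fun h : {ffun _} => h l') E; rewrite !ffunE.
Qed.

(** In a column over an [n]-dimensional dyadic cube the indices of the cubes that meet [A] differ by
    at most [C * n], so there are at most [C * n + 1] of them. *)
Lemma cells_graph b k n (i : 'I_n.+1) (A : set K^^n.+1) C :
  (forall x y, A x -> A y -> `|x 0 i - y 0 i| <= C%:R * l1 (col' i x - col' i y)) ->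
  (#|cells b k A| <= (C * n).+1 * (b * 2 ^ k) ^ n)%N.
Proof.
move=> HA; have -> : ((b * 2 ^ k) ^ n)%N = #|[set: {ffun 'I_n -> 'I_(b * 2 ^ k)}]%SET|.
  by rewrite cardsT card_ffun !card_ord.
apply: (card_fibers (f := dropc i)) => [j|y]; first by rewrite finset.in_setT.
set F := [set x in _ | _]%SET.
have -> : #|F| = #|[set (j : {ffun 'I_n.+1 -> 'I_(b * 2 ^ k)}) i | j in F]%SET|.
  rewrite card_in_imset // => j j' /setIdP[_ /eqP Ej] /setIdP[_ /eqP Ej'].
  by apply: dropc_inj; rewrite Ej Ej'.
rewrite -(ler_nat R) -natr1; apply: card_span => [|_ _ /imsetP[j + ->] /imsetP[j' + ->]].
  by rewrite natr1.
move=> /setIdP[/in_cells[x Ax jx] /eqP Ej] /setIdP[/in_cells[x' Ax' jx'] /eqP Ej'].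
have p2 := pow2_gt0 K k.
have Cl : `|x 0 i - x' 0 i| * 2%:R ^+ k <= (C * n)%:R.
  apply: (@le_trans _ _ (C%:R * l1 (col' i x - col' i x') * 2%:R ^+ k)).
    by rewrite ler_pM2r //; exact: HA.
  rewrite natrM -mulrA ler_wpM2l // /l1 mulr_suml -[n in X in _ <= X]card_ord -sum1_card natr_sum.
  apply: ler_sum => l _; rewrite !mxE -[2%:R ^+ k](gtr0_norm p2) -normrM mulrBl.
  have E : j (lift i l) = j' (lift i l).
    by have := congr1 (fun h : {ffun _} => h l) (etrans Ej (esym Ej')); rewrite !ffunE.
  have := jx (lift i l); have := jx' (lift i l); rewrite E ler_norml; lra.
have : (j i <= j' i + C * n)%N.
  rewrite -ltnS -(ltr_nat K) -natr1 natrD; have := jx i; have := jx' i.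
  have := ler_norm ((x 0 i - x' 0 i) * 2%:R ^+ k); rewrite normrM (gtr0_norm p2) mulrBl; lra.
by rewrite -(ler_nat R) natrD; lra.
Qed.

Lemma cells_drop b k n (i : 'I_n.+1) (A : set K^^n.+1) :
  (#|cells b k A| <= b * 2 ^ k * #|cells b k [set v | exists t, A (ins i t v)]|)%N.
Proof.
apply: (card_fibers (f := dropc i)) => [j /in_cells[x Ax jx]|y].
  apply/in_cells; exists (col' i x); first by exists (x 0 i); rewrite ins_col'.
  by move=> l; rewrite ffunE mxE; exact: jx.
set F := [set x in _ | _]%SET.
have -> : #|F| = #|[set (j : {ffun 'I_n.+1 -> 'I_(b * 2 ^ k)}) i | j in F]%SET|.
  rewrite card_in_imset // => j j' /setIdP[_ /eqP Ej] /setIdP[_ /eqP Ej'].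
  by apply: dropc_inj; rewrite Ej Ej'.
by rewrite -[X in (_ <= X)%N]card_ord max_card.
Qed.

Lemma surface_graph P n i k (nu : K^^n.+1) u x y : surface P i k nu u ->
  u x = 0 -> u y = 0 -> `|x 0 i - y 0 i| <= 3%:R * l1 (col' i x - col' i y).
Proof.
move=> Su ux uy; have := surface_lip (ins i (x 0 i) (col' i y)) x Su.
rewrite ux subr0 -{3}(ins_col' i x) insB subrr l1_ins normr0 add0r.
rewrite (_ : l1 (col' i y - col' i x) = l1 (col' i x - col' i y)); last first.
  by rewrite /l1; apply: eq_bigr => l _; rewrite !mxE distrC.
move: Su ux uy => [_ _ _ _ [a Ha]]; rewrite !Ha insE col'_ins => _ /eqP.
by rewrite subr_eq0 => /eqP ->.
Qed.

Lemma gen_scale P n (x : K^^n) (c : nat) : (0 < c)%N -> gen P x -> gen P (c%:R *: x).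
Proof.
move=> c0 /gen_rk gx; apply: rk_gen => //; apply: (rk_acl) gx => _ /valsP[i ->].
have c0' : c%:R != 0 :> K by rewrite pnatr_eq0 -lt0n.
have -> : x 0 i = (c%:R *: x) 0 i / c%:R by rewrite mxE mulrC mulKf.
have Dc : Df S P (fun y : K => y / c%:R).
  by apply: Df_mul; [exact: Df_id|apply: Df_inv; exact: Df_nat].
apply: (acl_fun (g := fun y : K => y / c%:R)); first by apply: Df_mono Dc => z; left.
by apply: acl_dcl; apply: acl_mem; right; rewrite /= mem_vals.
Qed.

Lemma oc_drop b k n (i : 'I_n.+1) (A : set K^^n.+1) :
  oc b k A <= b%:R * oc b k [set v | exists t, A (ins i t v)].
Proof.
rewrite /oc mulrA -[(k * n.+1)%N]/(k * n.+1)%N mulnS exprD invfM mulrA.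
rewrite ler_pM2r ?invr_gt0 ?pow2_gt0 // ler_pdivrMr ?pow2_gt0 //.
rewrite mulrAC -natrX -!natrM ler_nat; exact: cells_drop.
Qed.

Lemma bdd_drop b n (i : 'I_n.+1) (A : set K^^n.+1) : bdd b A -> bdd b [set v | exists t, A (ins i t v)].
Proof. by move=> bA v [t /bA H] l; have := H (lift i l); rewrite ins_lift. Qed.

(** The points of rank [n] lie on finitely many Lipschitz hypersurfaces, which meet few cubes by
    [cells_graph]. The remaining points have rank below [n], so their projection contains no generic
    point and is small by induction. *)
Lemma small_nogen P b n (A : set K^^n) : countable P -> D S P A -> bdd b A ->
  (forall x, A x -> ~ gen P x) -> vl A = 0.
Proof.
move=> cP; elim: n A => [|n IH] A DA bA NA.
  rewrite (_ : A = set0) ?vl_set0 //; apply/seteqP; split=> // x /NA; case.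
  by rewrite /gen /vals enum_ord0.
have [b0|b0] := posnP b.
  rewrite (_ : A = set0) ?vl_set0 //; apply/seteqP; split=> // x /bA/(_ ord0).
  by rewrite b0 => /andP[x0]; rewrite ltNge x0.
have b0' : 0 < b%:R :> K by rewrite ltr0n.
have [N HLD] := LD_ex n.
(* The surfaces are constructed inside the unit cube only; scaling by [b] does not change ranks. *)
pose A' : set K^^n.+1 := [set x | A (b%:R *: x)].
have Dsc (c : K) : Df S P (fun _ : K^^n.+1 => c) -> Df S P (fun x : K^^n.+1 => c *: x).
  move=> Dc; apply: Df_rV => i; under eq_fun do rewrite mxE.
  by apply: Df_mul => //; apply: Df_entry; exact: Df_id.
have DA' : D S P A' by apply: (D_comp DA); apply: Dsc; exact: Df_nat.
have [|z /NA Nz /(gen_scale b0)//|r [s [Hs Zs]]] := surface_cover HLD cP DA'.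
  move=> x /bA H i; have := H i; rewrite mxE => /andP[h1 h2]; apply/andP; split.
    by rewrite -(pmulr_rge0 _ b0').
  by rewrite -(ler_pM2l b0') mulr1 ltW.
pose u q x := (s q).2 (b%:R^-1 *: x).
have Du q : Df S P (u q).
  have [Ds _ _ _ _] := Hs q.
  apply: (Df_comp Ds); apply: Dsc; apply: Df_inv; exact: Df_nat.
pose A0 : set K^^n.+1 := [set x | A x /\ forall q, u q x <> 0].
have DA0 : D S P A0.
  apply: D_and => //; apply: D_big => q; apply: D_not; apply: D_eqT => //; exact: Df_0.
pose B : set K^^n := [set v | exists t, A0 (ins ord0 t v)].
have bA0 : bdd b A0 by apply: bdd_sub bA => x [].
have bB : bdd b B by exact: bdd_drop.
have DB : D S P B.
  have DA0' : D S P A0 := DA0.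
  apply: D_ex; apply: (D_comp DA0); apply: Df_ins; ddef.
have B0 : vl B = 0.
  apply: IH => // v [t [At ut]] gv.
  have [||q Hq] := Zs (b%:R^-1 *: ins ord0 t v).
  - by rewrite /A' /= scalerA divff ?scale1r // gt_eqF.
  - apply: (rk_acl) (gen_rk gv) => y /valsP[j ->].
    apply: (acl_mono (P := P <+ (b%:R^-1 *: ins ord0 t v))) => //.
    have -> : v 0 j = b%:R * (b%:R^-1 *: ins ord0 t v) 0 (lift ord0 j).
      by rewrite mxE ins_lift mulrA divff ?mul1r // gt_eqF.
    have Dc : Df S P (fun y : K => b%:R * y) by apply: Df_mul; [exact: Df_nat|exact: Df_id].
    apply: (acl_fun (g := fun y : K => b%:R * y)); first by apply: Df_mono Dc => z; left.
    by apply: acl_dcl; apply: acl_mem; right; rewrite /= mem_vals.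
  by apply: (ut q).
apply: (vl_eps (b := b)) => // e e0.
have e20 : 0 < e / 2%:R by rewrite divr_gt0.
have [|k1 H1] := oc_lower cP DB bB (v := e / 2%:R / b%:R).
  by rewrite B0 divr_gt0 ?ltr0n.
pose C := (r * (3 * n).+1 * b ^ n)%N.
have [|k2 H2] := @pow2_small (e / (C.+1)%:R).
  by rewrite divr_gt0 ?ltr0n.
exists (maxn k1 k2); have := H1 _ (leq_maxl k1 k2); have := H2 _ (leq_maxr k1 k2).
set k := maxn _ _ => h2 h1; have p2 := pow2_gt0 R k.
have ocA0 : oc b k A0 <= e / 2%:R.
  apply: le_trans (oc_drop b k ord0 A0) _.
  by rewrite mulrC -ler_pdivlMr ?ltr0n.
have ocq q : oc b k [set x | A x /\ u q x = 0] <= ((3 * n).+1 * b ^ n)%:R / 2%:R ^+ k.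
  rewrite /oc ler_pdivrMr ?pow2_gt0 // mulnS exprD mulrA divfK ?gt_eqF // exprM.
  rewrite -!natrX -natrM ler_nat -mulnA -expnMn.
  apply: (@cells_graph b k n (s q).1.1.1) => x y [_ ux] [_ uy].
  have := surface_graph (Hs q) ux uy.
  rewrite -[(b%:R^-1 *: x) 0 _]/((b%:R^-1 *: x) 0 (s q).1.1.1) !mxE -mulrBr normrM gtr0_norm ?invr_gt0 //.
  rewrite -(ler_pM2l b0') mulrA divff ?gt_eqF // mul1r => h; apply: le_trans h _.
  rewrite mulrCA ler_pM2l // /l1 mulr_sumr; apply: ler_sum => l _.
  by rewrite !mxE -mulrBr normrM gtr0_norm ?invr_gt0 // mulrA divff ?mul1r ?gt_eqF.
pose BB (o : option 'I_r) : set K^^n.+1 := if o is Some q then [set x | A x /\ u q x = 0] else A0.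
apply: le_trans (oc_bigU b k (s := None :: [seq Some q | q <- enum 'I_r]) (B := BB) _) _.
  move=> x Ax; have [[q uq]|N0] := pselect (exists q, u q x = 0).
    by exists (Some q); split=> //; rewrite in_cons /= map_f // mem_enum.
  exists None; split; first exact: mem_head.
  by split=> // q uq; apply: N0; exists q.
rewrite big_cons /= big_map big_enum /=.
have -> : e = e / 2%:R + e / 2%:R by field.
apply: lerD => //; apply: le_trans (ler_sum _ (fun q _ => ocq q)) _.
rewrite sumr_const card_ord -[leLHS]mulr_natl mulrA -natrM mulnA -/C.
have h2' : C.+1%:R * (2%:R / 2%:R ^+ k) <= e by rewrite mulrC -ler_pdivlMr ?ltr0n.
have i0 : 0 <= (2%:R ^+ k)^-1 :> R by rewrite invr_ge0 ltW.
have C0 : 0 <= C%:R :> R by rewrite ler0n.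
rewrite -natr1 in h2'; nra.
Qed.

(** * Additivity of the volume *)

Definition bd n (X : set K^^n) : set K^^n := [set z | forall d : K, 0 < d ->
  exists x y : K^^n, [/\ box z d x, box z d y, X x & ~ X y]].

Lemma D_bd P n (X : set K^^n) : D S P X -> D S P (bd X).
Proof.
move=> DX; have : D S P (fun z : K^^n => forall d : K, 0 < d ->
  exists x y : K^^n, (box z d x /\ box z d y) /\ (X x /\ ~ X y)) by rewrite /box; ddef.
apply: D_ext => z; split=> H d d0; have [x [y Hxy]] := H d d0; exists x, y.
  by move: Hxy => [[? ?] [? ?]]; split.
by move: Hxy => [? ? ? ?]; split.
Qed.

Lemma bd_nogen P n (X : set K^^n) z : countable P -> D S P X -> bd X z -> ~ gen P z.
Proof.
move=> cP DX Hz gz; have [Xz|Xz] := pselect (X z).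
  have [d d0 Hd] := near_gen cP gz DX Xz.
  by have [x [y [_ zy _]]] := Hz d d0; apply; exact: Hd.
have [d d0 Hd] := near_gen cP gz (D_not DX) Xz.
by have [x [y [zx _ Xx _]]] := Hz d d0; exact: (Hd x).
Qed.

(** The supremum of the parameters whose points lie in [X] gives a boundary point; it may be the end
    point [y], which is outside [X]. *)
Lemma bd_segment P n (X : set K^^n) (x y : K^^n) : D S P X -> X x -> ~ X y ->
  exists2 t : K, 0 <= t <= 1 & bd X (x + t *: (y - x)).
Proof.
move=> DX Xx Xy; pose g (t : K) := x + t *: (y - x).
have g0 : g 0 = x by rewrite /g scale0r addr0.
have g1 : g 1 = y by rewrite /g scale1r addrC subrK.
pose Q t := (0 <= t /\ t <= 1) /\ X (g t).
have Dg : Df S (P <+ x <+ y) g.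
  have Dx i : D S (P <+ x <+ y) (fun t => t = x 0 i).
    by apply: acl_dcl; apply: acl_mem; left; right; rewrite /= mem_vals.
  have Dy i : D S (P <+ x <+ y) (fun t => t = y 0 i).
    by apply: acl_dcl; apply: acl_mem; right; rewrite /= mem_vals.
  apply: Df_rV => i; have -> : (fun t => g t 0 i) = fun t => x 0 i + t * (y 0 i - x 0 i).
    by apply/funext => t; rewrite /g !mxE.
  have Dc (c : K) : D S (P <+ x <+ y) (fun t => t = c) ->
    Df S (P <+ x <+ y) (fun _ : K => c) by move=> H; rewrite /Df; ddef.
  by apply: Df_add; [exact: Dc|apply: Df_mul; [exact: Df_id|apply: Df_add; [|apply: Df_opp]; exact: Dc]].
have DX' : D S (P <+ x <+ y) X by apply: D_mono DX => z; left; left.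
have DQ : D S (P <+ x <+ y) Q.
  by rewrite /Q; apply: D_and; [ddef|exact: D_comp DX' Dg].
have [||s [s1 s2]] := def_sup DQ (x := 0) (b := 1).
- by split; [split|rewrite g0].
- by move=> t [[]].
have s0 : 0 <= s by apply: s1; split; [split|rewrite g0].
have s1' : s <= 1 by apply: s2 => t [[]].
exists s; first by rewrite s0 s1'.
move=> d d0; have [e e0 He] : exists2 e : K, 0 < e & forall t, `|t - s| < e -> box (g s) d (g t).
  have l0 := l1_ge0 (y - x).
  exists (d / (l1 (y - x) + 1)); first by rewrite divr_gt0 //; lra.
  move=> t ts i; rewrite /g !mxE opprD addrACA subrr add0r -mulrBl normrM.
  apply: (@le_lt_trans _ _ (`|t - s| * (l1 (y - x) + 1))).
    by rewrite ler_wpM2l //; have := le_l1 (y - x) i; rewrite !mxE; lra.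
  by rewrite -ltr_pdivlMr //; lra.
have [t [Qt ts st]] : exists t, [/\ Q t, t <= s & s - e < t].
  apply: contrapT => N; suff : s <= s - e by lra.
  apply: s2 => t Qt; rewrite leNgt; apply/negP => st; apply: N; exists t; split=> //; exact: s1.
have [t' [Nt' t's]] : exists t', ~ X (g t') /\ `|t' - s| < e.
  have [->|sn1] := eqVneq s 1; first by exists 1; rewrite g1 subrr normr0.
  have [q [q0 qe q1]] := @min2 e (1 - s) e0 ltac:(rewrite subr_gt0 lt_neqAle sn1 s1' //).
  exists (s + q / 2%:R); split.
    move=> Xq; suff : s + q / 2%:R <= s by lra.
    by apply: s1; split=> //; split; lra.
  by rewrite addrC addKr gtr0_norm; lra.
exists (g t), (g t'); split=> //; [apply: He|exact: He|by case: Qt].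
by rewrite ler0_norm; lra.
Qed.

Lemma cell_segment b k n (j : {ffun 'I_n -> 'I_(b * 2 ^ k)}) (x y : K^^n) t :
  cell j x -> cell j y -> 0 <= t <= 1 -> cell j (x + t *: (y - x)).
Proof.
move=> jx jy /andP[t0 t1] i; have := jx i; have := jy i; rewrite !mxE mulrDl -mulrA mulrBl.
set a := x 0 i * _; set c := y 0 i * _ => /andP[c1 c2] /andP[a1 a2].
have -> : a + t * (c - a) = (1 - t) * a + t * c by ring.
have h0 : 0 <= 1 - t by lra.
set m := (j i)%:R in c1 c2 a1 a2 *.
have e1 : (1 - t) * m <= (1 - t) * a by rewrite ler_wpM2l.
have e2 : t * m <= t * c by rewrite ler_wpM2l.
apply/andP; split; first lra.
have [t00|t00] := eqVneq t 0; first by rewrite t00; lra.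
have e3 : (1 - t) * a <= (1 - t) * (m + 1) by rewrite ler_wpM2l // ltW.
have e4 : t * c < t * (m + 1) by rewrite ltr_pM2l // lt_neqAle eq_sym t00.
lra.
Qed.

(** A cube that meets both sets meets the boundary of [X], since cubes are convex. The boundary has
    no generic points, hence volume 0, so that the cubes counted twice are negligible. *)
Lemma vlU P b n (X Y : set K^^n) : countable P -> D S P X -> D S P Y -> bdd b X -> bdd b Y ->
  (forall x, X x -> ~ Y x) -> vl (X `|` Y) = vl X + vl Y.
Proof.
move=> cP DX DY bX bY XY; apply/eqP; rewrite eq_le (vlU_le cP DX DY bX bY) /=.
pose B : set K^^n := bd X `&` [set z | forall i, 0 <= z 0 i < b%:R].
have DB : D S P B.
  apply: D_and; first exact: D_bd.
  have Db : Df S P (fun _ : K^^n => b%:R : K) by exact: Df_nat.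
  by have : D S P (fun z : K^^n => forall i, 0 <= z 0 i < b%:R) by ddef.
have bB : bdd b B by move=> z [].
have B0 : vl B = 0 by apply: (small_nogen cP DB bB) => x [Bx _]; exact: (bd_nogen cP DX Bx).
have key k : oc b k X + oc b k Y <= oc b k (X `|` Y) + oc b k B.
  rewrite /oc -!mulrDl ler_pM2r ?invr_gt0 ?pow2_gt0 // -!natrD ler_nat cellsU -cardsUI.
  rewrite leq_add2l subset_leq_card //; apply/fintype.subsetP => j.
  move=> /finset.setIP[/in_cells[x Xx jx] /in_cells[y Yy jy]].
  have [t t01 Bt] := bd_segment DX Xx (fun Xy => XY y Xy Yy).
  apply/in_cells; exists (x + t *: (y - x)); last exact: cell_segment.
  split=> // i; have jt := cell_segment jx jy t01 i; have p2 := pow2_gt0 K k.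
  apply/andP; split; first by rewrite -(pmulr_lge0 _ p2); apply: le_trans (proj1 (andP jt)).
  rewrite -(ltr_pM2r p2); apply: lt_le_trans (proj2 (andP jt)) _.
  by rewrite natr1 -natrX -natrM ler_nat ltn_ord.
apply/ler_addgt0Pr => e e0; have e20 : 0 < e / 2%:R by rewrite divr_gt0.
have [|k1 H1] := oc_lower cP DB bB (v := e / 2%:R); first by rewrite B0.
have [|k2 H2] := oc_lower cP (D_or DX DY) (bddU bX bY) (v := vl (X `|` Y) + e / 2%:R).
  by rewrite ltrDl.
have := H1 _ (leq_maxl k1 k2); have := H2 _ (leq_maxr k1 k2); set k := maxn _ _ => h2 h1.
have := key k; have := vl_le k bX; have := vl_le k bY.
rewrite -[fun x => X x \/ Y x]/(X `|` Y) in h2; lra.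
Qed.

Definition hbox b n : set K^^n := [set z | forall i, 0 <= z 0 i < b%:R].

Arguments hbox : clear implicits.

Lemma D_hbox P b n : D S P (hbox b n).
Proof.
have Db : Df S P (fun _ : K^^n => b%:R : K) by exact: Df_nat.
by have : D S P (fun z : K^^n => forall i, 0 <= z 0 i < b%:R) by ddef.
Qed.

Lemma bdd_hbox b n : bdd b (hbox b n).
Proof. by []. Qed.

Lemma vl_hbox b n : vl (hbox b n) = b%:R ^+ n.
Proof.
have ocE k : oc b k (hbox b n) = b%:R ^+ n.
  rewrite /oc (_ : cells _ _ _ = finset.setT); last first.
    apply/setP => j; rewrite finset.in_setT; apply/in_cells.
    have p2 := pow2_gt0 K k.
    exists (\row_i ((j i)%:R / 2%:R ^+ k)) => i; rewrite mxE.
      rewrite divr_ge0 ?ler0n ?(ltW p2) //= ltr_pdivrMr // -natrX -natrM ltr_nat; exact: ltn_ord.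
    by rewrite divfK ?gt_eqF // lexx ltrDl ltr01.
  rewrite cardsT card_ffun !card_ord natrX natrM natrX exprMn -exprM mulfK //.
have c0 : countable (@set0 K) by [].
apply/eqP; rewrite eq_le -{1}(ocE 0%N) vl_le //=; apply/ler_addgt0Pr => e e0.
have [|k1 /(_ k1 (leqnn _))] := oc_lower c0 (D_hbox set0 b n) (@bdd_hbox b n) (v := vl (hbox b n) + e).
  by rewrite ltrDl.
by rewrite ocE.
Qed.

Lemma vlC P b n (X : set K^^n) : countable P -> D S P X -> bdd b X ->
  vl (hbox b n `\` X) = b%:R ^+ n - vl X.
Proof.
move=> cP DX bX; have DC : D S P (hbox b n `\` X) by apply: D_and; [exact: D_hbox|exact: D_not].
have := vlU cP DX DC bX (bdd_sub (@subDsetl _ _ _) (@bdd_hbox b n)) (fun x Xx H => H.2 Xx).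
have -> : X `|` (hbox b n `\` X) = hbox b n.
  apply/seteqP; split=> x; first by move=> [/bX|[]].
  by move=> hx; have [Xx|Xx] := pselect (X x); [left|right].
rewrite vl_hbox; lra.
Qed.

(** * The Berarducci-Otero measure of definable sets *)

Section Translation.
Local Open Scope ereal_scope.

Lemma lo_translate n (X : set R^^n) (t : R^^n) :
  lebesgue_outer [set (x + t)%R | x in X] <= lebesgue_outer X.
Proof.
apply: le_ereal_inf_tmp => _ [I [a [b [ab XI ->]]]]; apply: ereal_inf_lbound.
exists I, (fun k => (a k + t)%R), (fun k => (b k + t)%R); split.
- by move=> k i; rewrite !mxE lerD2r.
- move=> _ [x /XI[k Ik xk] <-]; exists k => // i; rewrite !mxE !lerD2r; exact: xk.
- by apply: eq_esum => k _; congr _%:E; apply: eq_bigr => i _; rewrite !mxE opprD addrACA subrr addr0.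
Qed.

End Translation.

Definition tr n (c : K^^n) (A : set K^^n) : set K^^n := [set x - c | x in A].

(** Both translates consist of finite points, so [c - c'] is finite, and its standard part
    translates one image onto the other. *)
Lemma tr_st_le n (A : set K^^n) (c c' : K^^n) : tr c A `<=` finite_points K n ->
  tr c' A `<=` finite_points K n ->
  (lebesgue_outer (@st_image R K n (tr c' A)) <= lebesgue_outer (@st_image R K n (tr c A)))%E.
Proof.
move=> fc fc'; have [[x0 Ax0]|A0] := pselect (exists x, A x); last first.
  by apply: lo_mono => y [z [x Ax <-]]; case: A0; exists x.
have fcc i : finite_elt ((c - c') 0 i).
  have := finD (fc' _ (ex_intro2 _ _ x0 Ax0 erefl) i) (finN (fc _ (ex_intro2 _ _ x0 Ax0 erefl) i)).
  by congr finite_elt; rewrite !mxE; ring.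
apply: le_trans (lo_translate _ (\row_i str ((c - c') 0 i))).
apply: lo_mono => y [_ [x Ax <-] xy].
have fx i : finite_elt ((x - c) 0 i) by apply: fc; exists x.
exists (\row_i str ((x - c) 0 i)).
  by exists (x - c); [exists x|move=> i; rewrite mxE st_str].
apply/rowP => i; rewrite !mxE; have /st_stP H := xy i.
apply: stP_eq H; have := stPD (strP (fx i)) (strP (fcc i)).
by rewrite !mxE (_ : _ + _ = x 0 i - c' 0 i) //; ring.
Qed.

Lemma bdd_fin b n (A : set K^^n) : bdd b A -> A `<=` finite_points K n.
Proof. by move=> bA x Ax i; apply: (@fin_itv _ b); have /andP[-> /ltW] := bA x Ax i. Qed.

Lemma bo_premeasureE n (c : K^^n) b (A : set K^^n) : bdd b (tr c A) ->
  bo_premeasure R (A : set (definable_space S n)) = (vl (tr c A))%:E.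
Proof.
move=> bA; rewrite -(vl_fin bA); apply/eqP; rewrite eq_le; apply/andP; split.
  by apply: ereal_inf_lbound; exists c => //; exact: bdd_fin bA.
apply: le_ereal_inf_tmp => _ [c' /= fc' <-]; apply: tr_st_le => //; exact: bdd_fin bA.
Qed.

Lemma D_tr P n c (A : set K^^n) : D S P A -> exists P', [/\ P `<=` P', countable P -> countable P' & D S P' (tr c A)].
Proof.
move=> DA; exists (P <+ c); split; [exact: subsetUl|by move=> cP; ctb|].
have DA' : D S (P <+ c) A by apply: D_mono DA => x; left.
have Dc i (T : Type) (eT : encodable K T) : Df S (P <+ c) (fun _ : T => c 0 i).
  by apply: Df_cst; right; exact: mem_vals.
have : D S (P <+ c) (fun y => A (y + c)).
  apply: (D_comp DA'); apply: Df_rV => i.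
  have -> : (fun x : K^^n => (x + c) 0 i) = fun x => x 0 i + c 0 i by apply/funext => x; rewrite mxE.
  by apply: Df_add => //; apply: Df_entry; exact: Df_id.
apply: D_ext => y; split=> [Ay|[x Ax <-]]; last by rewrite subrK.
by exists (y + c) => //; rewrite addrK.
Qed.

Lemma fdiam_bdd n (A : set K^^n) : finite_diameter A -> exists (c : K^^n) b, bdd b (tr c A).
Proof.
move=> [d [N dN] dA]; have [[x0 Ax0]|A0] := pselect (exists x, A x); last first.
  by exists 0, 0%N => _ [x Ax <-]; case: A0; exists x.
exists (x0 - const_mx N%:R), (2 * N).+1 => _ [x Ax <-] i; rewrite !mxE.
have := le_trans (le_enorm (x - x0) i) (dA _ _ Ax Ax0); rewrite !mxE => h.
have : `|x 0 i - x0 0 i| <= N%:R by apply: (le_trans h); apply: le_trans (ler_norm d) dN.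
rewrite ler_norml -natr1 natrM => /andP[h1 h2]; apply/andP; split; lra.
Qed.

Lemma definable_D n (A : set K^^n) : definable S A -> exists2 P, countable P & D S P A.
Proof. by move=> /D_definable[P fP DA]; exists P => //; exact: finite_set_countable. Qed.

Lemma D_def P n (A : set K^^n) : D S P A -> definable S A.
Proof. by move=> [p _ pE]; exists p; apply/seteqP; split=> x /= /pE. Qed.

Lemma bo_premeasure_ge0' n (A : set (definable_space S n)) : (0 <= bo_premeasure R A)%E.
Proof. exact: bo_premeasure_ge0. Qed.

Lemma tr_bdd_def n (A : set K^^n) : small_definable S A -> exists (c : K^^n) b P,
  [/\ countable P, D S P (tr c A) & bdd b (tr c A)].
Proof.
move=> [/definable_D[P cP DA] /fdiam_bdd[c [b bA]]].
by have [P' [_ /(_ cP) cP' DA']] := D_tr c DA; exists c, b, P'.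
Qed.

Lemma tr_sub n c (A B : set K^^n) : A `<=` B -> tr c A `<=` tr c B.
Proof. by move=> AB _ [x /AB Bx <-]; exists x. Qed.

Lemma trU n c (A B : set K^^n) : tr c (A `|` B) = tr c A `|` tr c B.
Proof. exact: image_setU. Qed.

Lemma bo_premeasure_semi_additive n : @measure_function.semi_additive _ R (definable_space S n) (fun A => bo_premeasure R A).
Proof.
move=> F k mF tF mU; elim: k mU => [|k IH] mU.
  by rewrite !big_ord0 bo_premeasure0.
rewrite !big_ord_recr /= in mU *; set U := \big[_/_]_(i < k) _ in IH mU *.
have [c [b [P [cP DA bA]]]] := tr_bdd_def mU.
have sU : small_definable S U.
  split; last first.
    by have [_ [d df dU]] := mU; exists d => // x y Ux Uy; apply: dU; left.
  rewrite /U; elim: (k) => [|k' IH']; first by rewrite big_ord0; have [] := small_definable0 S n.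
  rewrite big_ord_recr /=; have [[p ->] _] := mF k'; move: IH' => [q ->].
  exists (FNot (FAnd (FNot q) (FNot p))); apply/seteqP; split=> x /=; last by move/not_andP => [] /contrapT; [left|right].
  by move=> [Hq|Hp] [].
have IH' := IH sU.
have [P1 cP1 DU] := definable_D sU.1; have [P2 cP2 DF] := definable_D (mF k).1.
have bU : bdd b (tr c U) by apply: bdd_sub bA; apply: tr_sub; exact: subsetUl.
have bF : bdd b (tr c (F k)) by apply: bdd_sub bA; apply: tr_sub; exact: subsetUr.
rewrite -IH' (bo_premeasureE bA) (bo_premeasureE bU) (bo_premeasureE bF) -EFinD; congr _%:E.
have [P1' [_ /(_ cP1) cP1' DU']] := D_tr c DU; have [P2' [_ /(_ cP2) cP2' DF']] := D_tr c DF.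
have cP12 := countable_setU cP1' cP2'.
have DU12 : D S (P1' `|` P2') (tr c U) by apply: D_mono DU' => x; left.
have DF12 : D S (P1' `|` P2') (tr c (F k)) by apply: D_mono DF' => x; right.
rewrite trU; apply: (vlU cP12 DU12 DF12 bU bF).
move=> _ [x Ux <-] [y Fy] /addIr xy; rewrite xy in Fy; move: Ux.
rewrite /U -bigcup_mkord => -[i /= ik Fi].
have E : i = k by apply: (tF i k I I); exists x.
by rewrite E ltnn in ik.
Qed.

(** By compactness finitely many of the covering sets suffice, and finite subadditivity is
    available. The sets are first intersected with [A], so that a single translation makes all of
    them bounded. *)
Lemma bo_premeasure_subadditive n : @measurable_subset_sigma_subadditive _ R (definable_space S n) (fun A => bo_premeasure R A).
Proof.
move=> A F mF mA AF; have [c [b [P [cP DA bA]]]] := tr_bdd_def mA.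
have /choice[Q HQ] k : exists Q, countable Q /\ D S Q (tr c (F k)).
  have [Q0 cQ0 DF] := definable_D (mF k).1; have [Q [_ /(_ cQ0) cQ DQ]] := D_tr c DF.
  by exists Q.
pose PP := P `|` \bigcup_k Q k.
have cPP : countable PP.
  by apply: countable_setU => //; apply: bigcup_countable => [|k _]; [exact: countableP|exact: (HQ k).1].
have DAA : D S PP (tr c A) by apply: D_mono DA => x; left.
have DFF k : D S PP (tr c (F k)) by apply: D_mono (HQ k).2 => x Qx; right; exists k.
have [|x|p [G [GF GA]]] := @compactness PP K^^n _ (tr c A)
    [set Z | exists k, Z = tr c (F k) `&` tr c A] cPP DAA.
- by move=> _ [k ->]; apply: D_and.
- move=> [x' Ax' <-]; have [k _ Fk] := AF x' Ax'.
  by exists (tr c (F k) `&` tr c A); [exists k|split; exists x'].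
have /choice[g Hg] i : exists k, G i = tr c (F k) `&` tr c A by exact: GF.
pose M := (\max_i g i).+1.
have gM i : (g i < M)%N by rewrite ltnS leq_bigmax.
have sub1 k : bdd b (tr c (F k `&` A)) by apply: bdd_sub bA; apply: tr_sub; exact: subIsetr.
have trI k : tr c (F k `&` A) = tr c (F k) `&` tr c A.
  apply/seteqP; split=> [_ [x [Fx Ax] <-]|y [[x Fx <-] [z Az /addIr zx]]]; first by split; exists x.
  by exists x => //; split=> //; rewrite -zx.
have le1 k : ((vl (tr c (F k `&` A)))%:E <= bo_premeasure R (F k))%E.
  rewrite -(bo_premeasureE (sub1 k)); have [c' [b' [P' [_ _ bF]]]] := tr_bdd_def (mF k).
  have bFA : bdd b' (tr c' (F k `&` A)) by apply: bdd_sub bF; apply: tr_sub; exact: subIsetl.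
  rewrite (bo_premeasureE bF) (bo_premeasureE bFA) lee_fin.
  by apply: (vl_mono bF); apply: tr_sub; exact: subIsetl.
rewrite (bo_premeasureE bA).
apply: (@le_trans _ _ (\sum_(0 <= k < M) bo_premeasure R (F k))%E); last first.
  by apply: nneseries_lim_ge => k _ _; exact: bo_premeasure_ge0.
rewrite big_mkord; apply: (@le_trans _ _ (\sum_(k < M) (vl (tr c (F k `&` A)))%:E)%E); last first.
  by apply: lee_sum => k _; exact: le1.
rewrite sumEFin lee_fin.
pose U m := [set x | exists k, (k < m)%N /\ tr c (F k `&` A) x].
have US m : U m.+1 = U m `|` tr c (F m `&` A).
  apply/seteqP; split=> x.
    move=> [k [+ Hk]]; rewrite ltnS leq_eqVlt => /orP[/eqP <-|km]; [by right|left; by exists k].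
  by move=> [[k [km Hk]]|Hm]; [exists k; split=> //; exact: ltnW|exists m].
have bU m : bdd b (U m) by move=> x [k [_ /sub1]].
have U0 : U 0%N = set0 by apply/seteqP; split=> // x [k []].
have DU m : D S PP (U m).
  elim: m => [|m IH]; first by rewrite U0; apply: D_const.
  by rewrite US; apply: D_or => //; rewrite trI; apply: D_and.
have key m : vl (U m) <= \sum_(k < m) vl (tr c (F k `&` A)).
  elim: m => [|m IH]; first by rewrite U0 vl_set0 big_ord0.
  rewrite US big_ord_recr /=; apply: le_trans (vlU_le cPP (DU m) _ (bU m) (sub1 m)) _.
    by rewrite trI; apply: D_and.
  by rewrite lerD2r.
apply: le_trans (key M); apply: (vl_mono (bU M)) => x /GA[i].
by rewrite Hg -trI => Gx; exists (g i); split.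
Qed.

HB.instance Definition _ n := isContent.Build _ (definable_space S n) R (@bo_premeasure R L K S n)
  (@bo_premeasure_ge0' n) (@bo_premeasure_semi_additive n).

HB.instance Definition _ n := Content_SigmaSubAdditive_isMeasure.Build _ R (definable_space S n)
  (@bo_premeasure R L K S n) (@bo_premeasure_subadditive n).

Lemma tr0 n (A : set K^^n) : tr 0 A = A.
Proof. by apply/seteqP; split=> [_ [x Ax <-]|x Ax]; [rewrite subr0|exists x; rewrite ?subr0]. Qed.

Lemma bdd_small b n (A : set K^^n) : definable S A -> bdd b A -> small_definable S A.
Proof.
move=> dA bA; split=> //; exists (n * b)%:R; first exact: fin_nat.
move=> x y Ax Ay; apply: le_trans (enorm_le_sum _) _.
rewrite natrM -[n in X in _ <= X]card_ord -sum1_card natr_sum mulr_suml.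
apply: ler_sum => i _; rewrite mul1r !mxE ler_norml.
have := bA x Ax i; have := bA y Ay i; lra.
Qed.

Lemma bo_measurable b n (A : set K^^n) : definable S A -> bdd b A ->
  measurable (A : set (caratheodory_type (@bo_outer R L K S n))).
Proof.
move=> dA bA; have mA : measurable (A : set (definable_space S n)) by exact: bdd_small dA bA.
apply: (@sub_caratheodory _ (definable_space S n) R (@bo_premeasure R L K S n : {measure set (definable_space S n) -> \bar R})).
exact: sub_gen_smallest.
Qed.

Lemma bo_measureE b n (A : set K^^n) : definable S A -> bdd b A ->
  bo_measure R S n A = (vl A)%:E.
Proof.
move=> dA bA; have mA : measurable (A : set (definable_space S n)) by exact: bdd_small dA bA.
rewrite [LHS](@measurable_mu_extE _ R (definable_space S n) (@bo_premeasure R L K S n : {measure set (definable_space S n) -> \bar R}) A mA).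
by have := @bo_premeasureE n 0 b A; rewrite tr0 => /(_ bA).
Qed.

(** * Fubini theorem *)

Section Split.
Variables (n k m : nat) (p : 'I_m -> 'I_n + 'I_k) (q : 'I_n + 'I_k -> 'I_m).
Hypotheses (pK : cancel p q) (qK : cancel q p).

(** The splitting of the coordinates into two blocks is an arbitrary bijection, because the charts
    of the coarea formula choose their coordinates freely. *)
Definition mix (T : Type) (y : T^^n) (z : T^^k) : T^^m :=
  \row_i match p i with inl a => y 0 a | inr c => z 0 c end.

Lemma mixl T (y : T^^n) z a : mix y z 0 (q (inl a)) = y 0 a.
Proof. by rewrite mxE qK. Qed.

Lemma mixr T (y : T^^n) z c : mix y z 0 (q (inr c)) = z 0 c.
Proof. by rewrite mxE qK. Qed.

Lemma split_coord i : (exists a, i = q (inl a)) \/ (exists c, i = q (inr c)).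
Proof. by rewrite -[i]pK; case: (p i) => [a|c]; [left; exists a|right; exists c]. Qed.

Lemma mix_ex T (x : T^^m) : exists y z, x = mix y z.
Proof.
exists (\row_a x 0 (q (inl a))), (\row_c x 0 (q (inr c))); apply/rowP => i.
by have [[a ->]|[c ->]] := split_coord i; rewrite ?mixl ?mixr mxE.
Qed.

Lemma mix_inj T (y y' : T^^n) z z' : mix y z = mix y' z' -> y = y' /\ z = z'.
Proof.
by move=> E; split; apply/rowP => i; [rewrite -(mixl y z) E mixl|rewrite -(mixr y z) E mixr].
Qed.

Lemma prod_split (F : comNzRingType) (G : 'I_m -> F) :
  \prod_i G i = (\prod_a G (q (inl a))) * \prod_c G (q (inr c)).
Proof.
rewrite (reindex q) /=; last by exists p => i _; [exact: qK|exact: pK].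
exact: big_sumType.
Qed.

Lemma perm_vals_mix (y : K^^n) z : perm_eq (vals (mix y z)) (vals y ++ vals z).
Proof.
have E : perm_eq (enum 'I_m) ([seq q (inl a) | a <- enum 'I_n] ++ [seq q (inr c) | c <- enum 'I_k]).
  have qI : injective q := can_inj qK.
  have u1 : uniq [seq q (inl a) | a <- enum 'I_n] by rewrite map_inj_uniq ?enum_uniq // => a a' /qI[].
  have u2 : uniq [seq q (inr c) | c <- enum 'I_k] by rewrite map_inj_uniq ?enum_uniq // => c c' /qI[].
  apply: uniq_perm; first exact: enum_uniq.
    rewrite cat_uniq u1 u2 andbT; apply/hasPn => _ /mapP[c _ ->]; apply/negP => /mapP[a _ /qI].
    by [].
  move=> i; rewrite mem_enum inE mem_cat; apply/esym/orP.
  have [[a ->]|[c ->]] := split_coord i; [left|right]; apply/mapP; [exists a|exists c]; rewrite ?mem_enum //.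
rewrite /vals; have := perm_map (fun i => mix y z 0 i) E; rewrite map_cat => /perm_trans; apply.
have -> : [seq mix y z 0 i | i <- [seq q (inl a) | a <- enum 'I_n]] = vals y.
  by rewrite -map_comp; apply: eq_map => i /=; rewrite mixl.
have -> : [seq mix y z 0 i | i <- [seq q (inr c) | c <- enum 'I_k]] = vals z.
  by rewrite -map_comp; apply: eq_map => i /=; rewrite mixr.
by [].
Qed.

End Split.

Lemma Df_mix n k m (p : 'I_m -> 'I_n + 'I_k) P T {eT : encodable K T} (y : T -> K^^n) (z : T -> K^^k) :
  Df S P y -> Df S P z -> Df S P (fun t => mix p (y t) (z t)).
Proof.
move=> Dy Dz; apply: Df_rV => i.
have -> : (fun t => mix p (y t) (z t) 0 i) = fun t => match p i with inl a => y t 0 a | inr c => z t 0 c end.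
  by apply/funext => t; rewrite mxE.
by case: (p i) => j; apply: Df_entry.
Qed.

Lemma gen_mix n k m (p : 'I_m -> 'I_n + 'I_k) q (pK : cancel p q) (qK : cancel q p) P (y : K^^n) (z : K^^k) :
  gen P (mix p y z) <-> gen P y /\ gen (P <+ y) z.
Proof.
rewrite /gen -ind_cat; split; apply: (ind_perm); last rewrite perm_sym; exact: (perm_vals_mix pK qK).
Qed.

Lemma D_finex P (J : finType) T {eT : encodable K T} (Q : J -> T -> Prop) :
  (forall j, D S P (Q j)) -> D S P (fun x => exists j, Q j x).
Proof.
move=> DQ; have : D S P (fun x => exists i : 'I_#|J|, Q (enum_val i) x) by apply: D_bigex => i.
apply: D_ext => x; split=> [[i Hi]|[j Hj]]; first by exists (enum_val i).
by exists (enum_rank j); rewrite enum_rankK.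
Qed.

(** The map [X] takes finitely many values, each on a definable set. Hence any condition on its
    value is definable, even one that involves real numbers. *)
Lemma D_pattern P (J : finType) T {eT : encodable K T} (X : T -> {set J}) (Q : {set J} -> Prop) :
  (forall j, D S P (fun y => j \in X y)) -> D S P (fun y => Q (X y)).
Proof.
move=> DX.
have : D S P (fun y => exists s : {set J}, Q s /\ forall j, (j \in s) <-> (j \in X y)).
  apply: D_finex => s; apply: D_and; first exact: D_const.
  by apply: D_fin => j; apply: D_iff => //; exact: D_const.
apply: D_ext => y; split=> [[s [Qs sX]]|Qy]; last by exists (X y).
suff -> : X y = s by [].
by apply/setP => j; apply/idP/idP => /sX.
Qed.

Section OuterProduct.
Variables (n k m : nat) (p : 'I_m -> 'I_n + 'I_k) (q : 'I_n + 'I_k -> 'I_m).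
Hypotheses (pK : cancel p q) (qK : cancel q p).
Local Open Scope ereal_scope.

Lemma lo_prod (X : set R^^n) (c d : R^^k) : (forall i, c 0 i <= d 0 i)%R ->
  (0 < vol c d)%R ->
  lebesgue_outer [set w | exists u z, [/\ X u, cbox c d z & w = mix p u z]] <= (vol c d)%:E * lebesgue_outer X.
Proof.
move=> cd v0; rewrite -lee_pdivrMl //.
apply: le_ereal_inf_tmp => _ [I [a [b [ab XI ->]]]]; rewrite lee_pdivrMl //.
apply: (@le_trans _ _ (\esum_(j in I) ((vol c d)%:E * (\prod_i (b j 0 i - a j 0 i)%R)%:E))).
  apply: ereal_inf_lbound.
  exists I, (fun j => mix p (a j) c), (fun j => mix p (b j) d); split.
  - by move=> j i; have [[a' ->]|[c' ->]] := split_coord pK i; rewrite ?(mixl qK) ?(mixr qK).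
  - move=> _ [u [z [/XI[j Ij uj] zcd ->]]]; exists j => // i.
    by have [[a' ->]|[c' ->]] := split_coord pK i; rewrite ?(mixl qK) ?(mixr qK).
  - apply: eq_esum => j _; rewrite -EFinM; congr _%:E.
    rewrite (prod_split pK qK) mulrC; congr (_ * _)%R.
      by apply: eq_bigr => i _; rewrite !(mixl qK).
    by apply: eq_bigr => i _; rewrite !(mixr qK).
rewrite /esum; apply: ge_ereal_sup => _ [A [fA AI] <-].
rewrite -ge0_mule_fsumr; last by move=> j; rewrite lee_fin prodr_ge0 // => i _; rewrite subr_ge0.
by apply: lee_wpmul2l; [rewrite lee_fin ltW|apply: ereal_sup_ubound; exists A].
Qed.

End OuterProduct.

Section OneSplit.
Variables (n k m : nat) (p : 'I_m -> 'I_n + 'I_k) (q : 'I_n + 'I_k -> 'I_m).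
Hypotheses (pK : cancel p q) (qK : cancel q p).

Definition fib (E : set K^^m) (y : K^^n) : set K^^k := [set z | E (mix p y z)].

(** The number of cubes that meet the fibre over [y] is the number of shadows that contain [y]. This
    makes it a finite sum of indicator functions of definable sets. *)
Definition shadow b l (E : set K^^m) (j : {ffun 'I_k -> 'I_(b * 2 ^ l)}) : set K^^n :=
  [set y | exists2 z, fib E y z & cell j z].

Lemma D_cell P b l (j : {ffun 'I_k -> 'I_(b * 2 ^ l)}) : D S P (cell j).
Proof.
apply: D_big => i; apply: D_andb; [apply: D_le|apply: D_lt].
- exact: Df_nat.
- by apply: Df_mul; [apply: Df_entry; exact: Df_id|apply: Df_exp; exact: Df_nat].
- by apply: Df_mul; [apply: Df_entry; exact: Df_id|apply: Df_exp; exact: Df_nat].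
- by apply: Df_add; [exact: Df_nat|exact: Df_1].
Qed.

Lemma D_fib2 P (E : set K^^m) : D S P E -> D S P (fun w : K^^n * K^^k => fib E w.1 w.2).
Proof. by move=> DE; apply: (D_comp DE); apply: Df_mix; ddef. Qed.

Lemma D_shadow P b l (E : set K^^m) (j : {ffun 'I_k -> 'I_(b * 2 ^ l)}) : D S P E -> D S P (shadow E j).
Proof.
move=> DE; have Dc := D_cell P j; have D2 := D_fib2 DE.
by have : D S P (fun y => exists2 z, fib E y z & cell j z) by ddef.
Qed.

Lemma bdd_fib b (E : set K^^m) y : bdd b E -> bdd b (fib E y).
Proof. by move=> bE z /bE H c; have := H (q (inr c)); rewrite (mixr qK). Qed.

Lemma bdd_shadow b b' l (E : set K^^m) (j : {ffun 'I_k -> 'I_(b' * 2 ^ l)}) : bdd b E -> bdd b (shadow E j).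
Proof. by move=> bE y [z /bE H _] a; have := H (q (inl a)); rewrite (mixl qK). Qed.

Lemma D_fib P (E : set K^^m) y : D S P E -> D S (P <+ y) (fib E y).
Proof.
move=> DE; apply: (@D_inst_vec P n y _ _ (fun w : K^^k * K^^n => fib E w.2 w.1)).
by apply: (D_comp DE); apply: Df_mix; ddef.
Qed.

Lemma vl_slab b l (E : set K^^m) (j : {ffun 'I_k -> 'I_(b * 2 ^ l)}) : bdd b E ->
  vl [set x | E x /\ exists y z, x = mix p y z /\ cell j z] <= vl (shadow E j) / 2%:R ^+ (l * k).
Proof.
move=> bE; have bS := bdd_shadow (j := j) bE.
have bE' : bdd b [set x | E x /\ exists y z, x = mix p y z /\ cell j z] by apply: bdd_sub bE => x [].
rewrite -lee_fin EFinM -(vl_fin bS) -(vl_fin bE').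
pose c := \row_i ((j i)%:R / 2%:R ^+ l) : R^^k.
pose d := \row_i (((j i)%:R + 1) / 2%:R ^+ l) : R^^k.
have vE : vol c d = (2%:R ^+ (l * k))^-1.
  rewrite /vol exprM -exprVn -[in RHS](card_ord k) -prodr_const.
  by apply: eq_bigr => i _; rewrite !mxE -mulrBl addrAC subrr add0r mul1r.
rewrite muleC -vE; apply: le_trans (lo_prod pK qK _ _ _); last 2 first.
- by move=> i; rewrite !mxE ler_pM2r ?invr_gt0 //; lra.
- by rewrite vE invr_gt0 pow2_gt0.
apply: lo_mono => w [x [Ex [y [z [xE jz]]]] xw].
exists (\row_a w 0 (q (inl a))), (\row_c w 0 (q (inr c))); split.
- exists y; last by move=> a; rewrite mxE -xw xE (mixl qK).
  by exists z => //; rewrite /fib /= -xE.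
- move=> i; rewrite !mxE; have /st_stP := xw (q (inr i)); rewrite xE (mixr qK) => Hi.
  have Er (s : nat) : stP (s%:R / 2%:R ^+ l : K) (s%:R / 2%:R ^+ l : R).
    by have := @stP_rat (s%:R / 2%:R ^+ l); rewrite !fmorph_div !rmorphXn /= !ratr_nat.
  have /andP[j1 j2] := jz i; apply/andP; split.
    by apply: (stP_le (Er _) Hi); rewrite ler_pdivrMr.
  rewrite natr1; apply: (stP_le Hi (Er _)); rewrite natr1 in j2; rewrite ler_pdivlMr //; exact: ltW.
- by apply/rowP => i; have [[a ->]|[c' ->]] := split_coord pK i; rewrite ?(mixl qK) ?(mixr qK) mxE.
Qed.

Lemma oc_shadow b l (E : set K^^m) y :
  oc b l (fib E y) = \sum_(j : {ffun 'I_k -> 'I_(b * 2 ^ l)}) (2%:R ^+ (l * k))^-1 * \1_(shadow E j) y.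
Proof.
rewrite /oc -mulr_sumr mulrC; congr (_ * _).
rewrite -sum1_card natr_sum big_mkcond; apply: eq_bigr => j _.
rewrite indicE; have -> : (y \in shadow E j) = (j \in cells b l (fib E y)).
  by apply/idP/in_cells => [/set_mem|/mem_set].
by case: (_ \in _).
Qed.

Lemma vl_le_shadow P b l (E : set K^^m) : countable P -> D S P E -> bdd b E ->
  vl E <= \sum_(j : {ffun 'I_k -> 'I_(b * 2 ^ l)}) (2%:R ^+ (l * k))^-1 * vl (shadow E j).
Proof.
move=> cP DE bE; pose sl (j : {ffun 'I_k -> 'I_(b * 2 ^ l)}) := [set x | E x /\ exists y z, x = mix p y z /\ cell j z].
have Dsl j : D S P (sl j).
  have Dc := D_cell P j.
  apply: D_and => //; apply: D_ex; apply: D_ex; apply: D_and; last by ddef.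
  by apply: D_eqT; [ddef|apply: Df_mix; ddef].
have bsl j : bdd b (sl j) by apply: bdd_sub bE => x [].
have key (s : seq {ffun 'I_k -> 'I_(b * 2 ^ l)}) : vl [set x | exists2 j, j \in s & sl j x] <= \sum_(j <- s) vl (sl j).
  elim: s => [|j s IH].
    by rewrite (_ : [set x | _] = set0) ?vl_set0 ?big_nil //; apply/seteqP; split=> // x [].
  rewrite (_ : [set x | _] = sl j `|` [set x | exists2 j, j \in s & sl j x]); last first.
    apply/seteqP; split=> x.
      by move=> [i]; rewrite inE => /orP[/eqP ->|si] Hi; [left|right; exists i].
    by move=> [Hj|[i si Hi]]; [exists j; rewrite ?mem_head|exists i; rewrite ?inE ?si ?orbT].
  rewrite big_cons; apply: le_trans (vlU_le cP (Dsl j) _ (bsl j) _) _ => //.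
  - have Di i : D S P (fun x => (i \in s) /\ sl i x) by apply: D_and => //; exact: D_const.
    by apply: D_ext (D_finex Di) => x; split=> [[i [si Hi]]|[i si Hi]]; exists i.
  - by move=> x [i _ /bsl].
  - by rewrite lerD2l.
apply: (@le_trans _ _ (\sum_j vl (sl j))); last first.
  by apply: ler_sum => j _; rewrite mulrC; exact: vl_slab.
have := key (enum {ffun 'I_k -> 'I_(b * 2 ^ l)}); rewrite big_enum /=.
rewrite (_ : [set x | _] = E) //; apply/seteqP; split=> x; first by move=> [j _ []].
move=> Ex; have [y [z xE]] := mix_ex pK qK x.
have Ez : fib E y z by rewrite /fib /= -xE.
have [j jz] := cell_ex l (bdd_fib (y := y) bE) Ez.
by exists j; rewrite ?mem_enum //; split=> //; exists y, z.
Qed.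

Local Notation mu := (bo_measure R S n).
Local Notation T := (caratheodory_type (@bo_outer R L K S n)).

Lemma oc_fib_measurable P b l (E : set K^^m) (DD : set T) : D S P E -> bdd b E ->
  measurable_fun DD (fun y : T => oc b l (fib E y)).
Proof.
move=> DE bE; have -> : (fun y : T => oc b l (fib E y)) = fun y : T =>
  \sum_(j : {ffun 'I_k -> 'I_(b * 2 ^ l)}) (2%:R ^+ (l * k))^-1 * \1_(shadow E j : set T) y.
  by apply/funext => y; exact: oc_shadow.
apply: measurable_sum => j; apply: measurable_funM => //.
apply: measurable_indic; apply: (bo_measurable (b := b)); last exact: bdd_shadow.
exact: D_def (D_shadow j DE).
Qed.

Lemma oc_fib_cvg P b (E : set K^^m) y : countable P -> D S P E -> bdd b E ->
  oc b l (fib E y) @[l --> \oo] --> vl (fib E y).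
Proof.
move=> cP DE bE; have Dy := D_fib y DE; have by_ := bdd_fib (y := y) bE.
have cPy : countable (P <+ y) by ctb.
apply/cvgrPdist_le => e e0; have [|l0 Hl0] := oc_lower cPy Dy by_ (v := vl (fib E y) + e).
  by rewrite ltrDl.
near=> l; have := Hl0 l; have := vl_le l by_ => h1 h2.
rewrite ler0_norm ?subr_le0 // opprB lerBlDl; apply: h2.
by near: l; exists l0.
Unshelve. all: by end_near. Qed.

Lemma vl_fib_measurable P b (E : set K^^m) (DD : set T) : countable P -> D S P E -> bdd b E -> measurable DD ->
  measurable_fun DD (fun y : T => vl (fib E y)).
Proof.
move=> cP DE bE mD; apply: (@measurable_fun_cvg _ T R DD (fun l y => oc b l (fib E y))).
- by move=> l; exact: oc_fib_measurable DE bE.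
- by move=> y _; exact: oc_fib_cvg cP DE bE.
Qed.

Lemma hbox_measurable b : measurable (hbox b n : set T).
Proof.
apply: (bo_measurable (b := b)); last exact: bdd_hbox.
exact: D_def (D_hbox set0 b n).
Qed.

Lemma mu_hbox b : mu (hbox b n) = (b%:R ^+ n)%:E.
Proof.
by rewrite (bo_measureE (D_def (D_hbox set0 b n)) (@bdd_hbox b n)) (vl_hbox).
Qed.

Lemma int_cst b (r : R) : (\int[mu]_(x in hbox b n) (cst r%:E : T -> \bar R) x = (r * b%:R ^+ n)%:E)%E.
Proof. by rewrite (integral_cst mu (hbox_measurable b)) EFinM; congr (_ * _)%E; exact: mu_hbox. Qed.

Lemma cst_integrable b (r : R) : 0 <= r -> mu.-integrable (hbox b n) (cst r%:E : T -> \bar R).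
Proof.
move=> r0; have mH := hbox_measurable b; apply/integrableP; split; first exact: measurable_cst.
have -> : (fun x : T => `|(cst r%:E : T -> \bar R) x|)%E = cst r%:E.
  by apply/funext => x /=; rewrite ger0_norm.
by rewrite int_cst ltry.
Qed.

(** At every dyadic level [E] is covered by the products of the shadows with their cubes, whose
    total volume is the integral of the count of the fibre. The counts are bounded and converge to
    the volume of the fibre. *)
Lemma vl_le_int P b (E : set K^^m) : countable P -> D S P E -> bdd b E ->
  ((vl E)%:E <= \int[mu]_(y in hbox b n) (vl (fib E y))%:E)%E.
Proof.
move=> cP DE bE; have mH := hbox_measurable b.
have Iocl l : (\int[mu]_(y in hbox b n) (oc b l (fib E y))%:E)%E =
    (\sum_(j : {ffun 'I_k -> 'I_(b * 2 ^ l)}) (2%:R ^+ (l * k))^-1 * vl (shadow E j))%:E.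
  under eq_integral do rewrite oc_shadow -sumEFin.
  have mS (j : {ffun 'I_k -> 'I_(b * 2 ^ l)}) : measurable (shadow E j : set T).
    apply: (bo_measurable (b := b)); last exact: bdd_shadow.
    exact: D_def (D_shadow j DE).
  have F1 (j : {ffun 'I_k -> 'I_(b * 2 ^ l)}) : measurable_fun (hbox b n : set T)
      (fun y : T => ((2%:R ^+ (l * k))^-1 * \1_(shadow E j : set T) y : R)%:E).
    by apply/measurable_EFinP; apply: measurable_funM; [exact: measurable_cst|exact: measurable_indic].
  have F2 (j : {ffun 'I_k -> 'I_(b * 2 ^ l)}) (y : T) : hbox b n y ->
      (0 <= ((2%:R ^+ (l * k))^-1 * \1_(shadow E j : set T) y : R)%:E)%E.
    by move=> _; rewrite lee_fin mulr_ge0.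
  rewrite (ge0_integral_sum mu mH F1 F2).
  rewrite -sumEFin; apply: eq_bigr => j _.
  under eq_integral do rewrite EFinM.
  have G1 : measurable_fun (hbox b n : set T) (fun y : T => (\1_(shadow E j : set T) y : R)%:E).
    by apply/measurable_EFinP; exact: measurable_indic.
  have G2 (y : T) : hbox b n y -> (0 <= (\1_(shadow E j : set T) y : R)%:E)%E by rewrite lee_fin.
  have G3 : (0 <= ((2%:R ^+ (l * k))^-1 : R)%:E)%E by [].
  rewrite (ge0_integralZl mu mH G1 G2 G3).
  rewrite (integral_indic mu mH (mS j)) EFinM; congr (_ * _)%E.
  have bS := bdd_shadow (j := j) bE.
  rewrite (_ : _ `&` _ = shadow E j); last first.
    by apply/seteqP; split=> y; [case|move=> Sy; split=> //; exact: bS].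
  exact: (bo_measureE (D_def (D_shadow j DE)) bS).
have cv : (\int[mu]_(y in hbox b n) (oc b l (fib E y))%:E)%E @[l --> \oo] -->
    (\int[mu]_(y in hbox b n) (vl (fib E y))%:E)%E.
  apply: (@dominated_cvg _ T R mu _ mH _ _ (cst (b%:R ^+ k)%:E)).
  - by move=> l; apply/measurable_EFinP; exact: oc_fib_measurable DE bE.
  - by move=> y _; apply/cvg_EFin; [exact: nearW|exact: oc_fib_cvg cP DE bE].
  - by [].
  - by apply: cst_integrable; rewrite exprn_ge0.
  - by move=> l y _; rewrite /= ger0_norm ?oc_ge0 // lee_fin oc_le.
rewrite -(cvg_lim _ cv) //; apply: lime_ge; first exact: cvgP cv.
by apply: nearW => l; rewrite Iocl lee_fin; exact: vl_le_shadow cP DE bE.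
Qed.

Lemma vl_hle b i (A : set K^^i) : bdd b A -> vl A <= b%:R ^+ i.
Proof. by move=> bA; apply: le_trans (vl_le 0 bA) (oc_le _ _ _). Qed.

Lemma vl_fib_integrable P b (E : set K^^m) : countable P -> D S P E -> bdd b E ->
  mu.-integrable (hbox b n) (fun y : T => (vl (fib E y))%:E).
Proof.
move=> cP DE bE; have mH := hbox_measurable b.
apply: (le_integrable mH _ _ (cst_integrable b (exprn_ge0 k (ler0n R b)))).
  by apply/measurable_EFinP; exact: vl_fib_measurable cP DE bE mH.
move=> y _; rewrite lee_fin !ger0_norm ?vl_ge0 //.
by apply: vl_hle; exact: bdd_fib.
Qed.

(** The missing inequality is [vl_le_int] for the complement of [E] in the box. *)
Lemma fubini P b (E : set K^^m) : countable P -> D S P E -> bdd b E ->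
  ((vl E)%:E = \int[mu]_(y in hbox b n) (vl (fib E y))%:E)%E.
Proof.
move=> cP DE bE; apply/eqP; rewrite eq_le (vl_le_int cP DE bE) /=.
have mH := hbox_measurable b; have iE := vl_fib_integrable cP DE bE.
pose C := hbox b m `\` E.
have DC : D S P C by apply: D_and; [exact: D_hbox|exact: D_not].
have bC : bdd b C by apply: bdd_sub (@bdd_hbox b m) => x [].
have := vl_le_int cP DC bC; rewrite (vlC cP DE bE).
have fC y : hbox b n y -> fib C y = hbox b k `\` fib E y.
  move=> hy; apply/seteqP; split=> z [h1 h2]; split=> //.
    by move=> c; have := h1 (q (inr c)); rewrite (mixr qK).
  by move=> i; have [[a ->]|[c ->]] := split_coord pK i; rewrite ?(mixl qK) ?(mixr qK).
have -> : (\int[mu]_(y in hbox b n) (vl (fib C y))%:E)%E =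
    (\int[mu]_(y in hbox b n) ((b%:R ^+ k)%:E - (vl (fib E y))%:E))%E.
  apply: eq_integral => y /set_mem hy; rewrite (fC y hy).
  have Dy := D_fib y DE; have cPy : countable (P <+ y) by ctb.
  by rewrite (vlC cPy Dy (bdd_fib (y := y) bE)).
have icst : mu.-integrable (hbox b n) (cst (b%:R ^+ k)%:E : T -> \bar R).
  by apply: cst_integrable; rewrite exprn_ge0.
rewrite (integralB mH icst iE) int_cst.
have fI : (\int[mu]_(y in hbox b n) (vl (fib E y))%:E)%E \is a fin_num := integrable_fin_num mH iE.
rewrite -(fineK fI) -EFinB !lee_fin.
have mkn : m = (k + n)%N.
  rewrite -[m]card_ord -[k]card_ord -[n in RHS]card_ord addnC -card_sum.
  by apply: bij_eq_card; exists q.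
have -> : b%:R ^+ m = b%:R ^+ k * b%:R ^+ n :> R by rewrite mkn exprD.
lra.
Qed.

End OneSplit.

(** By compactness finitely many of the sets already have no generic point in common, and a
    definable set without generic points is null. *)
Lemma no_gen_cap P n b (X : nat -> set K^^n) : countable P -> (forall l, D S P (X l)) ->
  (forall l, bdd b (X l)) -> (forall y, (forall l, X l y) -> ~ gen P y) ->
  (bo_measure R S n).-negligible (\bigcap_l X l).
Proof.
move=> cP DX bX NX.
have [||p [G [GF GA]]] := @rk_compact_cover P n n (hbox b n)
    [set Z | exists l, Z = fun y => ~ X l y] cP (D_hbox P b n).
- by move=> _ [l ->]; exact: D_not.
- move=> y _ /(rk_gen) gy; have /existsNP[l Hl] : ~ forall l, X l y by move=> /NX.
  by exists (fun y => ~ X l y) => //; exists l.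
have /choice[g Hg] i : exists l, G i = fun y => ~ X l y by exact: GF.
pose B := [set y | hbox b n y /\ forall i : 'I_p, X (g i) y].
have DB : D S P B by apply: D_and; [exact: D_hbox|apply: D_big => i].
have bB : bdd b B by move=> y [].
exists B; split.
- exact: (bo_measurable (D_def DB) bB).
- rewrite (bo_measureE (D_def DB) bB) (small_nogen cP DB bB) // => y [hy Xy] gy.
  by have [i] := GA y hy (gen_rk gy); rewrite Hg; apply.
- move=> y Xy; split; first exact: (bX 0%N _ (Xy 0%N I)).
  by move=> i; exact: Xy.
Qed.

(** The set of [y] that violate the inequality between the fibres need not be definable. Up to a
    margin [1 / (u + 1)] and a level [v] it is a countable intersection of definable sets, to which
    [no_gen_cap] applies. *)
Lemma fubini_le n k m k' m' (p : 'I_m -> 'I_n + 'I_k) q (p' : 'I_m' -> 'I_n + 'I_k') q'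
  (pK : cancel p q) (qK : cancel q p) (pK' : cancel p' q') (qK' : cancel q' p')
  P b (r : R) (E : set K^^m) (E' : set K^^m') :
  countable P -> D S P E -> D S P E' -> bdd b E -> bdd b E' -> 0 <= r ->
  (forall y, gen P y -> vl (fib p E y) <= r * vl (fib p' E' y)) -> vl E <= r * vl E'.
Proof.
move=> cP DE DE' bE bE' r0 H.
(* The volume on the right is replaced by its approximation at level [v]; the one on the left is
   recovered by letting [l] run through all levels. *)
pose X (u v l : nat) := [set y | hbox b n y /\ r * oc b v (fib p' E' y) + u.+1%:R^-1 <= oc b l (fib p E y)].
have DX u v l : D S P (X u v l).
  apply: D_and; first exact: D_hbox.
  have H1 (sg : {set {ffun 'I_k' -> 'I_(b * 2 ^ v)}}) : D S P (fun y => cells b v (fib p' E' y) = sg).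
    refine (D_pattern (X := fun y => cells b v (fib p' E' y)) (fun s => s = sg) _) => j.
    apply: D_ext (D_shadow p' j DE') => y; split=> [Hy|/in_cells//]; exact/in_cells.
  have H2 (sg : {set {ffun 'I_k -> 'I_(b * 2 ^ l)}}) : D S P (fun y => cells b l (fib p E y) = sg).
    refine (D_pattern (X := fun y => cells b l (fib p E y)) (fun s => s = sg) _) => j.
    apply: D_ext (D_shadow p j DE) => y; split=> [Hy|/in_cells//]; exact/in_cells.
  pose Phi (s : {set {ffun 'I_k' -> 'I_(b * 2 ^ v)}}) (s' : {set {ffun 'I_k -> 'I_(b * 2 ^ l)}}) :=
    r * (#|s|%:R / 2%:R ^+ (v * k')) + u.+1%:R^-1 <= #|s'|%:R / 2%:R ^+ (l * k) :> R.
  have Hs s : D S P (fun y => exists s', (cells b v (fib p' E' y) = s /\ cells b l (fib p E y) = s') /\ Phi s s').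
    apply: D_finex => s'; apply: D_and; last exact: D_const.
    by apply: D_and.
  apply: D_ext (D_finex Hs) => y; split=> [[s [s' [[<- <-]]]]|] //.
  by move=> HP; exists (cells b v (fib p' E' y)), (cells b l (fib p E y)).
have bX u v l : bdd b (X u v l) by move=> y [].
have NX u v : (bo_measure R S n).-negligible (\bigcap_l X u v l).
  apply: (no_gen_cap (b := b) cP) => // y Xy gy; have := H y gy; apply/negP; rewrite -ltNge.
  have by_ := bdd_fib qK (y := y) bE; have by' := bdd_fib qK' (y := y) bE'.
  have Dy := D_fib p y DE; have cPy : countable (P <+ y) by ctb.
  have u0 : 0 < u.+1%:R^-1 :> R by rewrite invr_gt0 ltr0n.
  have le1 : r * oc b v (fib p' E' y) + u.+1%:R^-1 <= vl (fib p E y).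
    apply/ler_addgt0Pr => e e0; have [|l0 Hl0] := oc_lower cPy Dy by_ (v := vl (fib p E y) + e).
      by rewrite ltrDl.
    by apply: le_trans (Hl0 l0 (leqnn _)); have [] := Xy l0.
  have : r * vl (fib p' E' y) <= r * oc b v (fib p' E' y) by rewrite ler_wpM2l // vl_le.
  set c := _^-1 in u0 le1 *; lra.
rewrite -lee_fin EFinM (fubini pK qK cP DE bE) (fubini pK' qK' cP DE' bE').
have mH := @hbox_measurable n b.
have iE := vl_fib_integrable qK cP DE bE; have iE' := vl_fib_integrable qK' cP DE' bE'.
have /integrableP[mE _] := iE; have /integrableP[mE' _] := iE'.
have G2 (y : caratheodory_type (@bo_outer R L K S n)) : hbox b n y -> (0 <= (vl (fib p' E' y))%:E)%E.
  by move=> _; rewrite lee_fin vl_ge0.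
have G3 : (0 <= r%:E)%E by rewrite lee_fin.
rewrite -(ge0_integralZl (bo_measure R S n) mH mE' G2 G3).
apply: (ae_ge0_le_integral mH _ mE _ (measurable_funeM r%:E mE')).
- by move=> y _; rewrite lee_fin vl_ge0.
- by move=> y _; rewrite -EFinM lee_fin mulr_ge0 ?vl_ge0.
have : (bo_measure R S n).-negligible (\bigcup_u \bigcup_v \bigcap_l X u v l).
  by apply: negligible_bigcup => u; apply: negligible_bigcup => v; exact: NX.
apply: negligibleS => y; move=> /not_implyP[hy] /negP; rewrite -EFinM lee_fin -ltNge => lt1.
pose d := vl (fib p E y) - r * vl (fib p' E' y); have d0 : 0 < d by rewrite subr_gt0.
have [u Hu] : exists u : nat, u.+1%:R^-1 < d / 2%:R.
  have := archi_boundP (_ : 0 <= (d / 2%:R)^-1); set N := Num.bound _.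
  rewrite invr_ge0 divr_ge0 ?(ltW d0) // => /(_ isT) HN; exists N.
  rewrite invf_plt ?posrE ?divr_gt0 //; apply: lt_trans HN _; by rewrite ltr_nat.
have by' := bdd_fib qK' (y := y) bE'.
have Dy' := D_fib p' y DE'; have cPy : countable (P <+ y) by ctb.
have [|v Hv] := oc_lower cPy Dy' by' (v := vl (fib p' E' y) + d / 2%:R / (r + 1)).
  by rewrite ltrDl !divr_gt0 //; lra.
exists u => //; exists v => // l _; split=> //.
have := vl_le l (bdd_fib qK (y := y) bE); have := Hv v (leqnn _).
set o := oc b v _ => ho hl.
have : r * o <= r * (vl (fib p' E' y) + d / 2%:R / (r + 1)) by rewrite ler_wpM2l.
have : r * (d / 2%:R / (r + 1)) <= d / 2%:R.
  rewrite mulrCA -[leRHS]mulr1 ler_pM2l ?divr_gt0 // ler_pdivrMr; lra.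
rewrite mulrDr; set w := r * (d / _ / _); set c := u.+1%:R^-1 in Hu *.
have dE : vl (fib p E y) = d + r * vl (fib p' E' y) by rewrite subrK.
lra.
Qed.

(** * Change of variables *)

Section Splits.

Definition p1r n (i : 'I_n.+1) (j : 'I_n.+1) : 'I_1 + 'I_n := if unlift i j is Some l then inr l else inl ord0.
Definition q1r n (i : 'I_n.+1) (s : 'I_1 + 'I_n) : 'I_n.+1 := match s with inl _ => i | inr l => lift i l end.

Lemma p1rK n (i : 'I_n.+1) : cancel (p1r i) (q1r i).
Proof. by move=> j; rewrite /p1r; case: (unliftP i j) => [l ->|->]. Qed.

Lemma q1rK n (i : 'I_n.+1) : cancel (q1r i) (p1r i).
Proof. by case=> [a|l]; rewrite /p1r /q1r; [rewrite unlift_none (ord1 a)|rewrite liftK]. Qed.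

Lemma mix1r T n (i : 'I_n.+1) (s : T^^1) (v : T^^n) : mix (p1r i) s v = \row_j (if unlift i j is Some l then v 0 l else s 0 ord0).
Proof. by apply/rowP => j; rewrite !mxE /p1r; case: (unliftP i j). Qed.

Lemma mix1rK n (i : 'I_n.+1) (s : K^^1) (v : K^^n) : mix (p1r i) s v = ins i (s 0 ord0) v.
Proof. by rewrite mix1r. Qed.

Definition pr1 n (i : 'I_n.+1) (j : 'I_n.+1) : 'I_n + 'I_1 := if unlift i j is Some l then inl l else inr ord0.
Definition qr1 n (i : 'I_n.+1) (s : 'I_n + 'I_1) : 'I_n.+1 := match s with inr _ => i | inl l => lift i l end.

Lemma pr1K n (i : 'I_n.+1) : cancel (pr1 i) (qr1 i).
Proof. by move=> j; rewrite /pr1; case: (unliftP i j) => [l ->|->]. Qed.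

Lemma qr1K n (i : 'I_n.+1) : cancel (qr1 i) (pr1 i).
Proof. by case=> [l|a]; rewrite /pr1 /qr1; [rewrite liftK|rewrite unlift_none (ord1 a)]. Qed.

Lemma mixr1K n (i : 'I_n.+1) (v : K^^n) (s : K^^1) : mix (pr1 i) v s = ins i (s 0 ord0) v.
Proof. by apply/rowP => j; rewrite !mxE /pr1; case: (unliftP i j). Qed.

(** The new coordinate [ord0], the height in the region below a graph, joins the second block, so
    the fibre of such a region is again one ([fib_Hypo]). *)
Definition up n k m (p : 'I_m -> 'I_n + 'I_k) (j : 'I_m.+1) : 'I_n + 'I_k.+1 :=
  if unlift ord0 j is Some l then match p l with inl a => inl a | inr c => inr (lift ord0 c) end else inr ord0.
Definition upq n k m (q : 'I_n + 'I_k -> 'I_m) (s : 'I_n + 'I_k.+1) : 'I_m.+1 :=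
  match s with inl a => lift ord0 (q (inl a))
  | inr c => if unlift ord0 c is Some l then lift ord0 (q (inr l)) else ord0 end.

Lemma upK n k m (p : 'I_m -> 'I_n + 'I_k) q : cancel p q -> cancel (up p) (upq q).
Proof.
move=> pK j; rewrite /up; case: (unliftP ord0 j) => [l ->|->] /=; last by rewrite unlift_none.
by case E: (p l) => [a|c] /=; rewrite ?liftK -E pK.
Qed.

Lemma upqK n k m (p : 'I_m -> 'I_n + 'I_k) q : cancel q p -> cancel (upq q) (up p).
Proof.
move=> qK [a|c] /=; rewrite /up ?liftK ?qK //.
by case: (unliftP ord0 c) => [l ->|->] /=; rewrite ?liftK ?qK ?unlift_none.
Qed.

(* The region below the graph of [h]; the new coordinate comes first. *)
Definition Hypo n (U : set K^^n) (h : K^^n -> K) : set K^^n.+1 :=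
  [set x | U (col' ord0 x) /\ 0 < x 0 ord0 < h (col' ord0 x)].

Lemma mix_up n k m (p : 'I_m -> 'I_n + 'I_k) (y : K^^n) (z : K^^k.+1) :
  mix (up p) y z = ins ord0 (z 0 ord0) (mix p y (col' ord0 z)).
Proof.
apply/rowP => j; case: (unliftP ord0 j) => [l ->|->]; rewrite ?ins_lift !mxE /up ?liftK ?unlift_none //.
by case: (p l) => // c; rewrite mxE.
Qed.

Lemma fib_Hypo n k m (p : 'I_m -> 'I_n + 'I_k) (U : set K^^m) h (y : K^^n) :
  fib (up p) (Hypo U h) y = Hypo (fib p U y) (fun z => h (mix p y z)).
Proof. by apply/seteqP; split=> z; rewrite /fib /Hypo /= mix_up col'_ins insE. Qed.

Lemma Hypo_ext n (U : set K^^n) h h' : (forall x, U x -> h x = h' x) -> Hypo U h = Hypo U h'.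
Proof. by move=> E; apply/seteqP; split=> x [Ux]; rewrite ?E // -?E. Qed.

End Splits.

Lemma D_Hypo P n (U : set K^^n) h : D S P U -> Df S P h -> D S P (Hypo U h).
Proof.
move=> DU Dh; have H : D S P (fun x : K^^n.+1 => U (col' ord0 x) /\ 0 < x 0 ord0 < h (col' ord0 x)) by ddef.
exact: H.
Qed.

Lemma bdd_Hypo b n (U : set K^^n) h : bdd b U -> (forall x, U x -> h x <= b%:R) -> bdd b (Hypo U h).
Proof.
move=> bU hb x [Ux /andP[x0 xh]] i; case: (unliftP ord0 i) => [j ->|->].
  by have := bU _ Ux j; rewrite mxE.
by rewrite (ltW x0) (lt_le_trans xh) ?hb.
Qed.

Lemma bdd_le b b' n (U : set K^^n) : (b <= b')%N -> bdd b U -> bdd b' U.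
Proof.
move=> bb' bU x /bU H i; have /andP[-> h] := H i; apply: lt_le_trans h _.
by rewrite ler_nat.
Qed.

Lemma vl_diff P b n (X Y : set K^^n) : countable P -> D S P X -> D S P Y -> bdd b Y -> X `<=` Y ->
  (forall x, Y x -> ~ X x -> ~ gen P x) -> vl X = vl Y.
Proof.
move=> cP DX DY bY XY N; have DD : D S P (Y `\` X) by apply: D_and => //; exact: D_not.
have bD : bdd b (Y `\` X) by apply: bdd_sub bY => x [].
have bX : bdd b X by apply: bdd_sub bY.
have -> : Y = X `|` (Y `\` X).
  by apply/seteqP; split=> x; [move=> Yx; have [|] := pselect (X x); [left|right]|move=> [/XY|[]]].
rewrite (vlU cP DX DD bX bD) => [|x Xx []//].
by rewrite (small_nogen cP DD bD) ?addr0 // => x [Yx Xx]; exact: N.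
Qed.

Lemma vl_partition P b n (J : finType) (X : J -> set K^^n) (Y : set K^^n) :
  countable P -> (forall j, D S P (X j)) -> D S P Y -> bdd b Y -> (forall j, X j `<=` Y) ->
  (forall i j x, X i x -> X j x -> i = j) -> (forall x, Y x -> gen P x -> exists j, X j x) ->
  vl Y = \sum_j vl (X j).
Proof.
move=> cP DX DY bY XY Xd Yc.
pose U (s : seq J) : set K^^n := [set x | exists j, j \in s /\ X j x].
have DU s : D S P (U s).
  have Dj j : D S P (fun x => (j \in s) /\ X j x) by apply: D_and => //; exact: D_const.
  exact: D_finex Dj.
have bU s : bdd b (U s) by apply: bdd_sub bY => x [j [_ /XY]].
have bX j : bdd b (X j) by apply: bdd_sub bY; exact: XY.
have key s : uniq s -> vl (U s) = \sum_(j <- s) vl (X j).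
  elim: s => [|j s IH] /=.
    by rewrite big_nil (_ : U [::] = set0) ?vl_set0 //; apply/seteqP; split=> // x [j []].
  move=> /andP[js us]; rewrite big_cons -IH // -(vlU cP (DX j) (DU s) (bX j) (bU s)).
    congr vl; apply/seteqP; split=> x.
      by move=> [i []]; rewrite inE => /orP[/eqP ->|si] Xi; [left|right; exists i].
    by move=> [Xj|[i [si Xi]]]; [exists j; rewrite mem_head|exists i; rewrite inE si orbT].
  by move=> x Xj [i [si Xi]]; rewrite (Xd _ _ _ Xj Xi) si in js.
have := key (enum J) (enum_uniq J); rewrite big_enum => <-; symmetry.
apply: (vl_diff cP (DU _) DY bY) => [x [j [_ /XY]]//|x Yx NU gx].
by have [j Xj] := Yc x Yx gx; apply: NU; exists j; rewrite mem_enum.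
Qed.

Lemma vl_itv_le b (X : set K^^1) (a c : K) : bdd b X -> 0 <= a -> a <= c -> c <= b%:R ->
  (forall x, X x -> a <= x 0 0 <= c) -> vl X <= str c - str a.
Proof.
move=> bX a0 ac cb Xac; rewrite -lee_fin -(vl_fin bX).
have fa : finite_elt a by apply: (@fin_itv _ b); rewrite a0 (le_trans ac).
have fc : finite_elt c by apply: (@fin_itv _ b); rewrite (le_trans a0 ac).
have sac : str a <= str c by apply: stP_le ac; exact: strP.
apply: le_trans (@lo_cover 1 unit (fun=> const_mx (str a)) (fun=> const_mx (str c)) _ _ _) _.
- by move=> _ i; rewrite !mxE.
- move=> y [x Xx xy]; exists tt => i; rewrite !mxE; have /st_stP Hx := xy i.
  have := Xac x Xx; rewrite ord1 in Hx * => /andP[ax xc].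
  by rewrite (stP_le (strP fa) Hx ax) (stP_le Hx (strP fc) xc).
by rewrite lee_fin (big_pred1 tt) //= /vol big_ord1 !mxE.
Qed.

Lemma str_nat (n : nat) : str (n%:R : K) = n%:R.
Proof. by apply: strE; exact: stP_nat. Qed.

(** From the upper bounds for the two complementary intervals. *)
Lemma vl_itv_ge P b (X : set K^^1) (a c : K) : countable P -> D S P X -> bdd b X -> 0 <= a -> a <= c -> c <= b%:R ->
  (forall x : K^^1, a < x 0 0 < c -> X x) -> str c - str a <= vl X.
Proof.
move=> cP DX bX a0 ac cb Xac.
pose P' := P `|` [set a] `|` [set c].
have cP' : countable P' by rewrite /P'; ctb.
have DX' : D S P' X by apply: D_mono DX => x; left; left.
pose Y1 : set K^^1 := [set x | 0 <= x 0 0 < b%:R /\ x 0 0 <= a].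
pose Y2 : set K^^1 := [set x | 0 <= x 0 0 < b%:R /\ c <= x 0 0].
have Da (T : Type) (eT : encodable K T) : Df S P' (fun _ : T => a) by apply: Df_cst; left; right.
have Dc (T : Type) (eT : encodable K T) : Df S P' (fun _ : T => c) by apply: Df_cst; right.
have Db (T : Type) (eT : encodable K T) : Df S P' (fun _ : T => b%:R : K) by exact: Df_nat.
have Dx : Df S P' (fun x : K^^1 => x 0 0) by apply: Df_entry; exact: Df_id.
have Dhb : D S P' (fun x : K^^1 => 0 <= x 0 0 < b%:R).
  by apply: D_andb; [apply: D_le => //; exact: Df_0|apply: D_lt].
have D1 : D S P' Y1 by apply: D_and => //; apply: D_le.
have D2 : D S P' Y2 by apply: D_and => //; apply: D_le.
have b1 : bdd b Y1 by move=> x [h _] i; rewrite ord1.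
have b2 : bdd b Y2 by move=> x [h _] i; rewrite ord1.
have sub : hbox b 1 `<=` X `|` (Y1 `|` Y2).
  move=> x hx; have h0 := hx 0; have [xa|ax] := leP (x 0 0) a; first by right; left.
  by have [cx|xc] := leP c (x 0 0); [right; right|left; apply: Xac; rewrite ax xc].
have := vl_mono (bddU bX (bddU b1 b2)) sub; rewrite (vl_hbox) expr1.
have := vlU_le cP' DX' (D_or D1 D2) bX (bddU b1 b2).
have := vlU_le cP' D1 D2 b1 b2.
have l1 : vl Y1 <= str a - str (0 : K).
  by apply: (vl_itv_le b1 (lexx _) a0 (le_trans ac cb)) => x [/andP[-> _] ->].
have l2 : vl Y2 <= str (b%:R : K) - str c.
  by apply: (vl_itv_le b2 (le_trans a0 ac) cb (lexx _)) => x [/andP[_ /ltW ->] ->].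
have s0 : str (0 : K) = 0 := str_nat 0.
rewrite s0 in l1; rewrite str_nat in l2.
rewrite -[fun x => Y1 x \/ Y2 x]/(Y1 `|` Y2); lra.
Qed.

Definition pt (t : K) : K^^1 := const_mx t.

Lemma ptE (x : K^^1) : x = pt (x 0 0).
Proof. by apply/rowP => i; rewrite ord1 mxE. Qed.

Lemma Df_pt P T {eT : encodable K T} (t : T -> K) : Df S P t -> Df S P (fun x => pt (t x)).
Proof.
move=> Dt; apply: Df_rV => i; have -> : (fun x => pt (t x) 0 i) = t by apply/funext => x; rewrite mxE.
exact: Dt.
Qed.

Lemma acl_app P n (f : K^^n -> K) v : Df S P f -> acl (P <+ v) (f v).
Proof.
move=> Df0; exists (fun s => s = f v); split=> //; last by exists [:: f v] => y ->; rewrite mem_head.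
by apply: (@D_inst_vec P n v K _ (fun p : K * K^^n => p.1 = f p.2)); ddef.
Qed.

Lemma rk_image P n k (g : K^^n -> K^^k) x d : Df S P g -> rk P (vals (g x)) d -> rk P (vals x) d.
Proof.
move=> Dg; apply: (rk_acl) => _ /valsP[i ->].
by apply: (acl_app (f := fun y => g y 0 i)); exact: Df_entry.
Qed.

Lemma gen_image P n (g : K^^n -> K^^n) x : Df S P g -> gen P (g x) -> gen P x.
Proof. by move=> Dg /gen_rk/(rk_image Dg)/(rk_gen). Qed.

Lemma D_img P n k (X : set K^^n) (g : K^^n -> K^^k) : D S P X -> Df S P g -> D S P [set g x | x in X].
Proof. by move=> DX Dg; have : D S P (fun y => exists2 x, X x & g x = y) by ddef. Qed.

Lemma vl_pt0 b (X : set K^^1) (e : K) : bdd b X -> 0 <= e <= b%:R -> (forall x, X x -> x 0 0 = e) -> vl X = 0.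
Proof.
move=> bX /andP[e0 eb] Xe; apply/eqP; rewrite eq_le vl_ge0 andbT.
rewrite -(subrr (str e)); apply: (vl_itv_le bX e0 (lexx _) eb) => x /Xe ->.
by rewrite lexx.
Qed.

Lemma vl_img_pt b (Z : set K^^1) (g : K^^1 -> K^^1) (e : K) :
  bdd b [set g x | x in Z] -> (forall x, Z x -> x 0 0 = e) -> vl [set g x | x in Z] = 0.
Proof.
move=> bgZ Ze; have [[x0 Zx0]|NZ] := pselect (exists x, Z x); last first.
  by rewrite (_ : [set g x | x in Z] = set0) ?vl_set0 //; apply/seteqP; split=> // y [x Zx]; case: NZ; exists x.
apply: (vl_pt0 (e := g x0 0 0) bgZ).
  by have /andP[-> /ltW ->] := bgZ (g x0) (ex_intro2 _ _ x0 Zx0 erefl) 0.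
by move=> _ [x Zx <-]; rewrite [x]ptE (Ze x Zx) -(Ze x0 Zx0) -ptE.
Qed.

Lemma count_itv (E : seq K) a q c : q \in E -> a < q -> q < c ->
  (count (fun e => a < e < q)%R E + count (fun e => q < e < c)%R E < count (fun e => a < e < c)%R E)%N.
Proof.
move=> qE aq qc; have : (0 < count (pred1 q) E)%N by rewrite -has_count has_pred1.
suff: (count (fun e => a < e < q)%R E + count (fun e => q < e < c)%R E + count (pred1 q) E <= count (fun e => a < e < c)%R E)%N.
  by set i1 := count _ _; set i2 := count _ _; set i3 := count _ _; set i4 := count _ _; clear; lia.
elim: E {qE} => //= d s; have : ((a < d < q)%R + (q < d < c)%R + (d == q) <= (a < d < c)%R)%N.
  have [dq|qd|->] := ltgtP d q; rewrite ?andbF ?andbT ?aq ?qc //=.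
    by rewrite (lt_trans dq qc) andbT; case: (a < d)%R.
  by rewrite (lt_trans aq qd); case: (d < c)%R.
set i1 := count _ _; set i2 := count _ _; set i3 := count _ _; set i4 := count _ _; clear => h1 h2.
have := leq_add h1 h2; set x1 := nat_of_bool _; set x2 := nat_of_bool _; set x3 := nat_of_bool _; set x4 := nat_of_bool _; clear; lia.
Qed.

(* The derivative bound holds at generic points only; the remaining points of
   [X] are absorbed by splitting at the finitely many points where the set of
   good points changes. *)
Lemma lip_image P b (X : set K^^1) (g : K^^1 -> K^^1) (rho : rat) :
  countable P -> D S P X -> Df S P g -> bdd b X -> bdd b [set g x | x in X] -> 0 <= rho ->
  (forall x, X x -> gen P x -> `|grad (fun y => g y 0 0) x 0 0| <= ratr rho) ->
  vl [set g x | x in X] <= ratr rho * vl X.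
Proof.
move=> cP DX Dg bX bgX rho0 Hg.
have Dg0 : Df S P (fun y => g y 0 0) by exact: Df_entry.
(* A derivative bounded by [rho] gives local Lipschitz constants only above [rho]. The excess [e] is
   rational because standard parts are multiplied by rational constants in [stPM]; it is removed at
   the end. *)
have main (e : rat) : 0 < e -> vl [set g x | x in X] <= ratr (rho + e) * vl X.
  move=> e0; set r := rho + e; have r0 : 0 < r by rewrite /r; lra.
  have rK : 0 < ratr r :> K by rewrite ltr0q.
  have rR : 0 < ratr r :> R by rewrite ltr0q.
  pose c t := g (pt t) 0 0.
  have Dpt : Df S P pt by apply: Df_pt; exact: Df_id.
  have Dc : Df S P c by apply: (Df_comp Dg0).
  pose Q t := X (pt t) /\ exists d : K, 0 < d /\ forall u, `|u - t| < d -> `|c u - c t| <= ratr r * `|u - t|.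
  have Dr (T : Type) (eT : encodable K T) : Df S P (fun _ : T => ratr r : K).
    have -> : ratr r = (numq r)%:~R / (denq r)%:~R :> K by [].
    have Dint (z : int) : Df S P (fun _ : T => z%:~R : K).
      case: z => m; first exact: Df_nat.
      by rewrite NegzE mulrNz; apply: Df_opp; exact: Df_nat.
    by apply: Df_mul => //; exact: Df_inv.
  have DQ : D S P Q.
    apply: D_and; first exact: D_comp DX Dpt.
    apply: D_ex; apply: D_and; first by ddef.
    apply: D_all; apply: D_imp; first by ddef.
    by apply: D_le; [ddef|apply: Df_mul => //; ddef].
  have Qgen x : X x -> gen P x -> Q (x 0 0).
    move=> Xx gx; split; first by rewrite -ptE.
    have sg := grad_gen cP gx Dg0.
    have eK : 0 < ratr e :> K by rewrite ltr0q.
    have [|d d0 Hd] := sdiff_ptlip (M := ratr rho) (e := ratr e) sg _ eK.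
      by move=> j; rewrite ord1; exact: Hg.
    exists d; split=> // u ux; have l1E : l1 (pt u - x) = `|u - x 0 0|.
      by rewrite /l1 big_ord1 !mxE.
    have := Hd (pt u) _; rewrite l1E -rmorphD {1 2}/c -ptE; apply.
    by move=> i; rewrite ord1 mxE.
  have [E HE] := omin_pts DQ.
  pose Xab (a c : K) : set K^^1 := [set x | X x /\ a < x 0 0 < c].
  pose PP (a c : K) := P `|` [set a] `|` [set c].
  have cPP a c' : countable (PP a c') by rewrite /PP; ctb.
  have PPs a c' : P `<=` PP a c' by move=> x; left; left.
  have DXab a c' (P' : set K) : PP a c' `<=` P' -> D S P' (Xab a c').
    move=> sP; apply: D_and; first by apply: D_mono DX => x Px; apply: sP; left; left.
    have Da : Df S P' (fun _ : K^^1 => a) by apply: Df_cst; apply: sP; left; right.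
    have Dc' : Df S P' (fun _ : K^^1 => c') by apply: Df_cst; apply: sP; right.
    by apply: D_andb; apply: D_lt => //; apply: Df_entry; exact: Df_id.
  have bXab a c' : bdd b (Xab a c') by apply: bdd_sub bX => x [].
  have bgab a c' : bdd b [set g x | x in Xab a c'].
    by apply: bdd_sub bgX => _ [x [Xx _] <-]; exists x.
  have step (N : nat) : forall a c' : K, 0 <= a -> a < c' -> c' <= b%:R ->
      (count (fun e => a < e < c')%R E <= N)%N -> vl [set g x | x in Xab a c'] <= ratr r * vl (Xab a c').
    elim: N => [|N IH] a c' a0 ac cb HN.
      have nE q : q \in E -> ~~ (a < q < c').
        move=> qE; apply/negP => Hq; move: HN; rewrite leqn0 => /eqP/eqP; rewrite eqn0Ngt -has_count => /hasP; apply.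
        by exists q.
      have DX' := DXab a c' (PP a c') (fun x => id).
      (* Between consecutive points of [E] all points are good or none is. In the second case there
         are no generic points, neither in the interval nor in its image, because preimages of
         generic points are generic. *)
      have [good|bad] := HE a c' ac nE; last first.
        have -> : vl [set g x | x in Xab a c'] = 0.
          have Dg' := Df_mono (@PPs a c') Dg.
          apply: (small_nogen (cPP a c') (D_img DX' Dg') (bgab a c')).
          move=> _ [x [Xx xac] <-] gy; apply: (bad _ xac); apply: Qgen => //.
          by apply: (gen_image Dg); apply: ind_mono gy; exact: PPs.
        by rewrite mulr_ge0 ?vl_ge0 // ltW.
      have lip t u : a < t < c' -> a < u < c' -> `|c u - c t| <= ratr r * `|u - t|.
        apply: (lip1 Dc) => t' /good[_ [d [d0 Hd]]]; by exists d.
      pose t0 := (a + c') / 2%:R; pose M := ratr r * ((c' - a) / 2%:R).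
      have t0ac : a < t0 < c' by rewrite /t0; apply/andP; split; lra.
      have M0 : 0 <= M by rewrite mulr_ge0 ?(ltW rK) // divr_ge0; lra.
      have cb0 t : a < t < c' -> 0 <= c t < b%:R.
        move=> tac; have [Xt _] := good t tac; rewrite /c.
        by apply: (bgX (g (pt t))); exists (pt t).
      have /andP[ct0 ctb] := cb0 t0 t0ac.
      pose lo := Num.max 0 (c t0 - M); pose hi := Num.min b%:R (c t0 + M).
      have lo0 : 0 <= lo by rewrite le_max lexx.
      have hib : hi <= b%:R by rewrite ge_min lexx.
      have lohi : lo <= hi.
        by rewrite /lo /hi ge_max !le_min; apply/andP; split; apply/andP; split; lra.
      have hl : hi - lo <= ratr r * (c' - a).
        have h1 : hi <= c t0 + M by rewrite ge_min lexx orbT.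
        have h2 : c t0 - M <= lo by rewrite le_max lexx orbT.
        have -> : ratr r * (c' - a) = M + M by rewrite /M; field.
        lra.
      have vg : vl [set g x | x in Xab a c'] <= str hi - str lo.
        apply: (vl_itv_le (bgab a c') lo0 lohi hib) => _ [x [Xx xac] <-].
        have cx : g x 0 0 = c (x 0 0) by rewrite /c -ptE.
        rewrite cx; have := lip t0 (x 0 0) t0ac xac.
        have tx : ratr r * `|x 0 0 - t0| <= M.
          rewrite ler_pM2l // ler_norml /t0; move: xac => /andP[h1 h2]; apply/andP; split; lra.
        have /andP[cx0 cxb] := cb0 _ xac.
        rewrite ler_norml => /andP[h1 h2]; rewrite ge_max le_min cx0 (ltW cxb) /=.
        by apply/andP; split; lra.
      have vX : str c' - str a <= vl (Xab a c').
        apply: (vl_itv_ge (cPP a c') DX' (bXab a c') a0 (ltW ac) cb) => x xac.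
        by split=> //; have [] := good _ xac; rewrite -ptE.
      have fa : finite_elt a by apply: (@fin_itv _ b); rewrite a0 (le_trans (ltW ac)).
      have fc : finite_elt c' by apply: (@fin_itv _ b); rewrite (le_trans a0 (ltW ac)).
      have flo : finite_elt lo by apply: (@fin_itv _ b); rewrite lo0 (le_trans lohi).
      have fhi : finite_elt hi by apply: (@fin_itv _ b); rewrite (le_trans lo0).
      apply: (le_trans vg); apply: (@le_trans _ _ (ratr r * (str c' - str a))); last by rewrite ler_pM2l.
      apply: (stP_le _ _ hl).
        exact: stPD (strP fhi) (stPN (strP flo)).
      apply: stPM; first exact: ltW.
      exact: stPD (strP fc) (stPN (strP fa)).
    have [/hasP[q qE qac]|nE] := boolP (has (fun e => a < e < c') E); last first.
      by apply: IH => //; move: nE; rewrite has_count -leqNgt leqn0 => /eqP ->.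
    have /andP[aq qc] := qac.
    have cnt : (count (fun e => a < e < q)%R E + count (fun e => q < e < c')%R E < count (fun e => a < e < c')%R E)%N by exact: count_itv.
    have l1 : vl [set g x | x in Xab a q] <= ratr r * vl (Xab a q).
      apply: IH => //; first exact: le_trans (ltW qc) cb.
      rewrite -ltnS; apply: leq_trans HN; apply: leq_ltn_trans cnt; exact: leq_addr.
    have l2 : vl [set g x | x in Xab q c'] <= ratr r * vl (Xab q c').
      apply: IH => //; first exact: le_trans a0 (ltW aq).
      rewrite -ltnS; apply: leq_trans HN; apply: leq_ltn_trans cnt; exact: leq_addl.
    pose P3 := P `|` [set a] `|` [set c'] `|` [set q].
    have cP3 : countable P3 by rewrite /P3; ctb.
    have D1 : D S P3 (Xab a q) by apply: DXab => x [[Px|->]|->]; [left; left; left|left; left; right|right].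
    have D2 : D S P3 (Xab q c') by apply: DXab => x [[Px|->]|->]; [left; left; left|right|left; right].
    have Dg3 : Df S P3 g by apply: Df_mono Dg => x Px; left; left; left.
    pose Z : set K^^1 := [set x | X x /\ x 0 0 = q].
    have DZ : D S P3 Z.
      apply: D_and; first by apply: D_mono DX => x Px; left; left; left.
      apply: D_eqT; first by apply: Df_entry; exact: Df_id.
      by apply: Df_cst; right.
    have bgZ : bdd b [set g x | x in Z] by apply: bdd_sub bgX => _ [x [Xx _] <-]; exists x.
    have vZ : vl [set g x | x in Z] = 0 by apply: (vl_img_pt (e := q) bgZ) => x [].
    have gE : [set g x | x in Xab a c'] = [set g x | x in Xab a q] `|` ([set g x | x in Xab q c'] `|` [set g x | x in Z]).
      apply/seteqP; split=> y.
        move=> [x [Xx /andP[ax xc]] <-]; have [xq|qx|xq] := ltgtP (x 0 0) q.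
        - by left; exists x => //; split=> //; rewrite ax xq.
        - by right; left; exists x => //; split=> //; rewrite qx xc.
        - by right; right; exists x.
      move=> [[x [Xx /andP[ax xq]] <-]|[[x [Xx /andP[ax xq]] <-]|[x [Xx xq] <-]]]; exists x => //; split=> //.
      - by rewrite ax (lt_trans xq).
      - by rewrite xq (lt_trans aq).
      - by rewrite xq aq qc.
    have bU : bdd b ([set g x | x in Xab q c'] `|` [set g x | x in Z]) by apply: bddU.
    have DU : D S P3 ([set g x | x in Xab q c'] `|` [set g x | x in Z]).
      by apply: D_or; exact: D_img.
    rewrite gE; apply: le_trans (vlU_le cP3 (D_img D1 Dg3) DU (bgab a q) bU) _.
    have := vlU_le cP3 (D_img D2 Dg3) (D_img DZ Dg3) (bgab q c') bgZ; rewrite vZ.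
    have disj x : Xab a q x -> ~ Xab q c' x.
      by move=> [_ /andP[_ xq]] [_ /andP[qx _]]; have := lt_trans xq qx; rewrite ltxx.
    have := vlU cP3 D1 D2 (bXab a q) (bXab q c') disj.
    have sub : Xab a q `|` Xab q c' `<=` Xab a c'.
      move=> x [[Xx /andP[ax xq]]|[Xx /andP[ax xq]]]; split=> //.
        by rewrite ax (lt_trans xq).
      by rewrite xq (lt_trans aq).
    have := vl_mono (bXab a c') sub => h1 h2 h3.
    have : ratr r * (vl (Xab a q) + vl (Xab q c')) <= ratr r * vl (Xab a c') by rewrite ler_pM2l // -h2.
    lra.
  have [b0|b0] := posnP b.
    have X0 : X = set0 by apply/seteqP; split=> // x /bX /(_ 0); rewrite b0 => /andP[/le_lt_trans h /h]; rewrite ltxx.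
    by rewrite X0 image_set0 !vl_set0 mulr0.
  have bK : 0 < b%:R :> K by rewrite ltr0n.
  have H := step _ 0 b%:R (lexx _) bK (lexx _) (leqnn _).
  pose Z : set K^^1 := [set x | X x /\ x 0 0 = 0].
  have DZ : D S P Z by apply: D_and => //; apply: D_eqT; [apply: Df_entry; exact: Df_id|exact: Df_0].
  have bgZ : bdd b [set g x | x in Z] by apply: bdd_sub bgX => _ [x [Xx _] <-]; exists x.
  have vZ : vl [set g x | x in Z] = 0 by apply: (vl_img_pt (e := 0) bgZ) => x [].
  have DX0 : D S P (Xab 0 b%:R).
    apply: D_and => //; have Dx : Df S P (fun x : K^^1 => x 0 0) by apply: Df_entry; exact: Df_id.
    by apply: D_andb; apply: D_lt => //; [exact: Df_0|exact: Df_nat].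
  have gE : [set g x | x in X] `<=` [set g x | x in Xab 0 b%:R] `|` [set g x | x in Z].
    move=> _ [x Xx <-]; have /andP[x0 xb] := bX x Xx 0.
    move: x0; rewrite le_eqVlt => /orP[/eqP x0|x0]; first by right; exists x.
    by left; exists x => //; split=> //; rewrite x0 xb.
  apply: le_trans (vl_mono (bddU (bgab _ _) bgZ) gE) _.
  apply: le_trans (vlU_le cP (D_img DX0 Dg) (D_img DZ Dg) (bgab _ _) bgZ) _.
  rewrite vZ addr0; apply: (le_trans H); rewrite ler_pM2l //.
  by apply: vl_mono bX _ => x [].
rewrite leNgt; apply/negP => lt0.
have : 0 <= vl X by exact: vl_ge0.
move: lt0 main; set v := vl X; set w := vl _ => lt0 main v0; have v1 : 0 < v + 1 by lra.
have : 0 < (w - ratr rho * v) / (v + 1) by rewrite divr_gt0 ?subr_gt0.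
move=> /rat_in_itvoo [q]; rewrite in_itv /= => /andP[q0].
rewrite ltr_pdivlMr // => qlt; have q0' : 0 < q by rewrite -(@ltr0q R).
have := main q q0'; rewrite rmorphD /= mulrDl; rewrite mulrDr mulr1 in qlt; lra.
Qed.

Lemma graph_inv P n (X : set K^^n) (g : K^^n -> K^^n) : D S P X -> Df S P g ->
  (forall x y, X x -> X y -> g x = g y -> x = y) ->
  exists2 k : K^^n -> K^^n, Df S P k & forall x, X x -> k (g x) = x.
Proof.
move=> DX Dg gI.
pose Rl (y x : K^^n) := (X x /\ g x = y) \/ (x = 0 /\ ~ exists2 x', X x' & g x' = y).
have [||y x x' [[Xx gx]|[-> N]] [[Xx' gx']|[-> N']]|k Dk Hk] := @graph_fun P _ _ _ _ Rl.
- by rewrite /Rl; ddef.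
- move=> y; have [[x Xx gx]|N] := pselect (exists2 x', X x' & g x' = y); first by exists x; left.
  by exists 0; right.
- by apply: gI => //; rewrite gx gx'.
- by case: N'; exists x.
- by case: N; exists x'.
- by [].
exists k => // x Xx; case: (Hk (g x)) => [[Xk gk]|[_ []]]; last by exists x.
exact: gI.
Qed.

Lemma sdiff_mix n k m (p : 'I_m -> 'I_n + 'I_k) q (F : K^^m -> K) y z G : cancel p q -> cancel q p ->
  sdiff F (mix p y z) G -> sdiff (fun z => F (mix p y z)) z (\row_c G 0 (q (inr c))).
Proof.
move=> pK qK HF; pose J : 'M[K]_(k, m) := \matrix_(c, l) (l == q (inr c))%:R.
have -> : \row_c G 0 (q (inr c)) = G *m J^T.
  apply/rowP => c; rewrite !mxE (bigD1 (q (inr c))) //= !mxE eqxx mulr1 big1 ?addr0 // => l lc.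
  by rewrite !mxE (negPf lc) mulr0.
apply: (chain (phi := mix p y)) HF => l; case E: (p l) => [a|c].
  have -> : (fun z => mix p y z 0 l) = (fun=> y 0 a) by apply/funext => z'; rewrite mxE E.
  have -> : \row_j J j l = 0; last exact: sdiff_cst.
  by apply/rowP => c; rewrite !mxE; case: eqP => // lq; move: E; rewrite lq qK.
have -> : (fun z => mix p y z 0 l) = (fun z : K^^k => z 0 c) by apply/funext => z'; rewrite mxE E.
have -> : \row_j J j l = delta_mx 0 c; last exact: sdiff_coord.
by apply/rowP => c'; rewrite !mxE eqxx /= -(can_eq pK) E qK eq_sym.
Qed.

(** Apply [lip_image] to the inverse function, whose derivative the chain rule gives. *)
Lemma lip_image_inv P b (X : set K^^1) (g : K^^1 -> K^^1) (rho : rat) :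
  countable P -> D S P X -> Df S P g -> bdd b X -> bdd b [set g x | x in X] -> 0 < rho ->
  (forall x y, X x -> X y -> g x = g y -> x = y) ->
  (forall x, X x -> gen P x -> ratr rho <= `|grad (fun y => g y 0 0) x 0 0|) ->
  ratr rho * vl X <= vl [set g x | x in X].
Proof.
move=> cP DX Dg bX bgX rho0 gI Hg; have [k Dk Hk] := graph_inv DX Dg gI.
have kg : [set k y | y in [set g x | x in X]] = X.
  apply/seteqP; split=> x; first by move=> [_ [x' Xx' <-] <-]; rewrite Hk.
  by move=> Xx; exists (g x); [exists x|exact: Hk].
have r0 : 0 < ratr rho :> R by rewrite ltr0q.
rewrite -ler_pdivlMl // -fmorphV /= -{1}kg.
apply: (lip_image (b := b) cP) => //; [exact: D_img|by rewrite kg|by rewrite invr_ge0 ltW|].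
move=> _ [x Xx <-] ggx; have gx := gen_image Dg ggx.
have Dk0 : Df S P (fun y => k y 0 0) by exact: Df_entry.
have Dg0 : Df S P (fun y => g y 0 0) by exact: Df_entry.
have sk := grad_gen cP ggx Dk0; have sg := grad_gen cP gx Dg0.
pose J : 'M[K]_(1, 1) := grad (fun y => g y 0 0) x.
have sc : sdiff (fun y => k (g y) 0 0) x (grad (fun y => k y 0 0) (g x) *m J^T).
  apply: (chain (phi := g) (J := J)) sk => l; rewrite (ord1 l).
  by rewrite (_ : \row_j J j 0 = grad (fun y => g y 0 0) x) //; apply/rowP => c; rewrite mxE (ord1 c).
have [d d0 Hd] := near_gen cP gx DX Xx.
have := sdiff_unique (sdiff_local d0 (fun y Hy => congr1 (fun u : K^^1 => u 0 0) (Hk y (Hd y Hy))) sc) (sdiff_coord x 0).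
move/(congr1 (fun u : K^^1 => `|u 0 0|)); rewrite !mxE big_ord1 !mxE eqxx normrM normr1.
have := Hg x Xx gx; rewrite /J; set u := `|grad _ x 0 0| => Hu.
have rK : 0 < ratr rho :> K by rewrite ltr0q.
have u0 : 0 < u by exact: lt_le_trans Hu.
move/(canRL (mulfK (lt0r_neq0 u0))) => ->.
by rewrite div1r fmorphV lef_pV2.
Qed.

Lemma ins_up0 n (j : 'I_n.+1) (s : K) (y : K^^n.+1) : ins (lift ord0 j) s y 0 ord0 = y 0 ord0.
Proof.
have -> : ord0 = lift (lift ord0 j) ord0 :> 'I_n.+2 by apply/val_inj.
by rewrite ins_lift.
Qed.

Lemma col'_ins_up n (j : 'I_n.+1) (s : K) (y : K^^n.+1) :
  col' ord0 (ins (lift ord0 j) s y) = ins j s (col' ord0 y).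
Proof.
apply/rowP => k; rewrite mxE; case: (unliftP j k) => [l ->|->]; last by rewrite !insE.
have -> : lift ord0 (lift j l) = lift (lift ord0 j) (lift ord0 l).
  by apply/val_inj; rewrite /= /bump /=; lia.
by rewrite !ins_lift mxE.
Qed.

Lemma vl_fib_Hypo P b n (U : set K^^n) (k : K^^n -> K) x : countable P -> D S P U -> Df S P k -> bdd b U -> U x ->
  0 <= k x <= b%:R -> vl (fib (pr1 ord0) (Hypo U k) x) = str (k x).
Proof.
move=> cP DU Dk bU Ux /andP[k0 kb].
have E (s : K^^1) : fib (pr1 ord0) (Hypo U k) x s <-> 0 < s 0 0 < k x.
  by rewrite /fib /Hypo /= mixr1K col'_ins insE; split=> [[]//|]; split.
have bF : bdd b (fib (pr1 ord0) (Hypo U k) x).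
  by move=> s /E/andP[s0 sk] i; rewrite (ord1 i) (ltW s0) (lt_le_trans sk).
have s0 : str (0 : K) = 0 by exact: str_nat 0.
have -> : str (k x) = str (k x) - str (0 : K) by rewrite s0 subr0.
apply/eqP; rewrite eq_le; apply/andP; split.
  apply: (vl_itv_le bF (lexx _) k0 kb) => s /E/andP[/ltW -> /ltW ->]; exact: isT.
have cP' : countable (P <+ x) by ctb.
by apply: (vl_itv_ge cP' (D_fib _ _ (D_Hypo DU Dk)) bF (lexx _) k0 kb) => s /E.
Qed.

(* Fibrewise over [U] the two sides are the intervals [(0, k x)] and [(0, k' x)]. *)
Lemma vl_Hypo_le P b n (U : set K^^n) (k k' : K^^n -> K) (r : rat) : countable P -> D S P U -> Df S P k -> Df S P k' -> bdd b U ->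
  0 <= r -> (forall x, U x -> 0 <= k x <= b%:R) -> (forall x, U x -> 0 <= k' x <= b%:R) ->
  (forall x, U x -> k x <= ratr r * k' x) -> vl (Hypo U k) <= ratr r * vl (Hypo U k').
Proof.
move=> cP DU Dk Dk' bU r0 k0b k0b' kk.
apply: (fubini_le (pr1K ord0) (qr1K ord0) (pr1K ord0) (qr1K ord0) cP (D_Hypo DU Dk) (D_Hypo DU Dk')).
- by apply: bdd_Hypo bU _ => x /k0b/andP[].
- by apply: bdd_Hypo bU _ => x /k0b'/andP[].
- by rewrite ler0q.
move=> x _; have [Ux|Nx] := pselect (U x); last first.
  rewrite (_ : fib _ (Hypo U k) x = set0); first by rewrite vl_set0; apply: mulr_ge0; [rewrite ler0q|exact: vl_ge0].
  by apply/seteqP; split=> // s; rewrite /fib /Hypo /= mixr1K col'_ins => -[].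
rewrite (vl_fib_Hypo cP DU Dk bU Ux (k0b x Ux)) (vl_fib_Hypo cP DU Dk' bU Ux (k0b' x Ux)).
have fin (l : K^^n -> K) : 0 <= l x <= b%:R -> finite_elt (l x) by exact: fin_itv.
exact: (stP_le (strP (fin _ (k0b x Ux))) (stPM r0 (strP (fin _ (k0b' x Ux))))) (kk x Ux).
Qed.

(** * Changing one coordinate *)

Section Elem.
Variables (P : set K) (b C n : nat) (j : 'I_n.+1) (U : set K^^n.+1) (g h : K^^n.+1 -> K).
Let th (x : K^^n.+1) : K^^n.+1 := ins j (g x) (col' j x).
Hypotheses (cP : countable P) (DU : D S P U) (Dg : Df S P g) (Dh : Df S P h) (bU : bdd b U)
  (btU : bdd b [set th x | x in U]) (tI : forall x y, U x -> U y -> th x = th y -> x = y)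
  (h0b : forall x, U x -> 0 <= h (th x) <= b%:R) (wC : forall x, U x -> `|grad g x 0 j| <= C%:R).

Let D_th : Df S P th.
Proof. by apply: Df_ins => //; ddef. Qed.

Let fib_th (X : set K^^n.+1) y : fib (pr1 (lift ord0 j)) (Hypo [set th x | x in X] h) y =
  [set pt (g (ins j (s 0 0) (col' ord0 y))) | s in fib (pr1 (lift ord0 j)) (Hypo X (fun x => h (th x))) y].
Proof.
apply/seteqP; split=> s; rewrite /fib /Hypo /= ?mixr1K ?ins_up0 ?col'_ins_up.
  move=> [[x Xx tx] yh]; have vx : col' j x = col' ord0 y by rewrite -[RHS](col'_ins j (s 0 0)) -tx col'_ins.
  have xE : ins j (x 0 j) (col' ord0 y) = x by rewrite -vx ins_col'.
  exists (pt (x 0 j)); first by rewrite mixr1K ins_up0 col'_ins_up mxE xE tx.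
  by rewrite mxE xE [RHS]ptE -(insE j (s 0 0) (col' ord0 y)) -tx /th insE.
move=> [u]; rewrite mixr1K ins_up0 col'_ins_up => -[Xx yh] <-; rewrite mxE.
have -> : ins j (g (ins j (u 0 0) (col' ord0 y))) (col' ord0 y) = th (ins j (u 0 0) (col' ord0 y)) by rewrite /th col'_ins.
by split=> //; exists (ins j (u 0 0) (col' ord0 y)).
Qed.

Section Piece.
Variables (X : set K^^n.+1).
Hypotheses (DX : D S P X) (XU : X `<=` U).
Let E := Hypo [set th x | x in X] h.
Let E' := Hypo X (fun x => h (th x)).
Let p := pr1 (lift ord0 j).
Let gam y (s : K^^1) := pt (g (ins j (s 0 0) (col' ord0 y))).

Let bX : bdd b X. Proof. exact: bdd_sub XU bU. Qed.
Let btX : bdd b [set th x | x in X]. Proof. by apply: bdd_sub btU => _ [x /XU Ux <-]; exists x. Qed.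
Let DE : D S P E. Proof. by apply: D_Hypo => //; exact: D_img. Qed.
Let DE' : D S P E'. Proof. by apply: D_Hypo => //; exact: (Df_comp Dh). Qed.
Let bE : bdd b E. Proof. by apply: bdd_Hypo btX _ => _ [x /XU/h0b/andP[_ ?] <-]. Qed.
Let bE' : bdd b E'. Proof. by apply: bdd_Hypo bX _ => x /XU/h0b/andP[_ ?]. Qed.

Let D_gam y : Df S (P <+ y) (gam y).
Proof.
apply: Df_pt; have Dg' : Df S (P <+ y) g by apply: Df_mono Dg => x; left.
apply: (Df_comp Dg'); apply: Df_ins; first by apply: Df_entry; exact: Df_id.
by apply: Df_rV => i; apply: Df_cst; right; rewrite !mxE; exact: mem_vals.
Qed.

Let grad_gam y s : fib p E' y s -> gen P y -> gen (P <+ y) s ->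
  exists2 x, X x & grad (fun s => gam y s 0 0) s 0 0 = grad g x 0 j.
Proof.
move=> Es gy gs; pose x := ins j (s 0 0) (col' ord0 y).
have Xx : X x by move: Es; rewrite /fib /E' /Hypo /= mixr1K col'_ins_up => -[].
exists x => //; have gx : gen P x.
  have : gen P (ins (lift ord0 j) (s 0 0) y) by rewrite -mixr1K; apply/(gen_mix (pr1K _) (qr1K _)).
  by move/(gen_col' P ord0) => -[+ _]; rewrite col'_ins_up.
have := grad_gen cP gx Dg; rewrite {1}/x -mixr1K => /(sdiff_mix (pr1K j) (qr1K j)).
move=> H; rewrite (gradP (G := \row_c grad g x 0 (qr1 j (inr c)))) ?mxE //.
apply: sdiff_local ltr01 _ H => u _; by rewrite /gam mxE mixr1K.
Qed.

(** On the lines in direction [j] the map is the function [gam] of one variable, with derivative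
    equal to the partial derivative of [g]. The fibres are compared by [lip_image]. *)
Lemma elem_le (r : rat) : 0 <= r -> (forall x, X x -> `|grad g x 0 j| <= ratr r) -> vl E <= ratr r * vl E'.
Proof.
move=> r0 wr; apply: (fubini_le (pr1K (lift ord0 j)) (qr1K _) (pr1K (lift ord0 j)) (qr1K _) cP DE DE' bE bE').
  by rewrite ler0q.
move=> y gy; have -> : fib (pr1 (lift ord0 j)) E y = [set gam y s | s in fib p E' y] := fib_th X y.
have cPy : countable (P <+ y) by ctb.
apply: (lip_image cPy (D_fib p y DE') (D_gam y) (bdd_fib (qr1K _) bE') _ r0).
  by have := bdd_fib (qr1K (lift ord0 j)) (y := y) bE; rewrite /E fib_th.
by move=> s Es gs; have [x Xx ->] := grad_gam Es gy gs; exact: wr.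
Qed.

Lemma elem_ge (r : rat) : 0 <= r -> (forall x, X x -> ratr r <= `|grad g x 0 j|) -> ratr r * vl E' <= vl E.
Proof.
rewrite le_eqVlt => /orP[/eqP <- _|r0 wr]; first by rewrite rmorph0 mul0r vl_ge0.
rewrite -ler_pdivlMl ?ltr0q // -fmorphV /=.
apply: (fubini_le (pr1K (lift ord0 j)) (qr1K _) (pr1K (lift ord0 j)) (qr1K _) cP DE' DE bE' bE).
  by rewrite ler0q invr_ge0 ltW.
move=> y gy; have -> : fib (pr1 (lift ord0 j)) E y = [set gam y s | s in fib p E' y] := fib_th X y.
have cPy : countable (P <+ y) by ctb.
rewrite fmorphV /= ler_pdivlMl ?ltr0q //.
apply: (lip_image_inv cPy (D_fib p y DE') (D_gam y) (bdd_fib (qr1K _) bE') _ r0).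
- by have := bdd_fib (qr1K (lift ord0 j)) (y := y) bE; rewrite /E fib_th.
- move=> s u; rewrite /fib /E' /Hypo /= !mixr1K !col'_ins_up => -[/XU Us _] [/XU Uu _] gsu.
  have /tI : th (ins j (s 0 0) (col' ord0 y)) = th (ins j (u 0 0) (col' ord0 y)).
    by rewrite /th !col'_ins; congr ins; move: gsu => /(congr1 (fun v : K^^1 => v 0 0)); rewrite !mxE.
  move=> /(_ Us Uu) /(congr1 (fun v : K^^n.+1 => v 0 j)); rewrite !insE => su.
  by rewrite [s]ptE su -ptE.
by move=> s Es gs; have [x Xx ->] := grad_gam Es gy gs; exact: wr.
Qed.

End Piece.

Let w x := `|grad g x 0 j|.
Let Dw : Df S P w. Proof. by apply: Df_norm; apply: Df_entry; exact: Df_grad. Qed.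
Let hw x := h (th x) * w x.
Let Dht : Df S P (fun x => h (th x)). Proof. exact: (Df_comp Dh). Qed.
Let Dhw : Df S P hw. Proof. exact: Df_mul. Qed.

(** The domain is cut into pieces on which the partial derivative varies by at most [1 / (N + 1)].
    On each piece both sides lie between the same multiples of the unweighted volume, so the total
    error is at most [c / (N + 1)]. *)
Lemma cv_elem : vl (Hypo [set th x | x in U] h) = vl (Hypo U hw).
Proof.
pose b' := (b * C.+1)%N; have bb' : (b <= b')%N by rewrite leq_pmulr.
have hwb x : U x -> 0 <= hw x <= b'%:R.
  move=> Ux; have /andP[h0 hb] := h0b Ux; have w0 : 0 <= w x by rewrite /w.
  rewrite mulr_ge0 //= natrM; apply: ler_pM => //.
  by apply: le_trans (wC Ux) _; rewrite ler_nat.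
have h0b' x : U x -> 0 <= h (th x) <= b'%:R.
  by move=> /h0b/andP[-> hb] /=; apply: le_trans hb _; rewrite ler_nat.
have bbU : bdd b' U by exact: bdd_le bU.
set a1 := vl _; set a2 := vl _; set c := vl (Hypo U (fun x => h (th x))).
have c0 : 0 <= c by exact: vl_ge0.
have key (N : nat) : `|a1 - a2| * N.+1%:R <= c.
  pose rat_ (i : nat) : rat := i%:R / N.+1%:R.
  have rE i (F : numFieldType) : ratr (rat_ i) = i%:R / N.+1%:R :> F by rewrite fmorph_div /= !ratr_nat.
  pose X (i : 'I_(C * N.+1).+1) : set K^^n.+1 := [set x | U x /\ i%:R <= w x * N.+1%:R < i.+1%:R].
  have DX i : D S P (X i).
    have Dn (m : nat) : Df S P (fun _ : K^^n.+1 => m%:R : K) by exact: Df_nat.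
    have DwN : Df S P (fun x => w x * N.+1%:R) by exact: Df_mul.
    by apply: D_and => //; apply: D_andb; [apply: D_le|apply: D_lt].
  have XU i : X i `<=` U by move=> x [].
  have Xd i i' x : X i x -> X i' x -> i = i'.
    move=> [_ /andP[h1 h2]] [_ /andP[h3 h4]]; apply/val_inj/eqP.
    have := le_lt_trans h1 h4; have := le_lt_trans h3 h2; rewrite !ltr_nat !ltnS => l1 l2.
    by rewrite eqn_leq l1 l2.
  have Xc x : U x -> exists i, X i x.
    move=> Ux; pose P0 (i : nat) := w x * N.+1%:R < i.+1%:R.
    have wN : w x * N.+1%:R <= (C * N.+1)%:R by rewrite natrM ler_wpM2r // wC.
    have exP : exists i, P0 i by exists (C * N.+1)%N; rewrite /P0 (le_lt_trans wN) // ltr_nat.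
    case: (ex_minnP exP) => i Pi mi.
    have iC : (i < (C * N.+1).+1)%N by rewrite ltnS; apply: mi; rewrite /P0 (le_lt_trans wN) // ltr_nat.
    exists (Ordinal iC); split=> //=; apply/andP; split=> //.
    case: i Pi mi {iC} => [|i] _ mi; first by rewrite mulr_ge0 // /w.
    by rewrite leNgt; apply/negP => /mi; rewrite ltnn.
  have bS1 : bdd b (Hypo [set th x | x in U] h) by apply: bdd_Hypo btU _ => _ [x /h0b/andP[_ ?] <-].
  have bS2 : bdd b' (Hypo U hw) by apply: bdd_Hypo bbU _ => x /hwb/andP[].
  have bS3 : bdd b (Hypo U (fun x => h (th x))) by apply: bdd_Hypo bU _ => x /h0b/andP[].
  have e1 : a1 = \sum_i vl (Hypo [set th x | x in X i] h).
    apply: (vl_partition cP _ (D_Hypo (D_img DU D_th) Dh) bS1).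
    - by move=> i; apply: D_Hypo => //; exact: D_img.
    - by move=> i y [[x [Ux _] xy] yh]; split=> //; exists x.
    - move=> i i' y [[x Xx xy] _] [[x' Xx' xy'] _]; apply: (Xd i i' x) => //.
      by rewrite (tI (XU _ _ Xx) (XU _ _ Xx') (etrans xy (esym xy'))).
    - by move=> y [[x Ux xy] yh] _; have [i Xi] := Xc x Ux; exists i; split=> //; exists x.
  have part k bk : Df S P k -> bdd bk (Hypo U k) -> vl (Hypo U k) = \sum_i vl (Hypo (X i) k).
    move=> Dk bk'; apply: (vl_partition cP _ (D_Hypo DU Dk) bk').
    - by move=> i; exact: D_Hypo.
    - by move=> i y [/XU Uy yh].
    - by move=> i i' y [Xi _] [Xi' _]; exact: Xd Xi Xi'.
    - by move=> y [/Xc[i Xi] yh] _; exists i.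
  have e2 : a2 = \sum_i vl (Hypo (X i) hw) by exact: part bS2.
  have e3 : c = \sum_i vl (Hypo (X i) (fun x => h (th x))) by exact: part bS3.
  have piece i : `|vl (Hypo [set th x | x in X i] h) - vl (Hypo (X i) hw)| * N.+1%:R <= vl (Hypo (X i) (fun x => h (th x))).
    have r0 (m : nat) : (0 : rat) <= rat_ m by rewrite divr_ge0.
    have w1 x : X i x -> w x <= ratr (rat_ i.+1) by move=> [_ /andP[_ /ltW]]; rewrite rE ler_pdivlMr.
    have w2 x : X i x -> ratr (rat_ i) <= w x by move=> [_ /andP[]]; rewrite rE ler_pdivrMr.
    have l1 := elem_le (DX i) (@XU i) (r0 i.+1) w1; have l2 := elem_ge (DX i) (@XU i) (r0 i) w2.
    have bXi : bdd b' (X i) by exact: bdd_sub (@XU i) bbU.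
    have hwX x : X i x -> 0 <= hw x <= b'%:R by move=> /XU/hwb.
    have htX x : X i x -> 0 <= h (th x) <= b'%:R by move=> /XU/h0b'.
    have l3 : vl (Hypo (X i) hw) <= ratr (rat_ i.+1) * vl (Hypo (X i) (fun x => h (th x))).
      apply: (vl_Hypo_le cP (DX i) Dhw Dht bXi (r0 _) hwX htX) => x Xx.
      by rewrite /hw mulrC ler_wpM2r ?w1 //; have /andP[] := htX x Xx.
    have l4 : ratr (rat_ i) * vl (Hypo (X i) (fun x => h (th x))) <= vl (Hypo (X i) hw).
      have [i0|i0] := posnP i; first by rewrite rE i0 mul0r mul0r vl_ge0.
      have ri : 0 < rat_ i by rewrite divr_gt0 ?ltr0n.
      rewrite -ler_pdivlMl ?ltr0q // -fmorphV /=.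
      apply: (vl_Hypo_le cP (DX i) Dht Dhw bXi _ htX hwX); first by rewrite invr_ge0 ltW.
      move=> x Xx; rewrite fmorphV ler_pdivlMl ?ltr0q // mulrC ler_wpM2l ?w2 //.
      by have /andP[] := htX x Xx.
    move: l1 l2 l3 l4; rewrite !rE -[i.+1%:R]natr1; set u1 := vl _; set u2 := vl _; set u3 := vl _.
    rewrite ![_ / _ * _]mulrAC !ler_pdivlMr // !ler_pdivrMr //.
    set M : R := N.+1%:R; set ii : R := i%:R => l1 l2 l3 l4.
    have M0 : 0 < M by [].
    rewrite -(ger0_norm (ltW M0)) -normrM ler_norml mulrBl; apply/andP; split; lra.
  rewrite e1 e2 e3 -sumrB; apply: le_trans (ler_wpM2r _ (ler_norm_sum _ _ _)) _; first exact: ler0n.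
  by rewrite mulr_suml; apply: ler_sum => i _; exact: piece.
apply/eqP; rewrite -subr_eq0 -normr_eq0 eq_le normr_ge0 andbT leNgt; apply/negP => d0.
have := archi_boundP (divr_ge0 c0 (ltW d0)); set N := Num.bound _ => HN.
have := key N; rewrite leNgt => /negP; apply.
rewrite mulrC -ltr_pdivrMr //; apply: (lt_le_trans HN).
by rewrite ler_nat.
Qed.

End Elem.

(** * Isolated points and vanishing gradients *)

Lemma ind_acl P P' s : (forall c, P' c -> acl P c) -> ind P s -> ind P' s.
Proof.
elim: s P P' => //= x s IH P P' PP' [Nx Is]; split; first by move/(acl_trans PP').
apply: IH Is => c [/PP'|->]; first by apply: acl_mono => y; left.
by apply: acl_mem; right.
Qed.

(* A box around [x], inside a given one, whose data are independent from [x]: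
   what is algebraic over the box and over [x] is algebraic. *)
Lemma gen_box P n (x : K^^n) (d : K) : countable P -> 0 < d -> exists (w : K^^n) (c : K),
  [/\ 0 < c, box w c x, forall y, box w (5%:R * c) y -> box x d y &
   forall t, acl (P <+ x) t -> acl (P `|` [set` c :: vals w]) t -> acl P t].
Proof.
move=> cP d0; have d16 : 0 < d / 16%:R by rewrite divr_gt0.
have cPx : countable (P <+ x) by ctb.
have [w gw wx] := ex_gen x cPx d16.
have [||c /andP[c1 c2] Nc] := @ex_notin_acl (P <+ x <+ w) (d / 16%:R) (d / 8%:R).
- by ctb.
- by rewrite ltr_pM2l // ltf_pV2 ?posrE // ltr_nat.
have c0 : 0 < c by exact: lt_trans c1.
have d816 : d / 8%:R = 2%:R * (d / 16%:R) by field.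
exists w, c; split=> //.
- by move=> i; rewrite distrC (lt_trans (wx i)).
- move=> y wy i; have := wy i; have := wx i; rewrite !ltr_norml d816 in c2 * => /andP[h1 h2] /andP[h3 h4].
  by have dE : d = 16%:R * (d / 16%:R) by [field]; rewrite dE; set e := d / _ in h1 h2 c1 c2 *; apply/andP; split; lra.
move=> t tx tQ; apply: contrapT => Nt.
have I : ind (P <+ x) (vals w ++ [:: c]) by apply/ind_cat; split=> //=; split=> //.
have It : ind (P `|` [set t]) (vals w ++ [:: c]).
  by apply: ind_acl I => y [Py|->//]; apply: acl_mem; left.
have : ind P ((c :: vals w) ++ [:: t]).
  apply: (ind_perm (s := t :: (vals w ++ [:: c]))); last by split.
  by rewrite perm_sym perm_catC /= perm_cons perm_sym perm_catC.
by move/ind_cat => -[_ []].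
Qed.

(** In a box from [gen_box] the point [x] is the only one of [X], so its coordinates are algebraic
    over the box. They are trivially algebraic over [x], and the box is independent from [x]. *)
Lemma acl_isolated P n (X : set K^^n) x : countable P -> D S P X -> X x ->
  (exists2 d : K, 0 < d & forall y, box x d y -> X y -> y = x) -> forall i, acl P (x 0 i).
Proof.
move=> cP DX Xx [d d0 Hd] i; have [w [c [c0 wx wd H]]] := gen_box x cP d0.
apply: H; first by apply: acl_mem; right; exact: mem_vals.
have wd' y : box w c y -> box x d y.
  by move=> wy; apply: wd; apply: box_le wy; rewrite ler_peMl ?ler1n // ltW.
exists (fun t => exists y, (X y /\ box w c y) /\ t = y 0 i); split; last 1 first.
- by exists [:: x 0 i] => t [y [[Xy /wd' yd] ->]]; rewrite (Hd y yd Xy) mem_head.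
- pose P' := P `|` [set` c :: vals w].
  have DX' : D S P' X by apply: D_mono DX => u; left.
  have Dw (T : Type) (eT : encodable K T) : Df S P' (fun _ : T => w).
    by apply: Df_rV => l; apply: Df_cst; right; rewrite /= inE mem_vals orbT.
  have Dc (T : Type) (eT : encodable K T) : Df S P' (fun _ : T => c).
    by apply: Df_cst; right; rewrite /= mem_head.
  apply: D_ex; apply: D_and; last by ddef.
  by apply: D_and; [ddef|apply: D_box => //; ddef].
- by exists x.
Qed.

Lemma box_const P n (F : K^^n -> K) w c : Df S P F -> 0 < c ->
  (forall y, box w (5%:R * c) y -> sdiff F y 0) -> forall y z, box w c y -> box w c z -> F y = F z.
Proof.
move=> DF c0 H y z wy wz; pose gam t := y + t *: (z - y).
pose P' := P `|` [set` vals y ++ vals z].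
have Dv (v : K^^n) (T : Type) (eT : encodable K T) : {subset vals v <= vals y ++ vals z} -> Df S P' (fun _ : T => v).
  by move=> sv; apply: Df_rV => l; apply: Df_cst; right; apply: sv; exact: mem_vals.
have Dgam : Df S P' gam.
  apply: Df_rV => i; have -> : (fun t => gam t 0 i) = (fun t => y 0 i + t * (z 0 i - y 0 i)) by apply/funext => t; rewrite !mxE.
  have Dy (T : Type) (eT : encodable K T) : Df S P' (fun _ : T => y 0 i) by apply: Df_entry; apply: Dv => u uy; rewrite mem_cat uy.
  have Dz (T : Type) (eT : encodable K T) : Df S P' (fun _ : T => z 0 i) by apply: Df_entry; apply: Dv => u uy; rewrite mem_cat uy orbT.
  by apply: Df_add => //; apply: Df_mul; [exact: Df_id|apply: Df_add => //; exact: Df_opp].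
have Dc : Df S P' (fun t => F (gam t)).
  by apply: (Df_comp (Df_mono _ DF)) => // u; left.
(* To apply [lip1] at the ends 0 and 1 the segment is prolonged to the open interval from -1 to 2.
   The prolonged segment is within [c + 2 * (2 * c)] of [w], which explains the factor 5. *)
have gbox t : -1 < t < 2%:R -> box w (5%:R * c) (gam t).
  move=> /andP[t1 t2] i; rewrite !mxE; have := wy i; have := wz i; rewrite !ltr_norml.
  move=> /andP[h1 h2] /andP[h3 h4]; have zy : `|z 0 i - y 0 i| <= 2%:R * c by rewrite ler_norml; apply/andP; split; lra.
  have tt : `|t| <= 2%:R by rewrite ler_norml; apply/andP; split; lra.
  have := ler_pM (normr_ge0 _) (normr_ge0 _) tt zy; rewrite -normrM ler_norml => /andP[h5 h6].
  by apply/andP; split; lra.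
have key (e : K) : 0 < e -> `|F z - F y| <= e.
  move=> e0; have /(lip1 Dc)H1 : forall t, -1 < t < 2%:R -> exists2 d : K, 0 < d &
      forall u, `|u - t| < d -> `|F (gam u) - F (gam t)| <= e * `|u - t|.
    move=> t /gbox/H/sdiffE Hs; pose M := l1 (z - y) + 1; have M0 : 0 < M by rewrite ltr_wpDl ?l1_ge0.
    have [|d d0 Hd] := Hs (e / M); first by rewrite divr_gt0.
    have dif u v : gam u - gam v = (u - v) *: (z - y) by rewrite scalerBl; apply/rowP => i; rewrite !mxE; ring.
    exists (d / M); first by rewrite divr_gt0.
    move=> u; rewrite ltr_pdivlMr // => ut.
    have := Hd (gam u) (gam t) _ _.
    rewrite (_ : dot 0 _ = 0) ?subr0; last by rewrite /dot big1 // => i _; rewrite mxE mul0r.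
    move=> Hd'; apply: le_trans (Hd' _ _) _.
    - apply: box_l1; rewrite dif /l1 (eq_bigr (fun i => `|u - t| * `|(z - y) 0 i|)) => [|i _]; last by rewrite mxE normrM.
      rewrite -mulr_sumr; apply: le_lt_trans ut; rewrite ler_wpM2l //; rewrite /M /l1; lra.
    - exact: box_refl.
    - rewrite dif /l1 (eq_bigr (fun i => `|u - t| * `|(z - y) 0 i|)) => [|i _]; last by rewrite mxE normrM.
      rewrite -mulr_sumr -/(l1 (z - y)) mulrAC -mulrA ler_pM2l // ler_pdivrMr // ler_wpM2l // /M; lra.
  have := H1 0 1 _ _; rewrite /gam scale0r addr0 scale1r subrKC subr0 normr1 mulr1; apply; apply/andP; split; lra.
apply/esym/eqP; rewrite -subr_eq0 -normr_le0; apply/ler_addgt0Pl => e e0; rewrite addr0; exact: key.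
Qed.

(** A zero gradient at a generic point persists nearby, so [F] is constant on a box independent from
    [x], and its value there is algebraic over [P]. *)
Lemma grad_nz P n (F : K^^n -> K) x : countable P -> gen P x -> Df S P F -> ~ acl P (F x) -> grad F x != 0.
Proof.
move=> cP gx DF NF; apply/eqP => g0; apply: NF.
have sx : sdiff F x 0 by rewrite -g0; exact: grad_gen cP gx DF.
have DQ : D S P (fun y => sdiff F y 0).
  apply: (D_comp (D_sdiff DF) (g := fun y => (y, 0))); apply: Df_pair; first exact: Df_id.
  apply: Df_rV => i; have -> : (fun _ : K^^n => (0 : K^^n) 0 i) = fun=> 0 by apply/funext => y; rewrite mxE.
  exact: Df_0.
have [d d0 Hd] := near_gen cP gx DQ sx.
have [w [c [c0 wx wd H]]] := gen_box x cP d0.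
apply: H; first exact: acl_app.
have wc := box_const DF c0 (fun y wy => Hd y (wd y wy)).
exists (fun t => exists y, box w c y /\ t = F y); split; last 1 first.
- by exists [:: F x] => t [y [wy ->]]; rewrite (wc y x wy wx) mem_head.
- pose P' := P `|` [set` c :: vals w].
  have DF' : Df S P' F by apply: Df_mono DF => u; left.
  have Dw (T : Type) (eT : encodable K T) : Df S P' (fun _ : T => w).
    by apply: Df_rV => l; apply: Df_cst; right; rewrite /= inE mem_vals orbT.
  have Dc (T : Type) (eT : encodable K T) : Df S P' (fun _ : T => c).
    by apply: Df_cst; right; rewrite /= mem_head.
  by apply: D_ex; apply: D_and; [apply: D_box => //; ddef|ddef].
- by exists x.
Qed.

(** * Jacobian matrices and the induction on the dimension *)

Definition jac n k (psi : K^^n -> K^^k) x : 'M[K]_(n, k) :=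
  \matrix_(j, l) grad (fun y => psi y 0 l) x 0 j.

Definition sdm n k (psi : K^^n -> K^^k) x :=
  forall l, sdiff (fun y => psi y 0 l) x (\row_j jac psi x j l).

Lemma sdmP n k (psi : K^^n -> K^^k) x (J : 'M[K]_(n, k)) :
  (forall l, sdiff (fun y => psi y 0 l) x (\row_j J j l)) -> jac psi x = J /\ sdm psi x.
Proof.
move=> H; have E : jac psi x = J by apply/matrixP => j l; rewrite mxE (gradP (H l)) mxE.
by split=> // l; rewrite E.
Qed.

Lemma sdm_local n k (psi phi : K^^n -> K^^k) x d : 0 < d -> (forall y, box x d y -> psi y = phi y) ->
  sdm psi x -> jac phi x = jac psi x /\ sdm phi x.
Proof.
move=> d0 E H; apply: sdmP => l; apply: sdiff_local d0 _ (H l) => y /E ->.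
by [].
Qed.

Lemma sdm_gen P n k (psi : K^^n -> K^^k) x : countable P -> gen P x -> Df S P psi -> sdm psi x.
Proof.
move=> cP gx Dpsi l; have Dl : Df S P (fun y => psi y 0 l) by exact: Df_entry.
have := grad_gen cP gx Dl.
by rewrite (_ : grad _ x = \row_j jac psi x j l) //; apply/rowP => j; rewrite !mxE.
Qed.

Lemma jac_comp n k m (phi : K^^n -> K^^k) (chi : K^^k -> K^^m) x :
  sdm phi x -> sdm chi (phi x) -> jac (fun y => chi (phi y)) x = jac phi x *m jac chi (phi x) /\ sdm (fun y => chi (phi y)) x.
Proof.
move=> H1 H2; apply: sdmP => l.
have -> : \row_j (jac phi x *m jac chi (phi x)) j l = (\row_j jac chi (phi x) j l) *m (jac phi x)^T.
  by apply/rowP => j; rewrite !mxE; apply: eq_bigr => c _; rewrite !mxE mulrC.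
exact: chain (H2 l).
Qed.

Lemma Df_jac P n k (psi : K^^n -> K^^k) j l : Df S P psi -> Df S P (fun x => jac psi x j l).
Proof.
move=> Dpsi; have -> : (fun x => jac psi x j l) = fun x => grad (fun y => psi y 0 l) x 0 j by apply/funext => x; rewrite mxE.
by apply: Df_entry; apply: Df_grad; exact: Df_entry.
Qed.

Lemma Df_det P T {eT : encodable K T} n (A : T -> 'M[K]_n) : (forall i j, Df S P (fun x => A x i j)) -> Df S P (fun x => \det (A x)).
Proof.
move=> DA; rewrite /determinant; apply: Df_sum => s; apply: Df_mul; last by apply: Df_prod => i; exact: DA.
by case: (odd_perm s) => /=; [rewrite expr1; apply: Df_opp; exact: Df_1|exact: Df_1].
Qed.

Lemma D_sdm P n k (psi : K^^n -> K^^k) : Df S P psi -> D S P (sdm psi).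
Proof.
move=> Dpsi; apply: D_fin => l; have Dl : Df S P (fun y => psi y 0 l) by exact: Df_entry.
apply: (D_comp (D_sdiff Dl) (g := fun x => (x, \row_j jac psi x j l))); apply: Df_pair; first exact: Df_id.
apply: Df_rV => j; have -> : (fun x => (\row_j jac psi x j l) 0 j) = fun x => jac psi x j l by apply/funext => x; rewrite mxE.
exact: Df_jac.
Qed.

Lemma det_bound n (A : 'M[K]_n) (C : nat) : (forall i j, `|A i j| <= C%:R) -> `|\det A| <= (n`! * C ^ n)%:R.
Proof.
move=> AC; rewrite /determinant; apply: le_trans (ler_norm_sum _ _ _) _.
apply: le_trans (_ : \sum_(s : 'S_n) (C ^ n)%:R <= _).
  apply: ler_sum => s _; rewrite normrM normr_prod normrX normrN1 expr1n mul1r natrX.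
  have -> : C%:R ^+ n = \prod_(i < n) C%:R :> K by rewrite prodr_const card_ord.
  by apply: ler_prod => i _; rewrite normr_ge0 AC.
by rewrite sumr_const card_Sn natrM mulr_natl.
Qed.

Section Pivot.
Variables (n : nat) (j : 'I_n.+1) (G : K^^n.+1) (X : 'M[K]_n.+1).
Let T : 'M[K]_n.+1 := \matrix_(k, l) if l == j then G 0 k else (k == l)%:R.
Hypothesis X0 : forall k, X k ord0 = (k == j)%:R.

Let Tj l : (T *m X) j l = G 0 j * X j l.
Proof.
rewrite !mxE (bigD1 j) //= !mxE eqxx big1 ?addr0 // => k kj.
by rewrite !mxE (negPf kj) eq_sym (negPf kj) mul0r.
Qed.

Let Tk k l : (T *m X) (lift j k) l = G 0 (lift j k) * X j l + X (lift j k) l.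
Proof.
have nj : lift j k != j by rewrite eq_sym neq_lift.
rewrite !mxE (bigD1 j) //= !mxE eqxx; congr (_ + _).
rewrite (bigD1 (lift j k)) //= !mxE (negPf nj) eqxx mul1r big1 ?addr0 // => i /andP[ij ik].
by rewrite !mxE (negPf ij) eq_sym (negPf ik) mul0r.
Qed.

(** In the application [T] is the Jacobian matrix of the change of coordinate [j], and [X] that of
    the remaining map, whose first component is the coordinate [j]. Both determinants are expanded
    along the trivial row or column. *)
Lemma pivot_det : `|\det (T *m X)| = `|\det (row' j (col' ord0 X))| * `|G 0 j|.
Proof.
rewrite det_mulmx normrM mulrC; congr (_ * _).
  rewrite (expand_det_col X ord0) (bigD1 j) //= big1 ?addr0 => [|k kj]; last by rewrite X0 (negPf kj) mul0r.
  by rewrite X0 eqxx mul1r /cofactor normrM normrX normrN1 expr1n mul1r.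
rewrite (expand_det_row T j) (bigD1 j) //= big1 ?addr0 => [|k kj]; last first.
  by rewrite !mxE (negPf kj) eq_sym (negPf kj) mul0r.
rewrite mxE eqxx /cofactor (_ : row' j (col' j T) = 1%:M) ?det1 ?mulr1 ?normrM ?normrX ?normrN1 ?expr1n ?mulr1 //.
apply/matrixP => k l; rewrite !mxE eq_sym (negPf (neq_lift j l)) (inj_eq (@lift_inj _ j)).
by [].
Qed.

(** Rows of [T *m X] differ from those of [X] by multiples of row [j]. As [G 0 j] is the largest
    entry of [G], the multiples are bounded by the entries of row [j] of the product. *)
Lemma pivot_bound (C : nat) k l : (forall k, `|G 0 k| <= `|G 0 j|) -> G 0 j != 0 ->
  (forall k l, `|(T *m X) k l| <= C%:R) -> `|row' j (col' ord0 X) k l| <= (2 * C)%:R.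
Proof.
move=> Gm G0 TC; rewrite !mxE; set l' := lift ord0 l.
have := TC (lift j k) l'; have := TC j l'; rewrite Tj Tk; set u := X j l'; set v := X (lift j k) l'.
move=> h1 h2; have h3 : `|G 0 (lift j k) * u| <= C%:R.
  by apply: le_trans h1; rewrite !normrM ler_wpM2r.
have -> : v = (G 0 (lift j k) * u + v) - G 0 (lift j k) * u by rewrite addrC addKr.
by apply: le_trans (ler_normB _ _) _; rewrite natrM mulr_natl mulr2n lerD.
Qed.

End Pivot.

Lemma fubini_eq n k m k' m' (p : 'I_m -> 'I_n + 'I_k) q (p' : 'I_m' -> 'I_n + 'I_k') q'
  (pK : cancel p q) (qK : cancel q p) (pK' : cancel p' q') (qK' : cancel q' p')
  P b (E : set K^^m) (E' : set K^^m') :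
  countable P -> D S P E -> D S P E' -> bdd b E -> bdd b E' ->
  (forall y, gen P y -> vl (fib p E y) = vl (fib p' E' y)) -> vl E = vl E'.
Proof.
move=> cP DE DE' bE bE' H; apply/eqP; rewrite eq_le -[leRHS]mul1r -[X in _ && (_ <= X)]mul1r.
apply/andP; split.
  by apply: (fubini_le pK qK pK' qK' cP DE DE' bE bE') => // y /H ->; rewrite mul1r.
by apply: (fubini_le pK' qK' pK qK cP DE' DE bE' bE) => // y /H ->; rewrite mul1r.
Qed.

(** Compactness gives a finite cover of the generic points; each point goes to the first member that
    contains it. *)
Lemma gen_pieces P n (U : set K^^n) (FF : set (K^^n -> Prop)) : countable P -> D S P U ->
  (forall Q, FF Q -> D S P Q) -> (forall x, U x -> gen P x -> exists2 Q, FF Q & Q x) ->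
  exists N (X : 'I_N -> set K^^n), [/\ forall i, D S P (X i), forall i, X i `<=` U,
    forall i i' x, X i x -> X i' x -> i = i', forall x, U x -> gen P x -> exists i, X i x &
    forall i, exists2 Q, FF Q & X i `<=` Q].
Proof.
move=> cP DU DF FU.
have [||N [G [FG UG]]] := @rk_compact_cover P n n U FF cP DU; first exact: DF.
  by move=> x Ux /(rk_gen); exact: FU.
have DG i : D S P (G i) by exact: DF.
pose X (i : 'I_N) : set K^^n := [set x | U x /\ (G i x /\ forall i' : 'I_N, (i' < i)%N -> ~ G i' x)].
have DX i : D S P (X i).
  apply: D_and => //; apply: D_and => //; apply: D_fin => i'; apply: D_imp; first exact: D_const.
  exact: D_not.
have XU i : X i `<=` U by move=> x [].
have Xd i i' x : X i x -> X i' x -> i = i'.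
  move=> [_ [Gi Hi]] [_ [Gi' Hi']]; apply/val_inj; have [/Hi'//|/Hi//|//] := ltngtP i i'.
have Xc x : U x -> gen P x -> exists i, X i x.
  move=> Ux gx; have [i0 G0] := UG x Ux (gen_rk gx).
  have exP : exists i, (i < N)%N && `[< exists2 i' : 'I_N, i' = i :> nat & G i' x >].
    by exists i0; rewrite ltn_ord; apply/asboolP; exists i0.
  case: (ex_minnP exP) => i /andP[iN /asboolP[i1 i1E Gi1]] mi; exists i1; split=> //; split=> // i' i'i Gi'.
  have := mi i'; rewrite ltn_ord /=; move: i'i; rewrite i1E ltnNge => /negP + H; apply; apply: H.
  by apply/asboolP; exists i'.
exists N, X; split=> // i; exists (G i) => // x [_ []].
by [].
Qed.

(** The weight [h] makes the induction possible: when one coordinate is changed, the Jacobian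
    determinant in the other coordinates is part of the weight. *)
Definition CV_at n := forall P b C (U : set K^^n) (psi : K^^n -> K^^n) (h : K^^n -> K),
  countable P -> D S P U -> Df S P psi -> Df S P h -> bdd b U -> bdd b [set psi x | x in U] ->
  (forall x y, U x -> U y -> psi x = psi y -> x = y) -> (forall x, U x -> 0 <= h (psi x) <= b%:R) ->
  (forall x, U x -> forall j l, `|jac psi x j l| <= C%:R) ->
  vl (Hypo [set psi x | x in U] h) = vl (Hypo U (fun x => h (psi x) * `|\det (jac psi x)|)).

Section Step.
Variables (n : nat) (P : set K) (psi : K^^n.+1 -> K^^n.+1) (h : K^^n.+1 -> K) (b C : nat).
Hypotheses (IH : CV_at n) (cP : countable P) (Dpsi : Df S P psi) (Dh : Df S P h).
Let F x := psi x 0 ord0.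
Let th j (x : K^^n.+1) := ins j (F x) (col' j x).
Let chi j (a : K^^n.+1 -> K) z := psi (ins j (a z) (col' j z)).
Let sub j (a : K^^n.+1 -> K) z := row' j (col' ord0 (jac (chi j a) z)).

(** At [x] the map [psi] factors as [chi j a] after [th j]. The first factor changes only the
    coordinate [j], and the second carries this coordinate unchanged to the first place; on slices
    it is a map in [n] variables with Jacobian matrix [sub]. *)
Definition good j a x :=
  [/\ a (th j x) = x 0 j, sdm (chi j a) (th j x),
     forall k l, `|sub j a (th j x) k l| <= (2 * C)%:R &
     `|\det (jac psi x)| = `|\det (sub j a (th j x))| * `|grad F x 0 j|].

Let DF : Df S P F. Proof. exact: Df_entry. Qed.
Let D_th j : Df S P (th j). Proof. by apply: Df_ins => //; ddef. Qed.

Let D_chi j a : Df S P a -> Df S P (chi j a).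
Proof. by move=> Da; apply: (Df_comp Dpsi); apply: Df_ins => //; ddef. Qed.

Let D_sub j a k l : Df S P a -> Df S P (fun z => sub j a z k l).
Proof.
move=> Da; have -> : (fun z => sub j a z k l) = fun z => jac (chi j a) z (lift j k) (lift ord0 l).
  by apply/funext => z; rewrite !mxE.
by apply: Df_jac; exact: D_chi.
Qed.

Definition good_family : set (K^^n.+1 -> Prop) := [set Q | exists j a, Df S P a /\ Q = good j a].

Lemma D_good j a : Df S P a -> D S P (good j a).
Proof.
move=> Da; have Dat : Df S P (fun x => a (th j x)) by exact: (Df_comp Da).
have D1 : D S P (fun x => a (th j x) = x 0 j) by apply: D_eqT => //; apply: Df_entry; exact: Df_id.
have D2 : D S P (fun x => sdm (chi j a) (th j x)) by apply: (D_comp (D_sdm (D_chi j Da))).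
have Ds k l : Df S P (fun x => sub j a (th j x) k l) by exact: (Df_comp (D_sub j k l Da)).
have D3 : D S P (fun x => forall k l, `|sub j a (th j x) k l| <= (2 * C)%:R).
  by apply: D_fin => k; apply: D_fin => l; apply: D_le; [exact: Df_norm|exact: Df_nat].
have D4 : D S P (fun x => `|\det (jac psi x)| = `|\det (sub j a (th j x))| * `|grad F x 0 j|).
  apply: D_eqT; first by apply: Df_norm; apply: Df_det => i k; exact: Df_jac.
  apply: Df_mul; apply: Df_norm; first exact: Df_det.
  by apply: Df_entry; exact: Df_grad.
by have := D_and D1 (D_and D2 (D_and D3 D4)); apply: D_ext => x; rewrite /good; split=> [[? [? [? ?]]]|[]].
Qed.

(** The coordinate with the largest partial derivative of the first component is replaced, so that
    the other factor keeps a finite bound by [pivot_bound]. This derivative is nonzero because the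
    first component of [psi x] is not algebraic. *)
Lemma good_ex x : gen P x -> gen P (psi x) -> (forall j l, `|jac psi x j l| <= C%:R) ->
  exists j a, Df S P a /\ good j a x.
Proof.
move=> gx gy xC; have NF : ~ acl P (F x) by have /(gen_ins _ ord0) [] := gy.
have G0 := grad_nz cP gx DF NF; set G := grad F x in G0.
pose j := [arg max_(j > ord0) `|G 0 j|]%O.
have Gm k : `|G 0 k| <= `|G 0 j| by rewrite /j; case: arg_maxP => // i _; apply.
have Gj : G 0 j != 0.
  apply: contra G0 => /eqP Gj; apply/eqP/rowP => k; rewrite mxE; apply/eqP.
  by rewrite -normr_le0 (le_trans (Gm k)) // Gj normr0.
have sF : sdiff F x G := grad_gen cP gx DF.
have [d d0 Hd] := (sdiffE F x G).1 sF (`|G 0 j| / 2%:R) (divr_gt0 (etrans (normr_gt0 _) Gj) (ltr0n _ 2)).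
(* As the partial derivative in direction [j] is nonzero, [x] is isolated in its fibre under
   [th j]. *)
have Ax : acl (P <+ (th j x)) (x 0 j).
  apply: (acl_isolated (X := fun y => th j y = th j x)) => //; first by ctb.
    by apply: (@D_inst_vec P _ (th j x) _ _ (fun p : K^^n.+1 * K^^n.+1 => th j p.1 = p.2)); have Dj := D_th j; ddef.
  exists d => // y xy E; have Fy : F y = F x by rewrite -[LHS](insE j _ (col' j y)) -/(th j y) E insE.
  have cy : col' j y = col' j x by rewrite -[LHS](col'_ins j (F y)) -/(th j y) E col'_ins.
  have := Hd y x xy (box_refl _ d0); rewrite Fy subrr sub0r normrN.
  rewrite -(ins_col' j y) -(ins_col' j x) cy insB subrr l1_ins.
  have -> : l1 (0 : K^^n) = 0 by rewrite /l1 big1 // => i _; rewrite mxE normr0.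
  rewrite addr0 /dot (bigD1 j) //= insE big1 ?addr0 => [|i]; last first.
    by case: (unliftP j i) => [l ->|-> /eqP//] _; rewrite ins_lift mxE mulr0.
  rewrite normrM; set u := `|_ - _| => Hu; have : u = 0.
    have : 0 < `|G 0 j| by rewrite normr_gt0.
    have : 0 <= u by exact: normr_ge0.
    move=> u0 v0; move: Hu; rewrite mulrAC -mulrA ler_pM2l // => Hu; apply/eqP; rewrite eq_le u0 andbT; lra.
  by move/normr0_eq0/subr0_eq => ->.
have [a Da ax] := acl_func Ax; exists j, a; split=> //.
pose W := fun y => a (th j y) = y 0 j.
have DW : D S P W by apply: D_eqT; [exact: (Df_comp Da)|apply: Df_entry; exact: Df_id].
have inv y : W y -> ins j (a (th j y)) (col' j (th j y)) = y.
  by move=> ->; rewrite /th col'_ins ins_col'.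
have gz : gen P (th j x).
  apply: (gen_image (g := fun z => ins j (a z) (col' j z))); first by apply: Df_ins => //; ddef.
  by rewrite inv.
have sz := sdm_gen cP gz (D_chi j Da).
have st := sdm_gen cP gx (D_th j).
have [d1 d10 H1] := near_gen cP gx DW ax.
have [J1 s1] := jac_comp st sz.
have [J2 _] : jac psi x = jac (fun y => chi j a (th j y)) x /\ sdm psi x.
  by apply: sdm_local d10 _ s1 => y /H1 Wy; rewrite /chi inv.
have JT : jac (th j) x = \matrix_(k, l) if l == j then G 0 k else (k == l)%:R.
  have [] // := @sdmP _ _ (th j) x (\matrix_(k, l) if l == j then G 0 k else (k == l)%:R).
  move=> l; have [->|lj] := eqVneq l j.
    have -> : (fun y => th j y 0 j) = F by apply/funext => y; rewrite insE.
    by rewrite (_ : \row_k _ = G) //; apply/rowP => k; rewrite !mxE eqxx.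
  have -> : (fun y => th j y 0 l) = fun y => y 0 l.
    by apply/funext => y; rewrite /th; case: (unliftP j l) lj => [l' -> _|->]; rewrite ?eqxx // ins_lift mxE.
  rewrite (_ : \row_k _ = delta_mx 0 l); first exact: sdiff_coord.
  by apply/rowP => k; rewrite !mxE (negPf lj) eqxx.
have X0 k : jac (chi j a) (th j x) k ord0 = (k == j)%:R.
  pose V := fun z => F (ins j (a z) (col' j z)) = z 0 j.
  have DV : D S P V.
    apply: D_eqT; last by apply: Df_entry; exact: Df_id.
    by apply: (Df_comp DF); apply: Df_ins => //; ddef.
  have Vz : V (th j x) by rewrite /V inv // insE.
  have [d2 d20 H2] := near_gen cP gz DV Vz.
  rewrite mxE (gradP (G := delta_mx 0 j)) ?mxE //.
  by apply: sdiff_local d20 _ (sdiff_coord _ j) => z /H2 <-.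
have JE : jac psi x = (\matrix_(k, l) if l == j then G 0 k else (k == l)%:R) *m jac (chi j a) (th j x).
  by rewrite J2 J1 JT.
split=> //; last by rewrite JE; exact: pivot_det.
move=> k l; apply: (pivot_bound (G := G)) => // k' l'; rewrite -JE; exact: xC.
Qed.

(** The intermediate region has base [V], the image under [th j]. [cv_elem] compares it with the
    region over [X]. The comparison with the region over the image of [psi] is made on slices, where
    the induction hypothesis applies. *)
Lemma cv_piece (X : set K^^n.+1) j a : D S P X -> Df S P a -> bdd b X -> bdd b [set psi x | x in X] ->
  (forall x y, X x -> X y -> psi x = psi y -> x = y) ->
  (forall x, X x -> 0 <= h (psi x) <= b%:R) -> (forall x, X x -> forall j l, `|jac psi x j l| <= C%:R) ->
  (forall x, X x -> good j a x) ->
  vl (Hypo [set psi x | x in X] h) = vl (Hypo X (fun x => h (psi x) * `|\det (jac psi x)|)).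
Proof.
move=> DX Da bX bpX pI h0b xC gX.
pose V := [set th j x | x in X]; pose h' z := h (chi j a z) * `|\det (sub j a z)|.
have inv x : X x -> ins j (a (th j x)) (col' j (th j x)) = x.
  by move=> /gX[-> _ _ _]; rewrite /th col'_ins ins_col'.
have chiE x : X x -> chi j a (th j x) = psi x by move=> Xx; rewrite /chi inv.
have DV : D S P V by exact: D_img.
have bV : bdd b V.
  move=> _ [x Xx <-] i; rewrite /th; case: (unliftP j i) => [l ->|->]; rewrite ?insE ?ins_lift ?mxE; first exact: bX.
  by apply: (bpX (psi x)); exists x.
have Dh' : Df S P h'.
  by apply: Df_mul; [exact: (Df_comp Dh (D_chi j Da))|apply: Df_norm; apply: Df_det => k l; exact: D_sub].
pose B := (b * (n`! * (2 * C) ^ n).+1)%N; have bB : (b <= B)%N by rewrite leq_pmulr.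
have h'B z : V z -> 0 <= h' z <= B%:R.
  move=> [x Xx <-]; have /andP[h0 hb] := h0b x Xx; have [_ _ sC _] := gX x Xx.
  rewrite /h' chiE // mulr_ge0 //= natrM; apply: ler_pM => //.
  by apply: le_trans (det_bound sC) _; rewrite ler_nat.
have hB x : X x -> 0 <= h (psi x) <= B%:R.
  by move=> /h0b/andP[-> hb] /=; apply: le_trans hb _; rewrite ler_nat.
transitivity (vl (Hypo V h')); last first.
  have tI x y : X x -> X y -> th j x = th j y -> x = y by move=> /inv {2}<- /inv {2}<- ->.
  rewrite (cv_elem (j := j) (C := C) (b := B) cP DX DF Dh' (bdd_le bB bX) (bdd_le bB bV) tI).
  - congr vl; apply: Hypo_ext => x Xx; rewrite /h' chiE //.
    by have [_ _ _ ->] := gX x Xx; rewrite mulrA.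
  - by move=> x Xx; apply: h'B; exists x.
  - by move=> x /xC /(_ j ord0); rewrite mxE.
have bE1 : bdd B (Hypo [set psi x | x in X] h) by apply: bdd_Hypo (bdd_le bB bpX) _ => _ [x /hB/andP[_ ?] <-].
have bE2 : bdd B (Hypo V h') by apply: bdd_Hypo (bdd_le bB bV) _ => z /h'B/andP[].
(* One side is sliced by the first coordinate, the other by the coordinate [j]; [chi j a] carries
   the second to the first. *)
apply: (fubini_eq (upK (p1rK ord0)) (upqK (q1rK ord0)) (upK (p1rK j)) (upqK (q1rK j)) cP _ _ bE1 bE2).
- by apply: D_Hypo => //; exact: D_img.
- exact: D_Hypo.
move=> s gs; rewrite !fib_Hypo; pose Ps := P <+ s.
pose chis u := col' ord0 (chi j a (mix (p1r j) s u)); pose Vs := fib (p1r j) V s.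
have chisE u x : X x -> th j x = mix (p1r j) s u -> psi x = mix (p1r ord0) s (chis u).
  move=> Xx E; rewrite /chis -E chiE // mix1rK -[LHS](ins_col' ord0); congr ins.
  by rewrite -[LHS]/(F x) -(insE j (F x) (col' j x)) -/(th j x) E mix1rK insE.
have -> : fib (p1r ord0) [set psi x | x in X] s = [set chis u | u in Vs].
  apply/seteqP; split=> w; rewrite /fib /Vs /=.
    move=> [x Xx E]; pose u := col' j (th j x); have us : mix (p1r j) s u = th j x.
      rewrite mix1rK -[RHS](ins_col' j); congr ins; rewrite insE /F E mix1rK insE.
      by [].
    exists u; first by exists x.
    by have := chisE u x Xx (esym us); rewrite E !mix1rK => /(congr1 (col' ord0)); rewrite !col'_ins.
  by move=> [u [x Xx E] <-]; exists x => //; exact: chisE.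
have Dmix q (Y : Type) (eY : encodable K Y) (f : Y -> K^^n) : Df S Ps f -> Df S Ps (fun u => mix (p1r q) s (f u)).
  by move=> Df0; apply: Df_mix => //; apply: Df_rV => l; apply: Df_cst; right; exact: mem_vals.
have up (T U : Type) (eT : encodable K T) (eU : encodable K U) (f : T -> U) : Df S P f -> Df S Ps f by apply: Df_mono => t; left.
have Did : Df S Ps (fun u : K^^n => u) by exact: Df_id.
have Dchi' : Df S Ps (fun u => chi j a (mix (p1r j) s u)) by apply: (Df_comp (up _ _ _ _ _ (D_chi j Da))); exact: Dmix.
have Dchis : Df S Ps chis by rewrite /chis; ddef.
have hs0 u : Vs u -> 0 <= h (mix (p1r ord0) s (chis u)) <= b%:R.
  by move=> [x Xx E]; rewrite -(chisE _ _ Xx E) h0b.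
have jacs u k l : Vs u -> jac chis u k l = sub j a (mix (p1r j) s u) k l.
  move=> [x Xx E]; have [_ sx _ _] := gX x Xx; have := sx (lift ord0 l); rewrite E => /(sdiff_mix (p1rK j) (q1rK j)) H.
  rewrite !mxE (gradP (G := \row_c jac (chi j a) (mix (p1r j) s u) (lift j c) (lift ord0 l))) ?mxE //.
  have -> : (fun y => chis y 0 l) = fun z => chi j a (mix (p1r j) s z) 0 (lift ord0 l) by apply/funext => y; rewrite mxE.
  by move: H; congr sdiff; apply/rowP => c; rewrite !mxE.
rewrite (IH (P := Ps) (b := b) (C := (2 * C)%N)).
- congr vl; apply: Hypo_ext => u Vu; have [x Xx E] := Vu.
  rewrite /h' -E chiE // E -(chisE _ _ Xx E); congr (_ * `|\det _|).
  by apply/matrixP => k l; exact: jacs.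
- by rewrite /Ps; ctb.
- exact: D_fib.
- exact: Dchis.
- by apply: (Df_comp (up _ _ _ _ _ Dh)); exact: Dmix.
- exact: (bdd_fib (q1rK j) bV).
- by move=> _ [u [x Xx E] <-] l; rewrite mxE -E chiE //; apply: (bpX (psi x)); exists x.
- move=> u u' [x Xx E] [x' Xx' E'] uu; have px : psi x = psi x' by rewrite (chisE u x) // (chisE u' x') // uu.
  by have := congr1 (th j) (pI _ _ Xx Xx' px); rewrite E E' !mix1rK => /(congr1 (col' j)); rewrite !col'_ins.
- exact: hs0.
- by move=> u Vu k l; rewrite jacs //; have [x Xx <-] := Vu; have [_ _ ->] := gX x Xx.
Qed.

End Step.

Lemma CV n : CV_at n.
Proof.
elim: n => [|n IH] P b C U psi h cP DU Dpsi Dh bU bpU pI h0b xC.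
  have E (x y : K^^0) : x = y by apply/rowP => -[].
  have -> : [set psi x | x in U] = U.
    by apply/seteqP; split=> x; [move=> [y Uy _]; rewrite (E x y)|move=> Ux; exists x].
  congr vl; apply: Hypo_ext => x Ux; rewrite det_mx00 normr1 mulr1; congr h; exact: E.
have gimg x : U x -> gen P x -> gen P (psi x).
  move=> Ux gx; have [k Dk Hk] := graph_inv DU Dpsi pI.
  by apply: (gen_image Dk); rewrite Hk.
have [||N [X [DX XU Xd Xc XF]]] := gen_pieces (FF := good_family P psi C) cP DU.
- by move=> _ [j [a [Da ->]]]; exact: D_good.
- move=> x Ux gx; have [j [a [Da ga]]] := good_ex cP Dpsi gx (gimg x Ux gx) (xC x Ux).
  by exists (good psi C j a) => //; exists j, a.
pose hd x := h (psi x) * `|\det (jac psi x)|.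
have Dhd : Df S P hd.
  by apply: Df_mul; [exact: (Df_comp Dh)|apply: Df_norm; apply: Df_det => k l; exact: Df_jac].
pose B := (b * (n.+1`! * C ^ n.+1).+1)%N; have bB : (b <= B)%N by rewrite leq_pmulr.
have b1 : bdd b (Hypo [set psi x | x in U] h) by apply: bdd_Hypo bpU _ => _ [x /h0b/andP[_ ?] <-].
have b2 : bdd B (Hypo U hd).
  apply: bdd_Hypo (bdd_le bB bU) _ => x Ux; have /andP[h0 hb] := h0b x Ux.
  rewrite natrM; apply: ler_pM => //; apply: le_trans (det_bound (xC x Ux)) _.
  by rewrite ler_nat.
rewrite (vl_partition (X := fun i => Hypo [set psi x | x in X i] h) cP _ (D_Hypo (D_img DU Dpsi) Dh) b1).
- rewrite (vl_partition (X := fun i => Hypo (X i) hd) cP _ (D_Hypo DU Dhd) b2).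
  + apply: eq_bigr => i _; have [_ [j [a [Da ->]]] XG] := XF i.
    apply: (cv_piece (j := j) IH cP Dpsi Dh (DX i) Da).
    * exact: bdd_sub (@XU i) bU.
    * by apply: bdd_sub bpU => _ [x /XU Ux <-]; exists x.
    * by move=> x y /XU Ux /XU; exact: pI.
    * by move=> x /XU/h0b.
    * by move=> x /XU/xC.
    * exact: XG.
  + by move=> i; exact: D_Hypo.
  + by move=> i y [/XU Uy yh].
  + by move=> i i' y [Xi _] [Xi' _]; exact: Xd Xi Xi'.
  + move=> y [Uy yh] /(gen_col' P ord0)[gy _]; have [i Xi] := Xc _ Uy gy; by exists i.
- by move=> i; apply: D_Hypo => //; exact: D_img.
- by move=> i y [[x /XU Ux xy] yh]; split=> //; exists x.
- move=> i i' y [[x Xx xy] _] [[x' Xx' xy'] _]; apply: (Xd i i' x) => //.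
  by rewrite (pI _ _ (XU _ _ Xx) (XU _ _ Xx') (etrans xy (esym xy'))).
- move=> y [[x Ux xy] yh] /(gen_col' P ord0)[gy _].
  have gx : gen P x by apply: (gen_image Dpsi); rewrite xy.
  by have [i Xi] := Xc x Ux gx; exists i; split=> //; exists x.
Qed.

(** * Minors *)

Section CauchyBinet.

Lemma increasingP d n (s : {ffun 'I_d -> 'I_n}) : reflect (forall i j : 'I_d, (i < j)%N -> (s i < s j)%N) (increasing s).
Proof. by apply: (iffP forallP) => H i; [move=> j; have /forallP/(_ j)/implyP := H i|apply/forallP => j; apply/implyP; exact: H]. Qed.

Lemma increasing_inj d n (s : {ffun 'I_d -> 'I_n}) : increasing s -> injective s.
Proof.
move=> /increasingP H i j E; apply/val_inj; have [/H|/H|//] := ltngtP i j; by rewrite E ltnn.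
Qed.

Lemma increasing_id d (s : {ffun 'I_d -> 'I_d}) : increasing s -> s = [ffun i => i].
Proof.
move=> Hs; have sI := increasing_inj Hs; move/increasingP: Hs => H.
have ge (k : nat) (i : 'I_d) : i = k :> nat -> (i <= s i)%N.
  elim: k i => [|k IH] i ik; first by rewrite ik.
  have kd : (k < d)%N by rewrite (leq_trans _ (ltn_ord i)) // ik.
  have := IH (Ordinal kd) erefl; have := H (Ordinal kd) i; rewrite /= ik ltnSn => /(_ isT) h1 h2.
  exact: leq_ltn_trans h2 h1.
have := @leqif_sum 'I_d xpredT (fun i : 'I_d => i == s i :> nat) (fun i : 'I_d => nat_of_ord i) (fun i => nat_of_ord (s i)) _.
case=> [|_]; first by move=> i _; split; [exact: ge|].
have -> : (\sum_(i < d) s i = \sum_(i < d) i)%N; last first.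
  rewrite eqxx => /esym/forallP E; apply/ffunP => i; rewrite ffunE; apply/val_inj/esym/eqP.
  exact: E i.
by rewrite [RHS](reindex_inj (perm_inj (s := perm sI))) /=; apply: eq_bigr => i _; rewrite permE.
Qed.

(** Every injective function is, in a unique way, an increasing one after a permutation; see
    [sortf_inj] and [sortf_im]. *)
Definition sortf d n (x : {ffun 'I_d -> 'I_n} * 'S_d) : {ffun 'I_d -> 'I_n} := [ffun i => x.1 (x.2 i)].

Lemma sortf_inj d n : {in [set x : {ffun 'I_d -> 'I_n} * 'S_d | increasing x.1]%SET &, injective (@sortf d n)}.
Proof.
move=> [s u] [s' u']; rewrite !finset.in_set /= => Hs Hs' /ffunP E.
have E' i : s i = s' (u' (u^-1 i))%g.
  by have := E ((u^-1)%g i); rewrite !ffunE /= permKV.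
pose w : {ffun 'I_d -> 'I_d} := [ffun i => u' ((u^-1)%g i)].
have /increasing_id w1 : increasing w.
  apply/increasingP => i j ij; rewrite ltnNge leq_eqVlt; apply/negP => /orP[/eqP/val_inj/esym|].
    by rewrite !ffunE => /perm_inj/perm_inj ji; rewrite ji ltnn in ij.
  by move/(increasingP _ Hs'); rewrite !ffunE -!E' ltnNge (ltnW ((increasingP _ Hs) _ _ ij)).
have w2 i : u' ((u^-1)%g i) = i by move/ffunP: w1 => /(_ i); rewrite !ffunE.
have -> : u' = u by apply/permP => i; rewrite -[RHS]w2 permK.
by congr (_, _); apply/ffunP => i; rewrite E' w2.
Qed.

Lemma sortf_im d n : (@sortf d n @: [set x | increasing x.1])%SET = [set f : {ffun 'I_d -> 'I_n} | injectiveb f]%SET.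
Proof.
apply/setP => f; rewrite finset.in_set; apply/imsetP/injectiveP => [[[s u]]|fI].
  rewrite finset.in_set /= => /increasing_inj sI -> i j; rewrite !ffunE /=.
  by move/sI/perm_inj.
pose t := [tuple f i | i < d]; pose lo (i j : 'I_n) := (i <= j)%N.
have /tuple_permP[v vE] : perm_eq (sort lo t) t by rewrite perm_sort.
have nE x0 (i : 'I_d) : nth x0 (sort lo t) i = f (v i) by rewrite vE nth_mktuple tnth_mktuple.
exists ([ffun i => f (v i)], v^-1)%g; last by apply/ffunP => i; rewrite !ffunE /= permKV.
rewrite finset.in_set; apply/increasingP => i j ij; rewrite !ffunE ltn_neqAle; apply/andP; split.
  by apply/eqP => /val_inj/fI/perm_inj E; rewrite E ltnn in ij.
have so : sorted lo (sort lo t) by apply: sort_sorted => a b; exact: leq_total.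
have sz : size (sort lo t) = d by rewrite size_sort size_tuple.
have lotr : transitive lo by move=> a b c; exact: leq_trans.
have lorf : reflexive lo by move=> a; exact: leqnn.
have := @sorted_leq_nth _ lo lotr lorf (f i) _ so i j.
by rewrite !inE sz !ltn_ord !nE => /(_ isT isT (ltnW ij)).
Qed.

(** The determinant of the product is expanded as a sum over all functions [f]. Those that are not
    injective contribute 0, and the injective ones are grouped by their increasing rearrangement. *)
Lemma cauchy_binet d n (A : 'M[K]_(d, n)) :
  \sum_(t : {ffun 'I_d -> 'I_n} | increasing t) (\det (colsub t A)) ^+ 2 = \det (A *m A^T).
Proof.
have -> : \det (A *m A^T) = \sum_(f : {ffun 'I_d -> 'I_n}) (\prod_i A i (f i)) * \det (colsub f A).
  rewrite /determinant.
  transitivity (\sum_(s : 'S_d) \sum_(f : {ffun 'I_d -> 'I_n}) (-1) ^+ s * \prod_i (A i (f i) * A (s i) (f i))).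
    apply: eq_bigr => s _; rewrite -big_distrr /=; congr (_ * _).
    rewrite -(bigA_distr_bigA (fun i k => A i k * A (s i) k)); apply: eq_bigr => i _.
    by rewrite !mxE; apply: eq_bigr => k _; rewrite !mxE.
  rewrite exchange_big; apply: eq_bigr => f _ /=; rewrite -/(determinant _) -det_tr /determinant big_distrr /=.
  by apply: eq_bigr => s _; rewrite big_split /= mulrCA; congr (_ * (_ * _)); apply: eq_bigr => i _; rewrite !mxE.
rewrite [RHS](bigID (fun f => f \in [set f : {ffun 'I_d -> 'I_n} | injectiveb f]%SET)) /= [X in _ = _ + X]big1 ?addr0 => [|f]; last first.
  rewrite finset.in_set => /injectivePn[i [j ij E]]; rewrite -det_tr (determinant_alternate ij) ?mulr0 // => k.
  by rewrite !mxE E.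
rewrite -sortf_im (big_imset _ (@sortf_inj d n)) /=.
rewrite (eq_bigl (fun x => increasing x.1 && true)) => [|x]; last by rewrite finset.in_set andbT.
rewrite -(pair_big (fun s => increasing s) xpredT (fun s (u : 'S_d) => (\prod_i A i (sortf (s, u) i)) * \det (colsub (sortf (s, u)) A))) /=.
apply: eq_bigr => s _; rewrite expr2 {1}/determinant big_distrl; apply: eq_bigr => u _ /=.
have -> : colsub (sortf (s, u)) A = col_perm u (colsub s A) by apply/matrixP => i j; rewrite !mxE ffunE.
have -> : \det (col_perm u (colsub s A)) = (-1) ^+ u * \det (colsub s A) by rewrite col_permE det_mulmx det_perm odd_permV mulrC.
rewrite mulrCA mulrA; congr (_ * _ * _); by apply: eq_bigr => i _; rewrite !mxE ffunE.
Qed.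

Lemma ssm_row e n (A : 'M[K]_(e, n)) : sum_sqr_minors e A = \det (A *m A^T).
Proof.
rewrite -cauchy_binet /sum_sqr_minors (bigD1 [ffun i => i]) /=; last by apply/increasingP => i j; rewrite !ffunE.
rewrite [X in _ + X]big1 ?addr0 => [|s /andP[/increasing_id -> /eqP//]].
by apply: eq_bigr => t _; congr (\det _ ^+ 2); apply/matrixP => i j; rewrite !mxE ffunE.
Qed.

Lemma ssm_col e n (A : 'M[K]_(n, e)) : sum_sqr_minors e A = \det (A^T *m A).
Proof.
have := cauchy_binet A^T; rewrite trmxK => <-; rewrite /sum_sqr_minors; apply: eq_bigr => s _.
rewrite (bigD1 [ffun i => i]) /=; last by apply/increasingP => i j; rewrite !ffunE.
rewrite big1 ?addr0 => [|t /andP[/increasing_id -> /eqP//]].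
by rewrite -det_tr; congr (\det _ ^+ 2); apply/matrixP => i j; rewrite !mxE ffunE.
Qed.

Lemma ssm_ge0 e n k (A : 'M[K]_(n, k)) : 0 <= sum_sqr_minors e A.
Proof. by apply: sumr_ge0 => s _; apply: sumr_ge0 => t _; exact: sqr_ge0. Qed.

Lemma ssm_mul e n (A : 'M[K]_e) (B : 'M[K]_(e, n)) :
  Num.sqrt (sum_sqr_minors e (A *m B)) = Num.sqrt (sum_sqr_minors e B) * `|\det A|.
Proof.
rewrite !ssm_row trmx_mul mulmxA -(mulmxA A) !det_mulmx det_tr mulrAC -expr2 mulrC.
by rewrite sqrtrM -?ssm_row ?ssm_ge0 // sqrtr_sqr.
Qed.

(** Two triangular factorisations of the same block matrix. *)
Lemma sylvester n k (B : 'M[K]_(n, k)) (C : 'M[K]_(k, n)) : \det (1%:M + B *m C) = \det (1%:M + C *m B).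
Proof.
have E1 : block_mx (1%:M + B *m C) B 0 1%:M *m block_mx 1%:M 0 (- C) 1%:M = block_mx 1%:M B (- C) 1%:M.
  by rewrite mulmx_block !(mulmx1, mulmx0, mul0mx, mul1mx, add0r, addr0) mulmxN addrK.
have E2 : block_mx 1%:M 0 (- C) 1%:M *m block_mx 1%:M B 0 (1%:M + C *m B) = block_mx 1%:M B (- C) 1%:M.
  by rewrite mulmx_block !(mulmx1, mulmx0, mul0mx, mul1mx, add0r, addr0) mulNmx addrCA addNr addr0.
have := congr1 (@determinant _ _) (etrans E1 (esym E2)).
by rewrite !det_mulmx !det_lblock !det_ublock !det1 !mulr1 !mul1r.
Qed.

End CauchyBinet.

Section SplitMatrix.
Variables (n e m : nat) (p : 'I_m -> 'I_n + 'I_e) (q : 'I_n + 'I_e -> 'I_m).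
Hypotheses (pK : cancel p q) (qK : cancel q p).

Lemma big_split_sum (F : 'I_m -> K) : \sum_i F i = \sum_a F (q (inl a)) + \sum_c F (q (inr c)).
Proof.
rewrite (reindex q) /=; last by exists p => x _.
by rewrite big_sumType.
Qed.

Variables (D : 'M[K]_(m, n)) (J : 'M[K]_(e, m)).
Let A := rowsub (q \o inl) D.
Let B := colsub (q \o inl) J.
Hypotheses (J1 : forall c c', J c (q (inr c')) = (c == c')%:R) (JD : J *m D = 0).

Let DJ : rowsub (q \o inr) D = - (B *m A).
Proof.
apply/matrixP => c a; have := congr1 (fun M : 'M[K]_(e, n) => M c a) JD; rewrite !mxE big_split_sum.
rewrite [X in _ + X](bigD1 c) //= J1 eqxx mul1r [X in _ + (_ + X)]big1 ?addr0 => [|c' cc']; last by rewrite J1 eq_sym (negPf cc') mul0r.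
by move/eqP; rewrite addrC addr_eq0 => /eqP ->; congr (- _); apply: eq_bigr => b _; rewrite !mxE.
Qed.

(** The hypotheses express the remaining rows of [D] by [A] and [B]. The Gram determinant of [J]
    becomes that of [1 + B B^T], and the one of [D] becomes [1 + B^T B] between two factors [A]; the
    two inner determinants agree by [sylvester]. *)
Lemma complementary_minors : Num.sqrt (sum_sqr_minors e J) * `|\det A| = Num.sqrt (sum_sqr_minors n D).
Proof.
have E1 : J *m J^T = 1%:M + B *m B^T.
  apply/matrixP => c c'; rewrite !mxE big_split_sum addrC; congr (_ + _); first by apply: eq_bigr => a _; rewrite !mxE.
  rewrite (bigD1 c) //= !mxE !J1 eqxx mul1r eq_sym big1 ?addr0 // => d dc.
  by rewrite J1 eq_sym (negPf dc) mul0r.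
have E2 : D^T *m D = A^T *m (1%:M + B^T *m B) *m A.
  have -> : D^T *m D = A^T *m A + (rowsub (q \o inr) D)^T *m rowsub (q \o inr) D.
    by apply/matrixP => a a'; rewrite !mxE big_split_sum; congr (_ + _); apply: eq_bigr => b _; rewrite !mxE.
  have TN : (- (B *m A))^T = - (A^T *m B^T) by rewrite -trmx_mul; apply/matrixP => a a'; rewrite !mxE.
  by rewrite DJ TN mulNmx mulmxN opprK mulmxDr mulmx1 mulmxDl !mulmxA.
rewrite ssm_row ssm_col E1 E2 !det_mulmx det_tr mulrAC -expr2 sqrtrM ?sqr_ge0 // sqrtr_sqr mulrC.
by rewrite sylvester.
Qed.

(** Exchanging a chosen row for the remaining row [c] multiplies the minor by an entry of [J]. If
    the chosen minor is the largest, this bounds the entry by 1. *)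
Lemma swap_minor c a : `|\det (rowsub (fun b => q (if b == a then inr c else inl b)) D)| = `|J c (q (inl a))| * `|\det A|.
Proof.
pose T : 'M[K]_n := \matrix_(b, d) if b == a then - B c d else (b == d)%:R.
have -> : rowsub (fun b => q (if b == a then inr c else inl b)) D = T *m A.
  apply/matrixP => b d; have [->|ba] := eqVneq b a.
    have := congr1 (fun M : 'M[K]_(e, n) => M c d) DJ; rewrite !mxE eqxx /= => ->.
    rewrite -sumrN; apply: eq_bigr => i _; by rewrite !mxE eqxx mulNr.
  rewrite !mxE (negPf ba) (bigD1 b) //= !mxE (negPf ba) eqxx mul1r big1 ?addr0 // => i ib.
  by rewrite !mxE (negPf ba) eq_sym (negPf ib) mul0r.
rewrite det_mulmx normrM (expand_det_col T a) (bigD1 a) //= big1 ?addr0 => [|b ba]; last by rewrite mxE (negPf ba) mul0r.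
have -> : cofactor T a a = 1.
  rewrite /cofactor (_ : row' a (col' a T) = 1%:M) ?det1 ?mulr1; last first.
    by apply/matrixP => k l; rewrite !mxE eq_sym (negPf (neq_lift a k)) (inj_eq (@lift_inj _ a)).
  by rewrite -signr_odd addnn odd_double.
by rewrite mulr1 mxE eqxx normrN mxE.
Qed.

End SplitMatrix.

(** * Strict derivatives compared with differentials, and integrals *)

Section Differential.

Lemma sdm_is_differential n k (X : set K^^n) (F : K^^n -> K^^k) x : X x -> sdm F x ->
  is_differential X F x (jac F x).
Proof.
move=> Xx H; split=> // eps eps0; pose e := eps / (k.+1 * n.+1)%:R.
have e0 : 0 < e by rewrite divr_gt0 // ltr0n muln_gt0.
have /choice[d Hd] l : exists d : K, 0 < d /\ forall y z, box x d y -> box x d z ->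
    `|F y 0 l - F z 0 l - dot (\row_j jac F x j l) (y - z)| <= e * l1 (y - z).
  by have /sdiffE/(_ e e0)[d d0 Hd] := H l; exists d.
have [d0 d00 dd0] := min_all (fun l => (Hd l).1); exists d0 => // y _ yx.
have xy : box x d0 y by move=> i; have := le_lt_trans (le_enorm (y - x) i) yx; rewrite !mxE.
have l1e : l1 (y - x) <= n.+1%:R * enorm (y - x).
  rewrite /l1; apply: le_trans (ler_sum _ (fun i _ => le_enorm (y - x) i)) _.
  by rewrite sumr_const card_ord -[leLHS]mulr_natl ler_wpM2r ?enorm_ge0 // ler_nat.
apply: le_trans (enorm_le_sum _) _.
apply: le_trans (_ : \sum_(l < k) e * (n.+1%:R * enorm (y - x)) <= _).
  apply: ler_sum => l _; have [dl Hl] := Hd l; have := Hl y x (box_le (dd0 l) xy) (box_refl _ dl).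
  rewrite !mxE => Hl'; apply: le_trans (le_trans _ Hl') _; last by rewrite ler_wpM2l ?(ltW e0).
  by rewrite (_ : dot _ _ = \sum_j (y - x) 0 j * jac F x j l) // /dot; apply: eq_bigr => i _; rewrite mxE mulrC.
rewrite sumr_const card_ord -[leLHS]mulr_natl mulrCA /e natrM mulrA; set M := n.+1%:R; set N := k.+1%:R.
have M0 : M != 0 :> K by rewrite pnatr_eq0.
have N0 : 0 < N :> K by [].
rewrite (_ : _ * _ * _ = (k%:R / N) * (eps * enorm (y - x))); last first.
  by rewrite invfM; transitivity ((M^-1 * M) * (k%:R / N * (eps * enorm (y - x)))); [ring|rewrite mulVf // mul1r].
by rewrite ler_piMl ?mulr_ge0 ?enorm_ge0 ?(ltW eps0) // ler_pdivrMr // mul1r ler_nat.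
Qed.

Lemma is_differential_uniq n k (X : set K^^n) (F : K^^n -> K^^k) x d (A B : 'M[K]_(n, k)) :
  0 < d -> (forall y, box x d y -> X y) -> is_differential X F x A -> is_differential X F x B -> A = B.
Proof.
move=> d0 dX [_ HA] [_ HB]; apply/matrixP => i l; apply/eqP; rewrite -subr_eq0 -normr_le0.
apply/ler_addgt0Pl => e e0; rewrite addr0; have e2 : 0 < e / 2%:R by rewrite divr_gt0.
have [d1 d10 H1] := HA _ e2; have [d2 d20 H2] := HB _ e2.
have [d3 [d30 d31 d32]] := min2 d10 d20; have [t [t0 t3 td]] := min2 d30 d0.
pose h := t / 2%:R; have h0 : 0 < h by rewrite divr_gt0.
have ht : h < t by rewrite ltr_pdivrMr // ltr_pMr // ltr1n.
pose y := x + h *: delta_mx 0 i.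
have yx : y - x = h *: delta_mx 0 i by rewrite /y addrC addKr.
have ny : enorm (y - x) = h.
  rewrite yx /enorm (bigD1 i) //= !mxE !eqxx mulr1 big1 ?addr0 ?sqrtr_sqr ?gtr0_norm // => j ji.
  by rewrite !mxE eqxx (negPf ji) mulr0 expr0n.
have Xy : X y.
  apply: dX => j; have -> : y 0 j - x 0 j = (y - x) 0 j by rewrite !mxE.
  by apply: le_lt_trans (le_enorm _ _) _; rewrite ny (lt_le_trans ht).
have := H1 y Xy; have := H2 y Xy; rewrite ny => h2 h1.
have := le_trans (le_enorm _ l) (h1 (lt_le_trans ht (le_trans t3 d31))).
have := le_trans (le_enorm _ l) (h2 (lt_le_trans ht (le_trans t3 d32))).
rewrite yx -!scalemxAl !mxE (bigD1 i) //= [\sum_(j | _) _]big1 => [|j ji]; last by rewrite mxE eqxx (negPf ji) mul0r.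
rewrite (bigD1 i) //= [\sum_(j | _) _]big1 => [|j ji]; last by rewrite mxE eqxx (negPf ji) mul0r.
rewrite !mxE !eqxx !mul1r !addr0; set u := F y 0 l - F x 0 l => k2 k1.
have : h * `|A i l - B i l| <= h * e.
  rewrite -[h in leLHS](gtr0_norm h0) -normrM (_ : h * (A i l - B i l) = (u - h * B i l) - (u - h * A i l)); last by ring.
  apply: le_trans (ler_normB _ _) _; apply: le_trans (lerD k2 k1) _.
  by rewrite -mulrDl mulrC -splitr.
by rewrite ler_pM2l.
Qed.

Lemma Jac_sdm n k e (X : set K^^n) (F G : K^^n -> K^^k) x d : 0 < d -> (forall y, box x d y -> X y) ->
  (forall y, X y -> F y = G y) -> sdm G x -> (\rank (jac G x) <= e)%N ->
  Jac e X F x = (Num.sqrt (sum_sqr_minors e (jac G x)))%:E.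
Proof.
move=> d0 dX FG sG rk; have Xx : X x by apply: dX; exact: box_refl.
have HF : is_differential X F x (jac G x).
  have [_ H] := sdm_is_differential Xx sG; split=> // eps /H[dl dl0 Hd]; exists dl => // y Xy yx.
  by rewrite !FG //; exact: Hd.
have -> : Jac e X F x = if `[< exists L, is_differential X F x L >] && (\rank (differential X F x) <= e)%N
  then (Num.sqrt (sum_sqr_minors e (differential X F x)))%:E else +oo%E by [].
have -> : differential X F x = jac G x.
  rewrite /differential; case: xgetP => [A -> /= HA|/(_ (jac G x))//].
  exact: is_differential_uniq d0 dX HA HF.
by rewrite rk andbT asboolT //; exists (jac G x).
Qed.

Lemma tangent_open n (X : set K^^n) x v d : 0 < d -> (forall y, box x d y -> X y) -> tangent X x v.
Proof.
move=> d0 dX eps eps0; have [c [c0 cd ce]] := min2 d0 eps0.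
pose N := enorm v + 1; have N0 : 0 < N by rewrite ltr_wpDl ?enorm_ge0.
pose s := c / N; have s0 : 0 < s by rewrite divr_gt0.
have yx : x + s *: v - x = s *: v by rewrite addrC addKr.
have ns : enorm (s *: v) < c.
  have -> : enorm (s *: v) = s * enorm v.
    rewrite /enorm (eq_bigr (fun i => s ^+ 2 * v 0 i ^+ 2)) => [|i _]; last by rewrite mxE exprMn.
    by rewrite -mulr_sumr sqrtrM ?sqr_ge0 // sqrtr_sqr gtr0_norm.
  by rewrite /s mulrAC ltr_pdivrMr // ltr_pM2l // /N ltrDl.
exists (x + s *: v), s^-1; rewrite yx; split.
- apply: dX => i; have -> : (x + s *: v) 0 i - x 0 i = (s *: v) 0 i by rewrite !mxE addrC addKr.
  by apply: le_lt_trans (le_enorm _ _) _; exact: lt_le_trans ns cd.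
- by rewrite invr_gt0.
- exact: lt_le_trans ns ce.
- rewrite scalerA mulVf ?gt_eqF // scale1r subrr.
  by rewrite /enorm big1 ?sqrtr0 // => i _; rewrite mxE expr0n.
Qed.

Lemma M_bound n k (X : set K^^n) (A : 'M[K]_(n, k)) x d M i l : 0 < d -> (forall y, box x d y -> X y) ->
  (forall v, tangent X x v -> enorm (v *m A) <= M * enorm v) -> `|A i l| <= M.
Proof.
move=> d0 dX H; have := H _ (tangent_open (delta_mx 0 i) d0 dX).
have -> : enorm (delta_mx 0 i : K^^n) = 1.
  rewrite /enorm (bigD1 i) //= mxE !eqxx expr1n big1 ?addr0 ?sqrtr1 // => j ji.
  by rewrite mxE eqxx (negPf ji) expr0n.
rewrite mulr1; apply: le_trans; have := le_enorm (delta_mx 0 i *m A) l; rewrite -rowE mxE.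
by [].
Qed.

Lemma ssm_bound n k e (C : nat) : exists N : nat, forall A : 'M[K]_(n, k), (forall i j, `|A i j| <= C%:R) ->
  Num.sqrt (sum_sqr_minors e A) <= N%:R.
Proof.
pose b := ((e`! * C ^ e) ^ 2)%N; pose N := (#|{ffun 'I_e -> 'I_n}| * (#|{ffun 'I_e -> 'I_k}| * b))%N.
exists N.+1 => A AC; have sN : sum_sqr_minors e A <= N%:R.
  rewrite /sum_sqr_minors; apply: le_trans (_ : \sum_(s : {ffun 'I_e -> 'I_n} | increasing s) (#|{ffun 'I_e -> 'I_k}| * b)%:R <= _).
    apply: ler_sum => s _; apply: le_trans (_ : \sum_(t : {ffun 'I_e -> 'I_k} | increasing t) b%:R <= _).
      apply: ler_sum => t _; rewrite -real_normK ?num_real // natrX ler_sqr ?nnegrE ?ler0n //.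
      by apply: det_bound => i j; rewrite mxE.
    by rewrite sumr_const -[leLHS]mulr_natl -natrM ler_nat leq_mul2r max_card orbT.
  by rewrite sumr_const -[leLHS]mulr_natl -natrM ler_nat leq_mul2r max_card orbT.
apply: le_trans (_ : Num.sqrt (N.+1%:R ^+ 2) <= _); last by rewrite sqrtr_sqr ger0_norm.
by rewrite ler_wsqrtr // (le_trans sN) // expr2 -natrM ler_nat; lia.
Qed.

End Differential.

Lemma null_nogen P b n (X : set K^^n) : countable P -> D S P X -> bdd b X -> (forall x, X x -> ~ gen P x) ->
  (bo_measure R S n).-negligible (X : set (caratheodory_type (@bo_outer R L K S n))).
Proof.
move=> cP DX bX NX; exists X; split=> //.
  exact: (bo_measurable (D_def DX) bX).
by rewrite (bo_measureE (D_def DX) bX) (small_nogen cP DX bX NX).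
Qed.

(** The equation for [phi] is known only on [G], which contains all generic points of [U]. The rest
    is null, and as the measure is complete, [phi] is measurable together with the sum of the fibre
    volumes. *)
Lemma int_fib P b n k m (J : finType) (p : J -> 'I_m -> 'I_n + 'I_k) q (E : J -> set K^^m) (U G : set K^^n) phi :
  (forall j, cancel (p j) (q j)) -> (forall j, cancel (q j) (p j)) -> countable P -> D S P U -> D S P G -> bdd b U ->
  (forall j, D S P (E j)) -> (forall j, bdd b (E j)) -> (forall j y z, E j (mix (p j) y z) -> U y) ->
  (forall y, U y -> gen P y -> G y) -> (forall y, U y -> G y -> phi y = (\sum_j vl (fib (p j) (E j) y))%:E) ->
  (bo_measure R S n).-integrable U phi /\ (\int[bo_measure R S n]_(y in U) phi y = (\sum_j vl (E j))%:E)%E.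
Proof.
move=> pK qK cP DU DG bU DE bE EU UG phiE.
set mu := bo_measure R S n; pose T := caratheodory_type (@bo_outer R L K S n).
have mH : measurable (hbox b n : set T) := hbox_measurable b.
have mU : measurable (U : set T) := bo_measurable (D_def DU) bU.
have UH : (U : set T) `<=` hbox b n by move=> y /bU.
pose g (y : T) : \bar R := (\sum_j (vl (fib (p j) (E j) y))%:E)%E.
have ij j := vl_fib_integrable (qK j) cP (DE j) (bE j).
have ig : mu.-integrable (hbox b n) g by apply: integrable_sum => // j _; exact: ij.
have gU : mu.-integrable U g by exact: integrableS mH mU UH ig.
have gint : (\int[mu]_(y in U) g y = (\sum_j vl (E j))%:E)%E.
  rewrite -(setIidr UH) integral_mkcondr.
  have -> : (\int[mu]_(y in hbox b n) (g \_ U) y = \int[mu]_(y in hbox b n) g y)%E.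
    apply: eq_integral => y _; rewrite patchE; case: ifPn => // /negP yU; rewrite /g big1 // => j _.
    rewrite (_ : fib _ _ _ = set0) ?vl_set0 //; apply/seteqP; split=> // z /EU Uy.
    by case: yU; rewrite inE.
  rewrite /g integral_sum //.
  by rewrite -sumEFin; apply: eq_bigr => j _; rewrite (fubini (pK j) (qK j) cP (DE j) (bE j)).
have cmu : measure_is_complete mu by exact: measure_is_complete_caratheodory.
have ae : ae_eq mu U g phi.
  have DN : D S P (U `\` G) by apply: D_and => //; exact: D_not.
  have bN : bdd b (U `\` G) by apply: bdd_sub bU => y [].
  have NN : forall x, (U `\` G) x -> ~ gen P x by move=> x [Ux NG] gx; apply: NG; exact: UG.
  apply: negligibleS (null_nogen cP DN bN NN) => y /= /not_implyP[Uy ne]; split=> // Gy; apply: ne.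
  by rewrite phiE // /g sumEFin.
have [mg _] := integrableP _ _ _ gU; have mphi := ae_measurable_fun cmu ae (mg).
split; last by rewrite -gint; apply/esym; apply: ae_eq_integral.
apply/integrableP; split=> //.
rewrite (_ : (\int[mu]_(y in U) `|phi y| = \int[mu]_(y in U) `|g y|)%E).
  by have [] := integrableP _ _ _ gU.
have mp : measurable_fun (U : set T) (abse \o (phi : T -> \bar R)) by exact: (measurableT_comp (@abse_measurable R setT) mphi).
have mgg : measurable_fun (U : set T) (abse \o g) by exact: (measurableT_comp (@abse_measurable R setT) mg).
apply/esym; apply: (@ae_eq_integral _ _ _ mu U _ _ mU mgg mp).
by apply: filterS ae => y /= H Uy; rewrite H.
Qed.

Lemma int_st P b n (U : set K^^n) (k : K^^n -> K) phi : countable P -> D S P U -> Df S P k -> bdd b U ->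
  (forall x, U x -> 0 <= k x <= b%:R) -> forall V : set K^^n, D S P V -> bdd b V -> U `<=` V ->
  (forall x, V x -> gen P x -> U x) -> (forall x, U x -> phi x = st_ext R (k x)%:E) ->
  (bo_measure R S n).-integrable V phi /\ (\int[bo_measure R S n]_(y in V) phi y = (vl (Hypo U k))%:E)%E.
Proof.
move=> cP DU Dk bU kb V DV bV UV Vg phiE.
have bH : bdd b (Hypo U k) by apply: bdd_Hypo bU _ => x /kb/andP[].
have := @int_fib P b n 1 n.+1 'I_1 (fun=> pr1 ord0) (fun=> qr1 ord0) (fun=> Hypo U k) V U phi
  (fun=> pr1K ord0) (fun=> qr1K ord0) cP DV DU bV (fun=> D_Hypo DU Dk) (fun=> bH).
rewrite !big_ord1; apply=> //.
- by move=> _ y z; rewrite mixr1K => -[+ _]; rewrite col'_ins => /UV.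
- move=> y Vy Uy; rewrite big_ord1 (vl_fib_Hypo cP DU Dk bU Uy (kb y Uy)) phiE //.
  by rewrite /= st_str //; exact: fin_itv (kb y Uy).
Qed.

(** * Charts of rectifiable sets *)

Definition jdet n k e (G : K^^n -> K^^k) x : K := Num.sqrt (sum_sqr_minors e (jac G x)).

Lemma Df_jdet P n k e (G : K^^n -> K^^k) : Df S P G -> Df S P (jdet e G).
Proof.
move=> DG; apply: Df_sqrt; apply: Df_sum => s; apply: Df_sum => t; apply: Df_exp; apply: Df_det => i j.
have -> : (fun x => mxsub s t (jac G x) i j) = fun x => jac G x (s i) (t j) by apply/funext => x; rewrite mxE.
exact: Df_jac.
Qed.

(** Only the values on [X] are known to be definable; extension by 0 gives a total definable
    function. *)
Lemma dfun_ex n k (X : set K^^n) (f : K^^n -> K^^k) : definable_fun S X f ->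
  exists P, [/\ countable P, D S P X & exists2 f', Df S P f' & forall x, X x -> f' x = f x].
Proof.
move=> /definable_D[P cP DG]; exists P.
pose g (x : K^^n) (y : K^^k) := graph_on X f (row_mx x y).
have Dg : D S P (fun p : K^^n * K^^k => g p.1 p.2).
  by apply: (D_comp DG); apply: Df_row_mx; ddef.
have gP x y : g x y <-> X x /\ y = f x.
  split=> [[x' Xx' /eq_row_mx[<- <-]]|[Xx ->]] //; by exists x.
split=> //.
  have DX : D S P (fun x => exists y, g x y) by apply: D_ex.
  by move: DX; apply: D_ext => x; split=> [[y /gP[]]|Xx] //; exists (f x); apply/gP.
pose Rl x y := g x y \/ (y = 0 /\ ~ exists y', g x y').
have [||x y z [/gP[Xx ->]|[-> N]] [/gP[Xx' ->]|[-> N']]|f' Df' Hf'] := @graph_fun P _ _ _ _ Rl.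
- by rewrite /Rl; ddef.
- by move=> x; have [[y Hy]|N] := pselect (exists y, g x y); [exists y; left|exists 0; right].
- by [].
- by case: N'; exists (f x); apply/gP.
- by case: N; exists (f x); apply/gP.
- by [].
exists f' => // x Xx; case: (Hf' x) => [/gP[]//|[_ []]]; exists (f x); exact/gP.
Qed.

(** [G] parametrises [C] over [U], and [w] lists the coordinates that recover the parameter. [U1]
    contains the generic points of [U] and consists of points with a strict derivative of finite
    bound [c]. *)
Definition chart_data e n (C : set K^^n) b P (G : K^^e -> K^^n) (w : 'I_e -> 'I_n) (U U1 : set K^^e) (c : nat) :=
  [/\ countable P, D S P U1, Df S P G, C = [set G x | x in U] & bdd b U] /\
  [/\ U1 `<=` U, forall x, U x -> gen P x -> U1 x, forall x, U x -> colsub w (G x) = x,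
     forall x, U1 x -> sdm G x /\ forall j l, `|jac G x j l| <= c%:R &
     hausdorff_basic R S e C = (vl (Hypo U1 (jdet e G)))%:E].

(** [hausdorff_basic] picks an unknown chart, so the data are read off from whichever chart it is,
    not from the one that witnesses rectifiability. *)
Lemma hb_chart e n (C : set K^^n) b : basic_rectifiable S e C -> bdd b C ->
  exists P G w U U1 c, @chart_data e n C b P G w U U1 c.
Proof.
move=> bC bdC; rewrite /chart_data /hausdorff_basic; case: xgetP => [v _ /=|/(_ _)N]; last first.
  have [M [k [E [s [U [f H]]]]]] := bC.
  by case: (N (\int[bo_measure R S e]_(x in U) st_ext R (Jac e U (fun x => row_mx x (f x)) x))%E); exists M, k, E, s, U, f.
move=> [M [k [E [s [U [f [[[M0 Mfin] _ oU [Df0 dM] CE] ->]]]]]]].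
have [P [cP DU [f' Df' f'E]]] := dfun_ex Df0.
pose F (x : K^^e) : K^^(e + k) := row_mx x (f' x); pose sg l := cast_ord (esym E) ((s^-1)%g l).
pose G x : K^^n := \row_l F x 0 (sg l); pose w c := s (cast_ord E (lshift k c)).
have sgK j : sg (s (cast_ord E j)) = j by rewrite /sg permK cast_ordK.
have DF : Df S P F by apply: Df_row_mx => //; exact: Df_id.
have DG : Df S P G.
  apply: Df_rV => l; have -> : (fun x => G x 0 l) = fun x => F x 0 (sg l) by apply/funext => x; rewrite mxE.
  exact: Df_entry.
have GF x : sdm F x -> jac G x = \matrix_(j, l) jac F x j (sg l) /\ sdm G x.
  move=> sF; apply: sdmP => l'; have -> : (fun y => G y 0 l') = fun y => F y 0 (sg l') by apply/funext => y; rewrite mxE.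
  by have := sF (sg l'); congr sdiff; apply/rowP => j; rewrite !mxE.
have CG : C = [set G x | x in U].
  have Gz x : U x -> col_perm s (G x) = castmx (erefl, E) (row_mx x (f x)).
    by move=> Ux; apply/rowP => j; rewrite castmxE !mxE /= -(cast_ordKV E j) sgK /F f'E // ord1 cast_ordK.
  have inj : injective (fun z : K^^n => col_perm s z).
    move=> z z' /rowP zz; apply/rowP => j; have := zz ((s^-1)%g j); rewrite !mxE permKV.
    by [].
  apply/seteqP; split=> z.
    move=> Cz; have : [set castmx (erefl, E) z | z in graph_on U f] (col_perm s z) by rewrite -CE; exists z.
    by move=> [_ [x Ux <-]]; rewrite -Gz // => /inj <-; exists x.
  move=> [x Ux <-]; have : [set col_perm s z | z in C] (col_perm s (G x)).
    by rewrite CE Gz //; exists (row_mx x (f x)) => //; exists x.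
  by move=> [z' Cz' /inj <-].
have wG x : colsub w (G x) = x by apply/rowP => a; rewrite mxE mxE sgK row_mxEl.
have bU : bdd b U.
  by move=> x Ux c; rewrite -{1 2}(wG x) mxE; apply: bdC; rewrite CG; exists x.
have [N MN] := Mfin; pose c := N.+1.
pose U1 : set K^^e := [set x | U x /\ (sdm F x /\ forall j l, `|jac F x j l| <= c%:R)].
have D1 : D S P U1.
  apply: D_and => //; apply: D_and; first exact: D_sdm.
  by apply: D_fin => j; apply: D_fin => l; apply: D_le; [apply: Df_norm; exact: Df_jac|exact: Df_nat].
have Ubox x : U x -> exists2 d, 0 < d & forall y, box x d y -> U y.
  move=> /oU[r r0 Hr]; have d0 : 0 < r / e.+1%:R by rewrite divr_gt0.
  exists (r / e.+1%:R) => // y yx; apply: Hr; apply: enorm_lt => // i; rewrite !mxE; exact: yx.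
have U1g x : U x -> gen P x -> U1 x.
  move=> Ux gx; have sF := sdm_gen cP gx DF; split=> //; split=> // j l.
  have [d d0 dU] := Ubox x Ux; rewrite mxE; case: (fintype.split_ordP l) => a ->.
    have -> : (fun y => F y 0 (lshift k a)) = fun y => y 0 a by apply/funext => y; rewrite row_mxEl.
    by rewrite (gradP (sdiff_coord x a)) mxE eqxx /=; case: eqP => _; rewrite ?normr1 ?normr0 ?ler1n.
  have -> : (fun y => F y 0 (rshift e a)) = fun y => f' y 0 a by apply/funext => y; rewrite row_mxEr.
  have sf := sdm_gen cP gx Df'; have [A HA tA] := dM x Ux.
  have HA' : is_differential U f x (jac f' x).
    have [_ H] := sdm_is_differential Ux sf; split=> // eps /H[dl dl0 Hd]; exists dl => // y Uy yx.
    by rewrite -!f'E //; exact: Hd.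
  have AE := is_differential_uniq d0 dU HA HA'; have := M_bound j a d0 dU tA; rewrite AE mxE => /le_trans; apply.
  by apply: le_trans (ler_norm M) (le_trans MN _); rewrite ler_nat.
exists P, G, w, U, U1, c; split=> //; split=> // [x []//|x [Ux [sF FC]]|].
  by have [-> sG] := GF x sF; split=> // j l; rewrite mxE.
have jE x : U1 x -> jdet e G x = jdet e F x.
  move=> [_ [sF _]]; have [JG _] := GF x sF; rewrite /jdet !ssm_row JG; congr (Num.sqrt (\det _)).
  apply/matrixP => i j; rewrite !mxE [LHS](reindex (fun l => s (cast_ord E l))) /=.
    by apply: eq_bigr => l _; rewrite !mxE sgK.
  exists sg => l _; rewrite ?sgK //; by rewrite /sg cast_ordKV permKV.
have [B HB] := @ssm_bound e n e c.
pose B' := maxn b B; have bB' : (b <= B')%N by rewrite leq_maxl.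
have [||||_ ->] := int_st (phi := fun x => st_ext R (Jac e U (fun x => row_mx x (f x)) x)) cP D1 (Df_jdet e DG) (bdd_le bB' (bdd_sub _ bU)) _ DU (bdd_le bB' bU) _ U1g.
- by move=> x [].
- move=> x [Ux [sF FC]]; rewrite sqrtr_ge0 /=; have [JG _] := GF x sF.
  apply: le_trans (HB _ _) _; first by move=> i j; rewrite JG mxE.
  by rewrite ler_nat leq_maxr.
- by move=> x [].
- move=> x U1x; have [Ux [sF _]] := U1x; have [d d0 dU] := Ubox x Ux; congr (st_ext R _).
  rewrite (Jac_sdm d0 dU (G := F)) ?jE //; last exact: rank_leq_row.
  by move=> y Uy; rewrite /F f'E.
by [].
Qed.

Lemma ext_split a b m (s : 'I_a -> 'I_m) : injective s -> (a + b)%N = m ->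
  exists q : 'I_a + 'I_b -> 'I_m, injective q /\ forall i, q (inl i) = s i.
Proof.
move=> sI E; pose C := (~: [set s i | i in 'I_a])%SET.
have cC : b = #|C|.
  by apply/eqP; rewrite -(eqn_add2l a) -[in X in _ == (X + _)%N](card_ord a) -(card_imset _ sI) cardsC card_ord; apply/eqP.
pose q (x : 'I_a + 'I_b) := match x with inl i => s i | inr j => enum_val (cast_ord cC j) end.
have nC i j : s i <> enum_val (cast_ord cC j).
  move=> sE; have := enum_valP (cast_ord cC j); rewrite -sE finset.in_setC => /negP; apply.
  exact: imset_f.
exists q; split=> // -[i|i] [j|j] //= => [/sI -> //|/nC//|/esym/nC//|/enum_val_inj/cast_ord_inj ->//].
Qed.

Lemma inj_split a b m (q : 'I_a + 'I_b -> 'I_m) : (a + b)%N = m -> injective q -> exists2 p, cancel p q & cancel q p.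
Proof.
move=> E qI; have [|p qK pK] := inj_card_bij qI; first by rewrite card_sum !card_ord E.
by exists p.
Qed.

Lemma det_reindex k m (M : 'M[K]_m) (s : 'I_k -> 'I_m) : injective s -> k = m -> `|\det (mxsub s s M)| = `|\det M|.
Proof.
move=> sI E; case: m / E M s sI => M s sI; have -> : mxsub s s M = row_perm (perm sI) (col_perm (perm sI) M).
  by apply/matrixP => i j; rewrite !mxE !permE.
by rewrite row_permE col_permE !det_mulmx !det_perm !normrM !normrX normrN1 !expr1n mul1r mulr1.
Qed.

Lemma mulmx_enorm n k (A : 'M[K]_(n, k)) (N : nat) v : (forall i l, `|A i l| <= N%:R) ->
  enorm (v *m A) <= (k * n * N)%:R * enorm v.
Proof.
move=> AN; apply: le_trans (enorm_le_sum _) _; rewrite -mulnA natrM -mulrA.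
apply: le_trans (_ : \sum_(l < k) (n * N)%:R * enorm v <= _); last by rewrite sumr_const card_ord -[leLHS]mulr_natl.
apply: ler_sum => l _; rewrite mxE; apply: le_trans (ler_norm_sum _ _ _) _.
apply: le_trans (_ : \sum_(i < n) N%:R * enorm v <= _); last by rewrite sumr_const card_ord -[leLHS]mulr_natl mulrA natrM.
apply: ler_sum => i _; rewrite normrM mulrC ler_pM //; exact: le_enorm.
Qed.

Lemma sdm_M_function P (N : nat) M n k (X : set K^^n) (F : K^^n -> K^^k) : D S P X -> Df S P F ->
  (forall x, X x -> sdm F x /\ forall i l, `|jac F x i l| <= N%:R) -> (k * n * N)%:R <= M -> M_function S M X F.
Proof.
move=> DX DF HF NM; split.
  by apply: (D_def (P := P)); apply: D_img => //; apply: Df_row_mx => //; exact: Df_id.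
move=> x Xx; have [sF bF] := HF x Xx; exists (jac F x); first exact: sdm_is_differential.
by move=> v _; apply: le_trans (mulmx_enorm v bF) _; rewrite ler_wpM2r ?enorm_ge0.
Qed.

(** By strict differentiability at [x] the function minus its linear part at [x] has a small
    Lipschitz constant around every nearby [y], which bounds the difference of the gradients. *)
Lemma sdm_C1 n k (X : set K^^n) (F : K^^n -> K^^k) : (forall x, X x -> sdm F x) -> C1_on X F.
Proof.
move=> HF; exists (jac F); split=> [x Xx|x Xx eps e0]; first by apply: sdm_is_differential => //; exact: HF.
have /choice[d Hd] l : exists d : K, 0 < d /\ forall y, box x d y -> X y -> forall i, `|jac F y i l - jac F x i l| < eps.
  have e2 : 0 < eps / 2%:R by rewrite divr_gt0.
  have [d d0 Hd] := (sdiffE _ _ _).1 (HF x Xx l) _ e2; exists (d / 2%:R); split=> [|y xy Xy i]; first by rewrite divr_gt0.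
  have near z : box y (d / 2%:R) z -> box x d z.
    by move=> yz j; have := yz j; have := xy j; rewrite !ltr_norml => /andP[h1 h2] /andP[h3 h4]; apply/andP; split; lra.
  have d2 : 0 < d / 2%:R by rewrite divr_gt0.
  have sh := sdiff_sub (HF y Xy l) (sdiff_lin (\row_j jac F x j l) y).
  have := grad_bound sh d2 (M := eps / 2%:R) _ i; rewrite !mxE => /(_ _)/le_lt_trans; apply.
    move=> z yz; have := Hd z y (near z yz) (near y (box_refl _ d2)); rewrite dotBr.
    by congr (`|_| <= _); ring.
  by rewrite ltr_pdivrMr // ltr_pMr // ltr1n.
have [d' d'0 dd'] := min_all (fun l => (Hd l).1); exists d' => // y Xy yx i l.
apply: (Hd l).2 => //; apply: box_le (dd' l) _ => j.
by have := le_lt_trans (le_enorm (y - x) j) yx; rewrite !mxE.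
Qed.

(** * Permuted cells and families of cells *)

Definition cperm n (s : 'S_n) (v : K^^n) : K^^n := col_perm s v.

Lemma cpermK n (s : 'S_n) : cancel (cperm s) (cperm s^-1).
Proof. by move=> v; apply/rowP => i; rewrite !mxE permKV. Qed.

Lemma cpermKV n (s : 'S_n) : cancel (cperm s^-1) (cperm s).
Proof. by move=> v; apply/rowP => i; rewrite !mxE permK. Qed.

Lemma Df_cperm P n (s : 'S_n) : Df S P (cperm s).
Proof. by apply: Df_rV => i; rewrite /cperm; under eq_fun do rewrite mxE; apply: Df_entry; exact: Df_id. Qed.

Lemma sdm_cperm n k (s : 'S_n) (F : K^^n -> K^^k) (N : nat) u : sdm F (cperm s u) -> (forall i l, `|jac F (cperm s u) i l| <= N%:R) ->
  sdm (fun u => F (cperm s u)) u /\ forall i l, `|jac (fun u => F (cperm s u)) u i l| <= N%:R.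
Proof.
move=> sF bF; have [|J1 s1] := @sdmP n n (cperm s) u (\matrix_(i, j) (i == s j)%:R).
  move=> l; have -> : (fun y => cperm s y 0 l) = fun y => y 0 (s l) by apply/funext => y; rewrite mxE.
  by rewrite (_ : \row_j _ = delta_mx 0 (s l)); [exact: sdiff_coord|apply/rowP => j; rewrite !mxE eqxx].
have [J2 s2] := jac_comp s1 sF; split=> // i l; rewrite J2 J1 mxE (bigD1 ((s^-1)%g i)) //= big1 ?addr0 => [|j ji].
  by rewrite [X in X * _]mxE permKV eqxx mul1r.
rewrite [X in X * _]mxE; case: eqP => [E|_]; last by rewrite mul0r.
by rewrite E permK eqxx in ji.
Qed.

(** The steps of the cell single out coordinates in an arbitrary order; the permutation moves each
    of them to the last place. The factor [n] converts bounds for entries into bounds for the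
    operator norm. *)
Lemma PC_Mcell P (N : nat) n (C : set K^^n) M : (n * N)%:R <= M -> PC P N%:R C ->
  exists s : 'S_n, M_cell S M [set cperm s v | v in C].
Proof.
elim: n C => [|n IH] C NM /=.
  move=> ->; exists 1%g; apply/seteqP; split=> // v _; exists v => //.
  by apply/rowP => -[].
have nM : (n * N)%:R <= M by apply: le_trans NM; rewrite ler_nat leq_mul2r leqnSn orbT.
move=> [i [X [f [g [PX [Df0 Dg] [rf rg] fg ->]]]]]; have [s Hs] := IH X nM PX.
have DX := PC_D PX; set X' := [set cperm s v | v in X] in Hs.
have X'P u : X' u -> X (cperm s^-1 u) by move=> [v Xv <-]; rewrite cpermK.
have DX' : D S P X' by apply: D_img => //; exact: Df_cperm.
have C1 k : Df S P k -> reg N%:R X k -> C1_M_function S M X' (fun u => k (cperm s^-1 u)).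
  move=> Dk rk; have H u : X' u -> sdm (fun u => const_mx (k (cperm s^-1 u)) : K^^1) u /\
      forall i l, `|jac (fun u => const_mx (k (cperm s^-1 u)) : K^^1) u i l| <= N%:R.
    move=> /X'P Xu; have [sk bk] := rk _ Xu.
    have [|J1 s1] := @sdmP n 1 (fun v => pt (k v)) (cperm s^-1 u) (\matrix_(i, l) grad k (cperm s^-1 u) 0 i).
      move=> l; have -> : (fun y => pt (k y) 0 l) = k by apply/funext => y; rewrite mxE.
      by rewrite (_ : \row_j _ = grad k (cperm s^-1 u)) //; apply/rowP => j; rewrite !mxE.
    by apply: (sdm_cperm (F := fun v => pt (k v))) => // j l; rewrite J1 mxE.
  split; last by apply: sdm_C1 => u /H[].
  apply: (sdm_M_function DX' _ H); last by rewrite mul1n.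
  by apply: Df_pt; apply: (Df_comp Dk); exact: Df_cperm.
exists (lift_perm ord_max i s), X' => //; right.
exists (fun u => f (cperm s^-1 u)), (fun u => g (cperm s^-1 u)); split; [exact: C1|exact: C1|by move=> u /X'P /fg|].
have c' (w : K^^n.+1) : col' ord_max (cperm (lift_perm ord_max i s) w) = cperm s (col' i w).
  by apply/rowP => j; rewrite !mxE lift_perm_lift.
have cm (w : K^^n.+1) : cperm (lift_perm ord_max i s) w 0 ord_max = w 0 i by rewrite mxE lift_perm_id.
apply/seteqP; split=> z.
  by move=> [w [Xw fwg] <-]; rewrite /= c' cm cpermK; split=> //; exists (col' i w).
move=> [/X'P Xz fzg]; exists (cperm (lift_perm ord_max i s)^-1 z); last exact: cpermKV.
have := Xz; have := fzg; rewrite -(cpermKV (lift_perm ord_max i s) z) !c' !cm !cpermK.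
by split.
Qed.

Lemma Df_param P k (v : K^^k) n (g : K^^n -> K) : Df S (P <+ v) g ->
  exists2 g' : K^^n * K^^k -> K, Df S P g' & forall x, g' (x, v) = g x.
Proof.
move=> /D_param_vec[Q [DQ QE]].
pose Rl (w : K^^n * K^^k) t := (Q ((w.1, t), w.2) /\ forall t', Q ((w.1, t'), w.2) -> t' = t) \/
  (t = 0 /\ ~ exists t, Q ((w.1, t), w.2) /\ forall t', Q ((w.1, t'), w.2) -> t' = t).
have [||w t t' [[Q1 u1]|[-> N]] [[Q2 u2]|[-> N']]|g' Dg' Hg'] := @graph_fun P _ _ _ _ Rl.
- by rewrite /Rl; ddef.
- move=> w; have [[t Ht]|N] := pselect (exists t, Q ((w.1, t), w.2) /\ forall t', Q ((w.1, t'), w.2) -> t' = t).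
    by exists t; left.
  by exists 0; right.
- exact: u2.
- by case: N'; exists t.
- by case: N; exists t'.
- by [].
exists g' => // x; have H : Q ((x, g x), v) /\ forall t', Q ((x, t'), v) -> t' = g x.
  by split=> [|t' Ht']; [exact/(QE (x, g x))|exact/(QE (x, t'))].
by case: (Hg' (x, v)) => [[Q1 u1]|[_ []]]; [rewrite (H.2 _ Q1)|exists (g x)].
Qed.

Lemma Df_inst P k (v : K^^k) n (g : K^^n * K^^k -> K) : Df S P g -> Df S (P <+ v) (fun x => g (x, v)).
Proof.
move=> Dg; apply: (Df_comp (Df_mono _ Dg)); first by move=> t; left.
by apply: Df_pair; [exact: Df_id|apply: Df_rV => i; apply: Df_cst; right; exact: mem_vals].
Qed.

Lemma D_reg P k n (N : nat) (E : K^^n * K^^k -> Prop) (g : K^^n * K^^k -> K) : D S P E -> Df S P g ->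
  D S P (fun y => reg N%:R [set x | E (x, y)] (fun x => g (x, y))).
Proof.
move=> DE Dg; have H : D S P (fun y => forall x, E (x, y) -> exists G : K^^n,
    sdiff (fun x => g (x, y)) x G /\ forall j, `|G 0 j| <= N%:R).
  by rewrite /sdiff /box; ddef.
apply: D_ext H => y; split=> H x /H; last by move=> [sg bg]; exists (grad (fun x => g (x, y)) x).
by move=> [G [sG bG]]; rewrite (gradP sG).
Qed.

(** The parameters [y] in the bounding functions become variables. The requirements on these
    functions are definable in [y'], so they carve out a [P]-definable set [Y] on which the formulas
    still define cells. *)
Lemma PC_family P k (y : K^^k) (N : nat) n (C : set K^^n) : PC (P <+ y) N%:R C ->
  exists (E : K^^n * K^^k -> Prop) (Y : K^^k -> Prop),
  [/\ D S P E, D S P Y, Y y, forall x, E (x, y) <-> C x &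
     forall y', Y y' -> PC (P <+ y') N%:R [set x | E (x, y')]].
Proof.
elim: n C => [|n IH] C /=.
  by move=> ->; exists (fun=> True), (fun=> True); split=> //; exact: D_True.
move=> [i [X [f [g [/IH[E [Y [DE DY Yy EX HY]]] [/Df_param[f' Df' f'E] /Df_param[g' Dg' g'E]] [rf rg] fg ->]]]]].
pose E' (w : K^^n.+1 * K^^k) := E (col' i w.1, w.2) /\ f' (col' i w.1, w.2) < w.1 0 i < g' (col' i w.1, w.2).
pose Y' y := [/\ Y y, reg N%:R [set x | E (x, y)] (fun x => f' (x, y)), reg N%:R [set x | E (x, y)] (fun x => g' (x, y)) &
  forall x, E (x, y) -> f' (x, y) < g' (x, y)].
have EXs : [set x | E (x, y)] = X by apply/seteqP; split=> x /EX.
have fE : (fun x => f' (x, y)) = f by apply/funext.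
have gE : (fun x => g' (x, y)) = g by apply/funext.
exists E', Y'; split.
- by rewrite /E'; ddef.
- have D1 : D S P (fun y => forall x, E (x, y) -> f' (x, y) < g' (x, y)) by ddef.
  by have := D_and DY (D_and (D_reg N DE Df') (D_and (D_reg N DE Dg') D1)); apply: D_ext => y'; rewrite /Y'; split=> [[? [? [? ?]]]|[]].
- by rewrite /Y' EXs fE gE; split=> // x /EX/fg; rewrite f'E g'E.
- by move=> x; rewrite /E' /= f'E g'E EX.
move=> y' [Yy' rf' rg' fg']; exists i, [set x | E (x, y')], (fun x => f' (x, y')), (fun x => g' (x, y')); split=> //.
- exact: HY.
- by split; exact: Df_inst.
Qed.

(** * The coarea formula *)

Lemma D_dim P T {eT : encodable K T} k d (Z : T -> K^^k -> Prop) :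
  D S P (fun t : T * K^^k => Z t.1 t.2) -> D S P (fun y => dim_ge (Z y) d).
Proof.
move=> DZ; have : D S P (fun y => exists s : {ffun 'I_d -> 'I_k}, injective s /\ exists (z : K^^d) (r : K), 0 < r /\
    forall w, enorm (w - z) < r -> exists2 x, Z y x & colsub s x = w).
  apply: D_finex => s; apply: D_and; first exact: D_const.
  do 2 (apply: D_ex); apply: D_and; first by ddef.
  apply: D_all; apply: D_imp.
    by apply: D_lt; [apply: Df_enorm; apply: Df_rV => i; under eq_fun do rewrite !mxE|]; ddef.
  apply: D_ex2; first by apply: (D_comp (g := fun t => (t.1.1.1.1, t.2)) DZ); ddef.
  by apply: D_eqT; [apply: Df_rV => i; under eq_fun do rewrite mxE|]; ddef.
apply: D_ext => y; split=> [[s H]|[s [si H]]]; first by exists s.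
by exists [ffun i => s i]; split=> [i i'|]; rewrite ?ffunE; [exact: si|move: H; congr ex; apply/funext => z; congr ex; apply/funext => r; congr and; apply/propext; split=> H w /H[x Zx <-]; exists x => //; apply/rowP => i; rewrite !mxE ffunE].
Qed.

Section Coarea.
Variables (m n e : nat) (hm : (n + e)%N = m) (P : set K) (cP : countable P).
Variables (f : K^^m -> K^^n) (Df0 : Df S P f).

Lemma ssm_minor (A : 'M[K]_(m, n)) : sum_sqr_minors n A != 0 -> exists2 s : 'I_n -> 'I_m, injective s & \det (rowsub s A) != 0.
Proof.
move=> nz; apply: contrapT => N; case/eqP: nz; apply: big1 => s /increasing_inj sI; apply: big1 => t /increasing_id ->.
have -> : mxsub s [ffun i => i] A = rowsub s A by apply/matrixP => i j; rewrite !mxE ffunE.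
by apply/eqP; rewrite expf_eq0 /=; apply: contraT => d; case: N; exists s.
Qed.
Lemma minor_ssm (A : 'M[K]_(m, n)) (s : 'I_n -> 'I_m) : injective s -> \det (rowsub s A) != 0 -> sum_sqr_minors n A != 0.
Proof.
move=> sI d; have : [ffun i => s i] \in (@sortf n m @: [set x | increasing x.1])%SET.
  by rewrite sortf_im finset.in_set; apply/injectiveP => i j; rewrite !ffunE => /sI.
case/imsetP => -[t u]; rewrite finset.in_set /= => Ht E.
have dt : \det (rowsub t A) != 0.
  apply: contra d => /eqP d0; rewrite (_ : rowsub s A = row_perm u (rowsub t A)).
    by rewrite row_permE det_mulmx d0 mulr0.
  by apply/matrixP => i j; rewrite !mxE; move/ffunP/(_ i): E; rewrite !ffunE => ->.
rewrite gt_eqF // /sum_sqr_minors (bigD1 t) //= ltr_pwDl //; last by do 2!apply: sumr_ge0 => ? _; exact: sqr_ge0.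
rewrite (bigD1 [ffun i => i]) /=; last by apply/increasingP => i j; rewrite !ffunE.
rewrite ltr_pwDl //; last by apply: sumr_ge0 => ? _; exact: sqr_ge0.
rewrite (_ : mxsub _ _ A = rowsub t A); last by apply/matrixP => i j; rewrite !mxE ffunE.
by rewrite lt_def sqr_ge0 expf_eq0 /= dt.
Qed.

(** The inverse matrix enlarges the norm at most by the factor [c], while the error of linearisation
    is at most [1 / (c + 1)] times the distance, which is too small to cancel the linear part. *)
Lemma sdm_inj (psi : K^^m -> K^^m) x : sdm psi x -> \det (jac psi x) != 0 ->
  exists2 d : K, 0 < d & forall y, box x d y -> psi y = psi x -> y = x.
Proof.
move=> H d0; set J := jac psi x in d0; have uJ : J \in unitmx by rewrite unitmxE unitfE.
pose c := \sum_l \sum_i `|invmx J l i|; have c0 : 0 <= c by do 2!apply: sumr_ge0 => ? _.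
pose e0 := (c + 1)^-1; have e0p : 0 < e0 by rewrite invr_gt0 ltr_wpDl.
have /choice[d Hd] l : exists d : K, 0 < d /\ forall y z, box x d y -> box x d z ->
    `|psi y 0 l - psi z 0 l - dot (\row_j J j l) (y - z)| <= e0 * l1 (y - z).
  by have /sdiffE/(_ e0 e0p)[d dp Hd] := H l; exists d.
have [d' d'0 dd'] := min_all (fun l => (Hd l).1); exists d' => // y xy E.
set v := y - x; have vJ l : `|(v *m J) 0 l| <= e0 * l1 v.
  have [dl Hl] := Hd l; have := Hl y x (box_le (dd' l) xy) (box_refl _ dl).
  rewrite E subrr sub0r normrN -/v (_ : dot _ _ = (v *m J) 0 l) // mxE /dot.
  by apply: eq_bigr => i _; rewrite !mxE mulrC.
have vE : v = (v *m J) *m invmx J by rewrite mulmxK.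
have : l1 v <= c * (e0 * l1 v).
  rewrite {1}/l1 {1}vE /c exchange_big /= mulr_suml; apply: ler_sum => i _.
  rewrite mxE mulr_suml; apply: le_trans (ler_norm_sum _ _ _) _; apply: ler_sum => l _.
  by rewrite normrM mulrC ler_wpM2l.
have c1 : 0 < c + 1 by rewrite ltr_wpDl.
have w0 := l1_ge0 v; rewrite mulrCA mulrC ler_pdivlMr // mulrDr mulr1 [l1 v * c]mulrC gerDl => w1.
apply/subr0_eq/rowP => i; rewrite [RHS]mxE; apply/eqP; rewrite -normr_le0.
exact: le_trans (le_l1 v i) w1.
Qed.

Section Split.
Variables (p : 'I_m -> 'I_n + 'I_e) (q : 'I_n + 'I_e -> 'I_m).
Hypotheses (pK : cancel p q) (qK : cancel q p).

Definition vq (x : K^^m) : K^^e := \row_c x 0 (q (inr c)).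
Definition phi (x : K^^m) : K^^m := mix p (f x) (vq x).

Definition phi_mx (A : 'M[K]_(m, n)) : 'M[K]_m :=
  \matrix_(i, l) match p l with inl b => A i b | inr c => (i == q (inr c))%:R end.

Lemma Df_phi : Df S P phi.
Proof. by apply: Df_mix => //; apply: Df_rV => c; rewrite /vq; under eq_fun do rewrite mxE; apply: Df_entry; exact: Df_id. Qed.

Lemma jac_phi x : sdm f x -> jac phi x = phi_mx (jac f x) /\ sdm phi x.
Proof.
move=> H; apply: sdmP => l; rewrite /phi; under eq_fun do rewrite mxE.
have -> : \row_j phi_mx (jac f x) j l = match p l with inl b => \row_j jac f x j b | inr c => delta_mx 0 (q (inr c)) end.
  by apply/rowP => j; rewrite !mxE; case: (p l) => b; rewrite !mxE ?eqxx.
case: (p l) => [b|c]; first exact: H.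
by apply: sdiff_local ltr01 _ (sdiff_coord x (q (inr c))) => y _; rewrite /vq mxE.
Qed.

Lemma det_phi_mx (A : 'M[K]_(m, n)) : `|\det (phi_mx A)| = `|\det (rowsub (q \o inl) A)|.
Proof.
rewrite -(det_reindex (phi_mx A) (s := fun i => q (fintype.split i)) _ hm); last first.
  by move=> i j /(can_inj qK)/(congr1 (@fintype.unsplit n e)); rewrite !fintype.splitK.
have -> : mxsub (fun i => q (fintype.split i)) (fun i => q (fintype.split i)) (phi_mx A) =
    block_mx (rowsub (q \o inl) A) 0 (rowsub (q \o inr) A) 1%:M.
  have spl a : fintype.split (lshift e a : 'I_(n + e)) = inl a by rewrite -[lshift e a]/(fintype.unsplit (inl a)) fintype.unsplitK.
  have spr c : fintype.split (rshift n c : 'I_(n + e)) = inr c by rewrite -[rshift n c]/(fintype.unsplit (inr c)) fintype.unsplitK.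
  apply/matrixP => i j; case: (fintype.split_ordP i) => a ->; case: (fintype.split_ordP j) => c ->.
  - by rewrite block_mxEul !mxE spl spl qK.
  - by rewrite block_mxEur !mxE spl spr qK (can_eq qK).
  - by rewrite block_mxEdl !mxE spl spr qK.
  - by rewrite block_mxEdr !mxE !spr qK (can_eq qK).
by rewrite det_lblock det1 mulr1.
Qed.

(** The rows that belong to the remaining coordinates; they form the Jacobian matrix of [a] along
    the fibre over [y] ([slice_jac]). *)
Definition Ja (a : K^^m -> K^^m) z : 'M[K]_(e, m) := rowsub (q \o inr) (jac a z).
Definition hq a z : K := Num.sqrt (sum_sqr_minors e (Ja a z)).

Lemma Df_hq a : Df S P a -> Df S P (hq a).
Proof.
move=> Da; apply: Df_sqrt; apply: Df_sum => s; apply: Df_sum => t; apply: Df_exp; apply: Df_det => i j.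
have -> : (fun z => mxsub s t (Ja a z) i j) = fun z => jac a z (q (inr (s i))) (t j) by apply/funext => z; rewrite !mxE.
exact: Df_jac.
Qed.

Lemma inv_jac a x : gen P x -> Df S P a -> a (phi x) = x ->
  [/\ gen P (phi x), sdm a (phi x), jac phi x = phi_mx (jac f x) & jac a (phi x) *m phi_mx (jac f x) = 1%:M].
Proof.
move=> gx Da ax; have gz : gen P (phi x) by apply: (gen_image Da); rewrite ax.
have sz := sdm_gen cP gz Da; have [Jp sp] := jac_phi (sdm_gen cP gx Df0).
(* That [phi] inverts [a] is a definable property of the generic point [phi x], so it holds near
   this point and can be differentiated. *)
split=> //; pose V z := phi (a z) = z.
have DV : D S P V by apply: D_eqT; [exact: (Df_comp Df_phi)|exact: Df_id].
have Vz : V (phi x) by rewrite /V ax.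
have [d d0 Hd] := near_gen cP gz DV Vz.
have sp' : sdm phi (a (phi x)) by rewrite ax.
have [J1 s1] := jac_comp sz sp'; have [J2 _] := sdm_local d0 Hd s1.
move: J1; rewrite -J2 ax Jp => <-.
have [] // := @sdmP m m id (phi x) 1%:M.
by move=> l; rewrite (_ : \row_j _ = delta_mx 0 l); [exact: sdiff_coord|apply/rowP => j; rewrite !mxE eqxx].
Qed.

Lemma inv_rows a x : jac a (phi x) *m phi_mx (jac f x) = 1%:M ->
  (forall c c', Ja a (phi x) c (q (inr c')) = (c == c')%:R) /\ Ja a (phi x) *m jac f x = 0.
Proof.
move=> H; split=> [c c'|].
  have := congr1 (fun M : 'M[K]_m => M (q (inr c)) (q (inr c'))) H; rewrite !mxE (can_eq qK) => <-.
  rewrite (bigD1 (q (inr c'))) //= !mxE qK eqxx mulr1 big1 ?addr0 // => l ne.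
  by rewrite [X in _ * X]mxE qK (negPf ne) mulr0.
apply/matrixP => c b; have := congr1 (fun M : 'M[K]_m => M (q (inr c)) (q (inl b))) H; rewrite !mxE (can_eq qK) => E.
transitivity ((inr c == inl b :> 'I_n + 'I_e)%:R : K) => //; rewrite -E; apply: eq_bigr => l _.
by rewrite [X in _ = _ * X]mxE qK [X in X * _]mxE.
Qed.

(* At [x] the map [phi] is inverted by [a].  The bound 1 is achieved by choosing
   the largest minor of the Jacobian matrix of [f]. *)
Definition goodp a x := [/\ a (phi x) = x, sdm a (phi x), (forall c l, `|Ja a (phi x) c l| <= 1) &
  jdet n f x = hq a (phi x) * `|\det (jac phi x)|].

Lemma D_goodp a : Df S P a -> D S P (goodp a).
Proof.
move=> Da; have Dp := Df_phi.
have D1 : D S P (fun x => a (phi x) = x) by apply: D_eqT; [exact: (Df_comp Da)|exact: Df_id].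
have D2 : D S P (fun x => sdm a (phi x)) by apply: (D_comp (D_sdm Da)).
have D3 : D S P (fun x => forall c l, `|Ja a (phi x) c l| <= 1).
  apply: D_fin => c; apply: D_fin => l; apply: D_le; last exact: Df_1.
  apply: Df_norm; have -> : (fun x => Ja a (phi x) c l) = fun x => jac a (phi x) (q (inr c)) l by apply/funext => x; rewrite !mxE.
  exact: (Df_comp (Df_jac _ _ Da)).
have D4 : D S P (fun x => jdet n f x = hq a (phi x) * `|\det (jac phi x)|).
  apply: D_eqT; first exact: Df_jdet.
  apply: Df_mul; first exact: (Df_comp (Df_hq Da)).
  by apply: Df_norm; apply: Df_det => i j; exact: Df_jac.
by have := D_and D1 (D_and D2 (D_and D3 D4)); apply: D_ext => x; rewrite /goodp; split=> [[? [? [? ?]]]|[]].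
Qed.

Lemma acl_inv x : (forall i, acl (P <+ (phi x)) (x 0 i)) -> exists2 a, Df S P a & a (phi x) = x.
Proof.
move=> H; have /choice[a Ha] i : exists a : K^^m -> K, Df S P a /\ a (phi x) = x 0 i.
  by have [a Da ax] := acl_func (H i); exists a.
exists (fun z => \row_i a i z); last by apply/rowP => i; rewrite mxE (Ha i).2.
by apply: Df_rV => i; under eq_fun do rewrite mxE; exact: (Ha i).1.
Qed.

End Split.

(** A form of Sard's theorem. As [f x] is generic, [e] coordinates of [x] are generic over it;
    together they form a generic point [phi x], over which [x] is algebraic. Hence [phi] has a local
    inverse with a derivative, and its Jacobian matrix is invertible. *)
Lemma gen_jdet x : gen P x -> gen P (f x) -> jdet n f x != 0.
Proof.
move=> gx gy; set Py := P <+ (f x).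
have sz : size (vals x) = m by exact: size_vals.
have [t [tx It tS]] := basis Py (vals x).
have le : (m <= n + size t)%N.
  rewrite -sz -(size_vals (f x)) -size_cat; apply: (steinitz gx) => y /tS; apply: acl_mono => c.
  by rewrite /Py => -[[|/= cf]|/= ct]; [left|right; rewrite /= mem_cat cf|right; rewrite /= mem_cat ct orbT].
have re : rk Py (vals x) e.
  have et : (e <= size t)%N by rewrite -(leq_add2l n) hm.
  by apply: (rk_le et); exists t.
have [s sI gs] := (rk_coords Py x e).1 re.
have [q' [q'I q's]] := ext_split (b := n) sI (etrans (addnC e n) hm).
pose q (u : 'I_n + 'I_e) := q' (match u with inl a => inr a | inr c => inl c end).
have qI : injective q by move=> [a|a] [c|c] /q'I // [->].
have [p pK qK] := inj_split hm qI.
have vqE : vq q x = colsub s x by apply/rowP => c; rewrite !mxE /q q's.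
have gz : gen P (phi p q x) by apply/(gen_mix pK qK); rewrite vqE.
have Ax i : acl (P <+ (phi p q x)) (x 0 i).
  (* Otherwise [m + 1] independent elements would be algebraic over the [m] coordinates of [x]. *)
  apply: contrapT => N; have I : ind P (vals (phi p q x) ++ [:: x 0 i]) by apply/ind_cat; split=> //=.
  have : (size (vals (phi p q x) ++ [:: x (0%R : 'I_1) i]) <= size (vals x))%N.
    apply: (steinitz I) => y; rewrite mem_cat inE => /orP[/valsP[l ->]|/eqP ->]; last by apply: acl_mem; right; exact: mem_vals.
    by apply: (acl_app (f := fun x => phi p q x 0 l)); apply: Df_entry; exact: Df_phi.
  by rewrite size_cat !size_vals addn1 ltnn.
have [a Da ax] := acl_inv Ax; have [_ _ _ J1] := inv_jac gx Da ax.
rewrite sqrtr_eq0 -ltNge lt_def ssm_ge0 andbT.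
apply: (@minor_ssm _ (q \o inl)); first by move=> i j E; have : inl i = inl j :> 'I_n + 'I_e by [exact: qI]; case.
rewrite -normr_eq0 -(det_phi_mx qK) normr_eq0; apply/eqP => d0.
by have := congr1 determinant J1; rewrite det_mulmx d0 mulr0 det1 => /esym/eqP; rewrite oner_eq0.
Qed.

Lemma goodp_ex x : gen P x -> jdet n f x != 0 -> exists p q a,
  [/\ cancel p q, cancel q p, Df S P a, gen P (phi p q x) & goodp p q a x].
Proof.
move=> gx; rewrite sqrtr_eq0 -ltNge lt_def => /andP[/ssm_minor[s sI ds] _].
have [q1 [q1I q1s]] := ext_split (b := e) sI hm.
pose T := {ffun 'I_n + 'I_e -> 'I_m}; pose A (q : 'I_n + 'I_e -> 'I_m) := rowsub (q \o inl) (jac f x).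
pose q0 : T := [ffun u => q1 u].
have q0I : injectiveb q0 by apply/injectiveP => u v; rewrite !ffunE => /q1I.
have d0 : `|\det (A q0)| > 0.
  rewrite normr_gt0 (_ : A q0 = rowsub s (jac f x)) //.
  by apply/matrixP => i j; rewrite !mxE /= ffunE q1s.
pose q : T := [arg max_(q > q0 | injectiveb q) `|\det (A q)|]%O.
have [/injectiveP qI qmax] : injectiveb q /\ forall q' : T, injectiveb q' -> `|\det (A q')| <= `|\det (A q)|.
  by rewrite /q; case: arg_maxP => // i iI imax; split=> // j; exact: imax.
have dq : `|\det (A q)| > 0 by exact: lt_le_trans d0 (qmax q0 q0I).
have [p pK qK] := inj_split hm qI.
have sf := sdm_gen cP gx Df0; have [Jp sp] := jac_phi p q sf.
have dJ : \det (jac (phi p q) x) != 0 by rewrite Jp -normr_gt0 (det_phi_mx qK).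
have Dp := Df_phi p q.
have Ax i : acl (P <+ (phi p q x)) (x 0 i).
  apply: (acl_isolated (X := fun y => phi p q y = phi p q x)) => //; first by ctb.
    by apply: (@D_inst_vec P _ (phi p q x) _ _ (fun u : K^^m * K^^m => phi p q u.1 = u.2)); ddef.
  exact: sdm_inj.
have [a Da ax] := acl_inv Ax; have [gz sz _ J1] := inv_jac gx Da ax.
have [K1 K0] := inv_rows qK J1.
exists p, q, a; split=> //; split=> //.
  move=> c l; rewrite -(pK l); case: (p l) => [b|c']; last by rewrite K1; case: (_ == _); rewrite ?normr1 ?normr0.
  (* The choice [q] is compared with the one in which the chosen coordinate [b] and the remaining
     coordinate [c] are exchanged. *)
  pose sw (u : 'I_n + 'I_e) : 'I_n + 'I_e :=
    match u with inl b' => if b' == b then inr c else inl b' | inr c' => if c' == c then inl b else inr c' end.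
  have swK : involutive sw by move=> [b'|c'] /=; case: eqP => [->|N] /=; rewrite //; case: eqP.
  pose q' : T := [ffun u => q (sw u)].
  have q'I : injectiveb q' by apply/injectiveP => u v; rewrite !ffunE => /qI/(inv_inj swK).
  have := qmax q' q'I; have -> : A q' = rowsub (fun b' => q (if b' == b then inr c else inl b')) (jac f x).
    by apply/matrixP => i j; rewrite !mxE /= ffunE.
  by rewrite (swap_minor pK qK K1 K0 c b) ger_pMl.
by rewrite Jp (det_phi_mx qK) /hq (complementary_minors pK qK K1 K0).
Qed.

Variables (A : set K^^m) (DA : D S P A) (Ac : A `<=` unit_cube K m).

(** * Hausdorff measure of the fibres *)

Section Theta.
Variables (N : nat) (p : 'I_N -> 'I_m -> 'I_n + 'I_e) (q : 'I_N -> 'I_n + 'I_e -> 'I_m) (a : 'I_N -> K^^m -> K^^m).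
Variables (X : 'I_N -> set K^^m).
Hypotheses (pK : forall j, cancel (p j) (q j)) (qK : forall j, cancel (q j) (p j)) (Da : forall j, Df S P (a j))
  (DX : forall j, D S P (X j)) (XA : forall j, X j `<=` A) (Xg : forall j x, X j x -> goodp (p j) (q j) (a j) x)
  (Xd : forall i j x, X i x -> X j x -> i = j).

(* [Wj j y] consists of the remaining coordinates of the points of [X j] over [y]. *)
Definition Ej j := Hypo [set phi (p j) (q j) x | x in X j] (hq (q j) (a j)).
Definition Wj j y := fib (p j) [set phi (p j) (q j) x | x in X j] y.
Definition fibre y := A `&` f @^-1` [set y].
Definition cover y := dim_lt (fibre y `\` [set x | exists j, X j x]) e.

Lemma unit_bdd k (Z : set K^^k) : Z `<=` unit_cube K k -> bdd 2 Z.
Proof. by move=> Zc x /Zc H i; have /andP[-> h] := H i; rewrite (le_lt_trans h) // ltr1n. Qed.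

Lemma fib_Ej j y : fib (up (p j)) (Ej j) y = Hypo (Wj j y) (fun v => hq (q j) (a j) (mix (p j) y v)).
Proof. exact: fib_Hypo. Qed.

Lemma WjP j y v : Wj j y v <-> exists2 x, X j x & f x = y /\ vq (q j) x = v.
Proof.
split=> [[x Xx]|[x Xx [fx vx]]]; last by exists x => //; rewrite /phi fx vx.
rewrite /phi => E; exists x => //; split.
  by apply/rowP => i; have := congr1 (fun z : K^^m => z 0 (q j (inl i))) E; rewrite !(mixl (qK j)).
by apply/rowP => i; have := congr1 (fun z : K^^m => z 0 (q j (inr i))) E; rewrite !(mixr (qK j)).
Qed.

Lemma slice_jac j y v : sdm (a j) (mix (p j) y v) ->
  jac (fun v => a j (mix (p j) y v)) v = Ja (q j) (a j) (mix (p j) y v) /\ sdm (fun v => a j (mix (p j) y v)) v.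
Proof.
move=> H; apply: sdmP => l; have := sdiff_mix (pK j) (qK j) (H l); congr sdiff.
by apply/rowP => c; rewrite !mxE.
Qed.

Lemma Wj_good j y v : Wj j y v -> exists2 x, X j x & [/\ f x = y, vq (q j) x = v, a j (mix (p j) y v) = x,
  sdm (fun v => a j (mix (p j) y v)) v & forall c l, `|jac (fun v => a j (mix (p j) y v)) v c l| <= 1].
Proof.
move=> /WjP[x Xx [fx vx]]; exists x => //; have [ax sx Jx _] := Xg Xx.
have zE : phi (p j) (q j) x = mix (p j) y v by rewrite /phi fx vx.
rewrite zE in ax sx Jx; have [JE sE] := slice_jac sx; split=> // c l.
by rewrite JE.
Qed.

Let D_phi j : Df S P (phi (p j) (q j)). Proof. exact: Df_phi. Qed.
Let D_hqj j : Df S P (hq (q j) (a j)). Proof. exact: Df_hq. Qed.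
Lemma D_img_phi j : D S P [set phi (p j) (q j) x | x in X j].
Proof. exact: D_img. Qed.

Lemma D_Wj j y : D S (P <+ y) (Wj j y).
Proof. by apply: D_fib; exact: D_img_phi. Qed.

Lemma bdd_Wj j y : bdd 2 (Wj j y).
Proof.
move=> v /WjP[x Xx [_ <-]] i; rewrite mxE; apply: (unit_bdd Ac).
exact: XA Xx.
Qed.

Lemma fibre_D P' (y : K^^n) : P `<=` P' -> (forall i, P' (y 0 i)) -> D S P' (fibre y).
Proof.
move=> PP' Py; apply: D_and; first exact: D_mono DA.
apply: D_eqT; first exact: Df_mono Df0.
by apply: Df_rV => i; exact: Df_cst.
Qed.

(** The domains of the charts of the partition and the sets [Wj] parametrise the same fibre up to
    points of rank below [e]. Both are cut along the common refinement, and on each common piece the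
    two parametrisations differ by the coordinate change [psi]. *)
Lemma Theta_eq y N' (Pp : 'I_N'.+1 -> set K^^m) : rectifiable_partition S e (fibre y) Pp -> cover y ->
  (\sum_(i < N') hausdorff_basic R S e (Pp (lift ord0 i)) = (\sum_j vl (fib (up (p j)) (Ej j) y))%:E)%E.
Proof.
move=> [Pcov Ptriv Pdef P0 Prect] cov.
have PpA i : Pp i `<=` fibre y by move=> x Px; rewrite -Pcov; exists i.
have /choice[ch Hch] : forall i : 'I_N', exists t : set K * (K^^e -> K^^m) * ('I_e -> 'I_m) * set K^^e * set K^^e * nat,
  chart_data (Pp (lift ord0 i)) 2 t.1.1.1.1.1 t.1.1.1.1.2 t.1.1.1.2 t.1.1.2 t.1.2 t.2.
  move=> i; have b2 : bdd 2 (Pp (lift ord0 i)) by apply: unit_bdd => x /PpA[/Ac].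
  by have [Pi [G [w [U [U1 [c H]]]]]] := hb_chart (Prect i) b2; exists (Pi, G, w, U, U1, c).
pose Pi i := (ch i).1.1.1.1.1; pose G i := (ch i).1.1.1.1.2; pose w i := (ch i).1.1.1.2.
pose U i := (ch i).1.1.2; pose U1 i := (ch i).1.2; pose c i := (ch i).2.
have {}Hch i : chart_data (Pp (lift ord0 i)) 2 (Pi i) (G i) (w i) (U i) (U1 i) (c i) by exact: Hch.
have [P0' cP0 DP0] := definable_D (Pdef ord0).
(* Genericity is now meant over everything involved: [y], the charts and the small part of the
   partition. *)
pose P' := P <+ y `|` P0' `|` \bigcup_(i in setT) Pi i.
have cP' : countable P'.
  apply: countable_setU; first by apply: countable_setU => //; ctb.
  by apply: bigcup_countable => [|i _]; [exact: countableP|have [[]] := Hch i].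
have sP : P `<=` P' by move=> t; left; left; left.
have sy i : P' (y 0 i) by left; left; right; exact: mem_vals.
have sPy : P <+ y `<=` P' by move=> t; left; left.
have sPi i : Pi i `<=` P' by move=> t Pt; right; exists i.
have DAy : D S P' (fibre y) by exact: fibre_D.
have DU1 i : D S P' (U1 i) by have [[_ H _ _ _] _] := Hch i; exact: D_mono (@sPi i) H.
have DG i : Df S P' (G i) by have [[_ _ H _ _] _] := Hch i; exact: Df_mono (@sPi i) H.
have U1U i : U1 i `<=` U i by have [_ []] := Hch i.
have GC i u : U i u -> Pp (lift ord0 i) (G i u) by have [[_ _ _ -> _] _] := Hch i; exists u.
have Gy i u : U1 i u -> fibre y (G i u) by move=> /U1U/GC/PpA.
have wG i u : U i u -> colsub (w i) (G i u) = u by have [_ [_ _ H _ _]] := Hch i; exact: H.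
have gU i u : U i u -> gen P' u -> U1 i u.
  by move=> Uu gu; have [_ [_ H _ _ _]] := Hch i; apply: H => //; exact: ind_mono (@sPi i) gu.
have rkG i u : U i u -> gen P' u -> rk P' (vals (G i u)) e.
  by move=> Uu gu; apply: rk_sub (gen_rk gu) => _ /valsP[l ->]; rewrite -{1}(wG i u Uu) mxE; exact: mem_vals.
pose hh j v := hq (q j) (a j) (mix (p j) y v); pose psi i j u := vq (q j) (G i u).
pose ay j v := a j (mix (p j) y v).
have Dmix j : Df S P' (fun v => mix (p j) y v).
  by apply: Df_mix; [apply: Df_rV => l; exact: Df_cst|exact: Df_id].
have Dhh j : Df S P' (hh j) by apply: (Df_comp (Df_mono sP (D_hqj j))); exact: Dmix.
have Dpsi i j : Df S P' (psi i j).
  by apply: Df_rV => l; rewrite /psi /vq; under eq_fun do rewrite mxE; exact: Df_entry.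
have Gpsi i j u : U1 i u -> X j (G i u) -> Wj j y (psi i j u) /\ ay j (psi i j u) = G i u.
  move=> Uu Xu; have [_ fy] := Gy i u Uu; have Wu : Wj j y (psi i j u) by apply/WjP; exists (G i u).
  split=> //; have [ax _ _ _] := Xg Xu; rewrite -[RHS]ax /ay /phi fy.
  by [].
(* By the chain rule for the chart [G i], which is the parametrisation by [Wj j y] after [psi i j].
   It is available at generic points and is imposed on the pieces [Uij]. *)
pose eqn i j u := jdet e (G i) u = hh j (psi i j u) * `|\det (jac (psi i j) u)|.
have eqn_gen i j u : U1 i u -> X j (G i u) -> gen P' u -> eqn i j u.
  move=> Uu Xu gu; have [Wu _] := Gpsi i j u Uu Xu.
  have DQ : D S P' (fun u => U1 i u /\ X j (G i u)).
    by apply: D_and => //; apply: (D_comp (D_mono sP (DX j))).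
  have [d d0 Hd] := near_gen cP' gu DQ (conj Uu Xu).
  have [x Xx [_ _ _ sv _]] := Wj_good Wu; have sp := sdm_gen cP' gu (Dpsi i j).
  have [J1 s1] := jac_comp sp sv.
  have [J2 _] := sdm_local (phi := G i) d0 (fun u' Hu' => (Gpsi i j u' (Hd u' Hu').1 (Hd u' Hu').2).2) s1.
  rewrite /eqn /jdet J2 J1 ssm_mul; congr (_ * _); congr (Num.sqrt (sum_sqr_minors _ _)).
  have [x' Xx' [fx' vx' ax' _ _]] := Wj_good Wu.
  have [_ sx' _ _] := Xg Xx'; rewrite /phi fx' vx' in sx'.
  exact: (slice_jac sx').1.
pose Uij i j := [set u | U1 i u /\ (X j (G i u) /\ eqn i j u)].
have DUij i j : D S P' (Uij i j).
  apply: D_and => //; apply: D_and; first exact: (D_comp (D_mono sP (DX j))).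
  apply: D_eqT; first exact: Df_jdet.
  apply: Df_mul; first exact: (Df_comp (Dhh j)).
  by apply: Df_norm; apply: Df_det => k l; exact: Df_jac.
have [B0 HB0] := @ssm_bound e m e 1; pose cmax := \max_i c i.
have [B1 HB1] := @ssm_bound e m e cmax.
pose B := maxn 2 (maxn B0 B1).
have B0B : (B0 <= B)%N by rewrite !leq_max leqnn orbT.
have B1B : (B1 <= B)%N by rewrite !leq_max leqnn !orbT.
have B2B : (2 <= B)%N by rewrite leq_max leqnn.
have hhB j v : Wj j y v -> 0 <= hh j v <= B%:R.
  move=> Wv; rewrite /hh /hq sqrtr_ge0 /=; have [x Xx [fx vx ax _ Hv]] := Wj_good Wv.
  have [_ sx Jx _] := Xg Xx; rewrite /phi fx vx in Jx.
  by apply: le_trans (HB0 _ Jx) _; rewrite ler_nat.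
have jGB i u : U1 i u -> 0 <= jdet e (G i) u <= B%:R.
  move=> Uu; rewrite sqrtr_ge0 /=; have [_ [_ _ _ H _]] := Hch i; have [_ Hc] := H u Uu.
  apply: le_trans (HB1 _ _) _; last by rewrite ler_nat.
  by move=> k l; apply: le_trans (Hc k l) _; rewrite ler_nat; exact: leq_bigmax.
have bU i : bdd B (U i) by have [[_ _ _ _ H] _] := Hch i; exact: bdd_le B2B H.
have bU1 i : bdd B (U1 i) by apply: bdd_sub (bU i); exact: U1U.
have bW j : bdd B (Wj j y) by apply: bdd_le B2B _; exact: bdd_Wj.
(* Generic parameters give points of rank [e] in the fibre, and these lie in some [X j] by
   [cover]. *)
have step1 i : vl (Hypo (U1 i) (jdet e (G i))) = \sum_j vl (Hypo (Uij i j) (jdet e (G i))).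
  apply: (vl_partition cP' _ (D_Hypo (DU1 i) (Df_jdet e (DG i))) (b := B)).
  - by move=> j; apply: D_Hypo => //; exact: Df_jdet.
  - by apply: bdd_Hypo (bU1 i) _ => u /jGB/andP[].
  - by move=> j z [[Uz _] hz].
  - by move=> j j' z [[_ [Xz _]] _] [[_ [Xz' _]] _]; exact: Xd Xz Xz'.
  move=> z [Uz hz] /(gen_col' P' ord0)[gz _]; set u := col' ord0 z in Uz hz gz *.
  suff [j Xj] : exists j, X j (G i u) by exists j; split=> //; split=> //; split=> //; exact: eqn_gen.
  apply: contrapT => NX; apply: (cov e (leqnn e)).
  apply/(dim_geP e cP' (A := fibre y `\` [set x | exists j, X j x])).
    apply: D_and => //; apply: D_not; apply: D_finex => j; exact: D_mono sP (DX j).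
  by exists (G i u); [split=> //; exact: Gy|apply: rkG => //; exact: U1U].
have step2 i j : vl (Hypo (Uij i j) (jdet e (G i))) = vl (Hypo [set psi i j u | u in Uij i j] (hh j)).
  rewrite (CV (C := c i) (b := B) cP' (DUij i j) (Dpsi i j) (Dhh j)).
  - by congr vl; apply: Hypo_ext => u [_ []].
  - by apply: bdd_sub (bU1 i) => u [].
  - by apply: bdd_sub (bW j) => _ [u [Uu [Xu _]] <-]; have [] := Gpsi i j u Uu Xu.
  - move=> u u' [Uu [Xu _]] [Uu' [Xu' _]] E; have [_ e1] := Gpsi i j u Uu Xu; have [_ e2] := Gpsi i j u' Uu' Xu'.
    by rewrite -(wG i u (U1U _ _ Uu)) -(wG i u' (U1U _ _ Uu')) -e1 -e2 E.
  - by move=> u [Uu [Xu _]]; apply: hhB; have [] := Gpsi i j u Uu Xu.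
  - move=> u [Uu _] k l; have [_ [_ _ _ H _]] := Hch i; have [_ Hc] := H u Uu.
    rewrite mxE (_ : (fun u => psi i j u 0 l) = fun u => G i u 0 (q j (inr l))); last by apply/funext => u'; rewrite mxE.
    by have := Hc k (q j (inr l)); rewrite mxE.
(* A generic parameter gives a point of rank [e], which cannot lie in the part of dimension less
   than [e], hence lies in one of the charts. *)
have step3 j : vl (Hypo (Wj j y) (hh j)) = \sum_i vl (Hypo [set psi i j u | u in Uij i j] (hh j)).
  apply: (vl_partition cP' _ (D_Hypo (D_mono sPy (D_Wj j y)) (Dhh j)) (b := B)).
  - by move=> i; apply: D_Hypo => //; exact: D_img.
  - by apply: bdd_Hypo (bW j) _ => v /hhB/andP[].
  - by move=> i z [[u [Uu [Xu _]] uz] hz]; split=> //; rewrite -uz; have [] := Gpsi i j u Uu Xu.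
  - move=> i i' z [[u [Uu [Xu _]] uz] _] [[u' [Uu' [Xu' _]] uz'] _].
    have [_ e1] := Gpsi i j u Uu Xu; have [_ e2] := Gpsi i' j u' Uu' Xu'.
    have E : G i u = G i' u' by rewrite -e1 -e2 uz uz'.
    have Pn : (Pp (lift ord0 i) `&` Pp (lift ord0 i')) !=set0.
      by exists (G i u); split; [|rewrite E]; apply: GC; exact: U1U.
    by have /(@lift_inj _ ord0) := Ptriv _ _ I I Pn.
  move=> z [Wz hz] /(gen_col' P' ord0)[gz _]; set v := col' ord0 z in Wz hz gz *.
  have /WjP[x Xx [fx vx]] := Wz.
  have rkx : rk P' (vals x) e.
    apply: rk_sub (gen_rk gz) => _ /valsP[l ->]; rewrite -vx mxE; exact: mem_vals.
  have : (\bigcup_i Pp i) x by rewrite Pcov; split=> //; exact: XA Xx.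
  move=> [i0 _]; case: (unliftP ord0 i0) => [i ->|->] Px; last first.
    case: (P0 e (leqnn e)); apply/(dim_geP e cP'); last by exists x.
    by apply: D_mono DP0 => t Pt; left; right.
  have [[_ _ _ CE _] _] := Hch i; move: Px; rewrite CE => -[u Uu uE].
  have gu : gen P' u by apply: (rk_gen); apply: (rk_image (g := G i)) => //; rewrite uE.
  have U1u := gU i u Uu gu; exists i; split=> //; exists u; last by rewrite /psi uE.
  by split=> //; split; [rewrite uE|apply: eqn_gen => //; rewrite uE].
have -> : (\sum_(i < N') hausdorff_basic R S e (Pp (lift ord0 i)) = \sum_(i < N') (vl (Hypo (U1 i) (jdet e (G i))))%:E)%E.
  by apply: eq_bigr => i _; have [_ [_ _ _ _]] := Hch i.
rewrite sumEFin; congr EFin.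
under eq_bigr do rewrite step1; rewrite exchange_big /=; apply: eq_bigr => j _.
by rewrite fib_Ej step3; apply: eq_bigr => i _; rewrite step2.
Qed.

Definition ay j y (v : K^^e) := a j (mix (p j) y v).

Lemma Df_ay P' j y : P <+ y `<=` P' -> Df S P' (ay j y).
Proof.
move=> sP; apply: (Df_comp (Df_mono _ (Da j))); first by move=> t Pt; apply: sP; left.
by apply: Df_mix; [apply: Df_rV => l; apply: Df_cst; apply: sP; right; exact: mem_vals|exact: Df_id].
Qed.

Lemma chart_rect j y P' (M0 : nat) (C : set K^^e) : P <+ y `<=` P' -> PC P' M0%:R C -> C `<=` Wj j y ->
  basic_rectifiable S e [set ay j y v | v in C].
Proof.
(* A common bound for the cell, whose functions have entries up to [M0], and for the chart, whose
   derivatives have entries up to 1. *)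
move=> sP PCC CW; pose M := (n.+1 * e.+1 * M0.+1)%:R : K.
have M1 : (e * M0)%:R <= M by rewrite ler_nat; lia.
have M2 : (n * e * 1)%:R <= M by rewrite ler_nat; lia.
have [s Ms] := PC_Mcell M1 PCC; set U := [set cperm s v | v in C] in Ms.
have UC u : U u -> C (cperm s^-1 u) by move=> [v Cv <-]; rewrite cpermK.
pose g v : K^^n := \row_b ay j y v 0 (q j (inl b)); pose F u := g (cperm s^-1 u).
have E : (e + n)%N = m by rewrite addnC.
pose sg (i : 'I_m) := q j (match fintype.split (cast_ord (esym E) i) with inl c => inr (s c) | inr b => inl b end).
have sgI : injective sg.
  move=> i i' /(can_inj (qK j)); case: fintype.split_ordP => u Eu; case: fintype.split_ordP => u' Eu' // [].
    by move/perm_inj => uu; apply: (cast_ord_inj (eq_n := esym E)); rewrite Eu Eu' uu.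
  by move=> uu; apply: (cast_ord_inj (eq_n := esym E)); rewrite Eu Eu' uu.
have ayE v : C v -> col_perm (perm sgI) (ay j y v) = castmx (erefl, E) (row_mx (cperm s v) (F (cperm s v))).
  move=> /CW/Wj_good[x Xx [_ vx ax _ _]]; apply/rowP => i; rewrite castmxE mxE permE /= ord1 /sg.
  case: fintype.split_ordP => u ->; rewrite ?row_mxEl ?row_mxEr mxE.
    by rewrite /ay ax -vx mxE.
  by rewrite cpermK.
have DC := PC_D PCC.
exists M, n, E, (perm sgI), U, F; split.
- by split; [rewrite ltr0n|exists (n.+1 * e.+1 * M0.+1)%N; rewrite ger0_norm].
- exact: Ms.
- move=> u /UC Cu; have [d d0 Hd] := PC_open PCC Cu; exists d => // u' uu.
  exists (cperm s^-1 u'); last exact: cpermKV.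
  by apply: Hd => i; rewrite !mxE; have := le_lt_trans (le_enorm (u' - u) ((s^-1)%g i)) uu; rewrite !mxE.
- apply: (sdm_M_function (P := P') (N := 1)) => //; first by apply: D_img => //; exact: Df_cperm.
    apply: (Df_comp (g := cperm s^-1)); last exact: Df_cperm.
    by apply: Df_rV => b; rewrite /g; under eq_fun do rewrite mxE; apply: Df_entry; exact: Df_ay.
  move=> u /UC/CW/Wj_good[x Xx [_ _ _ sa ba]].
  have [|Jg sg'] := @sdmP e n g (cperm s^-1 u) (\matrix_(c, b) jac (ay j y) (cperm s^-1 u) c (q j (inl b))).
    move=> b; rewrite /g; under eq_fun do rewrite mxE; have := sa (q j (inl b)); congr sdiff.
    by apply/rowP => c; rewrite !mxE.
  by apply: sdm_cperm => // c b; rewrite Jg mxE; exact: ba.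
apply/seteqP; split=> z.
  move=> [_ [v Cv <-] <-]; exists (row_mx (cperm s v) (F (cperm s v))); last by rewrite ayE.
  by exists (cperm s v) => //; exists v.
move=> [_ [u /UC Cu <-] <-]; exists (ay j y (cperm s^-1 u)); first by exists (cperm s^-1 u).
by rewrite ayE // cpermKV.
Qed.

Definition pieces y (J : finType) (ji : J -> 'I_N) (C : J -> set K^^e) := [set x | exists l, exists2 v, C l v & ay (ji l) y v = x].

(** Sufficient for a rectifiable partition of the fibre. It is stated by means of cells, so that it
    can spread from a generic [y] to a definable set of points ([split_gen]). *)
Definition split_fibre y := exists (M0 : nat) (J : finType) (ji : J -> 'I_N) (C : J -> set K^^e),
  [/\ forall l, PC (P <+ y) M0%:R (C l), forall l, C l `<=` Wj (ji l) y,
     forall l l' v, ji l = ji l' -> C l v -> C l' v -> l = l' & ~ dim_ge (fibre y `\` pieces y ji C) e].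

Lemma piece_X y (J : finType) (ji : J -> 'I_N) (C : J -> set K^^e) l v : C l `<=` Wj (ji l) y -> C l v ->
  [/\ fibre y (ay (ji l) y v), X (ji l) (ay (ji l) y v) & vq (q (ji l)) (ay (ji l) y v) = v].
Proof. by move=> CW /CW/Wj_good[x Xx [fx vx ax _ _]]; rewrite /ay ax; split=> //; split=> //; exact: XA Xx. Qed.

Lemma D_pieces y (J : finType) (ji : J -> 'I_N) (C : J -> set K^^e) P' : P <+ y `<=` P' -> (forall l, D S P' (C l)) ->
  D S P' (fibre y `\` pieces y ji C).
Proof.
move=> sP DC; apply: D_and; first by apply: fibre_D => [t Pt|i]; apply: sP; [left|right; exact: mem_vals].
by apply: D_not; apply: D_finex => l; apply: D_img => //; exact: Df_ay.
Qed.

Lemma rect_ex y : split_fibre y -> exists N' (Pp : 'I_N'.+1 -> set K^^m), rectifiable_partition S e (fibre y) Pp.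
Proof.
move=> [M0 [J [ji [C [PCC CW Cd dim]]]]]; have cPy : countable (P <+ y) by ctb.
have DC l : D S (P <+ y) (C l) := PC_D (PCC l).
have DR := @D_pieces y J ji C _ (fun t => id) DC.
pose Q (l : J) := [set ay (ji l) y v | v in C l].
pose Pp (i : 'I_#|J|.+1) := if unlift ord0 i is Some l then Q (enum_val l) else fibre y `\` pieces y ji C.
have Pl l : Pp (lift ord0 l) = Q (enum_val l) by rewrite /Pp liftK.
have P0 : Pp ord0 = fibre y `\` pieces y ji C by rewrite /Pp unlift_none.
have Qp l x : Q l x -> pieces y ji C x by move=> Qx; exists l.
exists #|J|, Pp; split.
- apply/seteqP; split=> x.
    move=> [i _]; case: (unliftP ord0 i) => [l ->|->]; rewrite ?P0 ?Pl; last by case.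
    by move=> [v Cv <-]; have [] := piece_X (CW _) Cv.
  move=> Fx; have [[l Ql]|Nx] := pselect (pieces y ji C x); last by exists ord0 => //; rewrite P0.
  by exists (lift ord0 (enum_rank l)) => //; rewrite Pl enum_rankK.
- move=> i i' _ _ [x []]; case: (unliftP ord0 i) => [l ->|->]; case: (unliftP ord0 i') => [l' ->|->]; rewrite ?P0 ?Pl //.
  + move=> [v Cv vx] [v' Cv' vx']; have [_ X1 v1] := piece_X (CW _) Cv; have [_ X2 v2] := piece_X (CW _) Cv'.
    rewrite vx in X1 v1; rewrite vx' in X2 v2; have jj := Xd X1 X2.
    by rewrite (enum_val_inj (Cd _ _ v jj Cv _)) // -v1 jj v2.
  + by move=> Qx [_ []]; exact: Qp Qx.
  + by move=> [_ Nx] /Qp.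
- move=> i; apply: (D_def (P := P <+ y)); case: (unliftP ord0 i) => [l ->|->]; rewrite ?P0 ?Pl //.
  by apply: D_img => //; exact: Df_ay.
- rewrite P0 => d ed /(dim_geP d cPy DR)[x Rx rx]; apply: dim.
  by apply/(dim_geP e cPy DR); exists x => //; exact: rk_le ed rx.
by move=> l; rewrite Pl; apply: chart_rect (PCC _) (CW _).
Qed.

(** The existence of one partition excludes the default value, and [Theta_eq] applies to the
    partition that is picked. *)
Lemma hausdorff_fibre y : split_fibre y -> hausdorff R S e (fibre y) = (\sum_j vl (fib (up (p j)) (Ej j) y))%:E.
Proof.
move=> sy; have [N' [Pp HP]] := rect_ex sy; rewrite /hausdorff; case: xgetP => [v _ /=|/(_ (\sum_(i < N') hausdorff_basic R S e (Pp (lift ord0 i)))%E)H]; last first.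
  by case: H; exists N', Pp.
move=> [N1 [P1 [HP1 ->]]]; apply: Theta_eq HP1 _.
have [M0 [J [ji [C [PCC CW Cd dim]]]]] := sy; have cPy : countable (P <+ y) by ctb.
have DC l : D S (P <+ y) (C l) := PC_D (PCC l).
have DR := @D_pieces y J ji C _ (fun t => id) DC.
have DX' : D S (P <+ y) (fibre y `\` [set x | exists j, X j x]).
  apply: D_and; first by apply: fibre_D => [t|i]; [left|right; exact: mem_vals].
  by apply: D_not; apply: D_finex => j; apply: D_mono (DX j) => t; left.
move=> d ed /(dim_geP d cPy DX')[x [Fx Nx] rx]; apply: dim.
apply/(dim_geP e cPy DR); exists x; last exact: rk_le ed rx.
split=> // -[l [v0 Cv vx]]; apply: Nx; have [_ Xx _] := piece_X (CW _) Cv.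
by exists (ji l); rewrite -vx.
Qed.

Lemma dim_fibre y : split_fibre y -> dim_le (fibre y) e.
Proof.
move=> [M0 [J [ji [C [PCC CW Cd dim]]]]] d ed; have cPy : countable (P <+ y) by ctb.
have DC l : D S (P <+ y) (C l) := PC_D (PCC l).
have DR := @D_pieces y J ji C _ (fun t => id) DC.
have DF : D S (P <+ y) (fibre y) by apply: fibre_D => [t|i]; [left|right; exact: mem_vals].
move=> /(dim_geP d cPy DF)[x Fx rx]; apply: dim.
apply/(dim_geP e cPy DR); exists x; last exact: rk_le (ltnW ed) rx.
split=> // -[l [v Cv vx]].
have := rk_image (g := ay (ji l) y) (x := v) (Df_ay _ (fun t => id)); rewrite vx => /(_ _ (rk_le ed rx))/rk_size.
by rewrite size_vals ltnn.
Qed.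

Hypothesis Xcov : forall x, A x -> gen P x -> jdet n f x != 0 -> exists j, X j x.

(** A point of rank [e] over a generic [y] has rank [n + e = m] over [P], so it is generic. By
    [gen_jdet] it has nonzero Jacobian and lies in a piece. *)
Lemma fibre_piece y x : gen P y -> fibre y x -> rk (P <+ y) (vals x) e ->
  exists j, [/\ Wj j y (vq (q j) x), ay j y (vq (q j) x) = x & gen (P <+ y) (vq (q j) x)].
Proof.
move=> gy [Ax fx] rx; have gx : gen P x.
  apply: (rk_gen); have := rk_cat gy rx; rewrite size_vals hm.
  apply: (rk_acl) => t; rewrite mem_cat => /orP[/valsP[i ->]|tx]; last by apply: acl_mem; right.
  by rewrite -fx; apply: (acl_app (f := fun x => f x 0 i)); ddef.
have [j Xx] : exists j, X j x.
  by apply: Xcov => //; apply: (gen_jdet) => //; rewrite [f x]fx.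
have [ax _ _ _] := Xg Xx; rewrite /phi [f x]fx in ax.
exists j; split=> //; first by apply/(WjP); exists x.
by apply: (rk_gen); apply: (rk_image (Df_ay j (fun t => id))); rewrite /ay ax.
Qed.

(** The sets [Wj] over the generic [y] are decomposed with [y] as parameter, and [PC_family] turns
    the cells into families. That the families still split the fibre, including the dimension of the
    rest, is a definable condition on [y']. *)
Lemma split_gen y : gen P y -> exists Q : K^^n -> Prop, [/\ D S P Q, Q y & forall y', Q y' -> split_fibre y'].
Proof.
move=> gy; have [M0 HL] := LD_ex e; have cPy : countable (P <+ y) by ctb.
have Wc j : Wj j y `<=` unit_cube K e.
  move=> v /(WjP)[x Xx [_ <-]] c; rewrite mxE; exact: Ac (XA Xx) _.
have /choice[IC HIC] j : exists IC : {I : finType & I -> set K^^e}, [/\ forall i, PC (P <+ y) M0%:R (projT2 IC i),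
    forall i, projT2 IC i `<=` Wj j y, forall i i' v, projT2 IC i v -> projT2 IC i' v -> i = i' &
    forall v, Wj j y v -> gen (P <+ y) v -> exists i, projT2 IC i v].
  have [I [C H]] := HL _ _ cPy (D_Wj j y) (@Wc j); by exists (existT _ I C).
pose J : finType := {j : 'I_N & projT1 (IC j)}; pose ji (l : J) := tag l; pose C (l : J) := projT2 (IC (tag l)) (tagged l).
have PCC l : PC (P <+ y) M0%:R (C l) by have [H _ _ _] := HIC (tag l); exact: (H (tagged l)).
have CW l : C l `<=` Wj (ji l) y by have [_ H _ _] := HIC (tag l); exact: (H (tagged l)).
have Cd l l' v : ji l = ji l' -> C l v -> C l' v -> l = l'.
  case: l l' => j i [j' i']; rewrite /C /= => E; case: _ / E i' => i' Ci Ci'.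
  by have [_ _ H _] := HIC j; rewrite (H _ _ _ Ci Ci').
have /choice[EY HEY] l : exists EY : (K^^e * K^^n -> Prop) * (K^^n -> Prop),
    [/\ D S P EY.1, D S P EY.2, EY.2 y, forall x, EY.1 (x, y) <-> C l x &
     forall y', EY.2 y' -> PC (P <+ y') M0%:R [set x | EY.1 (x, y')]].
  by have [E [Y H]] := PC_family (PCC l); exists (E, Y).
pose C' y' l := [set v | (EY l).1 (v, y')]; have C'y : C' y = C.
  by apply/funext => l; apply/seteqP; split=> v; have [_ _ _ H _] := HEY l; apply H.
pose Q y' := [/\ forall l, (EY l).2 y', forall l v, (EY l).1 (v, y') -> Wj (ji l) y' v,
  forall l l', ji l = ji l' -> l <> l' -> forall v, ~ ((EY l).1 (v, y') /\ (EY l').1 (v, y')) & ~ dim_ge (fibre y' `\` pieces y' ji (C' y')) e].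
exists Q; split.
- have : D S P (fun y' => (forall l, (EY l).2 y') /\ (forall l v, (EY l).1 (v, y') -> Wj (ji l) y' v) /\
     (forall l l', ji l = ji l' -> l <> l' -> forall v, ~ ((EY l).1 (v, y') /\ (EY l').1 (v, y'))) /\ ~ dim_ge (fibre y' `\` pieces y' ji (C' y')) e).
    apply: D_and; first by apply: D_fin => l; have [] := HEY l.
    apply: D_and.
      apply: D_fin => l; apply: D_all; apply: D_imp.
        by have [H _ _ _ _] := HEY l; apply: (D_comp (g := fun t => (t.2, t.1)) H); ddef.
      exact: D_fib2 (D_img_phi (ji l)).
    apply: D_and.
      apply: D_fin => l; apply: D_fin => l'; apply: D_imp; first exact: D_const.
      apply: D_imp; first exact: D_const.
      apply: D_all; apply: D_not; apply: D_and; [have [H _ _ _ _] := HEY l|have [H _ _ _ _] := HEY l'];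
      by apply: (D_comp (g := fun t => (t.2, t.1)) H); ddef.
    apply: D_not; apply: D_dim; apply: D_and.
      by apply: D_and; [ddef|apply: D_eqT; ddef].
    apply: D_not; apply: D_finex => l; apply: D_ex2.
      by have [H _ _ _ _] := HEY l; apply: (D_comp (g := fun t => (t.2, t.1.1)) H); ddef.
    by apply: D_eqT; [apply: (Df_comp (Da (ji l))); apply: Df_mix|]; ddef.
  by apply: D_ext => y'; split=> [[? [? []]]|[]].
- split; first by move=> l; have [] := HEY l.
  + by move=> l v El; apply: CW; have [_ _ _ H _] := HEY l; apply/H.
  + move=> l l' E ne v [El El']; apply: ne; have [_ _ _ H _] := HEY l; have [_ _ _ H' _] := HEY l'.
    by apply: (Cd l l' v E); [apply/H|apply/H'].
  + rewrite C'y => /(dim_geP e cPy (@D_pieces y _ ji _ _ (fun t => id) (fun l => PC_D (PCC l))))[x [Fx Nx] rx].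
    have [j [Wv av gv]] := fibre_piece gy Fx rx; have [_ _ _ /(_ _ Wv gv)[i Ci]] := HIC j.
    by apply: Nx; exists (Tagged (fun j => projT1 (IC j)) i); exists (vq (q j) x).
move=> y' [Yy EW Ed dim]; exists M0, J, ji, (C' y'); split=> //.
- by move=> l; have [_ _ _ _] := HEY l; apply.
- move=> l l' v E El El'; have [//|ne] := pselect (l = l'); by case: (Ed l l' E ne v).
Qed.

Lemma split_cover : exists2 G : set K^^n, D S P G & (forall y, unit_cube K n y -> gen P y -> G y) /\ G `<=` split_fibre.
Proof.
have [| |k [G [GF Gc]]] := rk_compact_cover (e := n) (A := unit_cube K n)
    (F := [set Q | D S P Q /\ forall y', Q y' -> split_fibre y']) cP (D_cube _ _); first by move=> Q [].
  by move=> y _ /(rk_gen)/split_gen[Q [DQ Qy H]]; exists Q.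
exists [set y | exists i, G i y]; first by apply: D_bigex => i; have [] := GF i.
split=> [y Uy gy|y [i /(proj2 (GF i))//]]; exact: Gc Uy (gen_rk gy).
Qed.

End Theta.

(** * The two sides of the formula *)

Hypothesis fD : forall x, unit_cube K m x -> unit_cube K n (f x).
Variables (c : nat) (fc : forall x y i, unit_cube K m x -> unit_cube K m y -> `|f y 0 i - f x 0 i| <= c%:R * l1 (y - x)).

(** The points where [Jac] can be computed from the strict derivative; they include all generic
    points of the cube. *)
Definition Reg x := [/\ unit_cube K m x, sdm f x, forall i l, `|jac f x i l| <= c%:R & exists2 d : K, 0 < d & forall y, box x d y -> unit_cube K m y].

Lemma D_Reg : D S P Reg.
Proof.
have : D S P (fun x => unit_cube K m x /\ sdm f x /\ (forall i l, `|jac f x i l| <= c%:R) /\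
    exists2 d : K, 0 < d & forall y, box x d y -> unit_cube K m y).
  apply: D_and; first exact: D_cube.
  apply: D_and; first exact: D_sdm.
  apply: D_and; first by apply: D_big => i; apply: D_big => l; apply: D_le; [apply: Df_norm; exact: Df_jac|ddef].
  apply: D_ex2; first by ddef.
  apply: D_all; apply: D_imp; first by apply: D_box; ddef.
  by apply: (D_comp (D_cube _ _)); ddef.
by apply: D_ext => x; split=> [[? [? []]]|[]].
Qed.

Lemma Reg_gen x : unit_cube K m x -> gen P x -> Reg x.
Proof.
move=> Ux gx; have [d d0 Hd] := near_gen cP gx (D_cube _ _) Ux; have sf := sdm_gen cP gx Df0.
split=> // [i l|]; last by exists d.
have := grad_bound (M := c%:R) (sf l) d0 (fun y Hy => fc l Ux (Hd y Hy)) i; by rewrite mxE.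
Qed.

Lemma int_Jac (g : K^^m -> K^^n) Z : (forall x, unit_cube K m x -> g x = f x) -> D S P Z -> Z `<=` unit_cube K m ->
  (bo_measure R S m).-integrable Z (fun x => st_ext R (Jac n (unit_cube K m) g x)) /\
  (\int[bo_measure R S m]_(x in Z) st_ext R (Jac n (unit_cube K m) g x))%E = (vl (Hypo (Z `&` Reg) (jdet n f)))%:E.
Proof.
move=> gf DZ Zc; have [B HB] := ssm_bound m n n c.
have bdB k (Y : set K^^k) : Y `<=` unit_cube K k -> bdd B.+2 Y.
  by move=> Yc; apply: bdd_le (unit_bdd Yc).
have DZR : D S P (Z `&` Reg) by apply: D_and => //; exact: D_Reg.
apply: (int_st cP DZR (Df_jdet n Df0) (b := B.+2)) => //.
- by apply: bdB => x [/Zc].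
- move=> x [_ [_ _ jc _]]; rewrite sqrtr_ge0 /=; apply: le_trans (HB _ jc) _; rewrite ler_nat; lia.
- exact: bdB.
- by move=> x Zx gx; split=> //; apply: Reg_gen => //; exact: Zc.
move=> x [_ [_ sf _ [d d0 Hd]]]; by rewrite (Jac_sdm d0 Hd gf sf (rank_leq_col _)).
Qed.

Definition charts : set (K^^m -> Prop) := [set Q | exists p : ('I_m -> 'I_n + 'I_e) * ('I_n + 'I_e -> 'I_m) * (K^^m -> K^^m),
  [/\ cancel p.1.1 p.1.2, cancel p.1.2 p.1.1, Df S P p.2 & Q = goodp p.1.1 p.1.2 p.2]].

Lemma coarea_pieces : exists (N : nat) (p : 'I_N -> 'I_m -> 'I_n + 'I_e) (q : 'I_N -> 'I_n + 'I_e -> 'I_m)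
    (a : 'I_N -> K^^m -> K^^m) (X : 'I_N -> set K^^m),
  [/\ (forall j, cancel (p j) (q j)) /\ (forall j, cancel (q j) (p j)), (forall j, Df S P (a j)) /\ (forall j, D S P (X j)),
    forall j, X j `<=` A `&` Reg, (forall j x, X j x -> goodp (p j) (q j) (a j) x) /\ (forall i j x, X i x -> X j x -> i = j) &
    forall x, A x -> gen P x -> jdet n f x != 0 -> exists j, X j x].
Proof.
(* Points with zero Jacobian have no points of the region below the graph over them. *)
pose U := [set x | (A x /\ Reg x) /\ jdet n f x != 0].
have DU : D S P U.
  have DJ := Df_jdet n Df0; have DR := D_Reg; apply: D_and; first exact: D_and.
  by apply: D_negb; apply: D_eqb => //; exact: Df_0.
have [||N [X [DX XU Xd Xc XQ]]] := gen_pieces (FF := charts) cP DU.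
- by move=> Q [p [_ _ Da ->]]; exact: D_goodp.
- move=> x [_ jx] gx; have [p [q [a [pK qK Da _ g]]]] := goodp_ex gx jx.
  by exists (goodp p q a) => //; exists (p, q, a).
have /choice[t Ht] j : exists p : ('I_m -> 'I_n + 'I_e) * ('I_n + 'I_e -> 'I_m) * (K^^m -> K^^m),
    [/\ cancel p.1.1 p.1.2, cancel p.1.2 p.1.1, Df S P p.2 & X j `<=` goodp p.1.1 p.1.2 p.2].
  by have [_ [p [? ? ? ->]] ?] := XQ j; exists p.
exists N, (fun j => (t j).1.1), (fun j => (t j).1.2), (fun j => (t j).2), X; split.
- by split=> j; have [] := Ht j.
- by split=> // j; have [] := Ht j.
- by move=> j x /XU[].
- by split=> // j; have [] := Ht j.
move=> x Ax gx jx; apply: Xc => //; split=> //; split=> //; apply: Reg_gen => //; exact: Ac.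
Qed.

Lemma vl_pieces N (p : 'I_N -> 'I_m -> 'I_n + 'I_e) (q : 'I_N -> 'I_n + 'I_e -> 'I_m)
    (a : 'I_N -> K^^m -> K^^m) (X : 'I_N -> set K^^m) : (forall j, cancel (p j) (q j)) -> (forall j, cancel (q j) (p j)) ->
  (forall j, Df S P (a j)) -> (forall j, D S P (X j)) -> (forall j, X j `<=` A `&` Reg) ->
  (forall j x, X j x -> goodp (p j) (q j) (a j) x) -> (forall i j x, X i x -> X j x -> i = j) ->
  (forall x, A x -> gen P x -> jdet n f x != 0 -> exists j, X j x) ->
  vl (Hypo (A `&` Reg) (jdet n f)) = \sum_j vl (Ej p q a X j) /\
  exists b, forall j, D S P (Ej p q a X j) /\ bdd b.+2 (Ej p q a X j).
Proof.
move=> pK qK Da DX XA Xg Xd Xc; have [B1 HB1] := ssm_bound m n n c; have [B2 HB2] := ssm_bound e m e 1.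
pose b := (B1 + B2)%N; have DJ := Df_jdet n Df0.
have bdB k (Y : set K^^k) : Y `<=` unit_cube K k -> bdd b.+2 Y.
  by move=> Yc; apply: bdd_le (unit_bdd Yc).
have ARc : A `&` Reg `<=` unit_cube K m by move=> x [/Ac].
have Jb x : Reg x -> jdet n f x <= b.+2%:R.
  by move=> [_ _ jc _]; apply: le_trans (HB1 _ jc) _; rewrite ler_nat /b; lia.
have phic j : [set phi (p j) (q j) x | x in X j] `<=` unit_cube K m.
  move=> _ [x /XA/ARc xc <-] i; have [[k ->]|[k ->]] := split_coord (pK j) i.
    by rewrite /phi mixl //; exact: fD.
  by rewrite /phi mixr // mxE; exact: xc.
have hb j x : X j x -> 0 <= hq (q j) (a j) (phi (p j) (q j) x) <= b.+2%:R.
  move=> /Xg[_ _ Jc _]; rewrite sqrtr_ge0 /=; apply: le_trans (HB2 _ Jc) _; rewrite ler_nat /b; lia.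
split; last first.
  exists b => j; split; first by apply: D_Hypo; [exact: D_img_phi|exact: Df_hq].
  by apply: bdd_Hypo; [exact: bdB (phic j)|move=> _ [x Xx <-]; have /andP[] := hb j x Xx].
rewrite (vl_partition cP (b := b.+2) (X := fun j => Hypo (X j) (jdet n f))).
- apply: eq_bigr => j _; rewrite /Ej.
  rewrite (CV (C := maxn c 1) (b := b.+2) cP (DX j) (Df_phi (p j) (q j)) (Df_hq (q j) (Da j))).
  + by congr vl; apply: Hypo_ext => x /Xg[].
  + by apply: bdB => x /XA/ARc.
  + exact: bdB (phic j).
  + by move=> x y /Xg[ax _ _ _] /Xg[ay _ _ _] E; rewrite -ax E ay.
  + exact: hb.
  + move=> x /XA[_ [_ sf jc _]] i l; have [-> _] := jac_phi (p j) (q j) sf; rewrite mxE.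
    case: (p j l) => k; first by apply: le_trans (jc i k) _; rewrite ler_nat leq_maxl.
    by rewrite (le_trans (y := 1%:R)) ?ler_nat ?leq_maxr //; case: eqP => _; rewrite ?normr1 ?normr0.
- by move=> j; exact: D_Hypo.
- by apply: D_Hypo => //; apply: D_and => //; exact: D_Reg.
- by apply: bdd_Hypo; [exact: bdB|move=> x [_ /Jb]].
- by move=> j z [/XA].
- by move=> i j z [Xi _] [Xj _]; exact: Xd Xi Xj.
move=> z [[Az _] /andP[z0 zJ]] /(gen_col' P ord0)[gz _].
have [|j Xj] := Xc _ Az gz; first by rewrite gt_eqF // (lt_trans z0).
by exists j; split=> //; rewrite z0.
Qed.

Lemma coarea_formula (g : K^^m -> K^^n) : (forall x, unit_cube K m x -> g x = f x) ->
  [/\ (bo_measure R S m).-integrable (unit_cube K m) (fun x => st_ext R (Jac n (unit_cube K m) g x)),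
   {ae bo_measure R S n, forall y, unit_cube K n y -> dim_le (A `&` g @^-1` [set y]) e},
   (bo_measure R S n).-integrable (unit_cube K n) (fun y => hausdorff R S e (A `&` g @^-1` [set y])) &
   (\int[bo_measure R S m]_(x in A) st_ext R (Jac n (unit_cube K m) g x) =
    \int[bo_measure R S n]_(y in unit_cube K n) hausdorff R S e (A `&` g @^-1` [set y]))%E].
Proof.
move=> gf; have [I1 _] := int_Jac gf (D_cube _ _) (fun x => id); have [_ I2] := int_Jac gf DA Ac.
have [N [p [q [a [X [[pK qK] [Da DX] XAR [Xg Xd] Xc]]]]]] := coarea_pieces.
have XA j : X j `<=` A by move=> x /XAR[].
have [vlE [b HE]] := vl_pieces pK qK Da DX XAR Xg Xd Xc.
have [G DG [Gc Gs]] := split_cover qK Da DX XA Xg Xc.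
have AE y : A `&` g @^-1` [set y] = fibre y.
  by apply/seteqP; split=> x [Ax <-]; split=> //; rewrite /preimage /= gf //; exact: Ac.
(* [G] consists of points whose fibres split, and it contains the generic points of the cube, so the
   slices of the regions [Ej] give the Hausdorff measures almost everywhere. *)
have [|||I3 I4] := int_fib (U := unit_cube K n) (phi := fun y => hausdorff R S e (fibre y)) (fun j => upK (pK j)) (fun j => upqK (qK j)) cP (D_cube _ _) DG
  (bdd_le (isT : (2 <= b.+2)%N) (unit_bdd (fun x => id))) (fun j => (HE j).1) (fun j => (HE j).2).
- move=> j y z [[x Xx E] _]; move: E; rewrite mix_up col'_ins => /(mix_inj (qK j))[<- _].
  by apply: fD; exact: Ac (XA j x Xx).
- exact: Gc.
- by move=> y _ Gy; apply: (hausdorff_fibre pK qK Da DX XA Xg Xd); exact: Gs.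
have hE : (fun y => hausdorff R S e (A `&` g @^-1` [set y])) = (fun y => hausdorff R S e (fibre y)) by apply/funext => y; rewrite AE.
split; [exact: I1| |by rewrite hE|by rewrite hE I2 vlE; symmetry; exact: I4].
apply: (negligibleS _ (null_nogen (b := 2) (X := unit_cube K n `\` G) cP _ _ _)).
- move=> y /= H; apply: contrapT => NG; apply: H => Uy; rewrite AE; apply: (dim_fibre Da); apply: Gs.
  by apply: contrapT => nG; apply: NG.
- by apply: D_and; [exact: D_cube|exact: D_not].
- by apply: unit_bdd => y [].
- by move=> y [Uy nG] gy; apply: nG; exact: Gc.
Qed.

End Coarea.

End TameGeometry.

Local Open Scope ereal_scope.

Theorem theorem7p2 (R : realType) (L : signature) (K : rcfType)
    (S : structure L K) (Ksat : aleph1_saturated S) (Komin : o_minimal S)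
    (m n : nat) (hnm : (n <= m)%N)
    (A : set 'rV[K]_m) (hA : A `<=` unit_cube K m) (dA : definable S A)
    (f : 'rV[K]_m -> 'rV[K]_n)
    (fD : forall x, unit_cube K m x -> unit_cube K n (f x))
    (df : definable_fun S (unit_cube K m) f)
    (lf : Klipschitz (unit_cube K m) f) :
  (bo_measure R S m).-integrable (unit_cube K m)
    (fun x => st_ext R (Jac n (unit_cube K m) f x)) /\
  {ae bo_measure R S n, forall y, unit_cube K n y ->
    dim_le (A `&` f @^-1` [set y]) (m - n)%N} /\
  (bo_measure R S n).-integrable (unit_cube K n)
    (fun y => hausdorff R S (m - n)%N (A `&` f @^-1` [set y])) /\
  \int[bo_measure R S m]_(x in A)
      st_ext R (Jac n (unit_cube K m) f x) =
  \int[bo_measure R S n]_(y in unit_cube K n)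
      hausdorff R S (m - n)%N (A `&` f @^-1` [set y]).
Proof.
(* Outside the cube nothing is known about [f]; the argument is carried out for the total definable
   function [f'] that agrees with [f] on the cube. *)
have [P1 [cP1 _ [f' Df' f'E]]] := dfun_ex df; have [P2 cP2 DA2] := definable_D dA.
pose P := P1 `|` P2; have cP : countable P by ctb.
have Df1 : Df S P f' by apply: Df_mono Df'; exact: subsetUl.
have DA1 : D S P A by apply: D_mono DA2; exact: subsetUr.
have [C [c Cc] HC] := lf.
(* Coordinates are at most the Euclidean norm, and the Euclidean norm is at most the sum norm
   [l1]. *)
have fc x y i : unit_cube K m x -> unit_cube K m y -> (`|f' y 0 i - f' x 0 i| <= c%:R * l1 (y - x))%R.
  move=> Ux Uy; rewrite !f'E //; have [->|yx] := eqVneq y x; first by rewrite !subrr normr0 mulr_ge0 ?l1_ge0.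
  have := le_enorm (f y - f x) i; rewrite !mxE => /le_trans; apply.
  rewrite (le_trans (ltW (HC _ _ Uy Ux yx))) // (le_trans (ler_wpM2r (enorm_ge0 _) (le_trans (ler_norm C) Cc))) //.
  by rewrite ler_wpM2l // enorm_le_sum.
have f'D x : unit_cube K m x -> unit_cube K n (f' x) by move=> Ux; rewrite f'E //; exact: fD.
have [|? ? ? ?] := coarea_formula Ksat Komin R (subnKC hnm) cP Df1 DA1 hA f'D fc (g := f); last by split.
by move=> x Ux; rewrite f'E.
Qed.
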